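(* Let $c=c_1+ic_2$ and $d=d_1+id_2$ be nonzero complex numbers (with real and imaginary parts as indicated) such that $$c_1>0,\quad c_2\ge0,\quad d_1>c_1,\quad\text{and}\quad\frac{d_2}{d_1}\ge\frac{c_2}{c_1}.$$ Let $C=\{c,d\}$ and $\theta_0:=-\frac12\arg c$ with $\arg c\in[0,\frac\pi2)$ (a generic direction for $C$). Let $\sigma=(\sigma_k)_{k\in\mathbb Z/4\mathbb Z}$ be a family of four complex $2\times2$-matrices such that $\sigma_k$ is upper-triangular if $k$ is odd, lower-triangular if $k$ is even, and $\sigma_4\sigma_3\sigma_2\sigma_1=\mathbb 1$. Set $\widehat C:=\{-\frac1c,-\frac1d\}$ and $\widehat\theta_0:=\pi-\theta_0$. Then there is an isomorphism in $\mathrm D^{\mathrm b}(\mathbf k_{\mathbb C\times\mathbb R})$ $${}^{\mathcal L}\mathcal F_\sigma^{C,\theta_0}\simeq\mathcal F_\sigma^{\widehat C,\widehat\theta_0}.$$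
   Context: $\mathbf{k}=\mathbb{C}$. For a complex manifold $X$, $\pi\colon X\times\mathbb{R}\to X$ is the projection and $t$ the coordinate on $\mathbb{R}$. For $Z\subseteq X$ locally closed and $\varphi\colon X\to\mathbb{R}$ continuous, $\mathsf{E}^{\varphi}_{Z|X}:=\pi^{-1}\mathbf{k}_Z\otimes\mathbf{k}_{\{t+\varphi\ge0\}}\in\mathrm{D}^{\mathrm b}(\mathbf{k}_{X\times\mathbb{R}})$. For a sheaf $\mathcal F$ on $X\times\mathbb{R}$, $\mathcal F_Z:=\mathcal F\otimes\mathbf{k}_{Z\times\mathbb{R}}$. Convolution: $\mathcal F\overset{*}{\otimes}\mathcal G:=\mathsf{R}\mu_!(q_1^{-1}\mathcal F\otimes q_2^{-1}\mathcal G)$ with $\mu,q_1,q_2\colon X\times\mathbb{R}^2\to X\times\mathbb{R}$, $\mu(x,t_1,t_2)=(x,t_1+t_2)$, $q_i(x,t_1,t_2)=(x,t_i)$. Generic directions: for a two-element set $C\subset\mathbb{C}^\times$, a direction $\theta\in\mathbb{R}/2\pi\mathbb{Z}$ is generic if the two elements $c\neq d$ satisfy $\operatorname{Re}(\frac c2z^2)\ne\operatorname{Re}(\frac d2z^2)$ for $z\neq0$ with $\arg z=\theta$. Given a generic $\theta_0$, number $C=\{c_{(1)},c_{(2)}\}$ so that $\operatorname{Re}(\frac{c_{(1)}}2z^2)<\operatorname{Re}(\frac{c_{(2)}}2z^2)$ for $z\ne0$, $\arg z=\theta_0$. The sheaf $\mathcal F_\sigma^{C,\theta_0}$ (all ranks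 equal to $1$): given $C$, a generic $\theta_0$, and $2\times2$ matrices $\sigma=(\sigma_k)_{k\in\mathbb{Z}/4\mathbb{Z}}$ with $\sigma_1,\sigma_3$ upper- and $\sigma_2,\sigma_4$ lower-triangular and $\sigma_4\sigma_3\sigma_2\sigma_1=\mathbb 1$, let $S_k=\{z\in\mathbb{C}\mid \arg z\in[\theta_0+(k-1)\frac\pi2,\theta_0+k\frac\pi2]\text{ if }z\ne0\}$, $S_{k,k+1}=S_k\cap S_{k+1}$. Then $\mathcal F_\sigma^{C,\theta_0}$ is the sheaf on $\mathbb{C}\times\mathbb{R}$, unique up to unique isomorphism, equipped with isomorphisms $\alpha_k\colon(\mathcal F_\sigma)_{S_k}\to\mathsf E^{-\operatorname{Re}(\frac{c_{(1)}}2z^2)}_{S_k|\mathbb{C}}\oplus\mathsf E^{-\operatorname{Re}(\frac{c_{(2)}}2z^2)}_{S_k|\mathbb{C}}$ such that over $S_{k,k+1}$ the transition isomorphism $\alpha_{k+1}\circ\alpha_k^{-1}$ is given by the matrix $\sigma_k$ (entries acting by scalar multiplication). Enhanced Fourier–Sato transform: with the projections $\widetilde p\colon\mathbb{C}_z\times\mathbb{C}_w\times\mathbb{R}\to\mathbb{C}_z\times\mathbb{R}$ and $\widetilde q\colon\mathbb{C}_z\times\mathbb{C}_w\times\mathbb{R}\to\mathbb{C}_w\times\mathbb{R}$, for $\mathcal F\in\mathrm{D}^{\mathrm b}(\mathbf k_{\mathbb{C}_z\times\mathbb{R}})$ set ${}^{\mathcal L}\mathcal F:=\mathsf R\widetilde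 q_!\big(\mathsf E^{-\operatorname{Re}(zw)}_{\mathbb{C}_z\times\mathbb{C}_w|\mathbb{C}_z\times\mathbb{C}_w}\overset{*}{\otimes}\widetilde p^{\,-1}\mathcal F\big)[1]\in\mathrm{D}^{\mathrm b}(\mathbf k_{\mathbb{C}_w\times\mathbb{R}})$. *)

(* Defs.v *)
From HB Require Import structures.
From mathcomp Require Import all_boot all_order all_algebra.
From mathcomp Require Import boolp classical_sets functions reals.
From mathcomp Require Import topology normedtype trigo.
From mathcomp Require Import complex.
Set Implicit Arguments.
Unset Strict Implicit.
Unset Printing Implicit Defensive.
Import Order.TTheory GRing.Theory Num.Theory.
Import numFieldNormedType.Exports.
Local Open Scope classical_set_scope.
Local Open Scope ring_scope.

Section DependentProduct.
Context {k : fieldType} {I : Type} (V : I -> lmodType k).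

Definition dprod : Type := forall i, V i.

HB.instance Definition _ := gen_eqMixin dprod.
HB.instance Definition _ := gen_choiceMixin dprod.

Let dadd (f g : dprod) : dprod := fun i => f i + g i.
Let dopp (f : dprod) : dprod := fun i => - f i.
Let dzero : dprod := fun=> 0.
Let dscale (a : k) (f : dprod) : dprod := fun i => a *: f i.

Let daddA : associative dadd.
Proof. by move=> f g h; apply: functional_extensionality_dep => i; exact: addrA. Qed.
Let daddC : commutative dadd.
Proof. by move=> f g; apply: functional_extensionality_dep => i; exact: addrC. Qed.
Let dadd0 : left_id dzero dadd.
Proof. by move=> f; apply: functional_extensionality_dep => i; exact: add0r. Qed.
Let daddN : left_inverse dzero dopp dadd.
Proof. by move=> f; apply: functional_extensionality_dep => i; exact: addNr. Qed.

HB.instance Definition _ := GRing.isZmodule.Build dprod daddA daddC dadd0 daddN.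

Let dscaleA a b (f : dprod) : dscale a (dscale b f) = dscale (a * b) f.
Proof. by apply: functional_extensionality_dep => i; exact: scalerA. Qed.
Let dscale1 : left_id 1 dscale.
Proof. by move=> f; apply: functional_extensionality_dep => i; exact: scale1r. Qed.
Let dscaleDr : right_distributive dscale +%R.
Proof. by move=> a f g; apply: functional_extensionality_dep => i; exact: scalerDr. Qed.
Let dscaleDl (f : dprod) : {morph dscale^~ f : a b / a + b}.
Proof. by move=> a b; apply: functional_extensionality_dep => i; exact: scalerDl. Qed.

HB.instance Definition _ := GRing.Zmodule_isLmodule.Build k dprod
  dscaleA dscale1 dscaleDr dscaleDl.

End DependentProduct.

Section Subspaces.
Context {k : fieldType} {V : lmodType k}.

Record linsub := LinSub {
  sscar :> set V;
  ss0 : sscar 0;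
  sslin : forall a u v, sscar u -> sscar v -> sscar (a *: u + v) }.

Variable P : linsub.

Record subsp : Type := SubSp { spval : V; spvalP : sscar P spval }.

Lemma spval_inj : injective spval.
Proof.
case=> u Pu [v Pv] /= uv; move: Pu Pv; rewrite uv => Pu Pv.
by congr SubSp; exact: Prop_irrelevance.
Qed.

HB.instance Definition _ := gen_eqMixin subsp.
HB.instance Definition _ := gen_choiceMixin subsp.

Lemma ssD u v : sscar P u -> sscar P v -> sscar P (u + v).
Proof. by move=> Pu Pv; rewrite -[u]scale1r; exact: sslin. Qed.
Lemma ssZ a u : sscar P u -> sscar P (a *: u).
Proof. by move=> Pu; rewrite -[_ *: _]addr0; apply: sslin => //; exact: ss0. Qed.
Lemma ssN u : sscar P u -> sscar P (- u).
Proof. by move=> Pu; rewrite -scaleN1r; exact: ssZ. Qed.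

Let sadd (u v : subsp) := SubSp (ssD (spvalP u) (spvalP v)).
Let sopp (u : subsp) := SubSp (ssN (spvalP u)).
Let szero := SubSp (ss0 P).
Let sscale a (u : subsp) := SubSp (ssZ a (spvalP u)).

Let saddA : associative sadd.
Proof. by move=> u v w; apply: spval_inj; exact: addrA. Qed.
Let saddC : commutative sadd.
Proof. by move=> u v; apply: spval_inj; exact: addrC. Qed.
Let sadd0 : left_id szero sadd.
Proof. by move=> u; apply: spval_inj; exact: add0r. Qed.
Let saddN : left_inverse szero sopp sadd.
Proof. by move=> u; apply: spval_inj; exact: addNr. Qed.

HB.instance Definition _ := GRing.isZmodule.Build subsp saddA saddC sadd0 saddN.

Let sscaleA a b u : sscale a (sscale b u) = sscale (a * b) u.
Proof. by apply: spval_inj; exact: scalerA. Qed.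
Let sscale1 : left_id 1 sscale.
Proof. by move=> u; apply: spval_inj; exact: scale1r. Qed.
Let sscaleDr : right_distributive sscale +%R.
Proof. by move=> a u v; apply: spval_inj; exact: scalerDr. Qed.
Let sscaleDl u : {morph sscale^~ u : a b / a + b}.
Proof. by move=> a b; apply: spval_inj; exact: scalerDl. Qed.

HB.instance Definition _ := GRing.Zmodule_isLmodule.Build k subsp
  sscaleA sscale1 sscaleDr sscaleDl.

Inductive lspan (S : set V) : set V :=
| lspan0 : lspan S 0
| lspan_cons a s u : S s -> lspan S u -> lspan S (a *: s + u).

Lemma lspan_lin S a u v : lspan S u -> lspan S v -> lspan S (a *: u + v).
Proof.
elim=> [|b s w Ss _ IH] Sv; first by rewrite scaler0 add0r.
by rewrite scalerDr scalerA -addrA; apply: lspan_cons => //; exact: IH.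
Qed.

Definition lspan_linsub S := LinSub (lspan0 S) (@lspan_lin S).

End Subspaces.
Arguments linsub {k} V.

Section TensorProductOfSpaces.
Context {k : fieldType} (V W : lmodType k).

Record biform := BiForm {
  bf :> V -> W -> k^o;
  bf_linl : forall w, linear (bf^~ w);
  bf_linr : forall v, linear (bf v) }.

(* Over a field, sum_i v_i (x) w_i vanishes iff sum_i b v_i w_i = 0 for every
   bilinear form b; the tensor product is therefore realized inside the dual
   of the space of bilinear forms, as the span of the evaluations. *)
Definition pure_ev (v : V) (w : W) : biform -> k^o := fun b => b v w.

Definition tens : lmodType k :=
  subsp (lspan_linsub [set f | exists v w, f = pure_ev v w]).

Lemma pure_in v w :
  lspan [set f | exists v w, f = pure_ev v w] (pure_ev v w).
Proof.
rewrite -[pure_ev v w]addr0 -[pure_ev v w]scale1r.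
by apply: lspan_cons; [exists v, w | exact: lspan0].
Qed.

Definition pure v w : tens :=
  @SubSp _ _ (lspan_linsub [set f | exists v w, f = pure_ev v w]) _ (pure_in v w).

End TensorProductOfSpaces.

Section Opens.
Context {X : topologicalType}.
Record opens := Opens { oset :> set X; osetP : open oset }.
Definition opensI (U V : opens) := Opens (openI (osetP U) (osetP V)).
Definition opensT := Opens (@openT X).
Lemma opensIl U V : oset (opensI U V) `<=` oset U. Proof. by move=> x []. Qed.
Lemma opensIr U V : oset (opensI U V) `<=` oset V. Proof. by move=> x []. Qed.
End Opens.
Arguments opens X : clear implicits.

Lemma open_pre {X Y : topologicalType} (f : continuousType X Y) (V : opens Y) :
  open (f @^-1` oset V).
Proof. by apply: open_comp (osetP V) => x _; exact: cts_fun. Qed.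

Definition opens_pre {X Y : topologicalType} (f : continuousType X Y)
  (V : opens Y) : opens X := Opens (open_pre f V).

Section Sheaves.
Context {k : fieldType} {X : topologicalType}.

Record sheaf := Sheaf {
  sec : opens X -> lmodType k;
  res : forall U V : opens X, oset V `<=` oset U -> sec U -> sec V;
  res_lin : forall U V (h : oset V `<=` oset U), linear (res h);
  res_id : forall U (h : oset U `<=` oset U) s, res h s = s;
  res_comp : forall U V W (h : oset V `<=` oset U) (h' : oset W `<=` oset V)
    (h'' : oset W `<=` oset U) s, res h' (res h s) = res h'' s;
  res_sep : forall (I : Type) (V : I -> opens X) (U : opens X)
    (h : forall i, oset (V i) `<=` oset U),
    oset U `<=` \bigcup_i oset (V i) ->
    forall s t, (forall i, res (h i) s = res (h i) t) -> s = t;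
  res_glue : forall (I : Type) (V : I -> opens X) (U : opens X)
    (h : forall i, oset (V i) `<=` oset U),
    oset U `<=` \bigcup_i oset (V i) ->
    forall s : (forall i, sec (V i)),
    (forall i j (W : opens X) (hi : oset W `<=` oset (V i))
        (hj : oset W `<=` oset (V j)), res hi (s i) = res hj (s j)) ->
    exists t : sec U, forall i, res (h i) t = s i }.

Lemma resD (F : sheaf) U V (h : oset V `<=` oset U) (s t : sec F U) :
  res h (s + t) = res h s + res h t.
Proof. by rewrite -[s]scale1r res_lin !scale1r. Qed.
Lemma res0 (F : sheaf) U V (h : oset V `<=` oset U) : res h (0 : sec F U) = 0.
Proof. by apply: (@addrI _ (res h 0)); rewrite -resD !addr0. Qed.
Lemma resZ (F : sheaf) U V (h : oset V `<=` oset U) a (s : sec F U) :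
  res h (a *: s) = a *: res h s.
Proof. by rewrite -[a *: s]addr0 res_lin res0 addr0. Qed.

Section Stalks.
Variables (F : sheaf) (x : X).

Record pregerm := PreGerm { pgU : opens X; pgx : oset pgU x; pgs : sec F pgU }.

Definition germ_eq (g h : pregerm) := exists (W : opens X)
  (hg : oset W `<=` oset (pgU g)) (hh : oset W `<=` oset (pgU h)),
  oset W x /\ res hg (pgs g) = res hh (pgs h).

Lemma germ_eq_refl g : germ_eq g g.
Proof. by exists (pgU g), (@subset_refl _ _), (@subset_refl _ _); split=> //; exact: pgx. Qed.
Lemma germ_eq_sym g h : germ_eq g h -> germ_eq h g.
Proof. by case=> W [hg] [hh] [Wx e]; exists W, hh, hg. Qed.
Lemma germ_eq_trans g h l : germ_eq g h -> germ_eq h l -> germ_eq g l.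
Proof.
case=> W [hg] [hh] [Wx e] [W' [hh'] [hl] [W'x e']].
have s1 : oset (opensI W W') `<=` oset W by move=> y [].
have s2 : oset (opensI W W') `<=` oset W' by move=> y [].
exists (opensI W W'), (subset_trans s1 hg), (subset_trans s2 hl); split=> //.
rewrite -(res_comp hg s1) e -(res_comp hl s2) -e'.
by rewrite (res_comp hh s1 (subset_trans s1 hh)) (res_comp hh' s2 (subset_trans s1 hh)).
Qed.

Definition stalk : Type := {A : set pregerm | exists g, A = germ_eq g}.

HB.instance Definition _ := gen_eqMixin stalk.
HB.instance Definition _ := gen_choiceMixin stalk.

Definition stalk_of (g : pregerm) : stalk := exist _ (germ_eq g) (ex_intro _ g erefl).
Definition stalk_repr (a : stalk) : pregerm := sval (cid (svalP a)).

Lemma stalk_ofP g h : stalk_of g = stalk_of h <-> germ_eq g h.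
Proof.
split=> [[e]|gh]; first by rewrite e; exact: germ_eq_refl.
apply: eq_exist; apply/funext => l; apply/propext; split=> H.
  exact: germ_eq_trans (germ_eq_sym gh) H.
exact: germ_eq_trans gh H.
Qed.

Lemma stalk_reprK a : stalk_of (stalk_repr a) = a.
Proof. by rewrite /stalk_repr; case: cid => g; case: a => A p /= e; apply: eq_exist. Qed.

Let mk U (Ux : oset U x) s := stalk_of (@PreGerm U Ux s).

Lemma stalk_of_res U V (h : oset V `<=` oset U) (Ux : oset U x) (Vx : oset V x)
  (s : sec F U) : stalk_of (PreGerm Vx (res h s)) = stalk_of (PreGerm Ux s).
Proof.
apply/stalk_ofP; exists V, (@subset_refl _ _), h; split=> //=.
by rewrite res_id.
Qed.

Lemma stalk_common (a b c : stalk) : exists U (Ux : oset U x) s t u,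
  [/\ a = mk Ux s, b = mk Ux t & c = mk Ux u].
Proof.
rewrite -(stalk_reprK a) -(stalk_reprK b) -(stalk_reprK c).
case: (stalk_repr a) (stalk_repr b) (stalk_repr c) => [U Ux s] [V Vx t] [W Wx u].
pose O := opensI U (opensI V W).
have Ox : oset O x by [].
have h1 : oset O `<=` oset U by move=> y [].
have h2 : oset O `<=` oset V by move=> y [_ []].
have h3 : oset O `<=` oset W by move=> y [_ []].
by exists O, Ox, (res h1 s), (res h2 t), (res h3 u); split; rewrite /mk stalk_of_res.
Qed.

Definition pgadd (g h : pregerm) : pregerm :=
  @PreGerm (opensI (pgU g) (pgU h)) (conj (pgx g) (pgx h))
    (res (@opensIl _ _ _) (pgs g) + res (@opensIr _ _ _) (pgs h)).
Let tadd a b := stalk_of (pgadd (stalk_repr a) (stalk_repr b)).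
Let tscale c a := let g := stalk_repr a in stalk_of (PreGerm (pgx g) (c *: pgs g)).
Let topp a := tscale (-1) a.
Let tzero := @mk opensT I 0.

Let taddE U (Ux : oset U x) s t : tadd (mk Ux s) (mk Ux t) = mk Ux (s + t).
Proof.
rewrite /tadd; have /stalk_ofP := stalk_reprK (mk Ux s).
have /stalk_ofP := stalk_reprK (mk Ux t).
case: (stalk_repr (mk Ux t)) => V Vx t'; case: (stalk_repr (mk Ux s)) => W Wx s'.
case=> A [/= hA] [hA'] [Ax eA] [B [/= hB] [hB'] [Bx eB]].
apply/stalk_ofP.
have c1 : oset (opensI A B) `<=` oset (opensI W V).
  by move=> y [/hA ? /hB].
have c2 : oset (opensI A B) `<=` oset U by move=> y [/hA'].
exists (opensI A B), c1, c2; split=> //=.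
have sA : oset (opensI A B) `<=` oset A by move=> y [].
have sB : oset (opensI A B) `<=` oset B by move=> y [].
rewrite !resD -{1}(res_comp hB' sB) -{1}(res_comp hA' sA) -eA -eB.
rewrite (res_comp _ _ (subset_trans sB hB)) (res_comp _ _ (subset_trans sA hA)).
by rewrite (res_comp _ _ (subset_trans sB hB)) (res_comp _ _ (subset_trans sA hA)).
Qed.

Let tscaleE U (Ux : oset U x) c s : tscale c (mk Ux s) = mk Ux (c *: s).
Proof.
rewrite /tscale; have /stalk_ofP := stalk_reprK (mk Ux s).
case: (stalk_repr (mk Ux s)) => V Vx s' [A [/= hA] [hA'] [Ax eA]].
by apply/stalk_ofP; exists A, hA, hA'; split=> //=; rewrite !resZ eA.
Qed.

Let tzeroE U (Ux : oset U x) : tzero = mk Ux 0.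
Proof.
by apply/stalk_ofP; exists U, (@subsetT _ _), (@subset_refl _ _); split=> //=; rewrite !res0.
Qed.

Let taddA : associative tadd.
Proof.
move=> a b c; have [U [Ux [s [t [u [-> -> ->]]]]]] := stalk_common a b c.
by rewrite !taddE addrA.
Qed.
Let taddC : commutative tadd.
Proof.
move=> a b; have [U [Ux [s [t [u [-> -> _]]]]]] := stalk_common a b b.
by rewrite !taddE addrC.
Qed.
Let tadd0 : left_id tzero tadd.
Proof.
move=> a; have [U [Ux [s [t [u [-> _ _]]]]]] := stalk_common a a a.
by rewrite (tzeroE Ux) taddE add0r.
Qed.
Let taddN : left_inverse tzero topp tadd.
Proof.
move=> a; have [U [Ux [s [t [u [-> _ _]]]]]] := stalk_common a a a.
by rewrite /topp tscaleE (tzeroE Ux) taddE scaleN1r addNr.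
Qed.

HB.instance Definition _ := GRing.isZmodule.Build stalk taddA taddC tadd0 taddN.

Let mkD U (Ux : oset U x) (s t : sec F U) : mk Ux s + mk Ux t = mk Ux (s + t).
Proof. exact: taddE. Qed.
Let tscaleA a b u : tscale a (tscale b u) = tscale (a * b) u.
Proof.
have [U [Ux [s [_ [_ [-> _ _]]]]]] := stalk_common u u u.
by rewrite !tscaleE scalerA.
Qed.
Let tscale1 : left_id 1 tscale.
Proof.
move=> u; have [U [Ux [s [_ [_ [-> _ _]]]]]] := stalk_common u u u.
by rewrite !tscaleE scale1r.
Qed.
Let tscaleDr : right_distributive tscale +%R.
Proof.
move=> a u v; have [U [Ux [s [t [_ [-> -> _]]]]]] := stalk_common u v u.
by rewrite mkD !tscaleE mkD scalerDr.
Qed.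
Let tscaleDl u : {morph tscale^~ u : a b / a + b}.
Proof.
move=> a b; have [U [Ux [s [_ [_ [-> _ _]]]]]] := stalk_common u u u.
by rewrite !tscaleE mkD scalerDl.
Qed.

HB.instance Definition _ := GRing.Zmodule_isLmodule.Build k stalk
  tscaleA tscale1 tscaleDr tscaleDl.

(* The germ at x of s, set to 0 by convention when x is not in U. *)
Definition germ (U : opens X) (s : sec F U) : stalk :=
  if pselect (oset U x) is left Ux then stalk_of (PreGerm Ux s) else 0.

Lemma germE U (Ux : oset U x) s : germ s = stalk_of (@PreGerm U Ux s).
Proof.
rewrite /germ; case: pselect => // Ux'.
by congr (stalk_of (PreGerm _ _)); exact: Prop_irrelevance.
Qed.

Lemma germ_lin U : linear (@germ U).
Proof.
move=> a s t; case: (pselect (oset U x)) => [Ux|nUx].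
  rewrite !(germE Ux); have -> : a *: stalk_of (PreGerm Ux s) = mk Ux (a *: s).
    exact: tscaleE.
  exact/esym/mkD.
by rewrite /germ; case: pselect => //= _; rewrite scaler0 addr0.
Qed.

Lemma germ_res U V (h : oset V `<=` oset U) (s : sec F U) : oset V x ->
  germ (res h s) = germ s.
Proof. move=> Vx; rewrite (germE Vx) (germE (h _ Vx)); exact: stalk_of_res. Qed.

Lemma germ_surj (a : stalk) : exists U (s : sec F U), oset U x /\ a = germ s.
Proof.
rewrite -(stalk_reprK a); case: (stalk_repr a) => U Ux s; exists U, s.
by rewrite (germE Ux).
Qed.

Lemma germ_surj2 (a b : stalk) : exists U (s t : sec F U),
  [/\ oset U x, a = germ s & b = germ t].
Proof.
have [U [Ux [s [t [_ [-> -> _]]]]]] := stalk_common a b a.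
by exists U, s, t; split; rewrite // (germE Ux).
Qed.

Lemma germ_eqP U (s t : sec F U) : oset U x -> germ s = germ t ->
  exists (W : opens X) (h : oset W `<=` oset U), oset W x /\ res h s = res h t.
Proof.
move=> Ux; rewrite !(germE Ux) => /stalk_ofP[W [h] [h'] [Wx /= e]].
exists W, h; split=> //; rewrite e; congr (res _ t); exact: Prop_irrelevance.
Qed.

End Stalks.

End Sheaves.
Arguments sheaf k X : clear implicits.

(* The sheaf of functions s(x) in V x that locally satisfy a condition B.
   Sections over U are extended by 0 outside U. *)
Section SheafOfFunctions.
Context {k : fieldType} {X : topologicalType} (V : X -> lmodType k).

Record local_cond := LocalCond {
  lc : opens X -> set (dprod V);
  lc0 : forall U, lc U 0;
  lc_lin : forall U a s t, lc U s -> lc U t -> lc U (a *: s + t);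
  lc_res : forall U W s, oset W `<=` oset U -> lc U s -> lc W s }.

Variable B : local_cond.

Definition is_fsec (U : opens X) : set (dprod V) := [set s |
  (forall x, ~ oset U x -> s x = 0) /\
  (forall x, oset U x -> exists (W : opens X) (b : dprod V),
     [/\ oset W `<=` oset U, oset W x, lc B W b &
         forall y, oset W y -> s y = b y])].

Lemma fsec0 U : is_fsec U 0.
Proof. by split=> // x Ux; exists U, 0; split=> //; exact: lc0. Qed.

Lemma fsec_lin U a s t : is_fsec U s -> is_fsec U t -> is_fsec U (a *: s + t).
Proof.
move=> [s0 sB] [t0 tB]; split=> [x nUx|x Ux].
  by rewrite [LHS](_ : _ = a *: s x + t x)// s0// t0// scaler0 addr0.
have [W [b [WU Wx Bb sb]]] := sB x Ux; have [W' [b' [WU' Wx' Bb' tb]]] := tB x Ux.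
exists (opensI W W'), (a *: b + b'); split=> //.
- by move=> y [/WU].
- by apply: lc_lin; [apply: lc_res Bb => y []|apply: lc_res Bb' => y []].
- move=> y [Wy W'y].
  by rewrite [LHS](_ : _ = a *: s y + t y)// sb// tb.
Qed.

Definition fsec U : linsub (dprod V) := LinSub (fsec0 U) (@fsec_lin U).

Definition fcut (W : opens X) (s : dprod V) : dprod V :=
  fun x => if pselect (oset W x) then s x else 0.

Lemma fcutE W s x : oset W x -> fcut W s x = s x.
Proof. by rewrite /fcut; case: pselect. Qed.
Lemma fcutN W s x : ~ oset W x -> fcut W s x = 0.
Proof. by rewrite /fcut; case: pselect. Qed.

Lemma fcut_fsec U W s : oset W `<=` oset U -> is_fsec U s -> is_fsec W (fcut W s).
Proof.
move=> WU [_ sB]; split=> [x|x Wx]; first exact: fcutN.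
have [A [b [AU Ax Bb sb]]] := sB x (WU x Wx).
exists (opensI A W), b; split=> //.
- by move=> y [].
- by apply: lc_res Bb => y [].
- by move=> y [/sb <- Wy]; rewrite fcutE.
Qed.

Definition fev (U : opens X) (s : subsp (fsec U)) : dprod V := spval s.

Definition fres (U W : opens X) (h : oset W `<=` oset U) (s : subsp (fsec U)) :
  subsp (fsec W) := @SubSp _ _ (fsec W) _ (fcut_fsec h (spvalP s)).

Lemma fres_lin U W (h : oset W `<=` oset U) : linear (fres h).
Proof.
move=> a s t; apply: spval_inj; apply: functional_extensionality_dep => x.
rewrite [RHS](_ : _ = a *: fcut W (spval s) x + fcut W (spval t) x)//=.
case: (pselect (oset W x)) => Wx; first by rewrite !fcutE.
by rewrite !fcutN// scaler0 addr0.
Qed.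

Lemma fres_id U (h : oset U `<=` oset U) s : fres h s = s.
Proof.
apply: spval_inj; apply: functional_extensionality_dep => x /=.
case: (pselect (oset U x)) => Ux; first by rewrite fcutE.
by rewrite fcutN//; case: (spvalP s) => ->.
Qed.

Lemma fres_comp U W A (h : oset W `<=` oset U) (h' : oset A `<=` oset W)
  (h'' : oset A `<=` oset U) s : fres h' (fres h s) = fres h'' s.
Proof.
apply: spval_inj; apply: functional_extensionality_dep => x /=.
case: (pselect (oset A x)) => Ax; last by rewrite !fcutN.
by rewrite !fcutE//; exact: h'.
Qed.

Lemma fres_sep (I : Type) (W : I -> opens X) (U : opens X)
    (h : forall i, oset (W i) `<=` oset U) :
  oset U `<=` \bigcup_i oset (W i) ->
  forall s t, (forall i, fres (h i) s = fres (h i) t) -> s = t.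
Proof.
move=> cov s t st; apply: spval_inj; apply: functional_extensionality_dep => x.
case: (pselect (oset U x)) => [/cov[i _ Wx]|nUx].
  by have /(congr1 (fun s => fev s x)) := st i; rewrite /fev /= !fcutE.
by case: (spvalP s) (spvalP t) => -> // _ [->].
Qed.

Lemma fres_glue (I : Type) (W : I -> opens X) (U : opens X)
    (h : forall i, oset (W i) `<=` oset U) :
  oset U `<=` \bigcup_i oset (W i) ->
  forall s : (forall i, subsp (fsec (W i))),
  (forall i j (A : opens X) (hi : oset A `<=` oset (W i))
        (hj : oset A `<=` oset (W j)), fres hi (s i) = fres hj (s j)) ->
  exists t : subsp (fsec U), forall i, fres (h i) t = s i.
Proof.
move=> cov s comp.
pose f : dprod V := fun x =>
  if pselect (exists i, oset (W i) x) is left H then spval (s (sval (cid H))) x else 0.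
have fE i x : oset (W i) x -> f x = spval (s i) x.
  move=> Wx; rewrite /f; case: pselect => [H|]; last by case; exists i.
  case: cid => j /= Wjx.
  have := comp i j (opensI (W i) (W j)) (@opensIl _ _ _) (@opensIr _ _ _).
  by move=> /(congr1 (fun s => fev s x)); rewrite /fev /= !fcutE.
have Uf : is_fsec U f.
  split=> [x nUx|x Ux].
    rewrite /f; case: pselect => // H; case: cid => i /= Wx.
    by case: nUx; exact: h Wx.
  have [i _ Wx] := cov x Ux.
  have [_ /(_ x Wx)[A [b [AW Ax Bb sb]]]] := spvalP (s i).
  exists A, b; split=> //; first exact: subset_trans AW (h i).
  by move=> y Ay; rewrite (fE i) ?sb//; exact: AW.
exists (@SubSp _ _ (fsec U) _ Uf) => i.
apply: spval_inj; apply: functional_extensionality_dep => x /=.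
case: (pselect (oset (W i) x)) => Wx; first by rewrite fcutE// (fE i).
by rewrite fcutN//; case: (spvalP (s i)) => ->.
Qed.

Definition fsheaf : sheaf k X :=
  Sheaf fres_lin fres_id fres_comp fres_sep fres_glue.

Definition fval (U : opens X) (s : sec fsheaf U) : dprod V := spval s.

(* The value at x of a germ at x. *)
Definition germ_val (x : X) (a : stalk fsheaf x) : V x :=
  fval (pgs (stalk_repr a)) x.

Lemma germ_valE x (U : opens X) (s : sec fsheaf U) : oset U x ->
  germ_val (germ x s) = fval s x.
Proof.
move=> Ux; rewrite /germ_val (germE Ux).
have /stalk_ofP := stalk_reprK (stalk_of (@PreGerm _ _ fsheaf x U Ux s)).
case=> W [h] [h'] [Wx] /(congr1 (fun s => fev s x)).
by rewrite /fev /= !fcutE.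
Qed.

Lemma germ_val_lin x : linear (@germ_val x).
Proof.
move=> a g h; have [U [s [t [Ux -> ->]]]] := germ_surj2 g h.
by rewrite -germ_lin !germ_valE.
Qed.

End SheafOfFunctions.

Section ConstantSheaf.
Context {k : fieldType} {X : topologicalType} (Z : set X).

(* For locally closed Z, the constant sheaf k_Z on Z, extended by 0 to X: a
   section over U is a locally constant function on Z `&` U with support closed
   in U. A nonzero constant is allowed over U only if Z `&` U is closed in U. *)
Definition cst_on (a : k) : dprod (fun _ : X => k^o) :=
  fun x => if pselect (Z x) then a else 0.

Lemma cst_on0 x : cst_on 0 x = 0.
Proof. by rewrite /cst_on; case: (pselect (Z x)). Qed.

Lemma cst_on_lin a b c x : cst_on (a * b + c) x = a *: cst_on b x + cst_on c x.
Proof. by rewrite /cst_on; case: (pselect (Z x)) => //= _; rewrite scaler0 addr0. Qed.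

Definition cst_cond (U : opens X) : set (dprod (fun _ : X => k^o)) := [set s |
  exists a : k, (a = 0 \/ closure (Z `&` oset U) `&` oset U `<=` Z) /\
    forall x, oset U x -> s x = cst_on a x].

Lemma cst_cond0 U : cst_cond U 0.
Proof.
exists 0; split; first by left.
by move=> x _; rewrite cst_on0.
Qed.

Lemma cst_cond_lin U a s t :
  cst_cond U s -> cst_cond U t -> cst_cond U (a *: s + t).
Proof.
move=> [b [Hb sb]] [c [Hc tc]]; exists (a * b + c); split.
  case: Hb => [->|Hb]; last by right.
  case: Hc => [->|Hc]; last by right.
  by left; rewrite mulr0 addr0.
move=> x Ux; by rewrite [LHS](_ : _ = a *: s x + t x)// sb// tc// cst_on_lin.
Qed.

Lemma cst_cond_res U W s : oset W `<=` oset U -> cst_cond U s -> cst_cond W s.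
Proof.
move=> WU [a [Ha sa]]; exists a; split; last by move=> x /WU; exact: sa.
case: Ha => [|Ha]; [by left|right].
move=> x [cx Wx]; apply: Ha; split; last exact: WU.
by apply: closureS cx => y [Zy /WU].
Qed.

Definition csheaf : sheaf k X :=
  fsheaf (LocalCond cst_cond0 cst_cond_lin cst_cond_res).

(* The section 1 of k_Z over U when Z is closed (and 0 by convention if not). *)
Lemma cst_one_fsec (U : opens X) : closed Z ->
  is_fsec (LocalCond cst_cond0 cst_cond_lin cst_cond_res) U (fcut U (cst_on 1)).
Proof.
move=> cZ; split=> [x|x Ux]; first exact: fcutN.
exists U, (cst_on 1); split=> //; last by move=> y; exact: fcutE.
exists 1; split=> //; right => y [+ _]; rewrite {2}(closure_id Z).1//.
by apply: closureS => z [].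
Qed.

Definition cst_one (U : opens X) : sec csheaf U :=
  if pselect (closed Z) is left h then @SubSp _ _ (fsec _ U) _ (cst_one_fsec U h)
  else 0.

End ConstantSheaf.
Arguments csheaf k {X} Z.

Section Pullback.
Context {k : fieldType} {X Y : topologicalType} (f : continuousType X Y).
Variable G : sheaf k Y.

Definition pull_cond (U : opens X) : set (dprod (fun x => stalk G (f x))) :=
  [set s | exists (W : opens Y) (t : sec G W), oset U `<=` f @^-1` oset W /\
     forall x, oset U x -> s x = germ (f x) t].

Lemma pull_cond0 U : pull_cond U 0.
Proof.
exists opensT, 0; split=> // x _.
by rewrite -[X in germ _ X](addNr 0) -scaleN1r germ_lin scaleN1r addNr.
Qed.

Lemma pull_cond_lin U a s t :
  pull_cond U s -> pull_cond U t -> pull_cond U (a *: s + t).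
Proof.
move=> [W [s' [UW ss]]] [W' [t' [UW' tt]]].
exists (opensI W W'), (a *: res (@opensIl _ W W') s' + res (@opensIr _ W W') t').
split=> [x Ux|x Ux]; first by split; [exact: UW|exact: UW'].
rewrite [LHS](_ : _ = a *: s x + t x)// ss// tt// germ_lin.
by rewrite !germ_res//; split; [exact: UW|exact: UW'|exact: UW|exact: UW'].
Qed.

Lemma pull_cond_res U W s : oset W `<=` oset U -> pull_cond U s -> pull_cond W s.
Proof.
move=> WU [A [t [UA st]]]; exists A, t; split; first exact: subset_trans UA.
by move=> x /WU; exact: st.
Qed.

(* The inverse image f^-1 G: its sections are the families of germs
   s(x) in G_{f x} induced locally on X by sections of G. *)
Definition pullback : sheaf k X :=
  fsheaf (LocalCond pull_cond0 pull_cond_lin pull_cond_res).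

End Pullback.

Section Tensor.
Context {k : fieldType} {X : topologicalType} (F G : sheaf k X).

Definition tens_germ (U : opens X) (s : sec F U) (t : sec G U) :
    dprod (fun x => tens (stalk F x) (stalk G x)) :=
  fun x => pure (germ x s) (germ x t).

Definition tens_cond (U : opens X) :
    set (dprod (fun x => tens (stalk F x) (stalk G x))) :=
  [set f | exists g, lspan [set b | exists s t, b = @tens_germ U s t] g /\
     forall x, oset U x -> f x = g x].

Lemma tens_cond0 U : tens_cond U 0.
Proof. by exists 0; split=> //; exact: lspan0. Qed.

Lemma tens_cond_lin U a s t :
  tens_cond U s -> tens_cond U t -> tens_cond U (a *: s + t).
Proof.
move=> [s' [Ss ss]] [t' [St tt]]; exists (a *: s' + t'); split.
  exact: lspan_lin.
by move=> x Ux; rewrite [LHS](_ : _ = a *: s x + t x)// ss// tt.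
Qed.

Lemma tens_cond_res U W s : oset W `<=` oset U -> tens_cond U s -> tens_cond W s.
Proof.
move=> WU [g [Sg sg]].
suff [g' [Sg' gg']] : exists g', lspan [set b | exists s t, b = @tens_germ W s t] g' /\
    forall x, oset W x -> g x = g' x.
  by exists g'; split=> // x Wx; rewrite sg ?gg'//; exact: WU.
elim: Sg => {sg} [|a b u [s' [t' ->]] _ [u' [Su' uu']]].
  by exists 0; split=> //; exact: lspan0.
exists (a *: tens_germ (res WU s') (res WU t') + u'); split.
  by apply: lspan_cons => //; exists (res WU s'), (res WU t').
move=> x Wx; rewrite [LHS](_ : _ = a *: tens_germ s' t' x + u x)// uu'//.
rewrite [RHS](_ : _ = a *: tens_germ (res WU s') (res WU t') x + u' x)//.
by rewrite /tens_germ !germ_res.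
Qed.

Definition tensor : sheaf k X :=
  fsheaf (LocalCond tens_cond0 tens_cond_lin tens_cond_res).

Lemma tens_sec_fsec (U : opens X) (s : sec F U) (t : sec G U) :
  is_fsec (LocalCond tens_cond0 tens_cond_lin tens_cond_res) U
    (fcut U (tens_germ s t)).
Proof.
split=> [x|x Ux]; first exact: fcutN.
exists U, (tens_germ s t); split=> //; last by move=> y; exact: fcutE.
exists (tens_germ s t); split=> //.
rewrite -[tens_germ s t]addr0 -[tens_germ s t]scale1r.
by apply: lspan_cons; [exists s, t | exact: lspan0].
Qed.

Definition tens_sec (U : opens X) (s : sec F U) (t : sec G U) : sec tensor U :=
  @SubSp _ _ (fsec _ U) _ (tens_sec_fsec s t).

End Tensor.

Section DirectSum.
Context {k : fieldType} {X : topologicalType} {I : finType} (F : I -> sheaf k X).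

Let ds (U : opens X) : lmodType k := dprod (fun i => sec (F i) U).
Let dr (U V : opens X) (h : oset V `<=` oset U) (s : ds U) : ds V :=
  fun i => res h (s i).

Lemma dsum_lin U V (h : oset V `<=` oset U) : linear (dr h).
Proof. by move=> a s t; apply: functional_extensionality_dep => i; exact: res_lin. Qed.
Lemma dsum_id U (h : oset U `<=` oset U) s : dr h s = s.
Proof. by apply: functional_extensionality_dep => i; exact: res_id. Qed.
Lemma dsum_comp U V W (h : oset V `<=` oset U) (h' : oset W `<=` oset V)
  (h'' : oset W `<=` oset U) s : dr h' (dr h s) = dr h'' s.
Proof. by apply: functional_extensionality_dep => i; exact: res_comp. Qed.
Lemma dsum_sep (J : Type) (V : J -> opens X) (U : opens X)
    (h : forall j, oset (V j) `<=` oset U) :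
  oset U `<=` \bigcup_j oset (V j) ->
  forall s t, (forall j, dr (h j) s = dr (h j) t) -> s = t.
Proof.
move=> cov s t st; apply: functional_extensionality_dep => i.
by apply: (@res_sep _ _ (F i) J V U h cov) => j; exact: (congr1 (fun s : ds _ => s i) (st j)).
Qed.
Lemma dsum_glue (J : Type) (V : J -> opens X) (U : opens X)
    (h : forall j, oset (V j) `<=` oset U) :
  oset U `<=` \bigcup_j oset (V j) ->
  forall s : (forall j, ds (V j)),
  (forall i j (W : opens X) (hi : oset W `<=` oset (V i))
        (hj : oset W `<=` oset (V j)), dr hi (s i) = dr hj (s j)) ->
  exists t : ds U, forall j, dr (h j) t = s j.
Proof.
move=> cov s comp.
have G i : exists t : sec (F i) U, forall j, res (h j) t = s j i.
  apply: (@res_glue _ _ (F i) J V U h cov (fun j => s j i)) => j l W hj hl.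
  exact: (congr1 (fun s : ds _ => s i) (comp j l W hj hl)).
exists (fun i => sval (cid (G i))) => j.
apply: functional_extensionality_dep => i; rewrite /dr; by case: cid.
Qed.

Definition dsum : sheaf k X :=
  Sheaf dsum_lin dsum_id dsum_comp dsum_sep dsum_glue.

End DirectSum.

Section Morphisms.
Context {k : fieldType} {X : topologicalType}.
Implicit Types F G H : sheaf k X.

Record mor F G := Mor {
  mfun :> forall U : opens X, sec F U -> sec G U;
  mor_lin : forall U, linear (@mfun U);
  mor_nat : forall U V (h : oset V `<=` oset U) s,
    mfun (res h s) = res h (mfun s) }.
Arguments mfun {F G} _ U _ : rename.

Definition is_iso F G (f : mor F G) := exists g : mor G F,
  forall U, cancel (f U) (g U) /\ cancel (g U) (f U).

Definition mono F G (f : mor F G) := forall U, injective (f U).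

Lemma mor0_lin F G (U : opens X) : linear (fun _ : sec F U => 0 : sec G U).
Proof. by move=> a s t; rewrite scaler0 addr0. Qed.
Lemma mor0_nat F G U V (h : oset V `<=` oset U) (s : sec F U) :
  0 = res h (0 : sec G U).
Proof. by rewrite res0. Qed.
Definition mor0 F G : mor F G := Mor (@mor0_lin F G) (@mor0_nat F G).

Lemma mopp_lin F G (f : mor F G) (U : opens X) : linear (fun s => - f U s).
Proof. by move=> a s t; rewrite mor_lin opprD scalerN. Qed.
Lemma mopp_nat F G (f : mor F G) U V (h : oset V `<=` oset U) (s : sec F U) :
  - f V (res h s) = res h (- f U s).
Proof. by rewrite mor_nat -!scaleN1r resZ. Qed.
Definition mopp F G (f : mor F G) : mor F G := Mor (mopp_lin f) (mopp_nat f).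

Lemma mor_0 F G (f : mor F G) U : f U 0 = 0.
Proof. by apply: (@addrI _ (f U 0)); rewrite -{1}[f U 0]scale1r -mor_lin scale1r !addr0. Qed.

Lemma mor_N F G (f : mor F G) U s : f U (- s) = - f U s.
Proof. by rewrite -scaleN1r -[_ *: s]addr0 (mor_lin f) mor_0 addr0 scaleN1r. Qed.

Definition stalk_map F G (f : mor F G) (x : X) (a : stalk F x) : stalk G x :=
  germ x (f _ (pgs (stalk_repr a))).

Lemma stalk_mapE F G (f : mor F G) (x : X) (U : opens X) (s : sec F U) :
  oset U x -> stalk_map f (germ x s) = germ x (f U s).
Proof.
move=> Ux; rewrite /stalk_map (germE Ux).
have /stalk_ofP := stalk_reprK (stalk_of (PreGerm Ux s)).
case=> W [h] [h'] [Wx] /(congr1 (f W)); rewrite !mor_nat => e.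
by rewrite -(germ_res h _ Wx) e germ_res.
Qed.

Definition injective_sheaf (J : sheaf k X) := forall F G (i : mor F G), mono i ->
  forall f : mor F J, exists g : mor G J, forall U s, g U (i U s) = f U s.

Record cpx := Cpx {
  ob : int -> sheaf k X;
  dif : forall n : int, mor (ob n) (ob (n + 1));
  dif2 : forall n (U : opens X) s, dif (n + 1) U (dif n U s) = 0 }.

Record cmor (K L : cpx) := CMor {
  cfun :> forall n, mor (ob K n) (ob L n);
  cfun_dif : forall n (U : opens X) s,
    cfun (n + 1) U (dif K n U s) = dif L n U (cfun n U s) }.

(* At each point x, the induced map on the cohomology of the complexes of
   stalks, H^(n+1)(K)_x -> H^(n+1)(L)_x, is injective and surjective. *)
Definition quasi_iso (K L : cpx) (f : cmor K L) := forall (n : int) (x : X),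
  (forall a : stalk (ob K (n + 1)) x, stalk_map (dif K (n + 1)) a = 0 ->
     (exists b : stalk (ob L n) x, stalk_map (f (n + 1)) a = stalk_map (dif L n) b) ->
     exists c : stalk (ob K n) x, a = stalk_map (dif K n) c) /\
  (forall b : stalk (ob L (n + 1)) x, stalk_map (dif L (n + 1)) b = 0 ->
     exists (a : stalk (ob K (n + 1)) x) (c : stalk (ob L n) x),
       stalk_map (dif K (n + 1)) a = 0 /\
       b = stalk_map (f (n + 1)) a + stalk_map (dif L n) c).

(* Isomorphism in the derived category: a roof K <- M -> L represents an
   isomorphism iff both of its legs are quasi-isomorphisms. As D^b is a full
   subcategory of D, no boundedness is required of M. *)
Definition derived_iso (K L : cpx) := exists (M : cpx) (f : cmor M K) (g : cmor M L),
  quasi_iso f /\ quasi_iso g.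

Definition bounded_below (K : cpx) := exists N : int, forall n, n < N ->
  forall (U : opens X) (s : sec (ob K n) U), s = 0.

Lemma shift1_dif2 (K : cpx) (n : int) (U : opens X) (s : sec (ob K (n + 1)) U) :
  mopp (dif K (n + 1 + 1)) U (mopp (dif K (n + 1)) U s) = 0.
Proof. by rewrite /= mor_N dif2 !oppr0. Qed.

(* K[1] *)
Definition shift1 (K : cpx) : cpx :=
  Cpx (ob := fun n => ob K (n + 1)) (@shift1_dif2 K).

Lemma in_deg0_dif2 F (n : int) (U : opens X) s :
  mor0 (if n + 1 == 0 then F else csheaf k set0)
       (if n + 1 + 1 == 0 then F else csheaf k set0) U
    (mor0 (if n == 0 then F else csheaf k set0)
       (if n + 1 == 0 then F else csheaf k set0) U s) = 0.
Proof. by []. Qed.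

(* F as a complex concentrated in degree 0; the sheaf k_Z for empty Z is 0. *)
Definition in_deg0 F : cpx :=
  Cpx (ob := fun n => if n == 0 then F else csheaf k set0) (@in_deg0_dif2 F).

Definition is_injective_resolution (K : cpx) (I : {I : cpx & cmor K I}) :=
  [/\ bounded_below (projT1 I), forall n, injective_sheaf (ob (projT1 I) n)
    & quasi_iso (projT2 I)].

(* A chosen bounded below injective resolution (K itself if there is none,
   which does not happen for bounded below K). *)
Definition injective_resolution (K : cpx) : cpx :=
  if pselect (exists I, @is_injective_resolution K I) is left h
  then projT1 (sval (cid h)) else K.

End Morphisms.

Section ProperDirectImage.
Context {k : fieldType} {X Y : topologicalType} (f : continuousType X Y).

(* The restriction of f to A, as a map to V, is proper: closed with compact
   fibres. Here A is a closed subset of f @^-1` V. *)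
Definition proper_over (V : opens Y) (A : set X) :=
  (forall B, closed B ->
     closure (f @` (A `&` B)) `&` oset V `<=` f @` (A `&` B)) /\
  (forall y, oset V y -> compact (A `&` f @^-1` [set y])).

Definition supp (F : sheaf k X) (U : opens X) (s : sec F U) : set X :=
  [set x | oset U x /\ germ x s <> 0].

Lemma germ0 (F : sheaf k X) x (U : opens X) : germ x (0 : sec F U) = 0.
Proof. by rewrite -[X in germ _ X](addNr 0) -scaleN1r germ_lin scaleN1r addNr. Qed.

Lemma supp0 (F : sheaf k X) (U : opens X) : supp (0 : sec F U) = set0.
Proof. by apply/seteqP; split=> x // [_]; rewrite germ0. Qed.

Lemma supp_lin (F : sheaf k X) (U : opens X) a (s t : sec F U) :
  supp (a *: s + t) `<=` supp s `|` supp t.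
Proof.
move=> x [Ux nz]; apply: contrapT => /not_orP[ns nt]; apply: nz.
have s0 : germ x s = 0 by apply: contrapT => ?; apply: ns.
have t0 : germ x t = 0 by apply: contrapT => ?; apply: nt.
by rewrite germ_lin s0 t0 scaler0 addr0.
Qed.

Lemma supp_closed (F : sheaf k X) (U : opens X) (s : sec F U) :
  exists D, closed D /\ supp s = D `&` oset U.
Proof.
exists (~` [set x | oset U x /\ germ x s = 0]); split; last first.
  apply/seteqP; split=> x; first by move=> [Ux nz]; split=> // -[].
  by move=> [nz Ux]; split=> // s0; exact: nz.
apply: open_closedC; rewrite openE => x [Ux].
rewrite -(germ0 F x U) => /(germ_eqP Ux)[W [h [Wx e]]].
rewrite /interior; apply: filterS (open_nbhs_nbhs (conj (osetP W) Wx)) => y Wy.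
split; first exact: (h _ Wy).
by rewrite -(germ_res h s Wy) e res0 germ0.
Qed.

Lemma proper_overS (V : opens Y) (A A' C D : set X) : closed D ->
  C = D `&` f @^-1` (oset V) -> C `<=` A `|` A' ->
  A `<=` f @^-1` (oset V) -> A' `<=` f @^-1` (oset V) ->
  proper_over V A -> proper_over V A' -> proper_over V C.
Proof.
move=> cD CD CA AV AV' [pA kA] [pA' kA']; split=> [B cB|y Vy].
  have e : f @` (C `&` B) = f @` (A `&` (B `&` D)) `|` f @` (A' `&` (B `&` D)).
    apply/seteqP; split=> y.
      move=> [x [Cx Bx] <-]; have Dx : D x by move: Cx; rewrite CD => -[].
      by case: (CA x Cx) => Ax; [left|right]; exists x.
    case=> -[x [Ax [Bx Dx]] <-]; exists x => //; split=> //; rewrite CD; split=> //.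
      exact: AV.
    exact: AV'.
  rewrite e closureU => y [[cy|cy] Vy].
    by left; apply: pA => //; exact: closedI.
  by right; apply: pA' => //; exact: closedI.
have -> : C `&` f @^-1` [set y] =
    ((A `&` f @^-1` [set y]) `|` (A' `&` f @^-1` [set y])) `&` D.
  apply/seteqP; split=> x.
    move=> [Cx fx]; have Dx : D x by move: Cx; rewrite CD => -[].
    by split=> //; case: (CA x Cx) => Ax; [left|right].
  by move=> [[[Ax fx]|[Ax fx]] Dx]; split=> //; rewrite CD; split=> //;
    [exact: AV|exact: AV'].
by apply: compact_closedI => //; apply: compactU; [exact: kA|exact: kA'].
Qed.

Section OneSheaf.
Variable F : sheaf k X.

Definition proper_supp (V : opens Y) : set (sec F (opens_pre f V)) :=
  [set s | proper_over V (supp s)].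
Arguments proper_supp : clear implicits.

Lemma proper_supp0 V : proper_supp V 0.
Proof.
rewrite /proper_supp /= supp0; split=> [B _ y|y _]; last by rewrite set0I; exact: compact0.
by rewrite set0I image_set0 closure0 => -[].
Qed.

Lemma supp_pre (V : opens Y) (s : sec F (opens_pre f V)) :
  supp s `<=` f @^-1` oset V.
Proof. by move=> x []. Qed.

Lemma proper_supp_lin V a s t :
  proper_supp V s -> proper_supp V t -> proper_supp V (a *: s + t).
Proof.
move=> ps pt; have [D [cD e]] := supp_closed (a *: s + t).
apply: proper_overS cD e _ _ _ ps pt; [exact: supp_lin|exact: supp_pre..].
Qed.

Definition shriek_sub (V : opens Y) : linsub (sec F (opens_pre f V)) :=
  LinSub (proper_supp0 V) (@proper_supp_lin V).

Lemma pre_sub (V W : opens Y) : oset W `<=` oset V ->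
  oset (opens_pre f W) `<=` oset (opens_pre f V).
Proof. by move=> WV x; exact: WV. Qed.

Lemma supp_res (U U' : opens X) (h : oset U' `<=` oset U) (s : sec F U) :
  supp (res h s) = supp s `&` oset U'.
Proof.
apply/seteqP; split=> x.
  by move=> [Ux]; rewrite germ_res// => nz; split=> //; split=> //; exact: h.
by move=> [[Ux nz] U'x]; split=> //; rewrite germ_res.
Qed.

Lemma proper_supp_res (V W : opens Y) (h : oset W `<=` oset V) s :
  proper_supp V s -> proper_supp W (res (pre_sub h) s).
Proof.
move=> [p c]; split=> [B cB y [cy Wy]|y Wy].
  have [] := p B cB y.
    split; last exact: (h _ Wy).
    by apply: closureS cy; apply: image_subset; rewrite supp_res => x [[]].
  move=> x [sx Bx] fx; exists x => //; split=> //.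
  by rewrite supp_res; split=> //=; rewrite /preimage /= fx.
rewrite supp_res (_ : _ `&` _ = supp s `&` f @^-1` [set y]); first exact/c/h.
apply/seteqP; split=> x; first by move=> [[]].
by move=> [sx fx]; split=> //; split=> //; rewrite /= /preimage /= fx.
Qed.

Definition shriek_res (V W : opens Y) (h : oset W `<=` oset V)
    (s : subsp (shriek_sub V)) : subsp (shriek_sub W) :=
  @SubSp _ _ (shriek_sub W) _ (proper_supp_res h (spvalP s)).

Lemma shriek_lin V W (h : oset W `<=` oset V) : linear (shriek_res h).
Proof. by move=> a s t; apply: spval_inj; exact: res_lin. Qed.
Lemma shriek_id V (h : oset V `<=` oset V) s : shriek_res h s = s.
Proof. by apply: spval_inj; exact: res_id. Qed.
Lemma shriek_comp U V W (h : oset V `<=` oset U) (h' : oset W `<=` oset V)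
  (h'' : oset W `<=` oset U) s : shriek_res h' (shriek_res h s) = shriek_res h'' s.
Proof. by apply: spval_inj; exact: res_comp. Qed.

Lemma cover_pre (J : Type) (V : J -> opens Y) (U : opens Y) :
  oset U `<=` \bigcup_j oset (V j) ->
  oset (opens_pre f U) `<=` \bigcup_j oset (opens_pre f (V j)).
Proof. by move=> cov x /cov[j _ Vx]; exists j. Qed.

Lemma shriek_sep (J : Type) (V : J -> opens Y) (U : opens Y)
    (h : forall j, oset (V j) `<=` oset U) :
  oset U `<=` \bigcup_j oset (V j) ->
  forall s t, (forall j, shriek_res (h j) s = shriek_res (h j) t) -> s = t.
Proof.
move=> cov s t st; apply: spval_inj.
apply: (@res_sep _ _ F J (fun j => opens_pre f (V j)) (opens_pre f U)
  (fun j => pre_sub (h j)) (cover_pre cov)) => j.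
exact: (congr1 (fun s => spval s) (st j)).
Qed.

Lemma shriek_glue (J : Type) (V : J -> opens Y) (U : opens Y)
    (h : forall j, oset (V j) `<=` oset U) :
  oset U `<=` \bigcup_j oset (V j) ->
  forall s : (forall j, subsp (shriek_sub (V j))),
  (forall i j (W : opens Y) (hi : oset W `<=` oset (V i))
        (hj : oset W `<=` oset (V j)), shriek_res hi (s i) = shriek_res hj (s j)) ->
  exists t : subsp (shriek_sub U), forall j, shriek_res (h j) t = s j.
Proof.
move=> cov s comp.
have [|t tE] := @res_glue _ _ F J (fun j => opens_pre f (V j)) (opens_pre f U)
  (fun j => pre_sub (h j)) (cover_pre cov) (fun j => spval (s j)).
  move=> i j W hi hj.
  apply: (@res_sep _ _ F unit (fun _ => opensI W (opens_pre f (opensI (V i) (V j)))) W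
    (fun _ => @opensIl _ _ _)).
    by move=> x Wx; exists tt => //; split=> //; split; [exact: hi|exact: hj].
  move=> _; have := congr1 (fun s => spval s)
    (comp i j (opensI (V i) (V j)) (@opensIl _ _ _) (@opensIr _ _ _)).
  move=> /(congr1 (res (@opensIr _ W (opens_pre f (opensI (V i) (V j)))))) /= E.
  have e l (hl : oset W `<=` oset (opens_pre f (V l)))
      (hl' : oset (opens_pre f (opensI (V i) (V j))) `<=` oset (opens_pre f (V l))) :
      res (@opensIl _ W (opens_pre f (opensI (V i) (V j)))) (res hl (spval (s l))) =
      res (@opensIr _ W (opens_pre f (opensI (V i) (V j)))) (res hl' (spval (s l))).
    have h'' := subset_trans (@opensIl _ W (opens_pre f (opensI (V i) (V j)))) hl.
    by rewrite (res_comp _ _ h'') (res_comp _ _ h'').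
  apply: (etrans (e i hi (pre_sub (@opensIl _ (V i) (V j))))).
  apply: etrans (esym (e j hj (pre_sub (@opensIr _ (V i) (V j))))).
  exact: E.
have suppE j : supp (spval (s j)) = supp t `&` f @^-1` oset (V j).
  by rewrite -tE supp_res.
have pt : proper_supp U t.
  split=> [B cB y [cy Uy]|y Uy].
    have [j _ Vy] := cov y Uy; have [p _] := spvalP (s j).
    have [|x [sx Bx] fx] := p B cB y.
      split=> // N Ny; have := cy (N `&` oset (V j)).
      case; first by apply: filterI => //; exact: open_nbhs_nbhs (conj (osetP (V j)) Vy).
      move=> z [[x [sx Bx] fx] [Nz Vz]]; exists z; split=> //; exists x => //.
      by split=> //; rewrite suppE; split=> //; rewrite /preimage /= fx.
    by exists x => //; split=> //; move: sx; rewrite suppE => -[].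
  have [j _ Vy] := cov y Uy; have [_ /(_ y Vy)] := spvalP (s j).
  rewrite suppE (_ : _ `&` _ = supp t `&` f @^-1` [set y])//.
  apply/seteqP; split=> x; first by move=> [[]].
  by move=> [sx fx]; split=> //; split=> //; rewrite /= /preimage /= fx.
by exists (@SubSp _ _ (shriek_sub U) _ pt) => j; apply: spval_inj; exact: tE.
Qed.

(* f_! F: the sections of F over f @^-1` V whose support is proper over V. *)
Definition shriek : sheaf k Y :=
  Sheaf shriek_lin shriek_id shriek_comp shriek_sep shriek_glue.

End OneSheaf.

Section Functoriality.
Variables (F G : sheaf k X) (u : mor F G).

Lemma shriek_mor_proper (V : opens Y) (s : sec F (opens_pre f V)) :
  proper_supp s -> proper_supp (u _ s).
Proof.
move=> ps; have [D [cD e]] := supp_closed (u _ s).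
refine (proper_overS cD e _ _ _ ps ps); [|exact: supp_pre..].
move=> x [Ux nz]; left; split=> // s0; apply: nz.
by rewrite -(stalk_mapE u s Ux) s0 -(germ0 F x (opens_pre f V)) stalk_mapE// mor_0 germ0.
Qed.

Definition shriek_fun (V : opens Y) (s : sec (shriek F) V) : sec (shriek G) V :=
  @SubSp _ _ (shriek_sub G V) _ (shriek_mor_proper (spvalP s)).

Lemma shriek_fun_lin V : linear (@shriek_fun V).
Proof. by move=> a s t; apply: spval_inj; exact: mor_lin. Qed.
Lemma shriek_fun_nat V W (h : oset W `<=` oset V) s :
  @shriek_fun W (res h s) = res h (@shriek_fun V s).
Proof. by apply: spval_inj; exact: mor_nat. Qed.

Definition shriek_mor : mor (shriek F) (shriek G) :=
  Mor shriek_fun_lin shriek_fun_nat.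

End Functoriality.

Lemma shriek_dif2 (K : cpx) (n : int) (V : opens Y) (s : sec (shriek (ob K n)) V) :
  shriek_mor (dif K (n + 1)) V (shriek_mor (dif K n) V s) = 0.
Proof. by apply: spval_inj; exact: dif2. Qed.

Definition shriek_cpx (K : @cpx k X) : @cpx k Y :=
  Cpx (ob := fun n => shriek (ob K n)) (@shriek_dif2 K).

Definition Rshriek (K : @cpx k X) : @cpx k Y :=
  shriek_cpx (injective_resolution K).

End ProperDirectImage.

Section Enhanced.
Context {R : realType}.
Local Notation C := R[i].

Definition mkcontinuous {X Y : topologicalType} (f : X -> Y) (h : continuous f) :
  continuousType X Y := mkcts h.

(* The complex line as a topological space, with the topology of its norm. *)
Definition Cline : topologicalType := R[i]^o.

Section PairContinuity.
Context {X Y Z : topologicalType}.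
Lemma fst_cts : continuous (fun p : X * Y => p.1).
Proof. by move=> [x y]; exact: cvg_fst. Qed.
Lemma snd_cts : continuous (fun p : X * Y => p.2).
Proof. by move=> [x y]; exact: cvg_snd. Qed.
Lemma pair_cts (f : Z -> X) (g : Z -> Y) : continuous f -> continuous g ->
  continuous (fun z => (f z, g z)).
Proof. by move=> cf cg z; apply: cvg_pair; [exact: cf|exact: cg]. Qed.
Lemma comp_cts (f : X -> Y) (g : Y -> Z) : continuous f -> continuous g ->
  continuous (fun x => g (f x)).
Proof. by move=> cf cg x; apply: continuous_comp; [exact: cf|exact: cg]. Qed.
End PairContinuity.

Section Convolution.
Context {X : topologicalType}.

Definition prX : continuousType (X * R)%type X :=
  mkcontinuous fst_cts.

Lemma q1_cts : continuous (fun p : X * (R * R) => (p.1, p.2.1) : X * R).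
Proof.
apply: pair_cts; first exact: fst_cts.
by apply: comp_cts; [exact: snd_cts|exact: fst_cts].
Qed.
Lemma q2_cts : continuous (fun p : X * (R * R) => (p.1, p.2.2) : X * R).
Proof.
apply: pair_cts; first exact: fst_cts.
by apply: comp_cts; exact: snd_cts.
Qed.
Lemma mu_cts : continuous (fun p : X * (R * R) => (p.1, p.2.1 + p.2.2) : X * R).
Proof.
apply: pair_cts; first exact: fst_cts.
apply: (@comp_cts _ _ _ _ (fun q : R * R => q.1 + q.2)); first exact: snd_cts.
exact: add_continuous.
Qed.

Definition q1 := mkcontinuous q1_cts.
Definition q2 := mkcontinuous q2_cts.
Definition mu := mkcontinuous mu_cts.

Definition convolution (F G : sheaf C (X * R)%type) : @cpx C (X * R)%type :=
  Rshriek mu (in_deg0 (tensor (pullback q1 F) (pullback q2 G))).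

Section Exponential.
Variables (phi : X -> R) (Z : set X).

Definition Esheaf : sheaf C (X * R)%type :=
  tensor (pullback prX (csheaf C Z)) (csheaf C [set p | 0 <= p.2 + phi p.1]).

(* Through C (x) C = C, a section of Esheaf is a function with complex values;
   Eval s p is its value at p. *)
Definition Eform_fun (p : X * R)
  (u : stalk (pullback prX (csheaf C Z)) p)
  (v : stalk (csheaf C [set p : X * R | 0 <= p.2 + phi p.1]) p) : C^o :=
  germ_val (germ_val u) * germ_val v.

Lemma Eform_linl p v : linear ((@Eform_fun p)^~ v).
Proof.
move=> a u u'; rewrite /Eform_fun germ_val_lin.
have -> : germ_val (a *: germ_val u + germ_val u') =
  a *: germ_val (germ_val u) + germ_val (germ_val u') by exact: germ_val_lin.
by rewrite mulrDl scalerAl.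
Qed.
Lemma Eform_linr p u : linear (@Eform_fun p u).
Proof. by move=> a v v'; rewrite /Eform_fun germ_val_lin mulrDr scalerAr. Qed.

Definition Eval (U : opens (X * R)%type) (s : sec Esheaf U) (p : X * R) : C :=
  spval (fval s p) (BiForm (@Eform_linl p) (@Eform_linr p)).

End Exponential.

(* F_Z, and the canonical morphism F -> F_Z (for closed Z) on sections. *)
Definition restrict (F : sheaf C (X * R)%type) (Z : set X) : sheaf C (X * R)%type :=
  tensor F (csheaf C (Z `*` [set: R])).

Definition to_restrict (F : sheaf C (X * R)%type) (Z : set X)
    (U : opens (X * R)%type) (s : sec F U) : sec (restrict F Z) U :=
  tens_sec s (cst_one (Z `*` [set: R]) U).

End Convolution.

(* z is nonzero and t is one of its arguments *)
Definition has_arg (z : C) (t : R) := exists2 r : R, 0 < r &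
  z = (r * cos t +i* (r * sin t))%C.

Definition quad (c : C) (z : Cline) : R := complex.Re (c / 2 * (z : C) ^+ 2).

(* S_j for j in Z/4Z; the representatives 0 and 4 give the same sector. *)
Definition sector (theta0 : R) (j : 'Z_4) : set Cline := [set z : Cline |
  (z : C) = 0 \/ exists2 t : R,
    theta0 + (j%:R - 1) * (pi / 2) <= t <= theta0 + j%:R * (pi / 2) & has_arg z t].

(* c enumerates the two-element set A as c_(1) = c 0, c_(2) = c 1 *)
Definition numbering (A : set C) (theta0 : R) (c : 'I_2 -> C) :=
  A = [set c 0; c 1] /\
  forall z : C, has_arg z theta0 -> quad (c 0) z < quad (c 1) z.

(* F together with the isomorphisms alpha_j glues the data sigma. The last
   clause is alpha_(j+1) o alpha_j^-1 = sigma_j over S_(j,j+1), tested on the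
   images of the sections s of F, which generate the stalks of F_(S_j). An entry
   sigma_(i,l) acts from the l-th to the i-th summand as the scalar followed by
   restriction to the support {t - Re(c_(i) z^2 / 2) >= 0} of the latter. *)
Definition is_Fsigma (A : set C) (theta0 : R) (sigma : 'Z_4 -> 'M[C]_2)
    (F : sheaf C (Cline * R)%type) :=
  exists (c : 'I_2 -> C),
  numbering A theta0 c /\
  exists alpha : forall j : 'Z_4, mor (restrict F (sector theta0 j))
    (dsum (fun i : 'I_2 => Esheaf (fun z => - quad (c i) z) (sector theta0 j))),
  (forall j, is_iso (alpha j)) /\
  forall (j : 'Z_4) (U : opens (Cline * R)%type) (s : sec F U) (p : Cline * R) (i : 'I_2),
    oset U p -> sector theta0 j p.1 -> sector theta0 (j + 1) p.1 ->
    0 <= p.2 - quad (c i) p.1 ->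
    Eval (alpha (j + 1) U (to_restrict (sector theta0 (j + 1)) s) i) p =
    \sum_(l < 2) sigma j i l * Eval (alpha j U (to_restrict (sector theta0 j) s) l) p.

Lemma pt_cts : continuous (fun p : (Cline * Cline) * R => (p.1.1, p.2) : Cline * R).
Proof.
apply: pair_cts; last exact: snd_cts.
by apply: comp_cts; exact: fst_cts.
Qed.
Lemma qt_cts : continuous (fun p : (Cline * Cline) * R => (p.1.2, p.2) : Cline * R).
Proof.
apply: pair_cts; last exact: snd_cts.
by apply: comp_cts; [exact: fst_cts|exact: snd_cts].
Qed.
Definition ptilde := mkcontinuous pt_cts.
Definition qtilde := mkcontinuous qt_cts.

(* The transform of a sheaf F (seen as an object of D^b) *)
Definition fourier_sato (F : sheaf C (Cline * R)%type) : @cpx C (Cline * R)%type :=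
  shift1 (Rshriek qtilde (convolution
    (Esheaf (fun x : Cline * Cline => - complex.Re ((x.1 : C) * (x.2 : C))) [set: Cline * Cline])
    (pullback ptilde F))).

End Enhanced.
Arguments Cline R : clear implicits.

(* Main.v *)
(* In the coordinates z = e^(i theta0) (x + i y), F_sigma is a quotient of the
   constant sheaf with fibre C^2: the vector v is 0 at (z, t) iff those of four
   linear functionals that are active there vanish at v, namely CR (if x >= 0)
   and CL (if x <= 0) when t >= q_c(z), DU (if y >= 0) and DD (if y <= 0) when t
   >= q_d(z), where q_c, q_d are the exponents. Each of the four pairs formed by
   one of CR, CL and one of DU, DD is a basis of the dual. A complex with a
   single nonzero cohomology sheaf, presented in this way as a quotient of a
   constant sheaf, is determined up to isomorphism in the derived category by the
   kernels of the quotient maps on stalks. It is therefore enough to follow these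
   kernels through the transform, which consists of proper direct images along
   the real lines t_1 (the convolution), y and x, computed fibrewise from soft
   resolutions. Along y the exponents are concave and only H^1_c of the fibres
   survives, and the maximum over y of each exponent appears; along x these
   maxima are convex and only H^0_c survives, and their minima appear, which are
   the exponents attached to -1/c and -1/d. The same four functionals remain,
   with x, y replaced by the coordinates of w in the frame rotated by pi -
   theta0. *)
Require Import Defs.
From mathcomp Require Import all_boot all_order all_algebra.
From mathcomp Require Import boolp classical_sets functions reals.
From mathcomp Require Import topology normedtype trigo.
From mathcomp Require Import complex.
From mathcomp Require Import zify ring lra.
Set Implicit Arguments.
Unset Strict Implicit.
Unset Printing Implicit Defensive.
Import Order.TTheory GRing.Theory Num.Theory.
Import numFieldNormedType.Exports.
Local Open Scope classical_set_scope.
Local Open Scope ring_scope.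

(** * Extension of linear maps *)

(** The four functionals are globally defined for two reasons: the relation sigma_4 sigma_3 sigma_2
    sigma_1 = 1 lets the frames of the four sectors be referred to one copy of C^2, and across each
    ray triangularity changes one of the two coordinates by a nonzero factor only, so that its
    vanishing is the same condition on both sides. The angle theta0 makes c e^(2 i theta0) equal to
    kap = |c| > 0, and the inequalities on c and d become kap < de1 = Re (d e^(2 i theta0)). This
    inequality acts on the two axes. On y = 0, where DU gives way to DD, it makes C active whenever
    D is; after the maximum over y it makes, on x = 0, where CR gives way to CL, D active whenever C
    is. So a full basis is in force wherever a functional in force changes. No resolution is
    explicit: only flabbiness or softness of its terms is used. Representatives of a vector exist
    only locally and up to coboundaries, hence a relation [rep] in place of a map from E to
    cocycles. The projections along y and x are underived direct images of one resolution, so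
    softness has to survive the first. *)

Section LinearExtension.
Context {k : fieldType}.

Section Projector.
Context {V : lmodType k}.
Implicit Types P : linsub V.

(** By Zorn, applied to the sets closed under linear combinations that meet P only in 0. The union
    of the empty chain must be admissible, so the empty set is; the disjunction [q = 0 \/ Q q]
    spares a proof that the maximal Q contains 0. *)
Lemma linsub_compl P : exists Q : set V,
  [/\ forall a u v, Q u -> Q v -> Q (a *: u + v),
      forall u, Q u -> sscar P u -> u = 0 &
      forall w, exists p q, [/\ sscar P p, q = 0 \/ Q q & w = p + q]].
Proof.
pose ok (A : set V) := (forall a u v, A u -> A v -> A (a *: u + v)) /\
  (forall u, A u -> sscar P u -> u = 0).
have [Fs sF tF|Q [[Ql Q0] Qmax]] := @Zorn_bigcup V ok.
  split=> [a u v [A FA Au] [B FB Bv]|u [A FA Au]]; last by apply (sF _ FA).2.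
  have [AB|BA] := tF _ _ FA FB.
    by exists B => //; apply: (sF _ FB).1 => //; exact: AB.
  by exists A => //; apply: (sF _ FA).1 => //; exact: BA.
exists Q; split=> // w.
have [Qw|nQw] := pselect (Q w).
  by exists 0, w; split; [exact: ss0|right|rewrite add0r].
pose Q' : set V := [set v | exists c u, (u = 0 \/ Q u) /\ v = c *: w + u].
have QZ a u : u = 0 \/ Q u -> a *: u = 0 \/ Q (a *: u).
  move=> [->|Qu]; first by left; rewrite scaler0.
  by right; rewrite -[a](subrK 1) scalerDl scale1r; exact: Ql.
have QD u v : u = 0 \/ Q u -> v = 0 \/ Q v -> u + v = 0 \/ Q (u + v).
  move=> [->|Qu]; first by rewrite add0r.
  move=> [->|Qv]; first by rewrite addr0; right.
  by right; rewrite -[u]scale1r; exact: Ql.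
have := Qmax Q'.
have QQ' : Q `<` Q'.
  split=> [u Qu|/(_ w) H]; first by exists 0, u; split; [right|rewrite scale0r add0r].
  by apply: nQw; apply: H; exists 1, 0; split; [left|rewrite scale1r addr0].
move=> /(_ QQ') nok; apply: contrapT => nw; apply: nok; split.
  move=> a _ _ [c [u [Qu ->]]] [d [v [Qv ->]]].
  exists (a * c + d), (a *: u + v); split; first by apply: QD => //; exact: QZ.
  by rewrite scalerDl scalerDr scalerA addrACA.
move=> _ [c [u [Qu ->]]] Pcu.
have [c0|c0] := eqVneq c 0.
  by case: Qu Pcu => [->|Qu]; rewrite c0 scale0r add0r // => ?; exact: Q0.
case: nw; exists (c^-1 *: (c *: w + u)), ((- c^-1) *: u); split.
- exact: ssZ.
- exact: QZ.
- by rewrite scalerDr scalerA mulVf// scale1r scaleNr addrK.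
Qed.

Lemma linsub_projector P : exists p : V -> V,
  [/\ linear p, forall v, sscar P (p v) & forall v, sscar P v -> p v = v].
Proof.
have [Q [Ql Q0 dec]] := linsub_compl P.
have /choice[p pP] : forall w, exists p, sscar P p /\ (w - p = 0 \/ Q (w - p)).
  by move=> w; have [p [q [Pp Qq ->]]] := dec w; exists p; rewrite addrAC subrr add0r.
have uniq w p1 p2 : sscar P p1 -> sscar P p2 -> (w - p1 = 0 \/ Q (w - p1)) ->
    (w - p2 = 0 \/ Q (w - p2)) -> p1 = p2.
  move=> P1 P2 Q1 Q2; apply/eqP; rewrite -subr_eq0; apply/eqP.
  have P12 : sscar P (p1 - p2) by apply: ssD => //; exact: ssN.
  have e : p1 - p2 = (-1) *: (w - p1) + (w - p2).
    by rewrite scaleN1r opprB addrA subrK.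
  case: Q1 Q2 => [z1|Q1] [z2|Q2].
  - by rewrite e z1 z2 scaler0 addr0.
  - by apply: (Q0) => //; rewrite e z1 scaler0 add0r.
  - apply/eqP; rewrite -oppr_eq0 opprB; apply/eqP; apply: Q0; last first.
      by rewrite -opprB; exact: ssN.
    have -> : p2 - p1 = w - p1 by rewrite -[w](subrK p2) z2 add0r.
    exact: Q1.
  - by apply: Q0 => //; rewrite e; exact: Ql.
exists p; split=> [a u v|v|v Pv]; last 2 first.
- by case: (pP v).
- apply: (uniq v) => //; [by case: (pP v)|by case: (pP v)|left; exact: subrr].
have [Pu Qu] := pP u; have [Pv Qv] := pP v; have [Puv Quv] := pP (a *: u + v).
apply: (uniq (a *: u + v)) => //; first exact: sslin.
rewrite opprD addrACA -scalerBr; case: Qu => [->|Qu].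
  by rewrite scaler0 add0r.
case: Qv => [->|Qv]; last by right; exact: Ql.
rewrite addr0; right.
by rewrite -[a](subrK 1) scalerDl scale1r; exact: Ql.
Qed.

End Projector.

Lemma lin0 (V W : lmodType k) (f : V -> W) : linear f -> f 0 = 0.
Proof. by move=> lf; have := lf (-1) 0 0; rewrite scaler0 addr0 scaleN1r addNr. Qed.
Lemma linDf (V W : lmodType k) (f : V -> W) u v : linear f -> f (u + v) = f u + f v.
Proof. by move=> lf; rewrite -[u]scale1r lf !scale1r. Qed.
Lemma linZf (V W : lmodType k) (f : V -> W) a u : linear f -> f (a *: u) = a *: f u.
Proof. by move=> lf; rewrite -[a *: u]addr0 lf lin0// addr0. Qed.
Lemma linNf (V W : lmodType k) (f : V -> W) u : linear f -> f (- u) = - f u.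
Proof. by move=> lf; rewrite -!scaleN1r linZf. Qed.
Lemma linBf (V W : lmodType k) (f : V -> W) u v : linear f -> f (u - v) = f u - f v.
Proof. by move=> lf; rewrite linDf// linNf. Qed.

(** A projector onto the range of [i], read back through [i], is a left inverse of [i]. Every vector
    space is thus injective, which yields injective sheaves stalk by stalk. *)
Lemma linear_extension (V W M : lmodType k) (i : V -> W) (f : V -> M) :
  linear i -> injective i -> linear f ->
  exists g : W -> M, linear g /\ forall v, g (i v) = f v.
Proof.
move=> li ii lf.
have r0 : range i 0 by exists 0 => //; exact: lin0.
have rl a u v : range i u -> range i v -> range i (a *: u + v).
  by move=> [x _ <-] [y _ <-]; exists (a *: x + y) => //; exact: li.
have [p [lp Pp pP]] := linsub_projector (LinSub r0 rl).
have /choice[j jP] : forall w, exists v, i v = p w.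
  by move=> w; have [v _ e] := Pp w; exists v.
exists (f \o j); split=> [a u v|v] /=.
  rewrite -lf; congr f; apply: ii; rewrite jP lp li !jP//.
by congr f; apply: ii; rewrite jP; apply: pP; exists v.
Qed.

Lemma separating_functional (V : lmodType k) (v : V) : v != 0 ->
  exists f : V -> k^o, linear f /\ f v = 1.
Proof.
move=> v0.
have [|||g [lg gE]] := @linear_extension k^o V k^o (fun a : k => a *: v) idfun.
- by move=> a b c; rewrite scalerDl -scalerA.
- move=> a b /eqP; rewrite -subr_eq0 -scalerBl scaler_eq0 (negbTE v0) orbF subr_eq0.
  by move/eqP.
- by [].
by exists g; split=> //; rewrite -[v]scale1r gE.
Qed.

End LinearExtension.

(** * Sections and germs *)

Section Restriction.
Context {k : fieldType} {X : topologicalType}.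
Implicit Types (F G : sheaf k X) (U V W : opens X).

(* Restriction without a proof of inclusion; it is 0 by convention when V is not
   contained in U. *)
Definition rst F U V (s : sec F U) : sec F V :=
  if pselect (oset V `<=` oset U) is left h then res h s else 0.

Lemma rstE F U V (h : oset V `<=` oset U) (s : sec F U) : rst V s = res h s.
Proof.
by rewrite /rst; case: pselect => // h'; congr (res _ s); exact: Prop_irrelevance.
Qed.

Lemma rst_lin F U V : linear (@rst F U V).
Proof.
move=> a s t; rewrite /rst; case: pselect => h; first exact: res_lin.
by rewrite scaler0 addr0.
Qed.

Lemma rst0 F U V : rst V (0 : sec F U) = 0.
Proof. exact/lin0/rst_lin. Qed.
Lemma rstD F U V (s t : sec F U) : rst V (s + t) = rst V s + rst V t.
Proof. exact/linDf/rst_lin. Qed.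
Lemma rstB F U V (s t : sec F U) : rst V (s - t) = rst V s - rst V t.
Proof. exact/linBf/rst_lin. Qed.
Lemma rstZ F U V a (s : sec F U) : rst V (a *: s) = a *: rst V s.
Proof. exact/linZf/rst_lin. Qed.

Lemma rst_id F U (s : sec F U) : rst U s = s.
Proof. by rewrite (rstE (@subset_refl _ _)) res_id. Qed.

Lemma rst_rst F U V W (s : sec F U) : oset W `<=` oset V -> oset V `<=` oset U ->
  rst W (rst V s) = rst W s.
Proof.
move=> WV VU; rewrite (rstE VU) (rstE WV) (rstE (subset_trans WV VU)).
exact: res_comp.
Qed.

Lemma mor_rst F G (f : mor F G) U V (s : sec F U) : f V (rst V s) = rst V (f U s).
Proof. by rewrite /rst; case: pselect => h; [exact: mor_nat|exact: mor_0]. Qed.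

Lemma mor_linear F G (f : mor F G) U : linear (@mfun _ _ F G f U).
Proof. exact: mor_lin. Qed.
Lemma morD F G (f : mor F G) U s t : f U (s + t) = f U s + f U t.
Proof. exact/linDf/mor_linear. Qed.
Lemma morB F G (f : mor F G) U s t : f U (s - t) = f U s - f U t.
Proof. exact/linBf/mor_linear. Qed.
Lemma morZ F G (f : mor F G) U a s : f U (a *: s) = a *: f U s.
Proof. exact/linZf/mor_linear. Qed.

Lemma germ_rst F x U V (s : sec F U) : oset V `<=` oset U -> oset V x ->
  germ x (rst V s) = germ x s.
Proof. by move=> h Vx; rewrite (rstE h) germ_res. Qed.

Lemma germ_eq_rst F x U (s t : sec F U) : oset U x -> germ x s = germ x t ->
  exists W, [/\ oset W x, oset W `<=` oset U & rst W s = rst W t].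
Proof.
by move=> Ux /(germ_eqP Ux)[W [h [Wx e]]]; exists W; split; rewrite ?(rstE h).
Qed.

Lemma germ0_rst F x U (s : sec F U) : oset U x -> germ x s = 0 ->
  exists W, [/\ oset W x, oset W `<=` oset U & rst W s = 0].
Proof.
move=> Ux; rewrite -(germ0 F x U) => /(germ_eq_rst Ux)[W [Wx WU e]].
by exists W; split; rewrite // e rst0.
Qed.

Lemma rst0_germ F x U W (s : sec F U) : oset W x -> oset W `<=` oset U ->
  rst W s = 0 -> germ x s = 0.
Proof. by move=> Wx WU e; rewrite -(germ_rst s WU Wx) e germ0. Qed.

Lemma germ_surj F x (a : stalk F x) : exists U (s : sec F U), oset U x /\ a = germ x s.
Proof. by have [U [s [_ [Ux -> _]]]] := germ_surj2 a a; exists U, s. Qed.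

Lemma sec_local_eq F U (s t : sec F U) :
  (forall x, oset U x -> exists W, [/\ oset W x, oset W `<=` oset U & rst W s = rst W t]) ->
  s = t.
Proof.
move=> H; pose I := {x | oset U x}.
have /choice[W WP] : forall i : I, exists W,
    [/\ oset W (sval i), oset W `<=` oset U & rst W s = rst W t].
  by move=> [x Ux]; exact: H.
have WU i : oset (W i) `<=` oset U by have [] := WP i.
apply: (@res_sep _ _ F I W U WU).
  by move=> x Ux; exists (exist _ x Ux) => //; have [] := WP (exist _ x Ux).
by move=> i; rewrite -!rstE; have [] := WP i.
Qed.

Lemma sec_germ_eq F U (s t : sec F U) :
  (forall x, oset U x -> germ x s = germ x t) -> s = t.
Proof.
by move=> H; apply: sec_local_eq => x Ux; exact: germ_eq_rst (H x Ux).
Qed.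

(** Uniqueness of the local sections satisfying P makes the chosen ones agree on overlaps, hence
    glue. It serves to turn a relation between sections into a morphism of sheaves. *)
Lemma sec_local F U (P : forall W, set (sec F W)) :
  (forall W V s, oset V `<=` oset W -> P W s -> P V (rst V s)) ->
  (forall W s t, P W s -> P W t -> s = t) ->
  (forall x, oset U x -> exists W, [/\ oset W x, oset W `<=` oset U & exists s, P W s]) ->
  exists s : sec F U, forall x, oset U x ->
    exists W, [/\ oset W x, oset W `<=` oset U & P W (rst W s)].
Proof.
move=> Pr Pu H; pose I := {x | oset U x}.
have /choice[W WP] : forall i : I, exists W,
    [/\ oset W (sval i), oset W `<=` oset U & exists s, P W s].
  by move=> [x Ux]; exact: H.
have ex i : exists s, P (W i) s by have [_ _ [s Ps]] := WP i; exists s.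
pose s i := sval (cid (ex i)); have sP i : P (W i) (s i) by exact: (svalP (cid (ex i))).
have WU i : oset (W i) `<=` oset U by have [] := WP i.
have [|i j V hi hj|t tP] := @res_glue _ _ F I W U WU _ s.
- by move=> x Ux; exists (exist _ x Ux) => //; have [] := WP (exist _ x Ux).
- by apply: Pu; rewrite -rstE; exact: Pr.
exists t => x Ux; exists (W (exist _ x Ux)); have [Wx h _] := WP (exist _ x Ux).
by split=> //; rewrite (rstE (WU _)) tP; exact: sP.
Qed.

Definition opensU U V := Opens (openU (osetP U) (osetP V)).

Lemma sec_glue2 F (U A B : opens X) (s : sec F A) (t : sec F B) :
  oset U `<=` oset A `|` oset B -> oset A `<=` oset U -> oset B `<=` oset U ->
  rst (opensI A B) s = rst (opensI A B) t ->
  exists u : sec F U, rst A u = s /\ rst B u = t.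
Proof.
move=> cov AU BU st.
pose W (b : bool) := if b then A else B.
pose r (b : bool) : sec F (W b) := if b return sec F (W b) then s else t.
have WU b : oset (W b) `<=` oset U by case: b.
have [|i j V hi hj|u uP] := @res_glue _ _ F bool W U WU _ r.
- by move=> x /cov[Ax|Bx]; [exists true|exists false].
- have E (V' : opens X) (hA : oset V' `<=` oset A) (hB : oset V' `<=` oset B) :
      rst V' s = rst V' t.
    have VAB : oset V' `<=` oset (opensI A B) by move=> x Vx; split; [exact: hA|exact: hB].
    rewrite -(rst_rst s VAB (@opensIl _ A B)) st rst_rst//; exact: opensIr.
  case: i hi; case: j hj => hj hi /=; rewrite -!rstE //; first exact: E.
  by rewrite (E V hj hi).
exists u; split; first by rewrite (rstE (WU true)) (uP true).
by rewrite (rstE (WU false)) (uP false).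
Qed.

Lemma stalk_map_linear F G (f : mor F G) x : linear (@stalk_map _ _ F G f x).
Proof.
move=> a g h; have [U [s [t [Ux -> ->]]]] := germ_surj2 g h.
by rewrite -germ_lin !stalk_mapE// mor_lin germ_lin.
Qed.

Lemma mono_stalk F G (f : mor F G) x : mono f -> injective (@stalk_map _ _ F G f x).
Proof.
move=> mf g h; have [U [s [t [Ux -> ->]]]] := germ_surj2 g h.
rewrite !stalk_mapE// => /(germ_eq_rst Ux)[W [Wx WU]].
rewrite -!mor_rst => /mf e.
by rewrite -(germ_rst s WU Wx) e germ_rst.
Qed.

Lemma germ_linear F x U : linear (@germ _ _ F x U).
Proof. exact: germ_lin. Qed.
Lemma germD F x U (s t : sec F U) : germ x (s + t) = germ x s + germ x t.
Proof. exact/linDf/germ_linear. Qed.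
Lemma germB F x U (s t : sec F U) : germ x (s - t) = germ x s - germ x t.
Proof. exact/linBf/germ_linear. Qed.

Definition exact_at (K : @cpx k X) (n : int) := forall U (s : sec (ob K (n + 1)) U) x,
  oset U x -> dif K (n + 1) U s = 0 ->
  exists W (b : sec (ob K n) W), [/\ oset W x, oset W `<=` oset U & rst W s = dif K n W b].

End Restriction.

(** * Injective resolutions *)

Section ProductSheaf.
Context {k : fieldType} {X : topologicalType}.

Section Def.
Variable M : X -> lmodType k.

(** The vacuous condition, so that sections are arbitrary families: [prodsheaf] is the product over
    x of the skyscraper sheaves with fibre [M x], as in the Godement construction. *)
Definition any_cond : local_cond M :=
  @LocalCond k X M (fun _ => setT) (fun _ => I) (fun _ _ _ _ _ _ => I) (fun _ _ _ _ _ => I).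

Definition prodsheaf : sheaf k X := fsheaf any_cond.

Lemma prodsec_is (U : opens X) (f : dprod M) : is_fsec any_cond U (fcut U f).
Proof.
split=> [x|x Ux]; first exact: fcutN.
by exists U, f; split=> // y; exact: fcutE.
Qed.

Definition prodsec (U : opens X) (f : dprod M) : sec prodsheaf U :=
  @SubSp _ _ (fsec any_cond U) _ (prodsec_is U f).

Lemma prodsecE U f x : oset U x -> fval (prodsec U f) x = f x.
Proof. exact: fcutE. Qed.

End Def.

Lemma fsec_eq (M : X -> lmodType k) (B : local_cond M) (U : opens X)
    (s t : sec (fsheaf B) U) :
  (forall x, oset U x -> fval s x = fval t x) -> s = t.
Proof.
move=> H; apply: spval_inj; apply: functional_extensionality_dep => x.
have [Ux|nUx] := pselect (oset U x); first exact: H.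
by case: (spvalP s) (spvalP t) => -> // _ [->].
Qed.

Lemma fval_rst (M : X -> lmodType k) (B : local_cond M) (U V : opens X)
    (s : sec (fsheaf B) U) x :
  oset V `<=` oset U -> oset V x -> fval (rst V s) x = fval s x.
Proof. by move=> VU Vx; rewrite (rstE VU) /fval /= fcutE. Qed.

Section MorToProd.
Variables (F : sheaf k X) (M : X -> lmodType k) (g : forall x, stalk F x -> M x).
Hypothesis gl : forall x, linear (@g x).

Let mf U (s : sec F U) : sec (prodsheaf M) U := prodsec U (fun x => g (germ x s)).
Lemma mor_to_prod_lin U : linear (@mf U).
Proof.
move=> a s t; apply: fsec_eq => x Ux.
have -> : fval (a *: mf s + mf t) x = a *: fval (mf s) x + fval (mf t) x by [].
by rewrite !prodsecE// germ_lin gl.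
Qed.
Lemma mor_to_prod_nat U V (h : oset V `<=` oset U) s : mf (res h s) = res h (mf s).
Proof.
rewrite -[in RHS](rstE h); apply: fsec_eq => x Vx.
by rewrite fval_rst// !prodsecE ?germ_res//; exact: h.
Qed.
Definition mor_to_prod : mor F (prodsheaf M) := Mor mor_to_prod_lin mor_to_prod_nat.

Lemma mor_to_prodE U (s : sec F U) x : oset U x -> fval (mor_to_prod U s) x = g (germ x s).
Proof. exact: prodsecE. Qed.

Lemma germ_val_mor_to_prod x (a : stalk F x) :
  germ_val (stalk_map mor_to_prod a) = g a.
Proof.
by have [U [s [Ux ->]]] := germ_surj a; rewrite stalk_mapE// germ_valE// prodsecE.
Qed.
End MorToProd.

(** A morphism into this product amounts to a linear map on each stalk; a monomorphism is injective
    on stalks, and the extension is made there. *)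
Lemma prodsheaf_injective (M : X -> lmodType k) : injective_sheaf (prodsheaf M).
Proof.
move=> F G i mi f.
have H x : exists g : stalk G x -> M x, linear g /\
    forall a, g (stalk_map i a) = germ_val (stalk_map f a).
  apply: (@linear_extension k (stalk F x) (stalk G x) (M x) (@stalk_map _ _ _ _ i x)
    (fun a => germ_val (stalk_map f a))).
  - exact: stalk_map_linear.
  - exact: mono_stalk.
  - by move=> a u v; rewrite stalk_map_linear germ_val_lin.
pose g x := sval (cid (H x)).
have gl x : linear (g x) by have [] := svalP (cid (H x)).
have gE x (a : stalk F x) : g x (stalk_map i a) = germ_val (stalk_map f a).
  by have [_] := svalP (cid (H x)); exact.
exists (mor_to_prod gl) => U s; apply: fsec_eq => x Ux.
by rewrite mor_to_prodE// -(stalk_mapE _ _ Ux) gE stalk_mapE// germ_valE.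
Qed.

(** No inclusion between U and V is asked: [t] extends to V what [s] is on the intersection of U and
    V. *)
Definition flabby (F : sheaf k X) := forall (U V : opens X) (s : sec F U),
  exists t : sec F V, forall W : opens X, oset W `<=` oset U -> oset W `<=` oset V ->
  rst W t = rst W s.

Lemma injective_flabby (J : sheaf k X) : injective_sheaf J -> flabby J.
Proof.
move=> iJ U V s.
have il (x : X) : linear (@idfun (stalk J x)) by [].
pose i := mor_to_prod il.
have mi : mono i.
  move=> W a b e; apply: sec_germ_eq => x Wx.
  by have := congr1 (fun c => fval c x) e; rewrite !mor_to_prodE.
have [r rE] := iJ _ _ i mi (@Mor _ _ J J (fun U s => s) (fun U a b c => erefl)
  (fun U V h s => erefl)).
(* [germ x s] is 0 by convention off U, so the family of germs extends [s] by zero in the product of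
   the stalks; the retraction [r] brings it back to J. *)
exists (r V (prodsec V (fun x => germ x s))) => W WU WV.
rewrite -mor_rst -[RHS]rE; congr (r W _); apply: fsec_eq => x Wx.
by rewrite mor_to_prodE// fval_rst// prodsecE ?germ_rst//; exact: WV.
Qed.

End ProductSheaf.

(** * Construction of the resolution, one degree at a time *)

Section InjectiveResolution.
Context {k : fieldType} {X : topologicalType}.

(** Only the kernel of a quotient map matters here, so the quotient is realized inside V by the
    complementary projector. *)
Lemma quotient_map_ex (V : lmodType k) (P : linsub V) : exists p : V -> V,
  linear p /\ forall v, p v = 0 <-> sscar P v.
Proof.
have [p [lp Pp pP]] := linsub_projector P.
exists (fun v => v - p v); split=> [a u v|v].
  by rewrite lp opprD addrACA -scalerBr.
split=> [/eqP|/pP->]; last exact: subrr.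
by rewrite subr_eq0 => /eqP ->.
Qed.
Definition quotient_map (V : lmodType k) (P : linsub V) := sval (cid (quotient_map_ex P)).
Lemma quotient_map_lin V (P : linsub V) : linear (quotient_map P).
Proof. by have [] := svalP (cid (quotient_map_ex P)). Qed.
Lemma quotient_mapP V (P : linsub V) v : quotient_map P v = 0 <-> sscar P v.
Proof. by have [_] := svalP (cid (quotient_map_ex P)); exact. Qed.

Variable K : @cpx k X.

(* The terms I^(n-1) -> I^n <- K^n of the resolution under construction. *)
Record rstate (n : int) := RState {
  rA : sheaf k X; rB : sheaf k X; rd : mor rA rB; rf : mor (ob K n) rB }.

Section Next.
Variables (n : int) (S : rstate n).
Let M (x : X) : lmodType k := (stalk (rB S) x * stalk (ob K (n + 1)) x)%type.

(** Modulo this relation, [M x] is the pushout at x of the cokernel of I^(n-1) -> I^n and of K^(n+1)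
    over K^n. The next term of the resolution is the product of these quotients, and exactness is
    read off at each stalk. *)
Definition pushout_rel x : set (M x) := [set v | exists c a,
  v = (stalk_map (rd S) c + stalk_map (rf S) a, - stalk_map (dif K n) a)].
Lemma pushout_rel0 x : @pushout_rel x 0.
Proof.
by exists 0, 0; rewrite !(lin0 (@stalk_map_linear _ _ _ _ _ _)) addr0 oppr0.
Qed.
Lemma pushout_rel_lin x a u v :
  @pushout_rel x u -> pushout_rel v -> pushout_rel (a *: u + v).
Proof.
move=> [c [b ->]] [c' [b' ->]]; exists (a *: c + c'), (a *: b + b').
rewrite !stalk_map_linear; congr pair => /=; last by rewrite opprD scalerN.
by rewrite scalerDr addrACA.
Qed.
Definition pushout_sub x := LinSub (@pushout_rel0 x) (@pushout_rel_lin x).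
Let q x := quotient_map (pushout_sub x).

Let dl (x : X) (b : stalk (rB S) x) : M x := q ((b, 0) : M x).
Let fl (x : X) (a : stalk (ob K (n + 1)) x) : M x := q ((0, a) : M x).
Let dl_lin x : linear (@dl x).
Proof.
move=> a u v; rewrite -[RHS]quotient_map_lin; congr (q _).
by congr pair; rewrite /= scaler0 addr0.
Qed.
Let fl_lin x : linear (@fl x).
Proof.
move=> a u v; rewrite -[RHS]quotient_map_lin; congr (q _).
by congr pair; rewrite /= scaler0 addr0.
Qed.

Definition next : rstate (n + 1) :=
  RState (mor_to_prod dl_lin) (mor_to_prod fl_lin).

Lemma next_d2 U (s : sec (rA S) U) : rd next U (rd S U s) = 0.
Proof.
apply: fsec_eq => x Ux; rewrite prodsecE//; apply/quotient_mapP.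
exists (germ x s), 0; rewrite !(lin0 (@stalk_map_linear _ _ _ _ _ _)) oppr0 addr0.
by rewrite stalk_mapE.
Qed.

Lemma next_comm U (s : sec (ob K n) U) : rf next U (dif K n U s) = rd next U (rf S U s).
Proof.
apply: fsec_eq => x Ux; rewrite !prodsecE//.
apply/eqP; rewrite -subr_eq0; apply/eqP; rewrite /fl /dl /q -linBf; last first.
  exact: quotient_map_lin.
apply/quotient_mapP; exists 0, (- germ x s).
rewrite !(lin0 (@stalk_map_linear _ _ _ _ _ _)) !(linNf _ (@stalk_map_linear _ _ _ _ _ _)).
by rewrite !stalk_mapE//; congr pair; rewrite /= ?opprK ?oppr0 ?addr0 // add0r.
Qed.

Lemma next_inj x (a : stalk (ob K (n + 1)) x) (b : stalk (rB S) x) :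
  stalk_map (rf next) a = stalk_map (rd next) b ->
  exists c, a = stalk_map (dif K n) c.
Proof.
move=> /(congr1 (@germ_val _ _ _ _ x)); rewrite !germ_val_mor_to_prod => /eqP.
rewrite -subr_eq0 => /eqP; rewrite /fl /dl /q -linBf; last exact: quotient_map_lin.
move=> /quotient_mapP[c [e /(congr1 snd) E]]; exists (- e).
have {E} : a - 0 = - stalk_map (dif K n) e by exact: E.
by rewrite subr0 => ->; rewrite (linNf _ (@stalk_map_linear _ _ _ _ _ _)).
Qed.

Lemma next_surj x (b : stalk (rB S) x) : stalk_map (rd next) b = 0 ->
  exists c a, stalk_map (dif K n) a = 0 /\ b = stalk_map (rf S) a + stalk_map (rd S) c.
Proof.
move=> /(congr1 (@germ_val _ _ _ _ x)); rewrite !germ_val_mor_to_prod.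
rewrite (lin0 (@germ_val_lin _ _ _ _ _)) => /quotient_mapP[c [a E]].
exists c, a; split; last by rewrite addrC; exact: (congr1 fst E).
by apply/oppr_inj; rewrite oppr0; exact: (esym (congr1 snd E)).
Qed.

End Next.

Definition zerosheaf : sheaf k X := prodsheaf (fun _ => 'rV[k]_0 : lmodType k).
Lemma zerosheaf0 U (s : sec zerosheaf U) : s = 0.
Proof. by apply: fsec_eq => x Ux; rewrite [LHS]thinmx0 [RHS]thinmx0. Qed.

Definition zero_state n : rstate n :=
  @RState n zerosheaf zerosheaf (mor0 _ _) (mor0 _ _).

(** Here [m] counts the steps made from the zero state in degree n - m; the cast along n - 1 + 1 = n
    is the price of integer degrees and is removed by [buildS]. *)
Fixpoint build (m : nat) (n : int) : rstate n :=
  if m is m'.+1 then ecast z (rstate z) (subrK 1 n) (next (build m' (n - 1)))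
  else zero_state n.

Lemma next_cast m (n' n : int) (e : n' = n) (E : n' + 1 = n + 1) :
  ecast z (rstate z) E (next (build m n')) = next (build m n).
Proof. by case: _ / e E => E; rewrite (eq_irrelevance E erefl). Qed.

Lemma buildS m n : build m.+1 (n + 1) = next (build m n).
Proof. exact: (next_cast _ (addrK 1 n)). Qed.

Lemma build_injective m n : injective_sheaf (rB (build m n)).
Proof.
case: m => [|m] /=; first exact: prodsheaf_injective.
have H (n' : int) (e : n' = n) (S : rstate n') :
    injective_sheaf (rB S) -> injective_sheaf (rB (ecast z (rstate z) e S)).
  by case: _ / e.
by apply: H; exact: prodsheaf_injective.
Qed.

(** The state in degree n + 1 equals [next] of the previous one only through a provable equation,
    and below the bound of K it need not; the map is then 0. *)
Definition link n (S : rstate n) (S' : rstate (n + 1)) : mor (rB S) (rB S') :=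
  if pselect (next S = S') is left e then ecast z (mor (rB S) (rB z)) e (rd (next S))
  else mor0 _ _.

Lemma link_next n (S : rstate n) : link S (next S) = rd (next S).
Proof.
by rewrite /link; case: pselect => // e; rewrite (Prop_irrelevance e erefl).
Qed.

Lemma injective_resolution_ex : bounded_below K -> exists I, @is_injective_resolution _ _ K I.
Proof.
move=> [N KN].
(* One step more than n - N: the state in degree N already is a [next], taken of the zero state in
   degree N - 1. *)
pose m (n : int) : nat := if n < N then 0%N else `|n - N|.+1.
pose St n := build (m n) n.
have StN n : n < N -> St n = zero_state n by rewrite /St /m => ->.
have StS n : N <= n + 1 -> St (n + 1) = next (St n).
  move=> Nn; rewrite /St -buildS; suff -> : m (n + 1) = (m n).+1 by [].
  rewrite /m ltNge Nn /=; congr S.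
  by case: ltP => Nn'; lia.
have d2 n U s : link (St (n + 1)) (St (n + 1 + 1)) U (link (St n) (St (n + 1)) U s) = 0.
  have [h|h] := ltP (n + 1) N.
    have -> : link (St n) (St (n + 1)) U s = 0.
      by move: (link _ _ U s); rewrite StN//; exact: zerosheaf0.
    exact: mor_0.
  move: s; rewrite (StS (n + 1)); last by lia.
  by rewrite link_next StS// link_next => s; exact: next_d2.
have Qi n x (a : stalk (ob K (n + 1)) x) (b : stalk (rB (St n)) x) :
    stalk_map (rf (St (n + 1))) a = stalk_map (link (St n) (St (n + 1))) b ->
    exists c, a = stalk_map (dif K n) c.
  have [h|h] := ltP (n + 1) N.
    have [U [s [Ux ->]]] := germ_surj a.
    by move=> _; exists 0; rewrite (KN _ h _ s) germ0 (lin0 (@stalk_map_linear _ _ _ _ _ _)).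
  by rewrite (StS n)// link_next => /next_inj.
have Qs n x (b : stalk (rB (St (n + 1))) x) :
    stalk_map (link (St (n + 1)) (St (n + 1 + 1))) b = 0 ->
    exists (a : stalk (ob K (n + 1)) x) (c : stalk (rB (St n)) x),
      stalk_map (dif K (n + 1)) a = 0 /\
      b = stalk_map (rf (St (n + 1))) a + stalk_map (link (St n) (St (n + 1))) c.
  move: b; have [h|h] := ltP (n + 1) N.
    rewrite (StN (n + 1))// => b _; have [U [s [Ux ->]]] := germ_surj b.
    exists 0, 0; rewrite !(lin0 (@stalk_map_linear _ _ _ _ _ _)) addr0; split=> //.
    by rewrite (zerosheaf0 s) germ0.
  rewrite (StS (n + 1)) ?link_next; last by lia.
  move=> b /next_surj[c [a [a0 ->]]]; exists a => {b}.
  by move: c; rewrite StS// link_next => c; exists c.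
pose I := Cpx d2.
have fd n U (s : sec (ob K n) U) : rf (St (n + 1)) U (dif K n U s) = dif I n U (rf (St n) U s).
  rewrite /I /=; have [h|h] := ltP (n + 1) N.
    by move: (rf _ U _) (link _ _ U _); rewrite StN// => a b; rewrite (zerosheaf0 a) (zerosheaf0 b).
  by rewrite (StS n)// link_next; exact: next_comm.
exists (existT _ I (@CMor _ _ K I (fun n => rf (St n)) fd)); split=> /=.
- exists N => n nN U; change (forall s : sec (rB (St n)) U, s = 0); rewrite StN//; exact: zerosheaf0.
- by move=> n; apply: build_injective.
by move=> n x; split=> [a _ [b]|b]; [exact: Qi|exact: Qs].
Qed.

Lemma injective_resolutionP : bounded_below K ->
  exists f : cmor K (injective_resolution K), quasi_iso f /\
    bounded_below (injective_resolution K) /\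
    forall n, flabby (ob (injective_resolution K) n).
Proof.
move=> bK; rewrite /injective_resolution; case: pselect => [h|]; last first.
  by move=> h; case: h; exact: injective_resolution_ex.
case: (cid h) => [[I f]] [/= bI iI qf]; exists f; split=> //; split=> // n.
exact: injective_flabby.
Qed.

End InjectiveResolution.

(** * Complexes with a single cohomology sheaf *)

Section Presentations.
Context {k : fieldType} {X : topologicalType}.
Implicit Types (U V W : opens X).

(* K has cohomology only in degree i + 2, where its cohomology sheaf is the
   quotient of the constant sheaf E by the subsheaf with fibres N x; rep U v s
   means that the class of the cocycle s over U is the image of v. *)
Record presentation (K : @cpx k X) (i : int) (E : lmodType k) (N : X -> set E)
    (rep : forall U, E -> set (sec (ob K (i + 1 + 1)) U)) : Prop := Presentation {
  pr_exact : forall j, j != i + 1 -> exact_at K j;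
  pr_res : forall U V v s, oset V `<=` oset U -> rep U v s -> rep V v (rst V s);
  pr_loc : forall U v s, (forall x, oset U x ->
    exists W, [/\ oset W x, oset W `<=` oset U & rep W v (rst W s)]) -> rep U v s;
  pr_closed : forall U v s, rep U v s -> dif K _ U s = 0;
  pr_lin : forall U a v w s t, rep U v s -> rep U w t -> rep U (a *: v + w) (a *: s + t);
  pr_ex : forall x v, exists U s, oset U x /\ rep U v s;
  pr_surj : forall U s x, oset U x -> dif K _ U s = 0 ->
    exists W v, [/\ oset W x, oset W `<=` oset U & rep W v (rst W s)];
  pr_ker : forall U v s x, oset U x -> rep U v s ->
    N x v <-> exists W b, [/\ oset W x, oset W `<=` oset U & rst W s = dif K _ W b];
  pr_d : forall U v s b, rep U v s -> rep U v (s + dif K _ U b) }.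

Definition presented K i E N := exists rep, @presentation K i E N rep.

(* The same for a sheaf F, with the surjections e x from E to the stalks. *)
Record stalk_presentation (F : sheaf k X) (E : lmodType k) (N : X -> set E)
    (e : forall x, E -> stalk F x) : Prop := StalkPresentation {
  sp_lin : forall x, linear (e x);
  sp_surj : forall x a, exists v, a = e x v;
  sp_ker : forall x v, e x v = 0 <-> N x v;
  sp_loc : forall x v, exists U (s : sec F U),
    oset U x /\ forall y, oset U y -> germ y s = e y v }.

Definition sheaf_presented F E N := exists e, @stalk_presentation F E N e.

Section Consequences.
Variables (K : @cpx k X) (i : int) (E : lmodType k) (N : X -> set E).
Variable rep : forall U, E -> set (sec (ob K (i + 1 + 1)) U).
Hypothesis P : presentation N rep.

Lemma pr_0 U : rep 0 (0 : sec _ U).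
Proof.
apply: (pr_loc P) => x Ux; have [W [s [Wx rs]]] := pr_ex P x 0.
exists (opensI W U); split; [by split|exact: opensIr|].
have := pr_res P (@opensIl _ W U) (pr_lin P (-1) rs rs).
by rewrite scaler0 addr0 scaleN1r addNr !rst0.
Qed.

Lemma pr_Z U a v s : rep v s -> rep (a *: v) (a *: s : sec _ U).
Proof. by move=> rs; have := pr_lin P a rs (pr_0 U); rewrite !addr0. Qed.
Lemma pr_N U v s : rep v s -> rep (- v) (- s : sec _ U).
Proof. by move=> /(pr_Z (-1)); rewrite !scaleN1r. Qed.
Lemma pr_D U v w s t : rep v s -> rep w t -> rep (v + w) (s + t : sec _ U).
Proof. by move=> rs rt; have := pr_lin P 1 rs rt; rewrite !scale1r. Qed.
Lemma pr_B U v w s t : rep v s -> rep w t -> rep (v - w) (s - t : sec _ U).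
Proof. by move=> rs rt; apply: pr_D => //; exact: pr_N. Qed.

Lemma pr_kerZ x a v : N x v -> N x (a *: v).
Proof.
move=> Nv; have [U [s [Ux rs]]] := pr_ex P x v.
have [/(_ Nv)[W [b [Wx WU e]]] _] := pr_ker P Ux rs.
by apply/(pr_ker P Ux (pr_Z a rs)); exists W, (a *: b); split; rewrite // rstZ e morZ.
Qed.

Lemma pr_ker0 x : N x 0.
Proof.
have Ux : oset (@opensT X) x by [].
apply/(pr_ker P Ux (pr_0 opensT)); exists opensT, 0.
by split; rewrite // rst0 mor_0.
Qed.

Lemma pr_kerN x v : N x v -> N x (- v).
Proof. by rewrite -scaleN1r; exact: pr_kerZ. Qed.

(** A primitive near x is one near every neighbouring point: the [N x] are the fibres of a subsheaf
    of the constant sheaf E. *)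
Lemma pr_ker_near x v : N x v -> exists W, oset W x /\ forall y, oset W y -> N y v.
Proof.
move=> Nv; have [U [s [Ux rs]]] := pr_ex P x v.
have [/(_ Nv)[W [b [Wx WU e]]] _] := pr_ker P Ux rs.
exists W; split=> // y Wy; apply/(pr_ker P (WU _ Wy) rs).
by exists W, b.
Qed.

(** By [pr_d], subtracting from a local representative the coboundary that it equals leaves the
    representative 0. *)
Lemma pr_zero U v : (forall x, oset U x -> N x v) -> rep v (0 : sec _ U).
Proof.
move=> Nv; apply: (pr_loc P) => x Ux.
have [V [s [Vx rs]]] := pr_ex P x v.
have [/(_ (Nv _ Ux))[W [b [Wx WU e]]] _] := pr_ker P Vx rs.
exists (opensI W U); split; [by split|exact: opensIr|].
have := pr_d P (- b) (pr_res P WU rs); rewrite mor_N e subrr.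
by move=> /(pr_res P (@opensIl _ W U)); rewrite !rst0.
Qed.

Lemma pr_eq U v w s x : oset U x -> rep v s -> rep w (s : sec _ U) -> N x (v - w).
Proof.
move=> Ux rv rw; apply/(pr_ker P Ux (pr_B rv rw)).
by exists U, 0; split; rewrite // subrr rst0 mor_0.
Qed.

Lemma pr_shift U v w s : rep v s -> (forall x, oset U x -> N x (w - v)) ->
  rep w (s : sec _ U).
Proof. by move=> rv /pr_zero/(pr_D rv); rewrite addr0 addrC subrK. Qed.

End Consequences.

(** [Negz 1] is -2, so the cohomology sheaf, in degree -2 + 2, is F in degree 0. *)
Lemma stalk_presentation_in_deg0 F E N : @sheaf_presented F E N ->
  presented (in_deg0 F) (Negz 1) N.
Proof.
move=> [e [el es ek ec]].
have z U (s : sec (csheaf k (@set0 X)) U) : s = 0.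
  apply: fsec_eq => x Ux; have [_ /(_ x Ux)[W [b [_ Wx [a [_ sa]] sb]]]] := spvalP s.
  have -> : fval s x = spval s x by [].
  by rewrite sb// sa// /cst_on; case: pselect.
exists (fun U v (s : sec F U) => forall x, oset U x -> germ x s = e x v).
split.
- move=> j j1 U s x Ux _.
  have -> : s = 0.
    move: s => /=; case: ifP => [/eqP j0|_ s]; last exact: z.
    by exfalso; move/eqP: j1; apply; move: j0 => /=; lia.
  by exists U, 0; split; rewrite // rst_id mor_0.
- move=> U V v s VU rs x Vx.
  by rewrite (@germ_rst k X F)// rs//; exact: VU.
- move=> U v s H x Ux; have [W [Wx WU]] := H x Ux; move=> /(_ x Wx).
  by rewrite (@germ_rst k X F).
- by [].
- move=> U a v w s t rs rt x Ux.
  by rewrite (@germ_lin k X F) rs// rt// el.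
- by move=> x v; have [U [s [Ux H]]] := ec x v; exists U, s.
- move=> U s x Ux _; have [v ev] := es x (@germ _ _ F x U s).
  have [W [t [Wx H]]] := ec x v.
  have O1 := @opensIl _ U W; have O2 := @opensIr _ U W.
  have Ox : oset (opensI U W) x by split.
  have [||A [Ax AI E1]] := @germ_eq_rst _ _ F x (opensI U W) (rst _ s) (rst _ t) => //.
  - by rewrite (@germ_rst _ _ F _ _ _ s O1 Ox) (@germ_rst _ _ F _ _ _ t O2 Ox) ev H.
  exists A, v; split=> //; first by move=> y /AI[].
  move=> y Ay; have [Uy Wy] := AI _ Ay.
  have -> : @rst k X F U A s = rst A t.
    by move: E1; rewrite !rst_rst//.
  by rewrite germ_rst ?H// => y' /AI[].
- move=> U v s x Ux rs; rewrite -ek -(rs x Ux); split.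
    move=> /(germ0_rst Ux)[W [Wx WU s0]]; exists W, 0; split=> //.
  by move=> [W [b [Wx WU s0]]]; exact: (@rst0_germ _ _ F x U W s Wx WU s0).
- move=> U v s b rs x Ux.
  have -> : s + dif (in_deg0 F) (Negz 1 + 1) U b = s by exact: addr0.
  exact: rs.
Qed.

(** * Invariance of presentations under quasi-isomorphisms *)

Section QuasiIso.
Variables (K I : @cpx k X) (f : cmor K I).
Hypothesis qf : quasi_iso f.

Lemma quasi_iso_inj n U (a : sec (ob K (n + 1)) U) (b : sec (ob I n) U) x :
  oset U x -> dif K _ U a = 0 -> f _ U a = dif I _ U b ->
  exists W c, [/\ oset W x, oset W `<=` oset U & rst W a = dif K n W c].
Proof.
move=> Ux da fa; have [/(_ (germ x a)) H _] := qf n x.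
have [||c] := H.
- by rewrite stalk_mapE// da germ0.
- by exists (germ x b); rewrite !stalk_mapE// fa.
have [V [c' [Vx ->]]] := germ_surj c; rewrite stalk_mapE// => E.
have O1 := @opensIl _ U V; have O2 := @opensIr _ U V.
have Ox : oset (opensI U V) x by split.
have [||A [Ax AI E1]] := @germ_eq_rst _ _ _ x (opensI U V) (rst _ a) (rst _ (dif K n V c')) => //.
- by rewrite !germ_rst// E.
exists A, (rst A c'); split=> //; first by move=> y /AI[].
by rewrite mor_rst; move: E1; rewrite !rst_rst//.
Qed.

Lemma quasi_iso_surj n U (b : sec (ob I (n + 1)) U) x :
  oset U x -> dif I _ U b = 0 -> exists W a c, [/\ oset W x, oset W `<=` oset U,
    dif K (n + 1) W a = 0 & rst W b = f _ W a + dif I n W c].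
Proof.
move=> Ux db; have [_ /(_ (germ x b))[]] := qf n x; first by rewrite stalk_mapE// db germ0.
move=> a [c]; have [V [a' [Vx ->]]] := germ_surj a; have [V' [c' [V'x ->]]] := germ_surj c.
rewrite !stalk_mapE// => -[a0 E].
have [A0 [A0x A0V a0']] := germ0_rst Vx a0.
pose O := opensI A0 (opensI U V').
have O1 : oset O `<=` oset U by move=> y [_ []].
have O2 : oset O `<=` oset V' by move=> y [_ []].
have O3 : oset O `<=` oset A0 by move=> y [].
have O4 := subset_trans O3 A0V.
have Ox : oset O x by [].
have [||A [Ax AI E1]] := @germ_eq_rst _ _ _ x O (rst O b)
  (f _ O (rst O a') + dif I n O (rst O c')) => //.
- by rewrite !mor_rst germD !germ_rst// E.
exists A, (rst A a'), (rst A c'); split=> //; first exact: subset_trans AI O1.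
  by rewrite mor_rst -(rst_rst _ (subset_trans AI O3) A0V) a0' rst0.
by move: E1; rewrite rstD -!mor_rst !rst_rst.
Qed.

Lemma presented_quasi_iso i E N : @presented K i E N -> presented I i N.
Proof.
(* The image of [rep] under [f], made local and stable under coboundaries, as [pr_loc] and [pr_d]
   demand. *)
move=> [rep P]; exists (fun U v s => forall x, oset U x -> exists W a b,
  [/\ oset W x, oset W `<=` oset U, rep W v a & rst W s = f _ W a + dif I _ W b]).
split.
- move=> j ji U s x Ux ds; have [W [a [c [Wx WU da sE]]]] := quasi_iso_surj Ux ds.
  have [W' [b [W'x W'W aE]]] := pr_exact P ji Wx da.
  exists W', (f _ W' b + rst W' c); split=> //; first exact: subset_trans WU.
  rewrite -(rst_rst _ W'W WU) sE rstD -(mor_rst (f _)) aE morD mor_rst; congr (_ + _).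
  exact: cfun_dif.
- move=> U V v s VU rs x Vx; have [W [a [b [Wx WU ra sE]]]] := rs x (VU _ Vx).
  have O1 := @opensIl _ V W; have O2 := @opensIr _ V W.
  exists (opensI V W), (rst _ a), (rst _ b); split=> //; first exact: (pr_res P O2 ra).
  by rewrite !mor_rst -rstD -sE !rst_rst.
- move=> U v s H x Ux; have [W [Wx WU /(_ x Wx)[W' [a [b [W'x W'W ra sE]]]]]] := H x Ux.
  exists W', a, b; split=> //; first exact: subset_trans WU.
  by rewrite -sE rst_rst.
- move=> U v s rs; apply: sec_local_eq => x Ux; have [W [a [b [Wx WU ra sE]]]] := rs x Ux.
  exists W; split=> //; rewrite rst0 -mor_rst sE morD dif2 addr0 -(cfun_dif f).
  by rewrite (pr_closed P ra) mor_0.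
- move=> U c v w s t rs rt x Ux; have [W [a [b [Wx WU ra sE]]]] := rs x Ux.
  have [W' [a' [b' [W'x W'U ra' tE]]]] := rt x Ux.
  have O1 := @opensIl _ W W'; have O2 := @opensIr _ W W'.
  exists (opensI W W'), (c *: rst _ a + rst _ a'), (c *: rst _ b + rst _ b').
  split=> //; first exact: subset_trans WU.
    by apply: (pr_lin P); [exact: (pr_res P O1 ra)|exact: (pr_res P O2 ra')].
  rewrite !mor_lin !mor_rst addrACA -scalerDr -!rstD -sE -tE.
  by rewrite rstD rstZ !rst_rst.
- move=> x v; have [U [s [Ux rs]]] := pr_ex P x v.
  exists U, (f _ U s); split=> // y Uy; exists U, s, 0.
  by split; rewrite // rst_id mor_0 addr0.
- move=> U s x Ux ds; have [W [a [c [Wx WU da sE]]]] := quasi_iso_surj Ux ds.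
  have [W' [v [W'x W'W ra]]] := pr_surj P Wx da.
  exists W', v; split=> //; first exact: subset_trans WU.
  move=> y W'y; exists W', (rst W' a), (rst W' c); split=> //.
  by rewrite rst_id !mor_rst -rstD -sE rst_rst.
- move=> U v s x Ux rs; have [W [a [b [Wx WU ra sE]]]] := rs x Ux; split.
    move=> /(pr_ker P Wx ra)[W' [c [W'x W'W aE]]].
    exists W', (f _ W' c + rst W' b); split=> //; first exact: subset_trans WU.
    rewrite -(rst_rst _ W'W WU) sE rstD -(mor_rst (f _)) aE morD mor_rst; congr (_ + _).
    exact: cfun_dif.
  move=> [W' [c [W'x W'U sE']]]; apply/(pr_ker P Wx ra).
  have O1 := @opensIl _ W W'; have O2 := @opensIr _ W W'.
  have [||| A [b' [Ax AW aE]]] := @quasi_iso_inj _ (opensI W W') (rst _ a)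
      (rst _ c - rst _ b) x.
  - by [].
  - by rewrite mor_rst (pr_closed P ra) rst0.
  - rewrite morB !mor_rst -sE'; apply/eqP; rewrite eq_sym subr_eq -rstD -sE.
    by rewrite !rst_rst.
  exists A, b'; split=> //; first exact: subset_trans O1.
  by rewrite -aE rst_rst.
- move=> U v s b rs x Ux; have [W [a [c [Wx WU ra sE]]]] := rs x Ux.
  exists W, a, (c + rst W b); split=> //.
  by rewrite rstD sE morD mor_rst addrA.
Qed.

End QuasiIso.
End Presentations.

(** * Subsheaves, truncation and isomorphism in the derived category *)

Section Subsheaf.
Context {k : fieldType} {X : topologicalType}.
Variables (F : sheaf k X) (P : forall U : opens X, linsub (sec F U)).
Hypothesis Pres : forall (U V : opens X) (s : sec F U), oset V `<=` oset U ->
  sscar (P U) s -> sscar (P V) (rst V s).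
Hypothesis Ploc : forall (U : opens X) (s : sec F U),
  (forall x, oset U x -> exists W : opens X,
     [/\ oset W x, oset W `<=` oset U & sscar (P W) (rst W s)]) -> sscar (P U) s.

Lemma sub_resP (U V : opens X) (h : oset V `<=` oset U) (s : subsp (P U)) :
  sscar (P V) (res h (spval s)).
Proof. by rewrite -rstE; apply: Pres => //; exact: spvalP. Qed.

Definition sub_res (U V : opens X) (h : oset V `<=` oset U) (s : subsp (P U)) :
  subsp (P V) := SubSp (sub_resP h s).

Lemma sub_lin U V (h : oset V `<=` oset U) : linear (sub_res h).
Proof. by move=> a s t; apply: spval_inj; exact: res_lin. Qed.
Lemma sub_id U (h : oset U `<=` oset U) s : sub_res h s = s.
Proof. by apply: spval_inj; exact: res_id. Qed.
Lemma sub_comp U V W (h : oset V `<=` oset U) (h' : oset W `<=` oset V)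
  (h'' : oset W `<=` oset U) s : sub_res h' (sub_res h s) = sub_res h'' s.
Proof. by apply: spval_inj; exact: res_comp. Qed.
Lemma sub_sep (J : Type) (V : J -> opens X) (U : opens X)
    (h : forall j, oset (V j) `<=` oset U) :
  oset U `<=` \bigcup_j oset (V j) ->
  forall s t, (forall j, sub_res (h j) s = sub_res (h j) t) -> s = t.
Proof.
move=> cov s t st; apply: spval_inj; apply: (@res_sep _ _ F J V U h cov) => j.
exact: (congr1 (fun s => spval s) (st j)).
Qed.
Lemma sub_glue (J : Type) (V : J -> opens X) (U : opens X)
    (h : forall j, oset (V j) `<=` oset U) :
  oset U `<=` \bigcup_j oset (V j) ->
  forall s : (forall j, subsp (P (V j))),
  (forall i j (W : opens X) (hi : oset W `<=` oset (V i))
        (hj : oset W `<=` oset (V j)), sub_res hi (s i) = sub_res hj (s j)) ->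
  exists t : subsp (P U), forall j, sub_res (h j) t = s j.
Proof.
move=> cov s comp.
have [|t tE] := @res_glue _ _ F J V U h cov (fun j => spval (s j)).
  by move=> i j W hi hj; exact: (congr1 (fun s => spval s) (comp i j W hi hj)).
have Pt : sscar (P U) t.
  apply: Ploc => x /cov[j _ Vx]; exists (V j); split=> //.
  by rewrite (rstE (h j)) tE; exact: spvalP.
by exists (SubSp Pt) => j; apply: spval_inj; exact: tE.
Qed.

Definition subsheaf : sheaf k X := Sheaf sub_lin sub_id sub_comp sub_sep sub_glue.

Lemma spval_rst (U V : opens X) (s : sec subsheaf U) : oset V `<=` oset U ->
  spval (rst V s : sec subsheaf V) = rst V (spval s).
Proof. by move=> VU; rewrite !(rstE VU). Qed.

End Subsheaf.

Section DerivedIso.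
Context {k : fieldType} {X : topologicalType}.

Lemma quasi_iso_sec (K L : @cpx k X) (f : cmor K L) :
  (forall n (U : opens X) (a : sec (ob K (n + 1)) U) (b : sec (ob L n) U) x, oset U x ->
     dif K _ U a = 0 -> f _ U a = dif L _ U b ->
     exists W c, [/\ oset W x, oset W `<=` oset U & rst W a = dif K n W c]) ->
  (forall n (U : opens X) (b : sec (ob L (n + 1)) U) x, oset U x -> dif L _ U b = 0 ->
     exists W a c, [/\ oset W x, oset W `<=` oset U,
       dif K (n + 1) W a = 0 & rst W b = f _ W a + dif L n W c]) ->
  quasi_iso f.
Proof.
move=> H1 H2 n x; split=> [a|b].
  have [U [s [Ux ->]]] := germ_surj a; rewrite stalk_mapE// => ds [b].
  have [V [t [Vx ->]]] := germ_surj b; rewrite !stalk_mapE// => e.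
  have [A [Ax AU s0]] := germ0_rst Ux ds.
  pose O := opensI A V.
  have O1 : oset O `<=` oset A by move=> y [].
  have O2 : oset O `<=` oset V by move=> y [].
  have O3 := subset_trans O1 AU; have Ox : oset O x by [].
  have [||B [Bx BO E]] := @germ_eq_rst _ _ _ x O (rst O (f _ U s)) (rst O (dif L n V t)) => //.
    by rewrite !germ_rst.
  have [|||W [c [Wx WB e']]] := H1 n B (rst B s) (rst B t) x => //.
  - by rewrite mor_rst -(rst_rst _ (subset_trans BO O1) AU) s0 rst0.
  - by move: E; rewrite !mor_rst !rst_rst.
  exists (germ x c); rewrite stalk_mapE// -e' !germ_rst//.
  - by apply: subset_trans O3.
have [U [s [Ux ->]]] := germ_surj b; rewrite stalk_mapE// => ds.
have [A [Ax AU s0]] := germ0_rst Ux ds.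
have [||W [a [c [Wx WU da e]]]] := H2 n A (rst A s) x => //; first by rewrite mor_rst.
exists (germ x a), (germ x c); rewrite !stalk_mapE// da germ0; split=> //.
by rewrite -germD -e !germ_rst.
Qed.

Section Truncation.
Variables (K : @cpx k X) (m : int).

(** Everything below degree m, cocycles in degree m and 0 above: the canonical truncation of K, the
    middle of the roof from K to its cohomology sheaf. *)
Definition trunc_set n (U : opens X) : set (sec (ob K n) U) :=
  [set s | (m <= n -> dif K n U s = 0) /\ (m < n -> s = 0)].
Lemma trunc_set0 n U : @trunc_set n U 0.
Proof. by split=> // _; rewrite mor_0. Qed.
Lemma trunc_set_lin n U a s t : @trunc_set n U s -> trunc_set t -> trunc_set (a *: s + t).
Proof.
move=> [ds s0] [dt t0]; split=> h; first by rewrite mor_lin ds// dt// scaler0 addr0.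
by rewrite s0// t0// scaler0 addr0.
Qed.
Definition trunc_sub n U := LinSub (@trunc_set0 n U) (@trunc_set_lin n U).

Lemma trunc_setr n (U V : opens X) (s : sec (ob K n) U) : oset V `<=` oset U ->
  sscar (trunc_sub n U) s -> sscar (trunc_sub n V) (rst V s).
Proof. by move=> VU [ds s0]; split=> h; [rewrite mor_rst ds// rst0|rewrite s0// rst0]. Qed.

Lemma trunc_setl n (U : opens X) (s : sec (ob K n) U) :
  (forall x, oset U x -> exists W : opens X,
     [/\ oset W x, oset W `<=` oset U & sscar (trunc_sub n W) (rst W s)]) ->
  sscar (trunc_sub n U) s.
Proof.
move=> H; split=> h; apply: sec_local_eq => x Ux; have [W [Wx WU [ds s0]]] := H x Ux.
  by exists W; split=> //; rewrite -mor_rst ds// rst0.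
by exists W; split=> //; rewrite s0// rst0.
Qed.

Definition trunc_ob n : sheaf k X := subsheaf (@trunc_setr n) (@trunc_setl n).

Lemma trunc_difP n U (s : sec (trunc_ob n) U) :
  sscar (trunc_sub (n + 1) U) (dif K n U (spval s)).
Proof.
split=> h; first exact: dif2.
by have [ds _] := spvalP s; apply: ds; lia.
Qed.
Definition trunc_dif_fun n U (s : sec (trunc_ob n) U) : sec (trunc_ob (n + 1)) U :=
  SubSp (trunc_difP s).
Lemma trunc_dif_lin n U : linear (@trunc_dif_fun n U).
Proof. by move=> a s t; apply: spval_inj; exact: mor_lin. Qed.
Lemma trunc_dif_nat n U V (h : oset V `<=` oset U) (s : sec (trunc_ob n) U) :
  trunc_dif_fun (res h s) = res h (trunc_dif_fun s).
Proof. by apply: spval_inj; exact: mor_nat. Qed.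
Definition trunc_dif n : mor (trunc_ob n) (trunc_ob (n + 1)) :=
  Mor (@trunc_dif_lin n) (@trunc_dif_nat n).
Lemma trunc_dif2 n (U : opens X) s : trunc_dif (n + 1) U (trunc_dif n U s) = 0.
Proof. by apply: spval_inj; exact: dif2. Qed.
Definition trunc : @cpx k X := Cpx trunc_dif2.

Definition trunc_incl_fun n U (s : sec (trunc_ob n) U) : sec (ob K n) U := spval s.
Lemma trunc_incl_lin n U : linear (@trunc_incl_fun n U). Proof. by []. Qed.
Definition trunc_incl_mor n : mor (ob trunc n) (ob K n) :=
  @Mor _ _ (trunc_ob n) (ob K n) (@trunc_incl_fun n) (@trunc_incl_lin n)
    (fun _ _ _ _ => erefl).
Definition trunc_incl : cmor trunc K :=
  @CMor _ _ trunc K trunc_incl_mor (fun _ _ _ => erefl).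

Lemma trunc_incl_quasi_iso : (forall n, m <= n -> exact_at K n) -> quasi_iso trunc_incl.
Proof.
move=> Kex; apply: quasi_iso_sec => n U.
  move=> a b x Ux da fa; have [h|h] := leP m n.
    exists U, 0; split=> //; rewrite rst_id mor_0; apply: spval_inj.
    by have [_] := spvalP a; apply; lia.
  have tb : sscar (trunc_sub n U) b by split; lia.
  by exists U, (SubSp tb); split=> //; rewrite rst_id; apply: spval_inj.
move=> b x Ux db; have [h|h] := leP m n.
  have [W [c [Wx WU e]]] := Kex n h U b x Ux db.
  by exists W, 0, c; rewrite !mor_0 add0r.
have tb : sscar (trunc_sub (n + 1) U) b by split=> // ?; lia.
exists U, (SubSp tb), 0; split=> //; first exact: spval_inj.
by rewrite rst_id mor_0 addr0.
Qed.

End Truncation.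

Section ToSheaf.
Variables (K : @cpx k X) (i : int) (E : lmodType k) (N : X -> set E).
Variable rep : forall U : opens X, E -> set (sec (ob K (i + 1 + 1)) U).
Hypothesis P : presentation N rep.
Variables (F : sheaf k X) (e : forall x, E -> stalk F x).
Hypothesis Fe : stalk_presentation N e.

Definition class_rel U (s : sec (ob K (i + 1 + 1)) U) (t : sec F U) :=
  forall x, oset U x -> exists W v, [/\ oset W x, oset W `<=` oset U,
    rep v (rst W s) & forall y, oset W y -> germ y t = e y v].

Lemma class_rel_uniq U (s : sec (ob K (i + 1 + 1)) U) t t' :
  class_rel s t -> class_rel s t' -> t = t'.
Proof.
move=> st st'; apply: sec_germ_eq => x Ux.
have [W [v [Wx WU rv tv]]] := st x Ux; have [W' [v' [Wx' WU' rv' tv']]] := st' x Ux.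
rewrite tv// tv'//; apply/eqP; rewrite -subr_eq0 -linBf; last exact: (sp_lin Fe).
apply/eqP/(sp_ker Fe).
have O1 := @opensIl _ W W'; have O2 := @opensIr _ W W'.
have Ox : oset (opensI W W') x by split.
apply: (pr_eq P Ox (s := rst _ s)).
  by move: (pr_res P O1 rv); rewrite rst_rst.
by move: (pr_res P O2 rv'); rewrite rst_rst.
Qed.

Lemma class_rel_rst U V (s : sec (ob K (i + 1 + 1)) U) t : oset V `<=` oset U ->
  class_rel s t -> class_rel (rst V s) (rst V t).
Proof.
move=> VU st x Vx; have [W [v [Wx WU rv tv]]] := st x (VU _ Vx).
have O1 := @opensIl _ V W; have O2 := @opensIr _ V W.
exists (opensI V W), v; split=> //.
  by rewrite rst_rst// -(rst_rst _ O2 WU); exact: (pr_res P).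
by move=> y [Vy Wy]; rewrite germ_rst// tv.
Qed.

Lemma class_rel_lin U a (s s' : sec (ob K (i + 1 + 1)) U) t t' :
  class_rel s t -> class_rel s' t' -> class_rel (a *: s + s') (a *: t + t').
Proof.
move=> st st' x Ux.
have [W [v [Wx WU rv tv]]] := st x Ux; have [W' [v' [Wx' WU' rv' tv']]] := st' x Ux.
have O1 := @opensIl _ W W'; have O2 := @opensIr _ W W'.
exists (opensI W W'), (a *: v + v'); split=> //; first exact: subset_trans WU.
  rewrite rstD rstZ; apply: (pr_lin P).
    by move: (pr_res P O1 rv); rewrite rst_rst.
  by move: (pr_res P O2 rv'); rewrite rst_rst.
by move=> y [Wy W'y]; rewrite germ_lin tv// tv'// (sp_lin Fe).
Qed.

Lemma class_rel_local U (s : sec (ob K (i + 1 + 1)) U) t :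
  (forall x, oset U x -> exists W, [/\ oset W x, oset W `<=` oset U &
     class_rel (rst W s) (rst W t)]) -> class_rel s t.
Proof.
move=> H x Ux; have [W [Wx WU /(_ x Wx)[W' [v [W'x W'W rv tv]]]]] := H x Ux.
exists W', v; split=> //; first exact: subset_trans WU.
  by move: rv; rewrite rst_rst.
by move=> y W'y; rewrite -tv// germ_rst//; exact: W'W.
Qed.

Lemma class_rel_ex U (s : sec (ob K (i + 1 + 1)) U) : dif K _ U s = 0 ->
  exists t, class_rel s t.
Proof.
move=> ds; have [W V s' VW [WU r]|W s1 s2 [_ r1] [_ r2]|x Ux|t tP] := @sec_local _ _ F U
  (fun W t => oset W `<=` oset U /\ class_rel (rst W s) t).
- split; first exact: subset_trans WU.
  by have := class_rel_rst VW r; rewrite rst_rst.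
- exact: class_rel_uniq r1 r2.
- have [W [v [Wx WU rv]]] := pr_surj P Ux ds; have [V [t [Vx tv]]] := sp_loc Fe x v.
  have O1 := @opensIl _ W V; have O2 := @opensIr _ W V.
  exists (opensI W V); split=> //; first exact: subset_trans WU.
  exists (rst _ t); split=> [|y Wy]; first exact: subset_trans WU.
  exists (opensI W V), v; split=> //.
    rewrite rst_id; first by move: (pr_res P O1 rv); rewrite rst_rst.
  by move=> z Wz; rewrite germ_rst//; apply: tv; case: Wz.
exists t; apply: class_rel_local => x Ux; have [W [Wx WU [_ r]]] := tP x Ux.
by exists W.
Qed.

Definition to_sheaf_fun U (s : sec (ob (trunc K (i + 1 + 1)) (i + 1 + 1)) U) : sec F U :=
  sval (cid (class_rel_ex ((spvalP s).1 (lexx _)))).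
Lemma to_sheafP U s : class_rel (spval s) (@to_sheaf_fun U s).
Proof. exact: (svalP (cid _)). Qed.
Lemma to_sheaf_lin U : linear (@to_sheaf_fun U).
Proof.
move=> a s t; apply: class_rel_uniq (to_sheafP _) _.
by apply: class_rel_lin; exact: to_sheafP.
Qed.
Lemma to_sheaf_nat U V (h : oset V `<=` oset U) s :
  @to_sheaf_fun V (res h s) = res h (@to_sheaf_fun U s).
Proof.
apply: class_rel_uniq (to_sheafP _) _.
have -> : spval (res h s) = rst V (spval s) by rewrite (rstE h).
by rewrite -rstE; apply: class_rel_rst => //; exact: to_sheafP.
Qed.
Definition to_sheaf : mor (ob (trunc K (i + 1 + 1)) (i + 1 + 1)) F :=
  Mor to_sheaf_lin to_sheaf_nat.

Lemma to_sheaf_eq0 U (s : sec (ob (trunc K (i + 1 + 1)) (i + 1 + 1)) U) x : oset U x ->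
  germ x (to_sheaf U s) = 0 <->
  exists W b, [/\ oset W x, oset W `<=` oset U & rst W (spval s) = dif K _ W b].
Proof.
move=> Ux; have [W [v [Wx WU rv tv]]] := to_sheafP s Ux.
rewrite tv// (sp_ker Fe) (pr_ker P Wx rv); split=> -[W' [b [W'x W'W E']]].
  exists W', b; split=> //; first exact: subset_trans WU.
  by move: E'; rewrite rst_rst.
have O1 := @opensIl _ W W'; have O2 := @opensIr _ W W'.
exists (opensI W W'), (rst _ b); split=> //.
by rewrite mor_rst -E' !rst_rst.
Qed.

Lemma to_sheaf_surj U (t : sec F U) x : oset U x ->
  exists W s, [/\ oset W x, oset W `<=` oset U & rst W t = to_sheaf W s].
Proof.
move=> Ux; have [v ev] := sp_surj Fe (germ x t).
have [V [s [Vx rs]]] := pr_ex P x v; have [V' [t' [V'x tv]]] := sp_loc Fe x v.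
have [||W [Wx WU E']] := @germ_eq_rst _ _ F x (opensI U V') (rst _ t) (rst _ t') => //.
- rewrite !germ_rst ?ev ?tv//; [exact: opensIr|exact: opensIl].
have WU1 : oset W `<=` oset U by move=> y /WU[].
have WU2 : oset W `<=` oset V' by move=> y /WU[].
have O1 := @opensIl _ W V; have O2 := @opensIr _ W V.
have rO := pr_res P O2 rs.
have ts : sscar (trunc_sub K (i + 1 + 1) (i + 1 + 1) (opensI W V)) (rst _ s).
  by split; rewrite ?ltxx// => _; exact: (pr_closed P rO).
exists (opensI W V), (SubSp ts); split=> //; first exact: subset_trans WU1.
apply: class_rel_uniq (to_sheafP _) => /= y Oy.
exists (opensI W V), v; split=> //; first by rewrite rst_id.
move=> z Oz; rewrite -tv; last by case: Oz => /WU2.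
rewrite -(rst_rst _ O1 WU1).
have -> : rst W t = rst W t' by move: E'; rewrite !rst_rst//; [exact: opensIr|exact: opensIl].
by rewrite rst_rst// germ_rst//; exact: subset_trans WU2.
Qed.

End ToSheaf.

(** The roof is K <- truncation -> F. The left leg uses exactness in positive degrees; on the right,
    the class map in degree 0 is locally onto with the local coboundaries as kernel, since the
    cohomology of K and the sheaf F are quotients of E by the same N. *)
Lemma presented_derived_iso (K : @cpx k X) (F : sheaf k X) (E : lmodType k) (N : X -> set E) :
  presented K (Negz 1) N -> sheaf_presented F N -> derived_iso K (in_deg0 F).
Proof.
(* [m] computes to 0, so that [to_sheaf] is a morphism in degree 0 without a cast. *)
move=> [rep P] [e Fe]; pose m : int := Negz 1 + 1 + 1.
pose g0 : mor (ob (trunc K m) 0) F := to_sheaf P Fe.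
pose g (n : int) : mor (ob (trunc K m) n) (ob (in_deg0 F) n) :=
  match n with Posz 0 => g0 | _ => mor0 _ _ end.
have gN n : n != 0 -> forall U s, g n U s = 0 by case: n => [[|n]|n].
have csh0 n : n != 0 -> forall (U : opens X) (s : sec (ob (in_deg0 F) n) U), s = 0.
  move=> /negbTE n0 U; rewrite /= n0 => s.
  apply: fsec_eq => x Ux; have [_ /(_ x Ux)[W [b [_ Wx [a [_ sa]] sb]]]] := spvalP s.
  have -> : fval s x = spval s x by [].
  by rewrite sb// sa// /cst_on; case: pselect.
have gd n (U : opens X) (s : sec (ob (trunc K m) n) U) :
    g (n + 1) U (dif (trunc K m) n U s) = dif (in_deg0 F) n U (g n U s).
  change (g (n + 1) U (dif (trunc K m) n U s) = 0).
  have [n0|n0] := eqVneq (n + 1) 0; last exact: gN.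
  have {}n0 : n = Negz 0 by lia.
  rewrite {}n0 in s *.
  change (g0 U (dif (trunc K m) (Negz 0) U s) = 0).
  apply: sec_germ_eq => x Ux; rewrite germ0; apply/(to_sheaf_eq0 P Fe) => //.
  by exists U, (spval s); split=> //; rewrite rst_id.
exists (trunc K m), (trunc_incl K m), (@CMor _ _ (trunc K m) (in_deg0 F) g gd).
split.
  apply: trunc_incl_quasi_iso => n mn; apply: (pr_exact P).
  by move: mn; rewrite /m; case: n => [n|[|n]].
have lift_exact n (U : opens X) (a : sec (ob (trunc K m) (n + 1)) U) x : n < 0 ->
    (exists (W : opens X) b, [/\ oset W x, oset W `<=` oset U & rst W (spval a) = dif K n W b]) ->
    exists (W : opens X) b, [/\ oset W x, oset W `<=` oset U & rst W a = dif (trunc K m) n W b].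
  move=> n0 [W [b [Wx WU E']]].
  have tb : sscar (trunc_sub K m n W) b by rewrite /m; split=> ?; exfalso; lia.
  exists W, (SubSp tb); split=> //; apply: spval_inj.
  by rewrite spval_rst.
apply: quasi_iso_sec => n U.
  move=> a b x Ux da fa.
  have [n0|n0] := leP 0 n.
    exists U, 0; split=> //; rewrite rst_id mor_0; apply: spval_inj.
    by have [_] := spvalP a; apply; rewrite /m; lia.
  have [n1|n1] := eqVneq n (Negz 0); last first.
    apply: lift_exact => //; apply: (pr_exact P) => //.
    exact: (congr1 (fun s => spval s) da).
  rewrite {}n1 in a b da fa n0 *; apply: lift_exact => //.
  have fa0 : g0 U a = 0 by exact: fa.
  by apply/(to_sheaf_eq0 P Fe _ Ux); rewrite -/g0 fa0 germ0.
move=> b x Ux _; have [n0|n0] := eqVneq (n + 1) 0; last first.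
  exists U, 0, 0; split=> //; first by rewrite mor_0.
  by rewrite (csh0 _ n0 U b) rst0 !mor_0 addr0.
have {}n0 : n = Negz 0 by lia.
rewrite {}n0 in b *.
have [W [s [Wx WU E']]] := to_sheaf_surj P Fe (b : sec F U) Ux.
exists W, s, 0; split=> //; last by rewrite mor_0 addr0; exact: E'.
apply: spval_inj; have [ds _] := spvalP s; exact: ds.
Qed.

End DerivedIso.

(** * Proper direct images along a line *)

(* lra is slow on large contexts, and fails on equations between sections. *)
Ltac slra := repeat match goal with
  | H : @eq (GRing.Lmodule.sort _) _ _ |- _ => clear H
  | H : @subset _ _ _ |- _ => clear H
  | H : oset _ _ |- _ => clear H
  | H : forall _, _ |- _ => clear H
  | H : ex _ |- _ => clear H
  end; lra.

Section RealInterval.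
Context {R : realType}.

(** Real induction, with [P c d] thought of as a property of the open interval from c to d: the
    supremum of the points reached from a is itself reached by gluing, and can be passed unless it
    is b. Tubes, sections, cohomology classes and linear functionals are all continued along fibres
    by this lemma. *)
Lemma interval_patch (P : R -> R -> Prop) (a b : R) : a <= b ->
  (forall c d c' d', c <= c' -> d' <= d -> P c d -> P c' d') ->
  (forall c d c' d', c <= c' -> c' < d -> d <= d' -> P c d -> P c' d' -> P c d') ->
  (forall r, a <= r <= b -> exists2 e, 0 < e & P (r - e) (r + e)) -> P a b.
Proof.
move=> ab mono glue loc.
suff [e e0 /mono] : exists2 e, 0 < e & P (a - e) (b + e) by apply; slra.
pose S : set R := [set x | a <= x <= b /\ exists2 e, 0 < e & P (a - e) (x + e)].
have Sa : S a by split; [slra|apply: loc; slra].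
have hS : has_sup S by split; [exists a|exists b => x [/andP[]]].
pose s := sup S.
have as_ : a <= s by exact: (ub_le_sup hS.2 Sa).
have sb : s <= b by apply: ge_sup; [exists a|move=> x [/andP[]]].
have [|e e0 Pe] := loc s; first by rewrite as_ sb.
have [x Sx sx] := sup_adherent e0 hS.
have xs : x <= s by exact: (ub_le_sup hS.2 Sx).
have [/andP[ax xb] [d d0 Pd]] := Sx.
have {}Pd : P (a - d) (s + e).
  have [h|h] := leP (s + e) (x + d); first exact: mono Pd.
  apply: (glue (a - d) (x + d) (Num.max (a - d) (s - e)) (s + e)) => //.
  - by rewrite le_max lexx.
  - by rewrite gt_max; apply/andP; split; move: sx; rewrite -/s; slra.
  - exact: ltW.
  - by apply: mono Pe => //; rewrite le_max lexx orbT.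
have [sb'|sb'] := eqVneq s b.
  exists (Num.min d e); first by rewrite lt_min d0.
  have h1 : Num.min d e <= d by rewrite ge_min lexx.
  have h2 : Num.min d e <= e by rewrite ge_min lexx orbT.
  by move: Pd; rewrite sb'; apply: mono; slra.
have {sb'}sb' : s < b by rewrite lt_neqAle sb'.
pose m := Num.min (e / 2) (b - s).
have m0 : 0 < m by rewrite lt_min; apply/andP; split; slra.
have m1 : m <= e / 2 by rewrite ge_min lexx.
have m2 : m <= b - s by rewrite ge_min lexx orbT.
have : S (s + m).
  split; first by apply/andP; split; slra.
  exists (Num.min d (e / 2)); first by rewrite lt_min; apply/andP; split; slra.
  have h1 : Num.min d (e / 2) <= d by rewrite ge_min lexx.
  have h2 : Num.min d (e / 2) <= e / 2 by rewrite ge_min lexx orbT.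
  by apply: mono Pd; slra.
by move=> /(ub_le_sup hS.2); rewrite -/s; slra.
Qed.

End RealInterval.

(** [h] is bounded on the compact fibre of S over y, and the part of S where it exceeds that bound
    by 1 has an image that is closed over V and misses y. *)
Lemma proper_over_bounded {R : realType} {X Y : topologicalType} (f : continuousType X Y)
    (h : X -> R) (V : opens Y) (S : set X) : continuous h -> proper_over f V S ->
  forall y, oset V y -> exists (V' : opens Y) M,
    [/\ oset V' y, oset V' `<=` oset V & forall x, oset V' (f x) -> S x -> `|h x| <= M].
Proof.
move=> ch [pS kS] y Vy.
have cB M : closed [set x | M <= `|h x|].
  apply: (@preimage_closed _ _ (fun x => `|h x|) [set r | M <= r]).
    move=> x _; apply: (@continuous_comp _ _ _ h (fun r : R => `|r|)).
      exact: ch.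
    exact: norm_continuous.
  exact: closed_ge.
have : compact (h @` (S `&` f @^-1` [set y])).
  apply: continuous_compact (kS y Vy); apply: continuous_subspaceT; exact: ch.
move=> /compact_bounded [M [Mr MM]].
pose M' := M + 1; have {}MM x : S x -> f x = y -> `|h x| <= M'.
  by move=> Sx fx; apply: (MM M'); [rewrite /M'; slra|exists x].
have nc : ~ closure (f @` (S `&` [set x | M' + 1 <= `|h x|])) y.
  move=> cy; have [x [Sx /= hx] fx] := pS _ (cB (M' + 1)) y (conj cy Vy).
  by have := MM x Sx fx; slra.
have oW : open (~` closure (f @` (S `&` [set x | M' + 1 <= `|h x|]))).
  by apply: closed_openC; exact: closed_closure.
exists (opensI V (Opens oW)), (M' + 1); split=> //; first exact: opensIl.
move=> x [Vx /= nx] Sx; rewrite leNgt; apply/negP => hx; apply: nx.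
by apply: subset_closure; exists x => //; split=> //=; exact: ltW.
Qed.

(** * Charts Y x R and proper supports *)

Section Chart.
Context {R : realType} {X Y : topologicalType}.

(* f is, up to the homeomorphism (f, h), the projection Y * R -> Y. *)
Record chart (f : continuousType X Y) (h : X -> R) (io : Y -> R -> X) : Prop := Chart {
  ch_fio : forall y r, f (io y r) = y;
  ch_hio : forall y r, h (io y r) = r;
  ch_io : forall x, io (f x) (h x) = x;
  ch_h : continuous h;
  ch_cio : continuous (fun p : Y * R => io p.1 p.2) }.

Lemma oi_open (a b : R) : open [set r : R | a < r < b].
Proof.
rewrite (_ : [set _ | _] = [set r | a < r] `&` [set r | r < b]).
  by apply: openI; [exact: open_gt|exact: open_lt].
by apply/seteqP; split=> x /=; [move=> /andP[]|move=> []] => -> ->.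
Qed.
Definition oi (a b : R) : opens R := Opens (@oi_open a b).
Definition olt (b : R) : opens R := Opens (@open_lt _ b).
Definition ogt (a : R) : opens R := Opens (@open_gt _ a).
Definition oout (M : R) : opens R := opensU (olt (- M)) (ogt M).

Variables (f : continuousType X Y) (h : X -> R) (io : Y -> R -> X).
Hypothesis ch : chart f h io.

Lemma bx_open (V : opens Y) (O : opens R) : open (f @^-1` oset V `&` h @^-1` oset O).
Proof.
apply: openI; first exact: open_pre.
by apply: open_comp (osetP O) => x _; exact: (ch_h ch).
Qed.
Definition bx V O : opens X := Opens (bx_open V O).

Lemma bxE V O x : oset (bx V O) x <-> oset V (f x) /\ oset O (h x).
Proof. by []. Qed.

Lemma bx_io V O y r : oset (bx V O) (io y r) <-> oset V y /\ oset O r.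
Proof. by rewrite bxE (ch_fio ch) (ch_hio ch). Qed.

Lemma bxS (V V' : opens Y) (O O' : opens R) : oset V `<=` oset V' -> oset O `<=` oset O' ->
  oset (bx V O) `<=` oset (bx V' O').
Proof. by move=> VV OO x [/VV ? /OO ?]. Qed.

Lemma bx_pre (V : opens Y) (O : opens R) : oset (bx V O) `<=` oset (opens_pre f V).
Proof. by move=> x []. Qed.

Lemma oiS (a b c d : R) : c <= a -> b <= d -> oset (oi a b) `<=` oset (oi c d).
Proof. by move=> ca bd x /= /andP[ax xb]; apply/andP; split; slra. Qed.

Lemma nbhs_opens (T : topologicalType) (x : T) (A : set T) : nbhs x A ->
  exists V : opens T, oset V x /\ oset V `<=` A.
Proof.
move=> H; exists (Opens (@open_interior _ A)); split; first exact: H.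
exact: interior_subset.
Qed.

Lemma bx_nbhs (U : opens X) y r : oset U (io y r) ->
  exists V e, [/\ oset V y, 0 < e & oset (bx V (oi (r - e) (r + e))) `<=` oset U].
Proof.
move=> Uyr; have cc : continuous (fun p : Y * R => io p.1 p.2) by exact: (ch_cio ch).
have /= := cc (y, r).
move=> /(_ _ (open_nbhs_nbhs (conj (osetP U) Uyr))) [[A B] /= [nA nB] AB].
have [V [Vy VA]] := nbhs_opens nA.
have [e /= e0 eB] := (nbhs_ballP _ _).1 nB.
exists V, e; split=> // x [Vx /= /andP[h1 h2]].
rewrite -(ch_io ch x); apply: (AB (f x, h x)); split; first exact: VA.
by apply: eB; rewrite /ball /= /ball_ ltr_norml; apply/andP; split; slra.
Qed.

Lemma bx_tube (U : opens X) y a b : a <= b ->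
  (forall r, a <= r <= b -> oset U (io y r)) ->
  exists V : opens Y, oset V y /\ oset (bx V (oi a b)) `<=` oset U.
Proof.
move=> ab H; pose P c d := exists V : opens Y, oset V y /\ oset (bx V (oi c d)) `<=` oset U.
apply: (@interval_patch _ P a b ab).
- move=> c d c' d' cc dd [V [Vy VU]]; exists V; split=> //.
  by apply: subset_trans VU; apply: bxS => //; exact: oiS.
- move=> c d c' d' cc cd dd [V [Vy VU]] [V' [Vy' VU']].
  exists (opensI V V'); split=> // x [[Vx V'x] /= /andP[h1 h2]].
  have [hd|hd] := ltP (h x) d; first by apply: VU; split=> //=; rewrite h1.
  by apply: VU'; split=> //=; rewrite h2 andbT; slra.
- by move=> r /H /bx_nbhs[V [e [Vy e0 VU]]]; exists e => //; exists V.
Qed.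

Lemma proper_bounded (V : opens Y) (S D : set X) : closed D -> S = D `&` f @^-1` oset V ->
  proper_over f V S <-> forall y, oset V y -> exists (V' : opens Y) M,
    [/\ oset V' y, oset V' `<=` oset V & forall x, oset V' (f x) -> S x -> `|h x| <= M].
Proof.
move=> cD SD; split=> [p|H]; first exact: (proper_over_bounded (ch_h ch) p).
have fib y M : (forall x, f x = y -> S x -> `|h x| <= M) -> oset V y ->
    S `&` f @^-1` [set y] = (io y @` `[- M, M]) `&` D.
  move=> bM Vy; apply/seteqP; split=> x.
    move=> [Sx /= fx]; split; last by move: Sx; rewrite SD => -[].
    exists (h x); last by rewrite -fx (ch_io ch).
    by rewrite /= in_itv /= -ler_norml; exact: bM.
  by move=> [[r _ <-] Dr]; rewrite SD /= /preimage /= (ch_fio ch).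
split=> [B cB y [cy Vy]|y Vy]; last first.
  have [V' [M [V'y V'V bM]]] := H y Vy.
  rewrite (fib y M)//; last by move=> x fx Sx; apply: bM => //; rewrite fx.
  apply: compact_closedI cD; apply: continuous_compact; last exact: segment_compact.
  apply: continuous_subspaceT.
  apply: (@comp_cts _ _ _ (fun r : R => (y, r)) (fun p : Y * R => io p.1 p.2)).
    by apply: (@pair_cts _ _ _ (fun=> y) idfun) => r; [exact: cvg_cst|exact: cvg_id].
  exact: (ch_cio ch).
apply: contrapT => nfy; have [V' [M [V'y V'V bM]]] := H y Vy.
have oU : open (~` (D `&` B)) by apply: closed_openC; exact: closedI.
have [||V2 [V2y V2U]] := @bx_tube (Opens oU) y (- (`|M| + 1)) (`|M| + 1).
- by have := normr_ge0 M; slra.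
- move=> r _ /= [Dr Br]; apply: nfy; exists (io y r); last exact: (ch_fio ch).
  by split=> //; rewrite SD /preimage /= (ch_fio ch).
have nb : nbhs y (oset V' `&` oset V2).
  by apply: filterI; apply: open_nbhs_nbhs; split=> //; exact: osetP.
have [z [[x [Sx Bx] <-] [V'x V2x]]] := cy _ nb.
have hx : `|h x| < `|M| + 1.
  by apply: (le_lt_trans (bM x V'x Sx)); have := ler_norm M; slra.
have := V2U x; apply; first by split=> //=; rewrite -ltr_norml.
by split=> //; move: Sx; rewrite SD => -[].
Qed.

Section Bounded.
Context {k : fieldType}.
Variable F : sheaf k X.

Definition bounded_supp (V : opens Y) (s : sec F (opens_pre f V)) :=
  forall y, oset V y -> exists (V' : opens Y) M, [/\ oset V' y, oset V' `<=` oset V &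
    forall x, oset V' (f x) -> M < `|h x| -> germ x s = 0].

Lemma proper_suppE V (s : sec F (opens_pre f V)) : proper_supp s <-> bounded_supp s.
Proof.
have [D [cD SD]] := supp_closed s; rewrite /proper_supp /= (proper_bounded cD SD).
split=> H y Vy; have [V' [M [V'y V'V b]]] := H y Vy; exists V', M; split=> // x V'x.
  move=> Mx; apply: contrapT => nz; have := b x V'x; rewrite leNgt Mx.
  by move=> /(_ (conj (V'V _ V'x) nz)).
by move=> [Ux nz]; rewrite leNgt; apply/negP => /(b x V'x).
Qed.

Definition mk_shriek V (s : sec F (opens_pre f V)) (b : bounded_supp s) : sec (shriek f F) V :=
  @SubSp _ _ (shriek_sub f F V) _ ((proper_suppE s).2 b).

Lemma shriek_bounded V (s : sec (shriek f F) V) : bounded_supp (spval s).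
Proof. by apply/proper_suppE; exact: (spvalP s). Qed.

Lemma shriek_rst V W (s : sec (shriek f F) V) : oset W `<=` oset V ->
  spval (rst W s : sec (shriek f F) W) = rst (opens_pre f W) (spval s).
Proof. by move=> WV; rewrite (rstE WV) (rstE (pre_sub WV)). Qed.

Lemma shriek_bounded_rst V (s : sec (shriek f F) V) y : oset V y ->
  exists (W : opens Y) M, [/\ oset W y, oset W `<=` oset V, 0 < M &
    rst (bx W (oout M)) (spval s) = 0].
Proof.
move=> Vy; have [V' [M [V'y V'V b]]] := shriek_bounded s Vy.
exists V', (`|M| + 1); split=> //; first by have := normr_ge0 M; slra.
have sub : oset (bx V' (oout (`|M| + 1))) `<=` oset (opens_pre f V).
  by move=> x [/V'V].
apply: sec_germ_eq => x Wx; rewrite germ0 germ_rst//; have [V'x Ox] := Wx.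
apply: b => //; have hM := ler_norm M.
have h1 := ler_norm (h x); have h2 := ler_norm (- h x); rewrite normrN in h2.
by case: Ox => /= Ox; slra.
Qed.

Lemma rst_bounded V (s : sec F (opens_pre f V)) : 
  (forall y, oset V y -> exists (W : opens Y) M, [/\ oset W y, oset W `<=` oset V &
    rst (bx W (oout M)) s = 0]) -> bounded_supp s.
Proof.
move=> H y Vy; have [W [M [Wy WV s0]]] := H y Vy.
exists W, M; split=> // x Wx Mx.
apply: (rst0_germ (W := bx W (oout M))) s0; last by move=> z [/WV].
split=> //=; have [h0|h0] := leP 0 (h x); [right|left] => /=.
  by rewrite -(ger0_norm h0).
by move: Mx; rewrite ltr0_norm//; slra.
Qed.

End Bounded.

(** Softness for the closures of open sets: a section near the closure of W is replaced by a global
    one, with equality asked on W only. It follows from flabbiness and is the property shown to pass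
    to f_!. *)
Definition soft {k : fieldType} {Z : topologicalType} (F : sheaf k Z) :=
  forall (U W : opens Z) (s : sec F U), closure (oset W) `<=` oset U ->
  exists t : sec F opensT, rst W t = rst W s.

Lemma flabby_soft {k : fieldType} {Z : topologicalType} (F : sheaf k Z) : flabby F -> soft F.
Proof.
move=> fF U W s WU; have [t tE] := fF U opensT s; exists t; apply: tE => //.
exact: subset_trans (@subset_closure _ _) WU.
Qed.

Lemma zero_extend {k : fieldType} {Z : topologicalType} (F : sheaf k Z)
    (U A B : opens Z) (s : sec F A) : oset U `<=` oset A `|` oset B ->
  oset A `<=` oset U -> oset B `<=` oset U -> rst (opensI A B) s = 0 ->
  exists t : sec F U, rst A t = s /\ rst B t = 0.
Proof.
move=> cov AU BU s0; apply: (sec_glue2 cov AU BU).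
by rewrite s0 rst0.
Qed.

(** The section is set to 0 off C, the part of its support over the closure of W, and then extended
    by flabbiness. The extension is supported in C: over U this lies in the proper support of [s],
    and near a point outside U there is nothing of C. *)
Lemma shriek_soft {k : fieldType} (F : sheaf k X) : flabby F -> soft (shriek f F).
Proof.
move=> fF U W s WU; have [D [cD SD]] := supp_closed (spval s).
pose C := D `&` f @^-1` closure (oset W).
have cC : closed C.
  by apply: closedI => //; apply: preimage_closed (@closed_closure _ _) => x _; exact: cts_fun.
pose A := opens_pre f W; pose B : opens X := Opens (closed_openC cC).
have WU' : oset W `<=` oset U by exact: subset_trans (@subset_closure _ _) WU.
have AU : oset A `<=` oset (opens_pre f U) by exact: pre_sub.
have germ_s x : oset B x -> oset U (f x) -> closure (oset W) (f x) -> germ x (spval s) = 0.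
  move=> Bx Ux Wx; apply: contrapT => nz; apply: Bx; split=> //.
  by have : supp (spval s) x by []; rewrite SD => -[].
have [||||u [uA uB]] := @zero_extend _ _ F (opensU A B) A B (rst A (spval s)).
- by [].
- by move=> x; left.
- by move=> x; right.
- rewrite rst_rst//; last exact: opensIl.
  apply: sec_germ_eq => x [Ax Bx]; rewrite germ0 germ_rst//; last first.
    by move=> z [/AU].
  by apply: germ_s => //; [exact: AU|exact: subset_closure].
have [t tE] := fF (opensU A B) (opens_pre f (@opensT Y)) u.
have tB x : oset B x -> germ x t = 0.
  move=> Bx; apply: (rst0_germ (W := B)) => //.
  by rewrite tE// ?uB// => z; right.
have bt : bounded_supp t.
  move=> y _; have [Uy|nUy] := pselect (oset U y).
    have [V' [M [V'y V'U b]]] := shriek_bounded s Uy.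
    exists V', M; split=> // x V'x Mx; apply: tB => /= -[Dx _].
    have : supp (spval s) x by rewrite SD; split=> //; exact: V'U.
    by move=> [_]; apply; exact: b.
  have oW : open (~` closure (oset W)) by apply: closed_openC; exact: closed_closure.
  exists (Opens oW), 0; split=> //; first by move=> /WU.
  by move=> x nx _; apply: tB => -[_].
exists (mk_shriek bt); apply: spval_inj.
have AO : oset A `<=` oset (opensU A B) by move=> x Ax; left.
by rewrite !shriek_rst//= tE// -[RHS]uA.
Qed.

End Chart.

Lemma closure_sub_closed (T : topologicalType) (A C : set T) : A `<=` C -> closed C ->
  closure A `<=` C.
Proof. by move=> AC cC; rewrite [C](closure_id C).1//; exact: closureS. Qed.

Lemma sec_empty {k : fieldType} {X : topologicalType} (F : sheaf k X) (U : opens X)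
  (s t : sec F U) : (forall x, ~ oset U x) -> s = t.
Proof. by move=> U0; apply: sec_germ_eq => x /U0. Qed.

Lemma sec_eq2 {k : fieldType} {X : topologicalType} (F : sheaf k X) (U A B : opens X)
  (s t : sec F U) : oset U `<=` oset A `|` oset B -> oset A `<=` oset U -> oset B `<=` oset U ->
  rst A s = rst A t -> rst B s = rst B t -> s = t.
Proof.
by move=> cov AU BU eA eB; apply: sec_local_eq => x /cov[Ax|Bx]; [exists A|exists B].
Qed.

Lemma rst_eqS {k : fieldType} {X : topologicalType} (F : sheaf k X) (U U' A B : opens X)
  (s : sec F U) (t : sec F U') : oset B `<=` oset A -> oset A `<=` oset U -> oset A `<=` oset U' ->
  rst A s = rst A t -> rst B s = rst B t.
Proof. by move=> BA AU AU' e; rewrite -(rst_rst s BA AU) e rst_rst. Qed.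

Lemma rst_eq0S {k : fieldType} {X : topologicalType} (F : sheaf k X) (U A B : opens X)
  (s : sec F U) : oset B `<=` oset A -> oset A `<=` oset U -> rst A s = 0 -> rst B s = 0.
Proof. by move=> BA AU e; rewrite -(rst_rst s BA AU) e rst0. Qed.

(** * Patching cocycles and primitives along a fibre *)

Section Push.
Context {k : fieldType} {R : realType} {X Y : topologicalType}.
Variables (f : continuousType X Y) (h : X -> R) (io : Y -> R -> X).
Hypothesis ch : chart f h io.
Hypothesis regY : forall (V : opens Y) y, oset V y ->
  exists V' : opens Y, oset V' y /\ closure (oset V') `<=` oset V.
Local Notation bx := (bx ch).
Local Notation pre := (opens_pre f).

Lemma bx_sub (V V' : opens Y) (O O' : opens R) : oset V `<=` oset V' -> oset O `<=` oset O' ->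
  oset (bx V O) `<=` oset (bx V' O').
Proof. exact: bxS. Qed.

Lemma bx_center V (a b r : R) y : oset V y -> a < r < b -> oset (bx V (oi a b)) (io y r).
Proof. by move=> Vy ab; apply/bx_io. Qed.

Lemma hge_closed (a : R) : closed (h @^-1` [set r | a <= r]).
Proof. by apply: preimage_closed; [move=> z _; exact: (ch_h ch)|exact: closed_ge]. Qed.
Lemma hle_closed (a : R) : closed (h @^-1` [set r | r <= a]).
Proof. by apply: preimage_closed; [move=> z _; exact: (ch_h ch)|exact: closed_le]. Qed.

(** The section is continued by 0 to the left of the midpoint of a and a', then extended by
    softness. Vanishing for h < a confines to the right of a any correction made with [t]. *)
Lemma soft_box (F : sheaf k X) (V : opens Y) (a b a' b' : R) y (s : sec F (bx V (oi a b))) :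
  soft F -> oset V y -> a < a' -> b' < b -> exists (V' : opens Y) (t : sec F opensT),
  [/\ oset V' y, oset V' `<=` oset V, rst (bx opensT (olt a)) t = 0 &
      rst (bx V' (oi a' b')) t = rst (bx V' (oi a' b')) s].
Proof.
move=> sF Vy aa bb; have [V1 [V1y V1V]] := regY Vy.
have fc : continuous f by move=> x; exact: cts_fun.
have V1V' := subset_trans (@subset_closure _ _) V1V.
pose a1 := (a + a') / 2.
pose A := bx V (oi a1 b); pose B := bx opensT (olt a1).
have AS : oset A `<=` oset (bx V (oi a b)).
  by apply: bx_sub => //; apply: oiS; rewrite // /a1; slra.
have [||||u [uA uB]] := @zero_extend _ _ F (opensU A B) A B (rst A s).
- by [].
- by move=> x; left.
- by move=> x; right.
- by apply: sec_empty => x [[_ /= /andP[h1 _]] [_ /= h2]]; slra.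
pose W := opensU (bx V1 (oi a' b')) (bx opensT (olt a)).
have cW : closure (oset W) `<=` oset (opensU A B).
  rewrite closureU => x [cx|cx].
    left; split.
      apply: V1V => N Nx; have fN : nbhs x (f @^-1` N) by apply: fc.
      by have [z [[V1z _] Nz]] := cx _ fN; exists (f z).
    have : closed (h @^-1` [set r | a' <= r]) by exact: hge_closed.
    move=> /(closure_sub_closed (A := oset (bx V1 (oi a' b')))) H1.
    have : closed (h @^-1` [set r | r <= b']) by exact: hle_closed.
    move=> /(closure_sub_closed (A := oset (bx V1 (oi a' b')))) H2.
    have /= h1 : a' <= h x by apply: H1 cx => z [_ /= /andP[/ltW]].
    have /= h2 : h x <= b' by apply: H2 cx => z [_ /= /andP[_ /ltW]].
    by rewrite /= /a1; apply/andP; split; slra.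
  right; split=> //=.
  have : closed (h @^-1` [set r | r <= a]) by exact: hle_closed.
  move=> /(closure_sub_closed (A := oset (bx opensT (olt a)))) H2.
  have /= h2 : h x <= a by apply: H2 cx => z [_ /= /ltW].
  by rewrite /a1; slra.
have [t tW] := sF _ W u cW.
have WU : oset W `<=` oset (opensU A B) by exact: subset_trans (@subset_closure _ _) cW.
exists V1, t; split=> //.
  have S : oset (bx opensT (olt a)) `<=` oset W by move=> x; right.
  rewrite (rst_eqS S _ _ tW)//; apply: (rst_eq0S _ _ uB); last by move=> x; right.
  by move=> x [_ /= ?]; split=> //=; rewrite /a1; slra.
have S : oset (bx V1 (oi a' b')) `<=` oset W by move=> x; left.
have S' : oset (bx V1 (oi a' b')) `<=` oset A.
  by apply: bx_sub => //; apply: oiS; rewrite /a1; slra.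
rewrite (rst_eqS S _ _ tW)// -(rst_rst u S'); last by move=> x; left.
by rewrite uA rst_rst.
Qed.

Lemma glue_bx (F : sheaf k X) (V : opens Y) (O O1 O2 O12 : opens R)
    (s : sec F (bx V O1)) (t : sec F (bx V O2)) :
  oset O `<=` oset O1 `|` oset O2 -> oset O1 `<=` oset O -> oset O2 `<=` oset O ->
  oset O1 `&` oset O2 `<=` oset O12 -> oset O12 `<=` oset O1 -> oset O12 `<=` oset O2 ->
  rst (bx V O12) s = rst (bx V O12) t ->
  exists u : sec F (bx V O), rst (bx V O1) u = s /\ rst (bx V O2) u = t.
Proof.
move=> cov S1 S2 S12 S3 S4 e; apply: sec_glue2.
- by move=> x [Vx /cov[Ox|Ox]]; [left|right].
- exact: bx_sub.
- exact: bx_sub.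
- apply: rst_eqS e; [|exact: bx_sub..].
  by move=> x [[Vx Ox] [_ O'x]]; split=> //; exact: S12.
Qed.

(** [interval_patch] for sections with a property Q. Two sections on overlapping boxes need not
    agree; the last hypothesis replaces the right one by a section that agrees with the left one on
    a strip in the overlap, and the two are cut and glued there. *)
Lemma section_patch (F : sheaf k X) (Q : forall U, set (sec F U)) y :
  (forall U W (s : sec F U), oset W `<=` oset U -> Q U s -> Q W (rst W s)) ->
  (forall U (s : sec F U), (forall x, oset U x ->
     exists W, [/\ oset W x, oset W `<=` oset U & Q W (rst W s)]) -> Q U s) ->
  (forall r : R, exists U (s : sec F U), oset U (io y r) /\ Q U s) ->
  (forall V (c d c' d' : R) (s : sec F (bx V (oi c d))) (s' : sec F (bx V (oi c' d'))),
    oset V y -> c <= c' -> c' < d -> d <= d' -> Q _ s -> Q _ s' ->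
    exists V2 e' e (s2 : sec F (bx V2 (oi c' d'))),
      [/\ oset V2 y, oset V2 `<=` oset V, [/\ c' <= e', e' < e & e <= d], Q _ s2 &
        rst (bx V2 (oi e' e)) s2 = rst (bx V2 (oi e' e)) s]) ->
  forall a b : R, a <= b -> exists V (s : sec F (bx V (oi a b))), oset V y /\ Q _ s.
Proof.
move=> Qr Ql loc corr a b ab.
pose P c d := exists V (s : sec F (bx V (oi c d))), oset V y /\ Q _ s.
apply: (@interval_patch _ P a b ab).
- move=> c d c' d' cc dd [V [s [Vy Qs]]].
  by exists V, (rst _ s); split=> //; apply: Qr Qs; apply: bx_sub => //; exact: oiS.
- move=> c d c' d' cc cd dd [V [s [Vy Qs]]] [V' [s' [V'y Qs']]].
  have O1 := @opensIl _ V V'; have O2 := @opensIr _ V V'.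
  have Oy : oset (opensI V V') y by split.
  have Qs1 := Qr _ (bx (opensI V V') (oi c d)) _ (bx_sub O1 (@subset_refl _ _)) Qs.
  have Qs2 := Qr _ (bx (opensI V V') (oi c' d')) _ (bx_sub O2 (@subset_refl _ _)) Qs'.
  have [V2 [e' [e [s2 [V2y V2V [ce ee ed] Q2 E]]]]] := corr _ _ _ _ _ _ _ Oy cc cd dd Qs1 Qs2.
  have T1 : oset (bx V2 (oi c e)) `<=` oset (bx (opensI V V') (oi c d)).
    by apply: bx_sub => //; exact: oiS.
  have T2 : oset (bx V2 (oi e' d')) `<=` oset (bx V2 (oi c' d')).
    by apply: bx_sub => //; exact: oiS.
  have E1 : oset (bx V2 (oi e' e)) `<=` oset (bx V2 (oi c e)).
    by apply: bx_sub => //; apply: oiS => //; slra.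
  have E2 : oset (bx V2 (oi e' e)) `<=` oset (bx V2 (oi e' d')).
    by apply: bx_sub => //; apply: oiS => //; slra.
  have [||||||| u [u1 u2]] := @glue_bx F V2 (oi c d') (oi c e) (oi e' d') (oi e' e)
      (rst _ (rst (bx (opensI V V') (oi c d)) s)) (rst _ s2).
  - move=> x /= /andP[h1 h2]; have [hx|hx] := ltP x e; [left|right] => /=; first by rewrite h1.
    by rewrite h2 andbT; slra.
  - by apply: oiS; slra.
  - by apply: oiS; slra.
  - by move=> x [/= /andP[_ h1] /andP[h2 _]]; rewrite h1 h2.
  - by apply: oiS; slra.
  - by apply: oiS; slra.
  - by rewrite [LHS]rst_rst// [RHS]rst_rst// E.
  exists V2, u; split=> //; apply: Ql => x [Vx Ox].
  have /andP[h1 h2] : c < h x < d' by exact: Ox.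
  have [hx|hx] := ltP (h x) e.
    exists (bx V2 (oi c e)); split; first by split=> //=; rewrite h1.
      by apply: bx_sub => //; apply: oiS; slra.
    by rewrite u1; exact: Qr Qs1.
  exists (bx V2 (oi e' d')); split; first by split=> //=; rewrite h2 andbT; slra.
    by apply: bx_sub => //; apply: oiS; slra.
  by rewrite u2; exact: Qr Q2.
- move=> r _; have [U [s [Ur Qs]]] := loc r.
  have [V [e [Vy e0 VU]]] := bx_nbhs ch Ur.
  by exists e => //; exists V, (rst _ s); split=> //; exact: Qr Qs.
Qed.

Variables (K : @cpx k X) (i : int) (E : lmodType k) (N : X -> set E).
Variable rep : forall U, E -> set (sec (ob K (i + 1 + 1)) U).
Hypothesis P : presentation N rep.
Hypothesis sK : forall n, soft (ob K n).

Definition locally_exact j U (s : sec (ob K (j + 1)) U) x :=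
  exists W b, [/\ oset W x, oset W `<=` oset U & rst W s = dif K j W b].

(** A primitive near one point is replaced by a global one [t] that vanishes for h < e, so that
    subtracting its coboundary changes nothing to the left. *)
Lemma soft_exact j U (s : sec (ob K (j + 1)) U) y r e e' V0 :
  oset U (io y r) -> locally_exact s (io y r) -> e < r < e' -> oset V0 y ->
  exists (V : opens Y) (eta : R) (t : sec (ob K j) opensT),
  [/\ oset V y, oset V `<=` oset V0, [/\ 0 < eta, e < r - eta & r + eta < e'],
    rst (bx opensT (olt e)) t = 0 &
    oset (bx V (oi (r - eta) (r + eta))) `<=` oset U /\
    rst (bx V (oi (r - eta) (r + eta))) s = rst (bx V (oi (r - eta) (r + eta))) (dif K j _ t)].
Proof.
move=> Ur [W [b [Wr WU sb]]] /andP[er re'] V0y.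
have [V [e1 [Vy e10 VW]]] := bx_nbhs ch Wr.
pose m := Num.min e1 (Num.min (r - e) (e' - r)).
have m0 : 0 < m by rewrite !lt_min e10; apply/andP; split; slra.
have m1 : m <= e1 by rewrite ge_min lexx.
have m2 : m <= r - e by rewrite !ge_min lexx orbT.
have m3 : m <= e' - r by rewrite !ge_min lexx !orbT.
pose V' := opensI V V0.
have VS : oset (bx V' (oi (r - m) (r + m))) `<=` oset W.
  by apply: subset_trans VW; apply: bx_sub; [exact: opensIl|apply: oiS; slra].
have V'y : oset V' y by split.
have am : r - m < r - m / 2 by slra.
have bm : r + m / 2 < r + m by slra.
have [V2 [t [V2y V2V t0 tb]]] := soft_box (rst (bx V' (oi (r - m) (r + m))) b) (@sK j) V'y am bm.
have S : oset (bx V2 (oi (r - m / 2) (r + m / 2))) `<=` oset (bx V' (oi (r - m) (r + m))).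
  by apply: bx_sub => //; apply: oiS; slra.
exists V2, (m / 2), t; split=> //.
- by apply: subset_trans V2V _; exact: opensIr.
- by split; slra.
- by apply: rst_eq0S t0 => //; apply: bx_sub => // x /=; slra.
split; first by apply: subset_trans WU; exact: subset_trans VS.
rewrite -(rst_rst s (subset_trans S VS) WU) sb -!mor_rst tb; congr (dif K j _ _).
by rewrite rst_rst.
Qed.

Lemma rep_match U U' v s s' y r e e' V0 : rep (U := U) v s -> rep (U := U') v s' ->
  oset U (io y r) -> oset U' (io y r) -> e < r < e' -> oset V0 y ->
  exists (V : opens Y) (eta : R) (t : sec (ob K (i + 1)) opensT), let B := bx V (oi (r - eta) (r + eta)) in
  [/\ oset V y, oset V `<=` oset V0, [/\ 0 < eta, e < r - eta & r + eta < e'],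
    oset B `<=` oset U /\ oset B `<=` oset U' &
    rst B s = rst B s' + rst B (dif K _ _ t)].
Proof.
move=> rs rs' Ur U'r er V0y.
have O1 := @opensIl _ U U'; have O2 := @opensIr _ U U'.
have Or : oset (opensI U U') (io y r) by split.
have rd : rep (v - v) (rst (opensI U U') s - rst _ s').
  by apply: (pr_B P); [exact: (pr_res P)|exact: (pr_res P)].
have le : locally_exact (rst (opensI U U') s - rst _ s') (io y r).
  by apply: (pr_ker P Or rd).1; rewrite subrr; exact: (pr_ker0 P).
have [V [eta [t [Vy VV0 [eta0 h1 h2] _ [BU tE]]]]] := soft_exact Or le er V0y.
exists V, eta, t => B; split=> //; first by split; exact: subset_trans BU _.
have tE' : rst B s - rst B s' = rst B (dif K _ _ t) by rewrite -tE rstB !rst_rst.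
by rewrite -tE' [RHS]addrC subrK.
Qed.

Lemma rep_extend y v a b : a <= b -> exists V (s : sec (ob K (i + 1 + 1)) (bx V (oi a b))),
  oset V y /\ rep v s.
Proof.
apply: (@section_patch _ (fun U s => rep (U := U) v s) y).
- by move=> U W s WU; exact: (pr_res P).
- by move=> U s; exact: (pr_loc P).
- by move=> r; exact: (pr_ex P).
move=> V c d c' d' s s' Vy cc cd dd rs rs'; pose r := (c' + d) / 2.
have hr : c' < r < d by rewrite /r; apply/andP; split; slra.
have [||V2 [eta [t [V2y V2V [eta0 h1 h2] [S1 S2] tE]]]] := rep_match rs rs' _ _ hr Vy.
- by apply: bx_center => //; slra.
- by apply: bx_center => //; slra.
exists V2, (r - eta), (r + eta), (rst _ s' + dif K _ _ (rst _ t)).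
have S : oset (bx V2 (oi c' d')) `<=` oset (bx V (oi c' d')) by exact: bx_sub.
split=> //; first by split; slra.
  by apply: (pr_d P); exact: (pr_res P).
have S3 : oset (bx V2 (oi (r - eta) (r + eta))) `<=` oset (bx V2 (oi c' d')).
  by apply: bx_sub => //; apply: oiS; slra.
by rewrite rstD mor_rst !rst_rst// tE.
Qed.

(** Outside the degree of the cohomology sheaf a cocycle is locally a coboundary and [soft_exact]
    applies; in that degree it represents some v near the point, and a representative of v over the
    long box is corrected by a coboundary to agree with it. *)
Lemma closed_correct j U (g : sec (ob K (j + 1)) U) y r e e' a b V0 :
  oset U (io y r) -> dif K _ _ g = 0 -> e < r < e' -> a < r < b -> oset V0 y ->
  exists (V : opens Y) (eta : R) (t : sec (ob K (j + 1)) (bx V (oi a b))),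
  let B := bx V (oi (r - eta) (r + eta)) in
  [/\ oset V y, oset V `<=` oset V0, [/\ 0 < eta, e < r - eta & r + eta < e'],
    [/\ oset B `<=` oset U, a < r - eta & r + eta < b] &
    dif K _ _ t = 0 /\ rst B t = rst B g].
Proof.
move=> Ur dg /andP[er re'] /andP[ar rb] V0y.
pose e1 := Num.max e a; pose e2 := Num.min e' b.
have he : e1 < r < e2 by rewrite gt_max er ar lt_min re' rb.
have e1e : e <= e1 by rewrite le_max lexx.
have e1a : a <= e1 by rewrite le_max lexx orbT.
have e2e : e2 <= e' by rewrite ge_min lexx.
have e2b : e2 <= b by rewrite ge_min lexx orbT.
have [ji|ji] := eqVneq j (i + 1); last first.
  have [W [c [Wr WU gc]]] := pr_exact P ji Ur dg.
  have le : locally_exact g (io y r) by exists W, c.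
  have [V [eta [t [Vy VV0 [eta0 h1 h2] _ [BU tE]]]]] := soft_exact Ur le he V0y.
  exists V, eta, (dif K _ _ (rst _ t)) => B.
  split=> //; [by split; slra|by split=> //; slra|split; first exact: dif2].
  have S : oset B `<=` oset (bx V (oi a b)) by apply: bx_sub => //; apply: oiS; slra.
  by rewrite tE mor_rst rst_rst.
subst j.
have [W [v [Wr WU rg]]] := pr_surj P Ur dg.
have [|V1 [s [V1y rs]]] := @rep_extend y v a b; first slra.
have hr : oset (bx V1 (oi a b)) (io y r) by apply: bx_center => //; slra.
have V01 : oset (opensI V0 V1) y by split.
have [V [eta [t [Vy VV0 [eta0 h1 h2] [S1 S2] tE]]]] := rep_match rg rs Wr hr he V01.
have VV1 : oset V `<=` oset V1 by move=> x /VV0[].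
have S3 : oset (bx V (oi a b)) `<=` oset (bx V1 (oi a b)) by exact: bx_sub.
exists V, eta, (rst _ s + dif K _ _ (rst _ t)) => B; split=> //.
- by move=> x /VV0[].
- by split; slra.
- by split; [exact: subset_trans S1 WU|slra..].
have S : oset B `<=` oset (bx V (oi a b)) by apply: bx_sub => //; apply: oiS; slra.
split; first by rewrite morD dif2 addr0 (pr_closed P (pr_res P S3 rs)).
by rewrite rstD mor_rst !rst_rst// -tE rst_rst.
Qed.

(** Two local primitives differ by a cocycle on the overlap; [closed_correct] extends this cocycle,
    up to a restriction, over the right box, and the right primitive is adjusted before gluing. *)
Lemma fiber_exact j V0 (al : sec (ob K (j + 1 + 1)) (pre V0)) y a b :
  oset V0 y -> dif K _ _ al = 0 -> (forall r, locally_exact al (io y r)) -> a <= b ->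
  exists V (be : sec (ob K (j + 1)) (bx V (oi a b))),
  [/\ oset V y, oset V `<=` oset V0 & dif K _ _ be = rst _ al].
Proof.
move=> V0y dal le ab.
pose Q U (s : sec (ob K (j + 1)) U) := oset U `<=` oset (pre V0) /\ dif K _ _ s = rst U al.
have [U W s WU [UV ds]|U s H|r|V c d c' d' s s' Vy cc cd dd [sV ds] [sV' ds']||V [be [Vy [VV0 dbe]]]] :=
    @section_patch (ob K (j + 1)) Q y _ _ _ _ a b => //.
- split; first exact: subset_trans UV.
  by rewrite mor_rst ds rst_rst.
- have UV : oset U `<=` oset (pre V0) by move=> x Ux; have [W [Wx _ [WV _]]] := H x Ux; exact: WV.
  split=> //; apply: sec_local_eq => x Ux; have [W [Wx WU [_ e]]] := H x Ux.
  by exists W; split; rewrite // -mor_rst e rst_rst.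
- by have [W [b' [Wr WV e]]] := le r; exists W, b'; split=> //; split.
- pose r := (c' + d) / 2.
  have hr : c' < r < d by rewrite /r; apply/andP; split; slra.
  have hr' : c' < r < d' by case/andP: hr => ? ?; slra.
  have S1 : oset (bx V (oi c' d)) `<=` oset (bx V (oi c d)) by apply: bx_sub => //; exact: oiS.
  have S2 : oset (bx V (oi c' d)) `<=` oset (bx V (oi c' d')) by apply: bx_sub => //; exact: oiS.
  have dg : dif K _ _ (rst (bx V (oi c' d)) s - rst _ s') = 0.
    by rewrite morB !mor_rst ds ds' !rst_rst// subrr.
  have [|V2 [eta [t [V2y V2V [eta0 h1 h2] [S _ _] [dt tE]]]]] :=
    closed_correct _ dg hr hr' Vy; first exact: bx_center.
  have S3 : oset (bx V2 (oi c' d')) `<=` oset (bx V (oi c' d')) by exact: bx_sub.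
  exists V2, (r - eta), (r + eta), (rst _ s' + t); split=> //.
  + by split; slra.
  + split; first exact: subset_trans sV'.
    by rewrite morD dt addr0 mor_rst ds' rst_rst.
  have S4 : oset (bx V2 (oi (r - eta) (r + eta))) `<=` oset (bx V2 (oi c' d')).
    by apply: bx_sub => //; apply: oiS; slra.
  by rewrite rstD tE rstB !rst_rst// [LHS]addrC subrK.
have O1 := @opensIl _ V V0; have O2 := @opensIr _ V V0.
have S : oset (bx (opensI V V0) (oi a b)) `<=` oset (bx V (oi a b)) by exact: bx_sub.
exists (opensI V V0), (rst _ be); split=> //.
by rewrite mor_rst dbe rst_rst.
Qed.

(** To the left of the support of [al] a primitive is a cocycle. A cocycle over the whole box that
    agrees with it near h = - M0 - 2 is subtracted, and the difference can be cut off to 0 there. *)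
Lemma left_primitive j V0 (al : sec (ob K (j + 1 + 1)) (pre V0)) y M0 M :
  oset V0 y -> dif K _ _ al = 0 -> (forall r, locally_exact al (io y r)) ->
  0 < M0 -> rst (bx V0 (oout M0)) al = 0 -> 0 < M ->
  exists V (be : sec (ob K (j + 1)) (bx V (olt M))) a',
  [/\ oset V y, oset V `<=` oset V0, rst (bx V (olt a')) be = 0, a' < M & dif K _ _ be = rst _ al].
Proof.
move=> V0y dal le M00 al0 M_0.
have [|V [b0 [Vy VV0 db0]]] := @fiber_exact _ _ _ _ (- M0 - 3) M V0y dal le; first slra.
have alz (V' : opens Y) (O : opens R) : oset V' `<=` oset V0 -> oset O `<=` oset (olt (- M0)) ->
    rst (bx V' O) al = 0.
  move=> V'V0 Oo; apply: rst_eq0S al0; last exact: bx_pre.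
  by apply: bx_sub => // x /Oo; left.
pose m := Num.min M (- M0).
have mM : m <= M by rewrite ge_min lexx.
have mM0 : m <= - M0 by rewrite ge_min lexx orbT.
have mE : - M0 <= m by rewrite le_min lexx andbT; slra.
have S1 : oset (bx V (oi (- M0 - 3) m)) `<=` oset (bx V (oi (- M0 - 3) M)).
  by apply: bx_sub => //; exact: oiS.
have dg : dif K _ _ (rst (bx V (oi (- M0 - 3) m)) b0) = 0.
  by rewrite mor_rst db0 rst_rst//; [apply: alz => // x /= /andP[_]; slra|exact: subset_trans (@bx_pre _ _ _ _ _ _ ch V _) (pre_sub VV0)].
have hr : - M0 - 3 < - M0 - 2 < - M0 by slra.
have hr' : - M0 - 3 < - M0 - 2 < M by slra.
have [|V2 [eta [t [V2y V2V [eta0 h1 h2] [S _ h3] [dt tE]]]]] :=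
  closed_correct _ dg hr hr' Vy; first by apply: bx_center => //; slra.
pose r := - M0 - 2.
have S2 : oset (bx V2 (oi (- M0 - 3) M)) `<=` oset (bx V (oi (- M0 - 3) M)) by exact: bx_sub.
have SA : oset (bx V2 (oi (r - eta) M)) `<=` oset (bx V2 (oi (- M0 - 3) M)).
  by apply: bx_sub => //; apply: oiS; rewrite /r; slra.
have V2V0 := subset_trans V2V VV0.
have pV2 (O : opens R) : oset (bx V2 O) `<=` oset (pre V0).
  exact: subset_trans (@bx_pre _ _ _ _ _ _ ch V2 _) (pre_sub V2V0).
have cov : oset (bx V2 (olt M)) `<=` oset (bx V2 (oi (r - eta) M)) `|` oset (bx V2 (olt (r + eta))).
  move=> x [Vx /= hx]; have [h4|h4] := ltP (r - eta) (h x); first by left; split=> //=; apply/andP; split.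
  by right; split=> //=; slra.
have A1 : oset (bx V2 (oi (r - eta) M)) `<=` oset (bx V2 (olt M)).
  by apply: bx_sub => // x /= /andP[].
have A2 : oset (bx V2 (olt (r + eta))) `<=` oset (bx V2 (olt M)).
  by apply: bx_sub => // x /=; rewrite /r; slra.
have [|u [u1 u2]] := @zero_extend _ _ _ _ _ _
    (rst (bx V2 (oi (r - eta) M)) (rst (bx V2 (oi (- M0 - 3) M)) b0 - t)) cov A1 A2.
  have S3 : oset (opensI (bx V2 (oi (r - eta) M)) (bx V2 (olt (r + eta)))) `<=`
      oset (bx V2 (oi (r - eta) (r + eta))).
    by move=> x [[Vx /= /andP[h4 _]] [_ /= h5]]; split=> //=; rewrite h4.
  have S4 : oset (bx V2 (oi (r - eta) (r + eta))) `<=` oset (bx V2 (oi (r - eta) M)).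
    by apply: bx_sub => //; apply: oiS; rewrite // /r; slra.
  have S5 := subset_trans S4 SA.
  apply: (rst_eq0S S3) => //; rewrite rst_rst// rstB rst_rst//.
  by rewrite tE rst_rst ?subrr.
exists V2, u, (r + eta); split=> //.
have bV : oset (bx V (oi (- M0 - 3) M)) `<=` oset (pre V0).
  exact: subset_trans (@bx_pre _ _ _ _ _ _ ch V _) (pre_sub VV0).
apply: (sec_eq2 cov) => //.
  have SA' := subset_trans SA S2.
  by rewrite -mor_rst u1 mor_rst morB dt subr0 mor_rst db0 !rst_rst.
rewrite -mor_rst u2 mor_0 rst_rst// alz// => x /=; rewrite /r; slra.
Qed.

(** To the right of the support of [al], [be] is a cocycle whose class is the obstruction to a
    primitive with proper support. Where it is locally exact it is killed by a coboundary [dif t]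
    with t = 0 for h < M0, and then continued by 0. *)
Lemma right_close j V0 V (al : sec (ob K (j + 1 + 1)) (pre V0)) y M0 M r a'
    (be : sec (ob K (j + 1)) (bx V (olt M))) :
  0 < M0 -> rst (bx V0 (oout M0)) al = 0 -> oset V y -> oset V `<=` oset V0 ->
  rst (bx V (olt a')) be = 0 -> a' < M -> dif K _ _ be = rst _ al -> M0 < r < M ->
  locally_exact be (io y r) ->
  exists V2 (be2 : sec (ob K (j + 1)) (pre V2)) M2,
  [/\ oset V2 y, oset V2 `<=` oset V0, rst (bx V2 (oout M2)) be2 = 0 &
     dif K _ _ be2 = rst _ al].
Proof.
move=> M00 al0 Vy VV0 be0 a'M dbe /[dup] hr /andP[hr1 hr2] le.
have Ur : oset (bx V (olt M)) (io y r) by apply/bx_io.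
have [V2 [eta [t [V2y V2V [eta0 h1 h2] t0 [S tE]]]]] := soft_exact Ur le hr Vy.
have V2V0 := subset_trans V2V VV0.
have SM : oset (bx V2 (olt M)) `<=` oset (bx V (olt M)) by exact: bx_sub.
have cov : oset (pre V2) `<=` oset (bx V2 (olt (r + eta))) `|` oset (bx V2 (ogt (r - eta))).
  by move=> x Vx; have [h4|h4] := ltP (h x) (r + eta); [left|right]; split=> //=; slra.
have A1 : oset (bx V2 (olt (r + eta))) `<=` oset (pre V2) by exact: bx_pre.
have A2 : oset (bx V2 (ogt (r - eta))) `<=` oset (pre V2) by exact: bx_pre.
have SB : oset (bx V2 (olt (r + eta))) `<=` oset (bx V2 (olt M)) by apply: bx_sub => // x /=; slra.
have SB' := subset_trans SB SM.
have [|u [u1 u2]] := @zero_extend _ _ _ _ _ _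
    (rst (bx V2 (olt (r + eta))) be - rst _ (dif K _ _ t)) cov A1 A2.
  have S3 : oset (opensI (bx V2 (olt (r + eta))) (bx V2 (ogt (r - eta)))) `<=`
      oset (bx V2 (oi (r - eta) (r + eta))).
    by move=> x [[Vx /= h4] [_ /= h5]]; split=> //=; rewrite h4 h5.
  have S4 : oset (bx V2 (oi (r - eta) (r + eta))) `<=` oset (bx V2 (olt (r + eta))).
    by apply: bx_sub => // x /= /andP[].
  by apply: (rst_eq0S S3) => //; rewrite rstB !rst_rst// tE subrr.
have pp : oset (pre V2) `<=` oset (pre V0) by exact: pre_sub.
(* Beyond this bound on the left both [be] (h < a') and [t] (h < M0) vanish; on the right h > r -
   eta, because r < M. *)
exists V2, u, (`|a'| + M + M0); split=> //.
  have ha := ler_norm a'; have ha' := ler_norm (- a'); rewrite normrN in ha'.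
  apply: sec_germ_eq => x [Vx Ox]; rewrite germ0 germ_rst//; last exact: bx_pre.
  case: Ox => /= Ox.
    have xB : oset (bx V2 (olt (r + eta))) x by split=> //=; slra.
    rewrite -(germ_rst u A1 xB) u1 germB !germ_rst//.
    have xT : oset (bx opensT (olt M0)) x by split=> //=; slra.
    rewrite -(germ_rst (dif K _ _ t) (V := bx opensT (olt M0)))// -mor_rst t0 mor_0 germ0 subr0.
    apply: (rst0_germ (W := bx V (olt a'))) be0; first by split; [exact: V2V|rewrite /=; slra].
    by apply: bx_sub => // z /=; slra.
  by apply: (rst0_germ (W := bx V2 (ogt (r - eta)))) => //; split=> //=; slra.
have alz : rst (bx V2 (ogt (r - eta))) al = 0.
  apply: rst_eq0S al0; last exact: bx_pre.
  by apply: bx_sub => // x /= hx; right => /=; slra.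
apply: (sec_eq2 cov) => //.
  by rewrite -mor_rst u1 morB !mor_rst dif2 rst0 subr0 dbe !rst_rst//; exact: (subset_trans (@bx_pre _ _ _ _ _ _ ch V _) (pre_sub VV0)).
by rewrite -mor_rst u2 mor_0 rst_rst// alz.
Qed.

End Push.

(** * Primitives with proper support *)

Section PushCommon.
Context {k : fieldType} {R : realType} {X Y : topologicalType}.
Variables (f : continuousType X Y) (h : X -> R) (io : Y -> R -> X).
Hypothesis ch : chart f h io.
Hypothesis regY : forall (V : opens Y) y, oset V y ->
  exists V' : opens Y, oset V' y /\ closure (oset V') `<=` oset V.
Local Notation bx := (bx ch).
Local Notation pre := (opens_pre f).
Variables (K : @cpx k X) (i : int) (E : lmodType k) (N : X -> set E).
Variable rep : forall U, E -> set (sec (ob K (i + 1 + 1)) U).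
Hypothesis P : presentation N rep.
Hypothesis sK : forall n, soft (ob K n).
Local Notation fK := (shriek_cpx f K).

(** [left_primitive], then [right_close]: the last hypothesis provides, arbitrarily far out, a place
    where the obstruction of [right_close] vanishes. *)
Lemma push_exact j V (al : sec (ob fK (j + 1 + 1)) V) y :
  oset V y -> dif fK _ _ al = 0 -> (forall r, locally_exact (spval al) (io y r)) ->
  (forall M0 : R, exists2 r, M0 < r & forall U (be : sec (ob K (j + 1)) U),
     oset U (io y r) -> dif K _ _ be = 0 -> locally_exact be (io y r)) ->
  exists W (be : sec (ob fK (j + 1)) W),
    [/\ oset W y, oset W `<=` oset V & rst W al = dif fK _ _ be].
Proof.
move=> Vy dal le re; have [W0 [M0 [W0y W0V M00 al0]]] := shriek_bounded_rst ch al Vy.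
have [r rM0 rex] := re M0.
have pW0 : oset (pre W0) `<=` oset (pre V) by exact: pre_sub.
pose al' := rst (pre W0) (spval al).
have dal' : dif K _ _ al' = 0.
  by rewrite mor_rst; have /= -> := congr1 (fun s => spval s) dal; rewrite rst0.
have al'0 : rst (bx W0 (oout M0)) al' = 0 by rewrite rst_rst//; exact: bx_pre.
have le' s : locally_exact al' (io y s).
  have [W [b [Wx WV e]]] := le s.
  have O1 := @opensIl _ W (pre W0); have O2 := @opensIr _ W (pre W0).
  exists (opensI W (pre W0)), (rst _ b); split=> //.
    by split=> //; rewrite /= /preimage /= (ch_fio ch).
  by rewrite mor_rst -e !rst_rst.
have r0 : 0 < r + 1 by slra.
have [V1 [be [a' [V1y V1W be0 a'r dbe]]]] := left_primitive regY P sK W0y dal' le' M00 al'0 r0.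
have hr : M0 < r < r + 1 by apply/andP; split; slra.
have beex : locally_exact be (io y r).
  have S : oset (bx V1 (oi M0 (r + 1))) `<=` oset (bx V1 (olt (r + 1))).
    by apply: bxS => // x /= /andP[].
  have [|| W [b [Wx WB e]]] := rex _ (rst (bx V1 (oi M0 (r + 1))) be).
  - by apply/bx_io.
  - rewrite mor_rst dbe rst_rst//; last exact: subset_trans (@bx_pre _ _ _ _ _ _ ch V1 _) (pre_sub V1W).
    apply: rst_eq0S al'0; last exact: bx_pre.
    by apply: bxS => // x /= /andP[? _]; right.
  exists W, b; split=> //; first exact: subset_trans WB S.
  by rewrite -e rst_rst.
have [V2 [be2 [M2 [V2y V2W be20 dbe2]]]] := right_close regY sK M00 al'0 V1y V1W be0 a'r dbe hr beex.
have bb : bounded_supp h be2.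
  apply: (rst_bounded (ch := ch)) => z V2z; exists V2, M2; split=> //.
exists V2, (mk_shriek ch bb); split=> //; first exact: subset_trans W0V.
apply: spval_inj; rewrite (shriek_rst al (subset_trans V2W W0V)).
by rewrite [RHS]dbe2 rst_rst//; exact: pre_sub.
Qed.

Lemma exact_at_pred (L : @cpx k Y) (Q : int -> Prop) :
  (forall j, Q (j + 1) -> exact_at L (j + 1)) -> forall j, Q j -> exact_at L j.
Proof. by move=> H j; rewrite -(subrK 1 j); exact: H. Qed.

Lemma io_pre W y r : oset W y -> oset (pre W) (io y r).
Proof. by move=> Wy; rewrite /= /preimage /= (ch_fio ch). Qed.

Lemma pr_class U (s : sec (ob K (i + 1 + 1)) U) y :
  (forall r, oset U (io y r)) -> dif K _ _ s = 0 ->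
  exists nu : R -> E, forall r, exists W,
    [/\ oset W (io y r), oset W `<=` oset U & rep (nu r) (rst W s)].
Proof.
move=> Uy ds; have H r : exists v, exists W,
    [/\ oset W (io y r), oset W `<=` oset U & rep v (rst W s)].
  by have [W [v [? ? ?]]] := pr_surj P (Uy r) ds; exists v, W.
by have [nu nuP] := choice H; exists nu.
Qed.

End PushCommon.

(* A family of vectors along the fibre over y that defines, modulo N, a section
   over that fibre of the quotient of the constant sheaf. *)
Definition compatible_family {k : fieldType} {R : realType} {X Y : topologicalType}
    {E : lmodType k} (io : Y -> R -> X) (N : X -> set E) (y : Y) (nu : R -> E) :=
  forall r, exists e v, 0 < e /\ forall r', `|r' - r| < e -> N (io y r') (nu r' - v).

(** * Direct image along a line when H^0_c of the fibres survives *)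

Section PushInterval.
Context {k : fieldType} {R : realType} {X Y : topologicalType}.
Variables (f : continuousType X Y) (h : X -> R) (io : Y -> R -> X).
Hypothesis ch : chart f h io.
Hypothesis regY : forall (V : opens Y) y, oset V y ->
  exists V' : opens Y, oset V' y /\ closure (oset V') `<=` oset V.
Local Notation bx := (bx ch).
Local Notation pre := (opens_pre f).
Variables (K : @cpx k X) (i : int) (E : lmodType k) (N : X -> set E).
Hypothesis sK : forall n, soft (ob K n).
Local Notation fK := (shriek_cpx f K).

Lemma pr_class_compat (rep : forall U, E -> set (sec (ob K (i + 1 + 1)) U))
    (P : presentation N rep) U (s : sec (ob K (i + 1 + 1)) U) y (nu : R -> E) :
  (forall r, exists W, [/\ oset W (io y r), oset W `<=` oset U & rep W (nu r) (rst W s)]) ->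
  compatible_family io N y nu.
Proof.
move=> H r; have [W [Wr WU rW]] := H r.
have [V [e [Vy e0 VW]]] := bx_nbhs ch Wr.
exists e, (nu r); split=> // r' hr'.
have [W' [W'r W'U rW']] := H r'.
have Wr' : oset W (io y r').
  by apply: VW; apply/bx_io; split=> //=; move: hr'; rewrite ltr_norml => /andP[? ?];
    apply/andP; split; slra.
have O1 := @opensIl _ W W'; have O2 := @opensIr _ W W'.
apply: (pr_eq P (U := opensI W W') (s := rst _ s)); first by split.
  by move: (pr_res P O2 rW'); rewrite rst_rst.
by move: (pr_res P O1 rW); rewrite rst_rst.
Qed.

Lemma pr_class_shift (rep : forall U, E -> set (sec (ob K (i + 1 + 1)) U))
    (P : presentation N rep) U (s : sec (ob K (i + 1 + 1)) U) x v w :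
  (exists W, [/\ oset W x, oset W `<=` oset U & rep W v (rst W s)]) -> N x (w - v) ->
  exists W, [/\ oset W x, oset W `<=` oset U & rep W w (rst W s)].
Proof.
move=> [W [Wx WU rW]] /(pr_ker_near P)[W' [W'x NW']].
have O1 := @opensIl _ W W'; have O2 := @opensIr _ W W'.
exists (opensI W W'); split=> //; first exact: subset_trans WU.
have := pr_res P O1 rW; rewrite rst_rst// => r'.
by apply: (pr_shift P r') => z [_ /NW'].
Qed.

Hypothesis Ninf : forall y, exists (V : opens Y) M, oset V y /\
  forall x, oset V (f x) -> M < `|h x| -> forall v, N x v.
Hypothesis Nfam : forall y nu, compatible_family io N y nu ->
  exists v, forall r, N (io y r) (nu r - v).
Variable N' : Y -> set E.
Hypothesis N'E : forall y v, N' y v <-> forall r, N (io y r) v.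

(** By [Nfam] a section of the quotient along a fibre comes from one vector, so H^0_c is E modulo
    the intersection of the kernels. H^1_c vanishes because by [Ninf] the quotient is 0 far out,
    which removes the obstruction of [right_close]; the same fact allows representatives to be cut
    off. *)
Lemma presented_push_interval : presented K i N -> presented fK i N'.
Proof.
move=> [rep P].
exists (fun V v (s : sec (ob fK (i + 1 + 1)) V) => rep (pre V) v (spval s)).
have lex_inf U v (s : sec (ob K (i + 1 + 1)) U) x : oset U x -> rep U v s ->
    N x v -> locally_exact s x.
  by move=> Ux rs Nx; exact: (pr_ker P Ux rs).1.
have Npos y : exists (V : opens Y) M, [/\ oset V y, 0 < M &
    forall x, oset V (f x) -> M < `|h x| -> forall v, N x v].
  have [V [M [Vy H]]] := Ninf y; exists V, (`|M| + 1); split=> //.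
    by have := normr_ge0 M; slra.
  by move=> x Vx Mx; apply: H => //; have := ler_norm M; slra.
split.
- apply: exact_at_pred => j ji V al y Vy dal.
  apply: (push_exact ch regY P sK Vy dal) => [r|M0].
    apply: (pr_exact P ji); first exact: (io_pre ch).
    exact: (congr1 (fun s => spval s) dal).
  have [V1 [M [V1y M_0 VM]]] := Npos y.
  have hM0 : M0 <= Num.max M0 M by rewrite le_max lexx.
  exists (Num.max M0 M + 1); first slra.
  move=> U be Ube dbe.
  (* Only for j = i + 1 is [be] in the degree of the cohomology sheaf; its class at r lies in N,
     which is everything so far out. *)
  have [ji'|ji'] := eqVneq j (i + 1); last exact: (pr_exact P ji').
  subst j; have [W [v [Wx WU rW]]] := pr_surj P Ube dbe.
  have [|W' [b [W'x W'W e]]] := lex_inf _ _ _ _ Wx rW.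
    apply: VM; first by rewrite (ch_fio ch).
    rewrite (ch_hio ch); have hM : M <= Num.max M0 M by rewrite le_max lexx orbT.
    by apply: lt_le_trans (ler_norm _); slra.
  exists W', b; split=> //; first exact: subset_trans WU.
  by rewrite -e rst_rst.
- by move=> U V v s VU rs; rewrite shriek_rst//; apply: (pr_res P) => //; exact: pre_sub.
- move=> U v s H; apply: (pr_loc P) => x Ux; have [W [Wx WU rW]] := H (f x) Ux.
  by exists (pre W); split=> //; [exact: pre_sub|rewrite -shriek_rst].
- by move=> U v s rs; apply: spval_inj; exact: (pr_closed P rs).
- by move=> U a v w s t rs rt; exact: (pr_lin P a rs rt).
- move=> y v; have [V0 [M [V0y M_0 VM]]] := Npos y.
  (* A representative over a box reaching beyond M on both sides is made 0 near h = - M - 1 and h =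
     M + 1, where every vector is in the kernel, and extended by 0. The second correction vanishes
     for h < M and so keeps the first. *)
  have [|V1 [s [V1y rs]]] := rep_extend ch regY P sK y v (a := - M - 2) (b := M + 2); first slra.
  have Ny r : M < `|r| -> forall v, N (io y r) v.
    by move=> Mr; apply: VM; rewrite ?(ch_fio ch) ?(ch_hio ch).
  have hr1 : - M - 2 < - M - 1 < - M by slra.
  have hr2 : M < M + 1 < M + 2 by slra.
  have Vy : oset (opensI V0 V1) y by split.
  have Ur1 : oset (bx V1 (oi (- M - 2) (M + 2))) (io y (- M - 1)) by apply: bx_center => //; slra.
  have [|V2 [eta1 [t1 [V2y V2V [eta10 h1 h2] _ [S1 tE1]]]]] :=
    soft_exact ch regY sK Ur1 (lex_inf _ _ _ _ Ur1 rs _) hr1 Vy.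
    by apply: Ny; rewrite -normrN; apply: lt_le_trans (ler_norm _); slra.
  have V2V1 : oset V2 `<=` oset V1 by move=> z /V2V[].
  have V2V0 : oset V2 `<=` oset V0 by move=> z /V2V[].
  have S2 : oset (bx V2 (oi (- M - 2) (M + 2))) `<=` oset (bx V1 (oi (- M - 2) (M + 2))) by exact: bxS.
  pose s1 := rst _ s - dif K _ _ (rst _ t1) : sec _ (bx V2 (oi (- M - 2) (M + 2))).
  have rs1 : rep _ v s1.
    by rewrite /s1 -mor_N; apply: (pr_d P); exact: (pr_res P).
  have Ur2 : oset (bx V2 (oi (- M - 2) (M + 2))) (io y (M + 1)) by apply: bx_center => //; slra.
  have [|V3 [eta2 [t2 [V3y V3V2 [eta20 h3 h4] t20 [S3 tE2]]]]] :=
    soft_exact ch regY sK Ur2 (lex_inf _ _ _ _ Ur2 rs1 _) hr2 V2y.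
    by apply: Ny; apply: lt_le_trans (ler_norm _); slra.
  pose lo := - M - 1 - eta1; pose hi := M + 1 + eta2.
  pose A := bx V3 (oi lo hi).
  have SA : oset A `<=` oset (bx V2 (oi (- M - 2) (M + 2))).
    by apply: bxS => //; apply: oiS; rewrite /lo /hi; slra.
  pose s2 := rst A s1 - rst A (dif K _ _ t2).
  have rs2 : rep A v s2 by rewrite /s2 -mor_rst -mor_N; apply: (pr_d P); exact: (pr_res P).
  pose B := bx V3 (opensU (olt (lo + eta1 + eta1)) (ogt (hi - eta2 - eta2))).
  have cov : oset (pre V3) `<=` oset A `|` oset B.
    move=> x Vx; have [hx|hx] := ltP (h x) (lo + eta1 + eta1); first by right; split=> //; left.
    have [hx'|hx'] := ltP (hi - eta2 - eta2) (h x); first by right; split=> //; right.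
    by left; split=> //=; rewrite /lo /hi in hx hx' *; apply/andP; split; slra.
  have [|||u [uA uB]] := @zero_extend _ _ _ _ _ _ s2 cov; [exact: bx_pre|exact: bx_pre| |].
    pose B1 := bx V3 (oi (- M - 1 - eta1) (- M - 1 + eta1)).
    pose B2 := bx V3 (oi (M + 1 - eta2) (M + 1 + eta2)).
    have T1 : oset B1 `<=` oset A.
      by apply: bxS => //; apply: oiS; rewrite /lo /hi; slra.
    have T2 : oset B2 `<=` oset A.
      by apply: bxS => //; apply: oiS; rewrite /lo /hi; slra.
    have Z1 : rst B1 s2 = 0.
      rewrite rstB !rst_rst// (rst_eq0S (A := bx opensT (olt M)) (s := dif K _ _ t2)) ?subr0//.
      + have T3 : oset B1 `<=` oset (bx V2 (oi (- M - 1 - eta1) (- M - 1 + eta1))) by exact: bxS.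
        rewrite rstB mor_rst !rst_rst//; last exact: subset_trans T1 SA.
          by rewrite (rst_eqS T3 S1 _ tE1)// subrr.
        exact: subset_trans T1 SA.
      + by apply: bxS => // x /= /andP[_ ?]; slra.
      + by rewrite -mor_rst t20 mor_0.
    have Z2 : rst B2 s2 = 0.
      by rewrite rstB !rst_rst// tE2 subrr.
    have Z (W : opens X) : oset W `<=` oset A -> oset W `<=` oset B1 `|` oset B2 ->
        rst W s2 = 0.
      move=> WA cW; apply: sec_local_eq => x Wx.
      have [Bx|Bx] := cW x Wx.
        exists (opensI W B1); split=> //; first exact: opensIl.
        rewrite rst0 rst_rst//; last exact: opensIl.
        by apply: (rst_eq0S _ T1 Z1); exact: opensIr.
      exists (opensI W B2); split=> //; first exact: opensIl.
      rewrite rst0 rst_rst//; last exact: opensIl.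
      by apply: (rst_eq0S _ T2 Z2); exact: opensIr.
    apply: Z; first exact: opensIl.
    move=> x [[Vx /= /andP[g1 g2]] [_ [/= g3|/= g3]]]; [left|right]; split=> //=.
      by move: g1 g3; rewrite /lo => g1 g3; apply/andP; split; slra.
    by move: g2 g3; rewrite /hi => g2 g3; apply/andP; split; slra.
  have BS : oset B `<=` oset (pre V3) by exact: bx_pre.
  have bu : bounded_supp h u.
    apply: (rst_bounded (ch := ch)) => z V3z; exists V3, (M + 2); split=> //.
    apply: rst_eq0S uB => //; apply: bxS => // x [/= hx|/= hx]; [left|right] => /=.
      by rewrite /lo; slra.
    by rewrite /hi; slra.
  exists V3, (mk_shriek ch bu); split=> //=.
  apply: (pr_loc P) => x Vx; have [Ax|Bx] := cov x Vx.
    by exists A; rewrite uA; split=> //; exact: bx_pre.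
  exists B; rewrite uB; split=> //; apply: (pr_zero P) => z [Vz Oz].
  apply: VM; first by apply: V2V0; exact: V3V2.
  case: Oz => /= Oz.
    by rewrite -normrN; apply: lt_le_trans (ler_norm _); move: Oz; rewrite /lo; slra.
  by apply: lt_le_trans (ler_norm _); move: Oz; rewrite /hi; slra.
- move=> U s y Uy ds; have [W0 [M0 [W0y W0U M00 s0]]] := shriek_bounded_rst ch s Uy.
  have [V0 [M [V0y M_0 VM]]] := Npos y.
  have ds' : dif K _ _ (spval s) = 0 by exact: (congr1 (fun s => spval s) ds).
  have [nu nuP] := pr_class P (fun r => io_pre ch r Uy) ds'.
  (* The same v serves along the whole fibre, hence over a tube |h| < M1 + 1; where |h| > M1 the
     section is 0 and every vector is in the kernel, so 0 represents v. *)
  have [v vP] := Nfam (pr_class_compat P nuP).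
  have vrep r : exists W, [/\ oset W (io y r), oset W `<=` oset (pre U) &
      rep W v (rst W (spval s))].
    by apply: (pr_class_shift P (nuP r)); rewrite -opprB; exact: (pr_kerN P).
  pose Q : set X := [set x | exists W, [/\ oset W x, oset W `<=` oset (pre U) &
    rep W v (rst W (spval s))]].
  have oQ : open Q.
    rewrite openE => x [W [Wx WU rW]].
    by apply: filterS (open_nbhs_nbhs (conj (osetP W) Wx)) => z Wz; exists W.
  pose M1 := Num.max M0 M.
  have hM0 : M0 <= M1 by rewrite le_max lexx.
  have hM : M <= M1 by rewrite le_max lexx orbT.
  have [||V1 [V1y V1Q]] := @bx_tube _ _ _ _ _ _ ch (Opens oQ) y (- (M1 + 1)) (M1 + 1); first slra.
    by move=> r _; exact: vrep.
  pose V := opensI W0 (opensI V0 V1).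
  have VW0 : oset V `<=` oset W0 by move=> z [].
  have VU := subset_trans VW0 W0U.
  exists V, v; split=> //; rewrite shriek_rst//; apply: (pr_loc P) => x [Wx [V0x V1x]].
  have [hx|hx] := ltP `|h x| (M1 + 1).
    have [|W [W'x W'U rW]] := V1Q x; first by split=> //=; rewrite -ltr_norml.
    have O1 := @opensIl _ W (pre V); have O2 := @opensIr _ W (pre V).
    exists (opensI W (pre V)); split=> //.
    rewrite rst_rst//; last exact: pre_sub.
    by move: (pr_res P O1 rW); rewrite rst_rst.
  have S : oset (bx V (oout M1)) `<=` oset (pre V) by exact: bx_pre.
  exists (bx V (oout M1)); split=> //.
    split=> //=; have [h0|h0] := leP 0 (h x); [right|left] => /=.
      by rewrite ger0_norm// in hx; slra.
    by rewrite ltr0_norm// in hx; slra.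
  rewrite rst_rst//; last exact: pre_sub.
  rewrite (rst_eq0S _ _ s0); last exact: subset_trans (@bx_pre _ _ _ _ _ _ ch W0 _) (pre_sub W0U).
    apply: (pr_zero P) => z [[_ [V0z _]] Oz]; apply: VM => //.
    case: Oz => /= Oz; last by apply: lt_le_trans (ler_norm _); slra.
    by rewrite -normrN; apply: lt_le_trans (ler_norm _); slra.
  by apply: bxS => // r [/= hr|/= hr]; [left|right] => /=; slra.
- move=> U v s y Uy rs; rewrite N'E; split=> [Nv|[W [b [Wy WU e]]] r].
    apply: (push_exact ch regY P sK Uy) => [|r|M0].
    + by apply: spval_inj; exact: (pr_closed P rs).
    + exact: lex_inf (io_pre ch r Uy) rs (Nv r).
    exists (M0 + 1); first slra.
    by move=> U' be Ur dbe; apply: (pr_exact P) Ur dbe; apply/eqP; lia.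
  apply/(pr_ker P (io_pre ch r Uy) rs); exists (pre W), (spval b); split=> //.
  + exact: (io_pre ch).
  + exact: pre_sub.
  by rewrite -shriek_rst// e.
- by move=> U v s b rs; exact: (pr_d P (spval b) rs).
Qed.
End PushInterval.

(** * Direct image along a line when H^1_c of the fibres survives *)

Section PushLine.
Context {k : fieldType} {R : realType} {X Y : topologicalType}.
Variables (f : continuousType X Y) (h : X -> R) (io : Y -> R -> X).
Hypothesis ch : chart f h io.
Hypothesis regY : forall (V : opens Y) y, oset V y ->
  exists V' : opens Y, oset V' y /\ closure (oset V') `<=` oset V.
Local Notation bx := (bx ch).
Local Notation pre := (opens_pre f).
Variables (K : @cpx k X) (i : int) (E : lmodType k) (N : X -> set E).
Hypothesis sK : forall n, soft (ob K n).
Local Notation fK := (shriek_cpx f K).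
Variable rep : forall U : opens X, E -> set (sec (ob K (i + 1 + 1)) U).
Hypothesis P : presentation N rep.
Arguments rep : clear implicits.

(* al has, over h < b and near the fibre of y, a primitive that vanishes far to
   the left and represents v to the right of b'; the class of al in
   H^1_c of the fibre is then the image of v. *)
Definition line_primitive V (al : sec (ob K (i + 1 + 1 + 1)) (pre V)) y v b W b' a'
    (be : sec (ob K (i + 1 + 1)) (bx W (olt b))) :=
  [/\ oset W y /\ oset W `<=` oset V, a' < b /\ b' < b, rst (bx W (olt a')) be = 0,
    dif K _ _ be = rst _ al & rep (bx W (oi b' b)) v (rst _ be)].

Definition has_primitive V al y v b := exists W b' a' be, @line_primitive V al y v b W b' a' be.

Lemma oi_olt (a b c : R) : b <= c -> oset (oi a b) `<=` oset (olt c).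
Proof. by move=> bc x /= /andP[_ ?]; lra. Qed.
Lemma olt_le (a b : R) : a <= b -> oset (olt a) `<=` oset (olt b).
Proof. by move=> ab x /= ?; lra. Qed.
Lemma ogt_le (a b : R) : b <= a -> oset (ogt a) `<=` oset (ogt b).
Proof. by move=> ab x /= ?; lra. Qed.

Lemma line_primitive_shrink V al y v b W b' a' be W2 a2 b2 :
  @line_primitive V al y v b W b' a' be -> oset W2 y -> oset W2 `<=` oset W ->
  a2 <= a' -> b' <= b2 -> b2 < b ->
  line_primitive al y v b2 a2 (rst (bx W2 (olt b)) be).
Proof.
move=> [[Wy WV] [ab bb] be0 dbe rb] W2y W2W aa b2b b2b'.
have S : oset (bx W2 (olt b)) `<=` oset (bx W (olt b)) by exact: bxS.
have S1 : oset (bx W2 (oi b2 b)) `<=` oset (bx W (oi b' b)) by apply: bxS => //; exact: oiS.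
have S2 : oset (bx W2 (oi b2 b)) `<=` oset (bx W2 (olt b)) by apply: bxS => //; exact: oi_olt.
have S3 : oset (bx W (oi b' b)) `<=` oset (bx W (olt b)) by apply: bxS => //; exact: oi_olt.
have S4 : oset (bx W2 (olt a2)) `<=` oset (bx W (olt a')) by apply: bxS => //; exact: olt_le.
have S5 : oset (bx W2 (olt a2)) `<=` oset (bx W2 (olt b)) by apply: bxS => //; apply: olt_le; lra.
have S6 : oset (bx W (olt a')) `<=` oset (bx W (olt b)) by apply: bxS => //; apply: olt_le; lra.
have S7 : oset (bx W (olt b)) `<=` oset (pre V).
  exact: subset_trans (@bx_pre _ _ _ _ _ _ ch W _) (pre_sub WV).
split=> //.
- by split=> //; exact: subset_trans WV.
- by split=> //; lra.
- by rewrite rst_rst//; exact: (rst_eq0S S4).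
- by rewrite mor_rst dbe rst_rst.
- by have := pr_res P S1 rb; rewrite !rst_rst.
Qed.

Lemma has_primitive_rst V V' al y v b : @has_primitive V al y v b -> oset V' y ->
  oset V' `<=` oset V -> has_primitive (rst (pre V') al) y v b.
Proof.
move=> [W [b' [a' [be H]]]] V'y V'V; have O1 := @opensIl _ W V'; have O2 := @opensIr _ W V'.
have [[Wy WV] [ab bb] be0 dbe rb] := H.
have Oy : oset (opensI W V') y by split.
have [_ ? ? d' ?] := line_primitive_shrink H Oy O1 (lexx _) (lexx _) bb.
exists (opensI W V'), b', a', (rst _ be); split=> //.
rewrite d' rst_rst//; last exact: pre_sub.
exact: subset_trans (@bx_pre _ _ _ _ _ _ ch _ _) (pre_sub O2).
Qed.

Lemma has_primitive_loc V V' al y v b : oset V' `<=` oset V ->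
  has_primitive (rst (pre V') al) y v b -> @has_primitive V al y v b.
Proof.
move=> V'V [W [b' [a' [be [[Wy WV] ? ? dbe ?]]]]]; exists W, b', a', be; split=> //.
  by split=> //; exact: subset_trans WV _.
rewrite dbe rst_rst//; last exact: pre_sub.
exact: subset_trans (@bx_pre _ _ _ _ _ _ ch _ _) (pre_sub WV).
Qed.

Lemma has_primitive_lin V al al2 y c v w b : @has_primitive V al y v b ->
  has_primitive al2 y w b -> has_primitive (c *: al + al2) y (c *: v + w) b.
Proof.
move=> [W [b1 [a1 [be H1]]]] [W' [b2 [a2 [be' H2]]]].
have [[Wy WV] [ab1 bb1] _ _ _] := H1; have [[W'y WV'] [ab2 bb2] _ _ _] := H2.
have O1 := @opensIl _ W W'; have O2 := @opensIr _ W W'.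
have Oy : oset (opensI W W') y by split.
pose a3 := Num.min a1 a2; pose b3 := Num.max b1 b2.
have a31 : a3 <= a1 by rewrite ge_min lexx.
have a32 : a3 <= a2 by rewrite ge_min lexx orbT.
have b31 : b1 <= b3 by rewrite le_max lexx.
have b32 : b2 <= b3 by rewrite le_max lexx orbT.
have b3b : b3 < b by rewrite gt_max bb1 bb2.
have [? ? be0 dbe rb] := line_primitive_shrink H1 Oy O1 a31 b31 b3b.
have [_ _ be0' dbe' rb'] := line_primitive_shrink H2 Oy O2 a32 b32 b3b.
exists (opensI W W'), b3, a3, (c *: rst _ be + rst _ be'); split=> //.
- by rewrite rstD rstZ be0 be0' scaler0 addr0.
- by rewrite mor_lin dbe dbe' rstD rstZ.
- by rewrite rstD rstZ; exact: (pr_lin P).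
Qed.

(** Right of b' the primitive is a cocycle representing v, so a representative of v over a longer
    box, corrected by a coboundary, continues it up to any b. *)
Lemma line_primitive_extend V al y v b1 W b' a' be b :
  @line_primitive V al y v b1 W b' a' be -> rst (bx W (ogt b')) al = 0 ->
  b1 <= b -> has_primitive al y v b.
Proof.
move=> [[Wy WV] [ab bb] be0 dbe rb] al0 b1b; pose r := (b' + b1) / 2.
have [|V1 [s [V1y rs]]] := rep_extend ch regY P sK y v (a := b') (b := b); first by lra.
have hr : b' < r < b1 by rewrite /r; apply/andP; split; lra.
have hr' : b' < r < b by case/andP: hr => ? ?; apply/andP; split; lra.
have V0y : oset (opensI W V1) y by split.
have [V2 [eta [t [V2y V2V [eta0 h1 h2] [S1 S2] tE]]]] := rep_match ch regY P sK
  rb rs (bx_center ch Wy hr) (bx_center ch V1y hr') hr V0y.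
have V2W : oset V2 `<=` oset W by move=> z /V2V[].
have V21 : oset V2 `<=` oset V1 by move=> z /V2V[].
have S3 : oset (bx V2 (oi b' b)) `<=` oset (bx V1 (oi b' b)) by exact: bxS.
pose s2 := rst (bx V2 (oi b' b)) s + dif K _ _ (rst _ t).
have rs2 : rep _ v s2 by apply: (pr_d P); exact: (pr_res P).
have S4 : oset (bx V2 (olt (r + eta))) `<=` oset (bx W (olt b1)).
  by apply: bxS => //; apply: olt_le; lra.
have S5 : oset (bx V2 (oi (r - eta) b)) `<=` oset (bx V2 (oi b' b)).
  by apply: bxS => //; apply: oiS => //; lra.
pose B := bx V2 (oi (r - eta) (r + eta)).
have S6 : oset B `<=` oset (bx V2 (oi (r - eta) b)).
  by apply: bxS => //; apply: oiS => //; lra.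
have S7 : oset B `<=` oset (bx V2 (olt (r + eta))) by apply: bxS => //; exact: oi_olt.
have S8 : oset (bx W (oi b' b1)) `<=` oset (bx W (olt b1)) by apply: bxS => //; exact: oi_olt.
have cO : oset (olt b) `<=` oset (olt (r + eta)) `|` oset (oi (r - eta) b).
  move=> x /= xb; have [hx|hx] := ltP x (r + eta); [by left|right => /=].
  by rewrite xb andbT; slra.
have S9 : oset (bx V2 (oi (r - eta) b)) `<=` oset (bx V2 (olt b)).
  by apply: bxS => //; exact: oi_olt.
have S10 : oset (bx V2 (olt (r + eta))) `<=` oset (bx V2 (olt b)).
  by apply: bxS => //; apply: olt_le; slra.
have [|||||| u [u1 u2]] := @glue_bx _ _ _ _ _ _ _ ch _ V2 (olt b) (olt (r + eta)) (oi (r - eta) b)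
    (oi (r - eta) (r + eta)) (rst _ be) (rst _ s2) cO.
- by apply: olt_le; slra.
- exact: oi_olt.
- by move=> x [/= g1 /andP[g2 _]]; rewrite g1 g2.
- exact: oi_olt.
- by apply: oiS => //; slra.
- rewrite !rst_rst//; move: tE; rewrite -/B /s2 rst_rst// => ->.
  by rewrite rstD mor_rst !rst_rst//; exact: subset_trans S6 S5.
pose a2 := Num.min a' (r - eta).
have a2a : a2 <= a' by rewrite ge_min lexx.
have a2r : a2 <= r - eta by rewrite ge_min lexx orbT.
have covX : oset (bx V2 (olt b)) `<=`
    oset (bx V2 (olt (r + eta))) `|` oset (bx V2 (oi (r - eta) b)).
  by move=> x [Vx /cO[]]; [left|right].
have V2V0 := subset_trans V2W WV.
have Spre (O : opens R) : oset (bx V2 O) `<=` oset (pre V).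
  exact: subset_trans (@bx_pre _ _ _ _ _ _ ch _ _) (pre_sub V2V0).
have SpreW (O : opens R) : oset (bx W O) `<=` oset (pre V).
  exact: subset_trans (@bx_pre _ _ _ _ _ _ ch _ _) (pre_sub WV).
exists V2, b', a2, u; split.
- by split.
- by split; slra.
- have T1 : oset (bx V2 (olt a2)) `<=` oset (bx V2 (olt (r + eta))).
    by apply: bxS => //; apply: olt_le; slra.
  rewrite -(rst_rst u T1 S10) u1 rst_rst//; apply: (rst_eq0S _ _ be0).
    by apply: bxS => //; exact: olt_le.
  by apply: bxS => //; apply: olt_le; exact: ltW.
- apply: (sec_eq2 covX) => //.
    by rewrite -mor_rst u1 mor_rst dbe !rst_rst.
  rewrite -mor_rst u2 mor_rst (pr_closed P rs2) rst0 rst_rst//.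
  apply/esym/(rst_eq0S _ _ al0) => //; apply: bxS => // x /= /andP[? _]; slra.
- apply: (pr_loc P) => x [Vx Ox]; have /= /andP[g1 g2] := Ox.
  have [hx|hx] := ltP (h x) (r + eta).
    have T1 : oset (bx V2 (oi b' (r + eta))) `<=` oset (bx V2 (oi b' b)).
      by apply: bxS => //; apply: oiS => //; slra.
    have T2 : oset (bx V2 (oi b' (r + eta))) `<=` oset (bx V2 (olt (r + eta))).
      by apply: bxS => //; exact: oi_olt.
    have T3 : oset (bx V2 (oi b' (r + eta))) `<=` oset (bx W (oi b' b1)).
      by apply: bxS => //; apply: oiS => //; slra.
    have T4 : oset (bx V2 (oi b' b)) `<=` oset (bx V2 (olt b)) by apply: bxS => //; exact: oi_olt.
    exists (bx V2 (oi b' (r + eta))); split=> //; first by split=> //=; rewrite g1.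
    rewrite rst_rst// -(rst_rst u T2 S10) u1 rst_rst//.
    by move: (pr_res P T3 rb); rewrite rst_rst.
  have T4 : oset (bx V2 (oi b' b)) `<=` oset (bx V2 (olt b)) by apply: bxS => //; exact: oi_olt.
  exists (bx V2 (oi (r - eta) b)); split=> //; first by split=> //=; rewrite g2 andbT; slra.
  by rewrite rst_rst// u2; exact: (pr_res P).
Qed.

(** Asking for primitives over h < b for all large b, and not for one b, lets two cocycles be
    compared over the same half line and lets b exceed the bounds of given supports. *)
Definition line_rep V v (al : sec (ob fK (i + 1 + 1 + 1)) V) :=
  dif fK _ _ al = 0 /\ forall y, oset V y -> exists b0, forall b, b0 < b ->
    has_primitive (spval al) y v b.

Lemma line_repI V v al : dif fK _ V al = 0 ->
  (forall y, oset V y -> exists b W b' a' be,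
     @line_primitive V (spval al) y v b W b' a' be /\ rst (bx W (ogt b')) (spval al) = 0) ->
  line_rep v al.
Proof.
move=> dal H; split=> // y Vy; have [b1 [W [b' [a' [be [Hb al0]]]]]] := H y Vy.
by exists b1 => b b1b; exact: (line_primitive_extend Hb al0 (ltW b1b)).
Qed.

Lemma line_rep_res U V v al : oset V `<=` oset U -> @line_rep U v al -> line_rep v (rst V al).
Proof.
move=> VU [dal H]; split; first by rewrite mor_rst dal rst0.
move=> y Vy; have [b0 Hb] := H y (VU _ Vy); exists b0 => b /Hb Hp.
by rewrite shriek_rst//; exact: has_primitive_rst Hp Vy VU.
Qed.

Lemma line_rep_loc U v al : (forall y, oset U y -> exists W,
    [/\ oset W y, oset W `<=` oset U & line_rep v (rst W al)]) -> @line_rep U v al.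
Proof.
move=> H; split.
  apply: sec_local_eq => y Uy; have [W [Wy WU [d _]]] := H y Uy.
  by exists W; split=> //; rewrite -mor_rst d rst0.
move=> y Uy; have [W [Wy WU [_ /(_ y Wy)[b0 Hb]]]] := H y Uy.
exists b0 => b /Hb; rewrite shriek_rst//; exact: has_primitive_loc.
Qed.

Lemma line_rep_lin U c v w al al' : @line_rep U v al -> line_rep w al' ->
  line_rep (c *: v + w) (c *: al + al').
Proof.
move=> [d H] [d' H']; split; first by rewrite mor_lin d d' scaler0 addr0.
move=> y Uy; have [b0 Hb] := H y Uy; have [b0' Hb'] := H' y Uy.
exists (Num.max b0 b0') => b; rewrite gt_max => /andP[/Hb h1 /Hb' h2].
exact: has_primitive_lin h1 h2.
Qed.

(** The connecting map of the fibre: a representative of v is cut off to 0 for h < -1, and [al] is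
    its coboundary, supported where -1 <= h <= -1/2, with the cut-off representative as
    primitive. *)
Lemma line_rep_ex y v : exists V al, oset V y /\ @line_rep V v al.
Proof.
have [|V1 [s [V1y rs]]] := rep_extend ch regY P sK y v (a := -1) (b := 1); first by lra.
have h1 : (-1 : R) < - (1 / 2) by lra.
have h2 : ((1 / 2) : R) < 1 by lra.
have [V2 [t [V2y V2V t0 tE]]] := soft_box regY s (@sK (i + 1 + 1)) V1y h1 h2.
have S0 : oset (bx V2 (oi (- (1 / 2)) (1 / 2))) `<=` oset (bx V1 (oi (-1) 1)).
  by apply: bxS => //; apply: oiS; lra.
pose A := bx V2 (olt (1 / 2)); pose B := bx V2 (ogt (- (1 / 2))).
have cov : oset (pre V2) `<=` oset A `|` oset B.
  by move=> x Vx; have [hx|hx] := ltP (h x) (1 / 2); [left|right]; split=> //=; slra.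
have AS : oset A `<=` oset (pre V2) by exact: bx_pre.
have BS : oset B `<=` oset (pre V2) by exact: bx_pre.
have rtE : rep (bx V2 (oi (- (1 / 2)) (1 / 2))) v (rst _ t) by rewrite tE; exact: (pr_res P).
have [|al [alA alB]] := @zero_extend _ _ _ _ _ _ (rst A (dif K _ _ t)) cov AS BS.
  have S1 : oset (opensI A B) `<=` oset (bx V2 (oi (- (1 / 2)) (1 / 2))).
    by move=> x [[Vx /= g1] [_ /= g2]]; split=> //=; rewrite g1 g2.
  have S2 : oset (bx V2 (oi (- (1 / 2)) (1 / 2))) `<=` oset A.
    by apply: bxS => //; exact: oi_olt.
  apply: (rst_eq0S S1) => //; rewrite rst_rst// -mor_rst.
  exact: (pr_closed P rtE).
have bal : bounded_supp h al.
  apply: (rst_bounded (ch := ch)) => z V2z; exists V2, 1; split=> //.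
  have S1 : oset (bx V2 (olt (-1))) `<=` oset A by apply: bxS => //; apply: olt_le; lra.
  have S2 : oset (bx V2 (ogt 1)) `<=` oset B by apply: bxS => //; apply: ogt_le; lra.
  have e1 : rst (bx V2 (olt (-1))) al = 0.
    rewrite -(rst_rst al S1 AS) alA rst_rst// -mor_rst.
    by rewrite (rst_eq0S _ _ t0) ?mor_0//; exact: bxS.
  have e2 : rst (bx V2 (ogt 1)) al = 0 by exact: (rst_eq0S S2 BS).
  apply: (@sec_eq2 _ _ _ _ (bx V2 (olt (-1))) (bx V2 (ogt 1))).
  - by move=> x [Vx [?|?]]; [left|right].
  - by apply: bxS => // x; left.
  - by apply: bxS => // x; right.
  - by rewrite rst0 rst_rst// ?e1//; [apply: bxS => // x; left|exact: bx_pre].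
  - by rewrite rst0 rst_rst// ?e2//; [apply: bxS => // x; right|exact: bx_pre].
exists V2, (mk_shriek ch bal); split=> //; apply: line_repI.
  apply: spval_inj => /=; apply: (sec_eq2 cov) => //.
    by rewrite -mor_rst alA mor_rst dif2 rst0 rst0.
  by rewrite -mor_rst alB mor_0 rst0.
move=> z V2z; exists (1 / 2), V2, (- (1 / 2)), (-1), (rst _ t); split=> //; split=> //=; first by split.
- by split; lra.
- by rewrite rst_rst//; [apply: (rst_eq0S _ _ t0) => //; exact: bxS|apply: bxS => //; apply: olt_le; lra].
- by rewrite mor_rst alA.
- by rewrite rst_rst//; apply: bxS => //; exact: oi_olt.
Qed.

(** v is the class, right of the support of [al], of a primitive that vanishes far to the left. *)
Lemma line_rep_surj U al y : oset U y -> dif fK (i + 1 + 1 + 1) U al = 0 ->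
  exists W v, [/\ oset W y, oset W `<=` oset U & line_rep v (rst W al)].
Proof.
move=> Uy dal; have [W0 [M0 [W0y W0U M00 al0]]] := shriek_bounded_rst ch al Uy.
have pW0 : oset (pre W0) `<=` oset (pre U) by exact: pre_sub.
have dal0 : dif K _ _ (spval al) = 0 by exact: (congr1 (fun s => spval s) dal).
pose al' := rst (pre W0) (spval al).
have dal' : dif K _ _ al' = 0 by rewrite mor_rst dal0 rst0.
have al'0 : rst (bx W0 (oout M0)) al' = 0 by rewrite rst_rst//; exact: bx_pre.
have le s : locally_exact al' (io y s).
  apply: (pr_exact P) dal'; first by apply/eqP; lia.
  exact: (io_pre ch).
have r0 : 0 < M0 + 2 by lra.
have [V1 [be [a' [V1y V1W be0 a'r dbe]]]] := left_primitive regY P sK W0y dal' le M00 al'0 r0.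
have hr : M0 < M0 + 1 < M0 + 2 by apply/andP; split; lra.
have SA : oset (bx V1 (oi M0 (M0 + 2))) `<=` oset (bx V1 (olt (M0 + 2))).
  by apply: bxS => //; exact: oi_olt.
have Spre (O : opens R) : oset (bx V1 O) `<=` oset (pre W0).
  exact: subset_trans (@bx_pre _ _ _ _ _ _ ch _ _) (pre_sub V1W).
have dbe0 : dif K _ _ (rst (bx V1 (oi M0 (M0 + 2))) be) = 0.
  rewrite mor_rst dbe rst_rst//; apply: (rst_eq0S _ _ al'0); last exact: bx_pre.
  by apply: bxS => // x /= /andP[? _]; right.
have [W' [v [W'y W'S rW]]] := pr_surj P (bx_center ch V1y hr) dbe0.
have [V2 [e [V2y e0 V2W']]] := bx_nbhs ch W'y.
pose e1 := Num.min e 1.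
have e10 : 0 < e1 by rewrite lt_min e0 ltr01.
have e1e : e1 <= e by rewrite ge_min lexx.
have e11 : e1 <= 1 by rewrite ge_min lexx orbT.
pose W := opensI V1 V2.
have WV1 := @opensIl _ V1 V2; have WV2 := @opensIr _ V1 V2.
have WU := subset_trans (subset_trans WV1 V1W) W0U.
pose b := M0 + 1 + e1; pose b' := M0 + 1 - e1; pose a2 := Num.min a' M0.
have a2a : a2 <= a' by rewrite ge_min lexx.
have a2M : a2 <= M0 by rewrite ge_min lexx orbT.
have T1 : oset (bx W (olt b)) `<=` oset (bx V1 (olt (M0 + 2))).
  by apply: bxS => //; apply: olt_le; rewrite /b; slra.
have T2 : oset (bx W (oi b' b)) `<=` oset W'.
  by apply: subset_trans V2W'; apply: bxS => //; apply: oiS; rewrite /b /b'; slra.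
have T3 : oset (bx W (oi b' b)) `<=` oset (bx W (olt b)) by apply: bxS => //; exact: oi_olt.
have T4 : oset (bx W (olt a2)) `<=` oset (bx W (olt b)).
  by apply: bxS => //; apply: olt_le; rewrite /b; slra.
have T5 : oset (bx W (olt b)) `<=` oset (pre W) by exact: bx_pre.
have T6 : oset (pre W) `<=` oset (pre U) by exact: pre_sub.
have T7 : oset (bx V1 (olt a')) `<=` oset (bx V1 (olt (M0 + 2))).
  by apply: bxS => //; apply: olt_le; exact: ltW.
have T8 : oset (bx W (olt a2)) `<=` oset (bx V1 (olt a')).
  by apply: bxS => //; exact: olt_le.
have T9 : oset (bx W (ogt b')) `<=` oset (bx W0 (oout M0)).
  apply: bxS; first exact: subset_trans WV1 V1W.
  by move=> x /=; rewrite /b' => ?; right => /=; slra.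
have T11 := subset_trans T1 (Spre _).
have T12 := subset_trans T2 W'S.
have T10 : oset (bx W0 (oout M0)) `<=` oset (pre U).
  exact: subset_trans (@bx_pre _ _ _ _ _ _ ch _ _) (pre_sub W0U).
exists W, v; split=> //; apply: line_repI; first by rewrite mor_rst dal rst0.
move=> z Wz; exists b, W, b', a2, (rst _ be); rewrite shriek_rst//; split; last first.
  rewrite rst_rst//; last exact: bx_pre.
  exact: (rst_eq0S T9 T10 al0).
split=> //; first by split.
- by split; rewrite /b /b'; slra.
- by rewrite rst_rst//; exact: (rst_eq0S T8 T7 be0).
- rewrite mor_rst dbe /al' !rst_rst//.
- by move: (pr_res P T2 rW); rewrite !rst_rst.
Qed.

Lemma line_rep_eq0 U al y : oset U y -> @line_rep U 0 al ->
  exists W be, [/\ oset W y, oset W `<=` oset U & rst W al = dif fK (i + 1 + 1) W be].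
Proof.
move=> Uy [dal H]; have [b0 Hb] := H y Uy.
have [W0 [M0 [W0y W0U M00 al0]]] := shriek_bounded_rst ch al Uy.
have pW0 : oset (pre W0) `<=` oset (pre U) by exact: pre_sub.
pose al' := rst (pre W0) (spval al).
have al'0 : rst (bx W0 (oout M0)) al' = 0 by rewrite rst_rst//; exact: bx_pre.
have m1 : b0 <= Num.max b0 M0 by rewrite le_max lexx.
have m2 : M0 <= Num.max b0 M0 by rewrite le_max lexx orbT.
pose b := Num.max b0 M0 + 1.
have b0b : b0 < b by rewrite /b; lra.
have [W [b' [a' [be Hp]]]] := has_primitive_rst (Hb b b0b) W0y W0U.
have [[Wy WW0] [ab bb] be0 dbe rb] := Hp.
pose m := Num.max b' M0.
have m3 : b' <= m by rewrite le_max lexx.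
have m4 : M0 <= m by rewrite le_max lexx orbT.
have mb : m < b by rewrite gt_max bb /b; lra.
have hr : b' < (m + b) / 2 < b by apply/andP; split; lra.
have hr' : M0 < (m + b) / 2 < b by apply/andP; split; lra.
have S : oset (bx W (oi b' b)) `<=` oset (bx W (olt b)) by apply: bxS => //; exact: oi_olt.
have le : locally_exact be (io y ((m + b) / 2)).
  have [W' [c [W'x W'S e]]] := (pr_ker P (bx_center ch Wy hr) rb).1 (pr_ker0 P _).
  exists W', c; split=> //; first exact: subset_trans W'S S.
  by move: e; rewrite rst_rst.
have [V2 [be2 [M2 [V2y V2W be20 dbe2]]]] := right_close regY sK M00 al'0 Wy WW0 be0 ab dbe hr' le.
have bb2 : bounded_supp h be2.
  by apply: (rst_bounded (ch := ch)) => z V2z; exists V2, M2; split.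
exists V2, (mk_shriek ch bb2); split=> //; first exact: subset_trans W0U.
apply: spval_inj; rewrite (shriek_rst al (subset_trans V2W W0U)).
by rewrite [RHS]dbe2 rst_rst//; exact: pre_sub.
Qed.

Lemma line_rep_0 V : @line_rep V 0 0.
Proof.
apply: line_repI; first by rewrite mor_0.
move=> y Vy; exists 1, V, 0, 0, 0; split; last exact: rst0.
split; rewrite ?rst0 ?mor_0//; [by split|exact: (pr_0 P)].
Qed.

(** Near h = r the section 0 represents v, so 0 is a primitive of the cocycle 0 with class v on the
    right. *)
Lemma line_rep_ker y v r : N (io y r) v -> exists V, oset V y /\ @line_rep V v 0.
Proof.
move=> /(pr_ker_near P)[W [Wx NW]]; have [V [e [Vy e0 VW]]] := bx_nbhs ch Wx.
exists V; split=> //; apply: line_repI; first by rewrite mor_0.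
move=> z Vz; exists (r + e), V, (r - e), (r - e), 0; split; last exact: rst0.
split; rewrite ?rst0 ?mor_0//; [by split|by split; lra|].
by apply: (pr_zero P) => x /VW/NW.
Qed.

Definition fibre_span y : set E := lspan [set w | exists r, N (io y r) w].

Lemma line_rep_span y v : fibre_span y v -> exists V, oset V y /\ @line_rep V v 0.
Proof.
elim=> [|a s u [r Nr] _ [V [Vy rV]]]; first by exists opensT; split=> //; exact: line_rep_0.
have [V' [V'y rV']] := line_rep_ker Nr.
exists (opensI V V'); split; first by split.
have -> : 0 = a *: 0 + 0 :> sec (ob fK (i + 1 + 1 + 1)) (opensI V V') by rewrite scaler0 addr0.
rewrite -(rst0 _ V) -{2}(rst0 _ V'); apply: line_rep_lin.
  by rewrite rst0; have := line_rep_res (@opensIr _ V V') rV'; rewrite rst0.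
by rewrite rst0; have := line_rep_res (@opensIl _ V V') rV; rewrite rst0.
Qed.

Lemma fibre_spanB y u v : fibre_span y u -> fibre_span y v -> fibre_span y (u - v).
Proof. by move=> su sv; rewrite addrC -scaleN1r; exact: lspan_lin. Qed.

Lemma fibre_span1 y r v : N (io y r) v -> fibre_span y v.
Proof.
by move=> Nv; rewrite -[v]scale1r -[_ *: _]addr0; apply: lspan_cons; [exists r|exact: lspan0].
Qed.

(* Modulo the span of the fibres of N, the class of a cocycle is constant along the fibre. *)
Lemma class_constant (W : opens Y) (b : R) (g : sec (ob K (i + 1 + 1)) (bx W (olt b))) y r r' w w' :
  oset W y -> dif K _ _ g = 0 -> r < r' < b ->
  (exists U, [/\ oset U (io y r), oset U `<=` oset (bx W (olt b)) & rep U w (rst U g)]) ->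
  (exists U, [/\ oset U (io y r'), oset U `<=` oset (bx W (olt b)) & rep U w' (rst U g)]) ->
  fibre_span y (w' - w).
Proof.
move=> Wy dg /andP[rr rb].
pose cl s w := exists U, [/\ oset U (io y s), oset U `<=` oset (bx W (olt b)) & rep U w (rst U g)].
have clb s u : cl s u -> s < b by move=> [U [Us /(_ _ Us)/bx_io[]]].
have cl_ex s : s < b -> exists u, cl s u.
  move=> sb; have Us : oset (bx W (olt b)) (io y s) by apply/bx_io.
  by have [U [u [Ux US rU]]] := pr_surj P Us dg; exists u, U.
have clE s u u' : cl s u -> cl s u' -> N (io y s) (u - u').
  move=> [U [Us US rU]] [U' [U's U'S rU']].
  have O1 := @opensIl _ U U'; have O2 := @opensIr _ U U'.
  apply: (pr_eq P (U := opensI U U') (s := rst _ g)); first by split.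
    by move: (pr_res P O1 rU); rewrite rst_rst.
  by move: (pr_res P O2 rU'); rewrite rst_rst.
pose Q c d := forall s s' u u', c < s < d -> c < s' < d -> cl s u -> cl s' u' ->
  fibre_span y (u' - u).
have H c d : c <= d -> d < b -> Q c d.
  move=> cd db; apply: (@interval_patch _ Q c d cd).
  - move=> c1 d1 c2 d2 cc dd H s s' u u' /andP[h1 h2] /andP[h3 h4].
    by apply: H; apply/andP; split; lra.
  - move=> c1 d1 c2 d2 cc c2d1 dd H1 H2 s s' u u' /andP[h1 h2] /andP[h3 h4] cu cu'.
    have mid t : t < b -> d1 <= t -> exists p, cl ((c2 + d1) / 2) p.
      by move=> tb dt; apply: cl_ex; lra.
    have sb := clb _ _ cu; have s'b := clb _ _ cu'.
    have hm1 : c1 < (c2 + d1) / 2 < d1 by apply/andP; split; lra.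
    have hm2 : c2 < (c2 + d1) / 2 < d2 by apply/andP; split; lra.
    have [sd|sd] := ltP s d1; have [sd'|sd'] := ltP s' d1.
    + by apply: (H1 s s') => //; apply/andP; split.
    + have [p cp] := mid _ s'b sd'.
      have -> : u' - u = (u' - p) - (u - p) by rewrite opprB addrA subrK.
      apply: fibre_spanB; last by apply: (H1 ((c2 + d1) / 2) s) => //; apply/andP; split.
      by apply: (H2 ((c2 + d1) / 2) s') => //; apply/andP; split; lra.
    + have [p cp] := mid _ sb sd.
      have -> : u' - u = (u' - p) - (u - p) by rewrite opprB addrA subrK.
      apply: fibre_spanB; first by apply: (H1 ((c2 + d1) / 2) s') => //; apply/andP; split.
      by apply: (H2 ((c2 + d1) / 2) s) => //; apply/andP; split; lra.
    + by apply: (H2 s s') => //; apply/andP; split; lra.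
  - move=> t /andP[ct td]; have [|p cp] := cl_ex t; first lra.
    have [U [Ut US rU]] := cp; have [V [e [Vy e0 VU]]] := bx_nbhs ch Ut.
    exists e => //.
    have near s u : t - e < s < t + e -> cl s u -> fibre_span y (u - p).
      move=> hs cu; apply: (@fibre_span1 _ s); apply: clE => //; exists U; split=> //.
      by apply: VU; apply/bx_io.
    move=> s s' u u' hs hs' cu cu'.
    have -> : u' - u = (u' - p) - (u - p) by rewrite opprB addrA subrK.
    by apply: fibre_spanB; [exact: near hs' cu'|exact: near hs cu].
move=> cw cw'; apply: (H (r - 1) ((r' + b) / 2) _ _ r r' w w') => //; lra.
Qed.

(** If [al] is the coboundary of a section with proper support, that section and the primitive given
    by [line_rep] differ by a cocycle with class 0 far left and v on the right; [class_constant]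
    compares the two. Conversely, a vector of the span is represented by 0, so [al] also represents
    the vector 0 near y and [line_rep_eq0] applies. *)
Lemma line_rep_kerP U v al y : oset U y -> @line_rep U v al ->
  fibre_span y v <-> exists W be,
    [/\ oset W y, oset W `<=` oset U & rst W al = dif fK (i + 1 + 1) W be].
Proof.
move=> Uy rv; split=> [/line_rep_span[V [Vy rV]]|[W0 [be0 [W0y W0U e]]]].
  have O1 := @opensIl _ U V; have O2 := @opensIr _ U V.
  have rUV : line_rep 0 (rst (opensI U V) al).
    have := line_rep_lin (-1) (line_rep_res O2 rV) (line_rep_res O1 rv).
    by rewrite rst0 scaler0 add0r scaleN1r addNr.
  have Oy : oset (opensI U V) y by split.
  have [W [be [Wy WU be1]]] := line_rep_eq0 Oy rUV.
  exists W, be; split=> //; first exact: subset_trans O1.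
  by rewrite -be1 rst_rst.
have [_ H] := line_rep_res W0U rv; have [b0 Hb] := H y W0y.
have [W1 [M [W1y W1W M_0 be00]]] := shriek_bounded_rst ch be0 W0y.
pose b := Num.max b0 M + 1.
have m1 : b0 <= Num.max b0 M by rewrite le_max lexx.
have m2 : M <= Num.max b0 M by rewrite le_max lexx orbT.
have b0b : b0 < b by rewrite /b; lra.
have [W [b' [a' [be Hp]]]] := has_primitive_rst (Hb b b0b) W1y W1W.
have [[Wy WW1] [ab bb] bez dbe rb] := Hp.
have Spre (O : opens R) : oset (bx W O) `<=` oset (pre W0).
  exact: subset_trans (@bx_pre _ _ _ _ _ _ ch _ _) (pre_sub (subset_trans WW1 W1W)).
have Spre1 (O : opens R) : oset (bx W O) `<=` oset (pre W1).
  exact: subset_trans (@bx_pre _ _ _ _ _ _ ch _ _) (pre_sub WW1).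
have Spre2 (O : opens R) : oset (bx W1 O) `<=` oset (pre W0).
  exact: subset_trans (@bx_pre _ _ _ _ _ _ ch _ _) (pre_sub W1W).
have eal : dif K _ _ (spval be0) = spval (rst W0 al) by exact: (esym (congr1 (fun s => spval s) e)).
pose g := be - rst (bx W (olt b)) (spval be0).
have dg : dif K _ _ g = 0.
  rewrite morB dbe mor_rst eal !rst_rst ?subrr//; exact: pre_sub.
pose m := Num.max b' M; pose p := Num.min a' (- M).
have m3 : b' <= m by rewrite le_max lexx.
have m4 : M <= m by rewrite le_max lexx orbT.
have mb : m < b by rewrite gt_max bb /b; lra.
have p1 : p <= a' by rewrite ge_min lexx.
have p2 : p <= - M by rewrite ge_min lexx orbT.
have T1 : oset (bx W (olt p)) `<=` oset (bx W (olt b)) by apply: bxS => //; apply: olt_le; lra.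
have T2 : oset (bx W (oi m b)) `<=` oset (bx W (olt b)) by apply: bxS => //; exact: oi_olt.
have T3 : oset (bx W (oi b' b)) `<=` oset (bx W (olt b)) by apply: bxS => //; exact: oi_olt.
have be0z (O : opens R) : oset O `<=` oset (oout M) -> rst (bx W O) (spval be0) = 0.
  by move=> OO; apply: rst_eq0S be00; last exact: Spre2; exact: bxS.
rewrite -[v]subr0.
apply: (@class_constant W b g y (p - 1) ((m + b) / 2) 0 v Wy dg).
- by apply/andP; split; lra.
- exists (bx W (olt p)); split=> //; first by apply/bx_io; split=> //=; lra.
  have -> : rst (bx W (olt p)) g = 0.
    rewrite rstB rst_rst// be0z ?subr0; last by move=> x /= ?; left => /=; lra.
    apply: (rst_eq0S _ _ bez); first by apply: bxS => //; exact: olt_le.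
    by apply: bxS => //; apply: olt_le; lra.
  exact: (pr_0 P).
exists (bx W (oi m b)); split=> //; first by apply/bx_io; split=> //=; apply/andP; split; lra.
have -> : rst (bx W (oi m b)) g = rst (bx W (oi m b)) be.
  by rewrite rstB rst_rst// be0z ?subr0// => x /= /andP[? _]; right => /=; lra.
have S : oset (bx W (oi m b)) `<=` oset (bx W (oi b' b)) by apply: bxS => //; exact: oiS.
by move: (pr_res P S rb); rewrite rst_rst.
Qed.

Lemma line_rep_d U v al (et : sec (ob fK (i + 1 + 1)) U) : @line_rep U v al ->
  line_rep v (al + dif fK _ U et).
Proof.
move=> [dal H]; split; first by rewrite morD dal dif2 addr0.
move=> y Uy; have [b0 Hb] := H y Uy.
have [W1 [M [W1y W1U M_0 et0]]] := shriek_bounded_rst ch et Uy.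
exists (Num.max b0 M) => b; rewrite gt_max => /andP[b0b Mb].
have [W [b' [a' [be Hp]]]] := has_primitive_rst (Hb b b0b) W1y W1U.
have [[Wy WW1] [ab bb] bez dbe rb] := Hp.
have Spre (O : opens R) : oset (bx W O) `<=` oset (pre U).
  exact: subset_trans (@bx_pre _ _ _ _ _ _ ch _ _) (pre_sub (subset_trans WW1 W1U)).
have Spre2 (O : opens R) : oset (bx W1 O) `<=` oset (pre U).
  exact: subset_trans (@bx_pre _ _ _ _ _ _ ch _ _) (pre_sub W1U).
have Spre1 (O : opens R) : oset (bx W O) `<=` oset (pre W1).
  exact: subset_trans (@bx_pre _ _ _ _ _ _ ch _ _) (pre_sub WW1).
pose m := Num.max b' M; pose p := Num.min a' (- M).
have m3 : b' <= m by rewrite le_max lexx.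
have m4 : M <= m by rewrite le_max lexx orbT.
have mb : m < b by rewrite gt_max bb Mb.
have p1 : p <= a' by rewrite ge_min lexx.
have p2 : p <= - M by rewrite ge_min lexx orbT.
have T1 : oset (bx W (olt p)) `<=` oset (bx W (olt b)) by apply: bxS => //; apply: olt_le; lra.
have T2 : oset (bx W (oi m b)) `<=` oset (bx W (olt b)) by apply: bxS => //; exact: oi_olt.
have T3 : oset (bx W (oi b' b)) `<=` oset (bx W (olt b)) by apply: bxS => //; exact: oi_olt.
have et0z (O : opens R) : oset O `<=` oset (oout M) -> rst (bx W O) (spval et) = 0.
  by move=> OO; apply: rst_eq0S et0; last exact: Spre2; exact: bxS.
exists W, m, p, (be + rst _ (spval et)); split.
- by split=> //; exact: subset_trans WW1 W1U.
- by split; lra.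
- rewrite rstD rst_rst// et0z ?addr0; last by move=> x /= ?; left => /=; lra.
  apply: (rst_eq0S _ _ bez); first by apply: bxS => //; exact: olt_le.
  by apply: bxS => //; apply: olt_le; lra.
- rewrite morD dbe mor_rst rst_rst//; last exact: pre_sub.
  by rewrite -rstD.
- rewrite rstD rst_rst// et0z ?addr0; last by move=> x /= /andP[? _]; right => /=; lra.
  have S : oset (bx W (oi m b)) `<=` oset (bx W (oi b' b)) by apply: bxS => //; exact: oiS.
  by move: (pr_res P S rb); rewrite rst_rst.
Qed.

Hypothesis Nfam : forall y nu, compatible_family io N y nu ->
  (exists M, forall r, M < `|r| -> N (io y r) (nu r)) -> forall r, N (io y r) (nu r).

Lemma line_exact_at j : j != i + 1 + 1 -> exact_at fK j.
Proof.
move: j; apply: exact_at_pred => j ji V al y Vy dal.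
have {}ji : j != i + 1 by apply: contra ji => /eqP ->.
have dal0 : dif K _ _ (spval al) = 0 by exact: (congr1 (fun s => spval s) dal).
apply: (push_exact ch regY P sK Vy dal) => [r|M0]; last first.
  exists (M0 + 1); first lra.
  by move=> U be Ur dbe; exact: (pr_exact P ji Ur dbe).
have Ur := io_pre ch r Vy.
have [ji'|ji'] := eqVneq j i; last first.
  by apply: (pr_exact P _ Ur dal0); apply: contra ji' => /eqP ?; apply/eqP; lia.
(* Here [al] is in the degree of the cohomology sheaf: its classes along the fibre form a section
   with bounded support, which [Nfam] makes 0. *)
subst j; have [nu nuP] := pr_class P (fun r => io_pre ch r Vy) dal0.
have [W [Wr WU rW]] := nuP r.
have Nr : N (io y r) (nu r).
  apply: (Nfam (pr_class_compat ch P nuP)).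
  have [W0 [M0 [W0y W0V M00 al0]]] := shriek_bounded_rst ch al Vy.
  exists M0 => s sM; have [W' [W's W'U rW']] := nuP s.
  apply/(pr_ker P W's rW'); pose O := opensI W' (bx W0 (oout M0)).
  have O1 : oset O `<=` oset W' by exact: opensIl.
  have O2 : oset O `<=` oset (bx W0 (oout M0)) by exact: opensIr.
  exists O, 0; split=> //.
    split=> //; apply/bx_io; split=> //=; move: sM; have [s0|s0] := leP 0 s.
      by rewrite ger0_norm// => ?; right.
    by rewrite ltr0_norm// => ?; left => /=; lra.
  rewrite mor_0 rst_rst//; apply: (rst_eq0S O2 _ al0).
  exact: subset_trans (@bx_pre _ _ _ _ _ _ ch _ _) (pre_sub W0V).
have [W' [b [W'x W'W e]]] := (pr_ker P Wr rW).1 Nr.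
exists W', b; split=> //; first exact: subset_trans WU.
by rewrite -e rst_rst.
Qed.

End PushLine.

(** The new degree is that of H^1_c. The connecting map sends E onto H^1_c of the fibre with the
    span of the kernels as its kernel; the hypothesis on families says that H^0_c vanishes. *)
Lemma presented_push_line {k : fieldType} {R : realType} {X Y : topologicalType}
    (f : continuousType X Y) (h : X -> R) (io : Y -> R -> X) (ch : chart f h io)
    (K : @cpx k X) (i : int) (E : lmodType k) (N : X -> set E) (N' : Y -> set E) :
  (forall (V : opens Y) y, oset V y ->
     exists V' : opens Y, oset V' y /\ closure (oset V') `<=` oset V) ->
  (forall n, soft (ob K n)) ->
  (forall y nu, compatible_family io N y nu ->
     (exists M, forall r, M < `|r| -> N (io y r) (nu r)) -> forall r, N (io y r) (nu r)) ->
  (forall y v, N' y v <-> lspan [set w | exists r, N (io y r) w] v) ->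
  presented K i N -> presented (shriek_cpx f K) (i + 1) N'.
Proof.
move=> regY sK Nfam N'E [rep P]; exists (fun V => @line_rep _ _ _ _ _ _ _ ch _ _ _ rep V).
split.
- move=> j; exact: (line_exact_at ch regY sK P Nfam).
- by move=> U V v s VU rs; apply: (line_rep_res P VU rs).
- by move=> U v s H; apply: line_rep_loc.
- by move=> U v s [].
- by move=> U a v w s t rs rt; apply: (line_rep_lin P a rs rt).
- by move=> y v; apply: (line_rep_ex ch regY sK P).
- by move=> U s y Uy ds; apply: (line_rep_surj ch regY sK P Uy ds).
- by move=> U v s y Uy rs; rewrite N'E; apply: (line_rep_kerP regY sK P Uy rs).
- by move=> U v s b rs; apply: (line_rep_d P b rs).
Qed.

(** * Stalks of pullbacks, tensor products and exponentials *)

Section SheafPresentations.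
Context {k : fieldType}.

Lemma sheaf_presented_ext {X : topologicalType} (F : sheaf k X) (E : lmodType k)
    (N N' : X -> set E) :
  (forall x v, N x v <-> N' x v) -> sheaf_presented F N -> sheaf_presented F N'.
Proof.
by move=> NN [e [el es ek ec]]; exists e; split=> // x v; rewrite ek.
Qed.

Section FunctionSheaf.
Context {X : topologicalType}.
Variables (V : X -> lmodType k) (B : local_cond V) (E : lmodType k) (N : X -> set E).
Variable e : forall x, E -> V x.
Hypothesis e_lin : forall x, linear (e x).
Hypothesis e_ker : forall x v, e x v = 0 <-> N x v.
Hypothesis e_near : forall (U : opens X) (s : sec (fsheaf B) U) x, oset U x ->
  exists W v, [/\ oset W x, oset W `<=` oset U & forall y, oset W y -> fval s y = e y v].
Hypothesis e_open : forall x v, N x v -> exists W : opens X, oset W x /\ forall y, oset W y -> N y v.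
Hypothesis e_loc : forall x v, exists (U : opens X) (s : sec (fsheaf B) U),
  oset U x /\ forall y, oset U y -> fval s y = e y v.

(** Near x the section has the values [e y v] for one v; the value 0 at x puts v in [N x], and N is
    open. *)
Lemma germ_val_inj x : injective (@germ_val _ _ _ B x).
Proof.
suff H (a : stalk (fsheaf B) x) : germ_val a = 0 -> a = 0.
  move=> a b ab; apply/eqP; rewrite -subr_eq0; apply/eqP/H.
  by rewrite (linBf _ _ (@germ_val_lin _ _ _ _ x)) ab subrr.
have [U [s [Ux ->]]] := germ_surj a; rewrite germ_valE// => sx.
have [W [v [Wx WU sv]]] := e_near s Ux.
move: sx; rewrite sv// e_ker => /e_open[W' [W'x NW']].
apply: (rst0_germ (W := opensI W W')); first by split.
  by move=> y [/WU].
apply: fsec_eq => y [Wy W'y]; rewrite fval_rst//; last by move=> z [/WU].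
by rewrite sv//; apply/e_ker; exact: NW'.
Qed.

Definition fsheaf_stalk_fun x (v : E) : stalk (fsheaf B) x :=
  let U := cid (e_loc x v) in germ x (sval (cid (svalP U))).

Lemma fsheaf_stalk_funE x v : germ_val (fsheaf_stalk_fun x v) = e x v.
Proof.
rewrite /fsheaf_stalk_fun; case: cid => U H /=; case: cid => s [Ux sE] /=.
by rewrite germ_valE// sE.
Qed.

Lemma fsheaf_stalk_presentation : stalk_presentation N fsheaf_stalk_fun.
Proof.
split.
- move=> x a u v; apply: germ_val_inj.
  by rewrite germ_val_lin !fsheaf_stalk_funE e_lin.
- move=> x a; have [U [s [Ux ->]]] := germ_surj a.
  have [W [v [Wx WU sv]]] := e_near s Ux; exists v; apply: germ_val_inj.
  by rewrite fsheaf_stalk_funE germ_valE// sv.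
- move=> x v; rewrite -e_ker -fsheaf_stalk_funE; split=> [->|H].
    exact: (lin0 (@germ_val_lin _ _ _ _ _)).
  by apply: germ_val_inj; rewrite H (lin0 (@germ_val_lin _ _ _ _ _)).
- move=> x v; have [U [s [Ux sE]]] := e_loc x v; exists U, s; split=> // y Uy.
  by apply: germ_val_inj; rewrite fsheaf_stalk_funE germ_valE// sE.
Qed.

End FunctionSheaf.

Lemma sp_near {X : topologicalType} (F : sheaf k X) (E : lmodType k) (N : X -> set E) e
    (Fe : @stalk_presentation _ _ F E N e) (U : opens X) (s : sec F U) x : oset U x ->
  exists W v, [/\ oset W x, oset W `<=` oset U & forall y, oset W y -> germ y s = e y v].
Proof.
move=> Ux; have [v ev] := sp_surj Fe (germ x s); have [V [t [Vx tv]]] := sp_loc Fe x v.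
have O1 := @opensIl _ U V; have O2 := @opensIr _ U V.
have Ox : oset (opensI U V) x by split.
have [||W [Wx WU E1]] := @germ_eq_rst _ _ _ x (opensI U V) (rst _ s) (rst _ t) => //.
  by rewrite !germ_rst// ev tv.
have W1 := subset_trans WU O1; have W2 := subset_trans WU O2.
exists W, v; split=> // y Wy; rewrite -(germ_rst s W1 Wy) -tv; last exact: W2.
by rewrite -(germ_rst t W2 Wy); move: E1; rewrite !rst_rst// => ->.
Qed.

Lemma sp_open {X : topologicalType} (F : sheaf k X) (E : lmodType k) (N : X -> set E) e
    (Fe : @stalk_presentation _ _ F E N e) x v : N x v ->
  exists W : opens X, oset W x /\ forall y, oset W y -> N y v.
Proof.
have [V [t [Vx tv]]] := sp_loc Fe x v.
rewrite -(sp_ker Fe) -tv// => /(germ0_rst Vx)[W [Wx WV t0]].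
exists W; split=> // y Wy; apply/(sp_ker Fe); rewrite -tv; last exact: WV.
exact: rst0_germ Wy WV t0.
Qed.

Section PullbackPresentation.
Context {X Y : topologicalType} (f : continuousType X Y) (G : sheaf k Y).
Variables (E : lmodType k) (N : Y -> set E) (e : forall y, E -> stalk G y).
Hypothesis Ge : stalk_presentation N e.

Lemma pull_sec_is (W : opens Y) (t : sec G W) :
  is_fsec (LocalCond (@pull_cond0 k X Y f G) (@pull_cond_lin k X Y f G) (@pull_cond_res k X Y f G))
    (opens_pre f W) (fcut (opens_pre f W) (fun x => germ (f x) t)).
Proof.
split=> [x|x Wx]; first exact: fcutN.
exists (opens_pre f W), (fun x => germ (f x) t); split=> //; last by move=> y; exact: fcutE.
by exists W, t; split.
Qed.
Definition pull_sec (W : opens Y) (t : sec G W) : sec (pullback f G) (opens_pre f W) :=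
  @SubSp _ _ (fsec _ (opens_pre f W)) _ (pull_sec_is t).

Lemma pullback_near (U : opens X) (s : sec (pullback f G) U) x : oset U x ->
  exists W v, [/\ oset W x, oset W `<=` oset U & forall y, oset W y -> fval s y = e (f y) v].
Proof.
move=> Ux; have [_ /(_ x Ux)[A [b [AU Ax [W [t [AW bt]]] sb]]]] := spvalP s.
have [W' [v [W'x W'W tv]]] := sp_near Ge t (AW _ Ax).
exists (opensI A (opens_pre f W')), v; split=> //; first by move=> y [/AU].
by move=> y [Ay W'y]; rewrite [LHS]sb// bt// tv.
Qed.

Lemma pullback_loc x v : exists (U : opens X) (s : sec (pullback f G) U),
  oset U x /\ forall y, oset U y -> fval s y = e (f y) v.
Proof.
have [W [t [Wx tv]]] := sp_loc Ge (f x) v.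
exists (opens_pre f W), (pull_sec t); split=> // y Wy.
by rewrite /fval /= fcutE// tv.
Qed.

Lemma pullback_open x v : N (f x) v ->
  exists W : opens X, oset W x /\ forall y, oset W y -> N (f y) v.
Proof.
by move=> /(sp_open Ge)[W [Wx NW]]; exists (opens_pre f W); split=> // y Wy; exact: NW.
Qed.

Definition pullback_stalk_fun := fsheaf_stalk_fun pullback_loc.

Lemma pullback_presentation :
  stalk_presentation (fun x => N (f x)) pullback_stalk_fun.
Proof.
apply: fsheaf_stalk_presentation.
- by move=> x; exact: (sp_lin Ge).
- by move=> x v; exact: (sp_ker Ge).
- exact: pullback_near.
- exact: pullback_open.
Qed.

Lemma pullback_stalk_funE x v : germ_val (pullback_stalk_fun x v) = e (f x) v.
Proof. exact: fsheaf_stalk_funE. Qed.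

End PullbackPresentation.

Lemma pullback_presented {X Y : topologicalType} (f : continuousType X Y) (G : sheaf k Y)
    (E : lmodType k) (N : Y -> set E) :
  sheaf_presented G N -> sheaf_presented (pullback f G) (fun x => N (f x)).
Proof.
by move=> [e Ge]; exists (pullback_stalk_fun f Ge); exact: pullback_presentation.
Qed.

Section PureTensors.
Variables V W : lmodType k.

Lemma pure_linr (v : V) : linear (@pure k V W v).
Proof. by move=> a w w'; apply: spval_inj; apply/funext => b; exact: bf_linr. Qed.
Lemma pure_linl (w : W) : linear (fun v : V => pure v w).
Proof. by move=> a v v'; apply: spval_inj; apply/funext => b; exact: bf_linl. Qed.

(** The product of functionals equal to 1 on v and on w is a bilinear form that detects the pure
    tensor. *)
Lemma pure_eq0 (v : V) (w : W) : pure v w = 0 <-> v = 0 \/ w = 0.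
Proof.
split=> [H|[->|->]]; last 2 first.
- exact: (lin0 (pure_linl w)).
- exact: (lin0 (pure_linr v)).
have [->|v0] := eqVneq v 0; first by left.
have [->|w0] := eqVneq w 0; first by right.
have [f [lf fv]] := separating_functional v0; have [g [lg gw]] := separating_functional w0.
have bl w' : linear (fun v' => f v' * g w' : k^o).
  by move=> a x y; rewrite lf mulrDl scalerAl.
have br v' : linear (fun w' => f v' * g w' : k^o).
  by move=> a x y; rewrite lg mulrDr scalerAr.
have := congr1 (fun t : tens V W => spval t (@BiForm k V W (fun v' w' => f v' * g w') bl br)) H.
rewrite /= /pure_ev /= fv gw mulr1 => /eqP.
by rewrite [X in _ == X](_ : _ = 0)// oner_eq0.
Qed.

End PureTensors.

Section TensorPresentation.
Context {X : topologicalType} (F G : sheaf k X).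
Variables (N1 : X -> set k^o) (a : forall x, k^o -> stalk F x).
Variables (E : lmodType k) (N : X -> set E) (b : forall x, E -> stalk G x).
Hypothesis Fa : stalk_presentation N1 a.
Hypothesis Gb : stalk_presentation N b.

(** The stalk of F is spanned by [a x 1], so these tensors exhaust the stalk of the tensor product;
    [N1 x 1] says that the stalk of F is 0. *)
Let e x v : tens (stalk F x) (stalk G x) := pure (a x 1) (b x v).

Lemma tensor_e_lin x : linear (e x).
Proof. by move=> c u v; rewrite /e (sp_lin Gb) pure_linr. Qed.

Lemma tensor_e_ker x v : e x v = 0 <-> N1 x 1 \/ N x v.
Proof. by rewrite /e pure_eq0 (sp_ker Fa) (sp_ker Gb). Qed.

Lemma tensor_near (U : opens X) (s : sec (tensor F G) U) x : oset U x ->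
  exists W v, [/\ oset W x, oset W `<=` oset U & forall y, oset W y -> fval s y = e y v].
Proof.
move=> Ux; have [_ /(_ x Ux)[A [g0 [AU Ax [g [gS g0g]] sg]]]] := spvalP s.
suff [W [v [Wx WA gv]]] : exists W v, [/\ oset W x, oset W `<=` oset A &
    forall y, oset W y -> g y = e y v].
  exists W, v; split=> //; first exact: subset_trans AU.
  by move=> y Wy; rewrite [LHS]sg ?g0g ?gv//; exact: WA.
elim: gS => {g0g sg} [|c _ u [p [q ->]] _ [W [v [Wx WA uv]]]].
  by exists A, 0; split=> // y _; rewrite (lin0 (tensor_e_lin y)).
have [W1 [d [W1x W1A pd]]] := sp_near Fa p Ax; have [W2 [v' [W2x W2A qv]]] := sp_near Gb q Ax.
exists (opensI W (opensI W1 W2)), (c *: (d *: v') + v); split=> //; first by move=> y [/WA].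
move=> y [Wy [W1y W2y]].
rewrite [LHS](_ : _ = c *: tens_germ p q y + u y)// uv// tensor_e_lin; congr (_ *: _ + _).
rewrite /tens_germ pd// qv// (linZf _ _ (tensor_e_lin y)) /e.
have -> : a y d = (d : k) *: (a y 1 : stalk F y).
  by rewrite -(linZf _ _ (sp_lin Fa y)); congr (a y _); exact: (esym (mulr1 _)).
exact: (linZf _ _ (pure_linl _)).
Qed.

Lemma tensor_loc x v : exists (U : opens X) (s : sec (tensor F G) U),
  oset U x /\ forall y, oset U y -> fval s y = e y v.
Proof.
have [U [s [Ux s1]]] := sp_loc Fa x 1; have [V [t [Vx tv]]] := sp_loc Gb x v.
have O1 := @opensIl _ U V; have O2 := @opensIr _ U V.
exists (opensI U V), (tens_sec (rst _ s) (rst _ t)); split; first by split.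
move=> y Oy; rewrite /fval /= fcutE// /tens_germ !germ_rst//.
by case: Oy => Uy Vy; rewrite s1// tv.
Qed.

Lemma tensor_open x v : N1 x 1 \/ N x v ->
  exists W : opens X, oset W x /\ forall y, oset W y -> N1 y 1 \/ N y v.
Proof.
case=> [/(sp_open Fa)|/(sp_open Gb)] [W [Wx NW]]; exists W; split=> // y Wy.
  by left; exact: NW.
by right; exact: NW.
Qed.

Definition tensor_stalk_fun := fsheaf_stalk_fun tensor_loc.

Lemma tensor_presentation :
  stalk_presentation (fun x => [set v | N1 x 1 \/ N x v]) tensor_stalk_fun.
Proof.
apply: fsheaf_stalk_presentation.
- exact: tensor_e_lin.
- exact: tensor_e_ker.
- by move=> U s x; apply: tensor_near.
- exact: tensor_open.
Qed.

Lemma tensor_stalk_funE x v : germ_val (tensor_stalk_fun x v) = pure (a x 1) (b x v).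
Proof. exact: fsheaf_stalk_funE. Qed.

End TensorPresentation.

Section ConstantPresentation.
Context {X : topologicalType} (Z : set X).
Hypothesis cZ : closed Z.

Let e (x : X) (c : k^o) : k^o := cst_on Z c x.

Lemma cst_e_lin x : linear (e x).
Proof. by move=> a c d; rewrite /e -cst_on_lin. Qed.

Lemma cst_e_ker x c : e x c = 0 <-> (Z x -> c = 0).
Proof.
rewrite /e /cst_on; case: pselect => Zx; first by split=> // H; exact: H.
by split.
Qed.

Lemma cst_near (U : opens X) (s : sec (csheaf k Z) U) x : oset U x ->
  exists W v, [/\ oset W x, oset W `<=` oset U & forall y, oset W y -> fval s y = e y v].
Proof.
move=> Ux; have [_ /(_ x Ux)[W [b [WU Wx [c [_ bc]] sb]]]] := spvalP s.
by exists W, c; split=> // y Wy; rewrite [LHS]sb// bc.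
Qed.

Lemma cst_loc x v : exists (U : opens X) (s : sec (csheaf k Z) U),
  oset U x /\ forall y, oset U y -> fval s y = e y v.
Proof.
exists opensT, ((v : k) *: (cst_one Z opensT : sec (csheaf k Z) opensT)); split=> // y _.
rewrite /cst_one; case: pselect => // cZ'.
rewrite [LHS](_ : _ = v *: (fcut opensT (cst_on Z 1) y : k^o))// fcutE// /e.
by rewrite /cst_on; case: pselect => ?; rewrite ?scaler0//; exact: mulr1.
Qed.

Lemma cst_open x (c : k^o) : (Z x -> c = 0) ->
  exists W : opens X, oset W x /\ forall y, oset W y -> Z y -> c = 0.
Proof.
move=> H; have [Zx|nZx] := pselect (Z x).
  by exists opensT; split=> // y _ _; exact: H.
by exists (Opens (closed_openC cZ)); split.
Qed.

Definition cst_stalk_fun := fsheaf_stalk_fun cst_loc.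

Lemma cst_presentation : stalk_presentation (fun x => [set c : k^o | Z x -> c = 0]) cst_stalk_fun.
Proof.
apply: fsheaf_stalk_presentation.
- exact: cst_e_lin.
- exact: cst_e_ker.
- by move=> U s x; apply: cst_near.
- exact: cst_open.
Qed.

Lemma cst_stalk_funE x v : germ_val (cst_stalk_fun x v) = cst_on Z v x.
Proof. exact: fsheaf_stalk_funE. Qed.

End ConstantPresentation.

End SheafPresentations.

(** * Exponential sheaves *)

Section EsheafPresentation.
Context {R : realType} {X : topologicalType} (phi : X -> R) (Z : set X).
Hypothesis cphi : continuous phi.
Hypothesis cZ : closed Z.
Local Notation C := R[i].

Lemma epigraph_closed : closed [set p : X * R | 0 <= p.2 + phi p.1].
Proof.
apply: (@preimage_closed _ _ (fun p : X * R => p.2 + phi p.1) [set r | 0 <= r]); last first.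
  exact: closed_ge.
move=> p _; apply: continuousD; first exact: cvg_snd.
by apply: (@continuous_comp _ _ _ fst phi); [exact: cvg_fst|exact: cphi].
Qed.

Definition Estalk_fun := tensor_stalk_fun
  (pullback_presentation (@prX R X) (cst_presentation (k := C) cZ))
  (cst_presentation (k := C) epigraph_closed).

Definition Esupp : set (X * R) := [set p | Z p.1 /\ 0 <= p.2 + phi p.1].

Lemma Esheaf_presentation :
  stalk_presentation (fun p => [set c : C^o | Esupp p -> c = 0]) Estalk_fun.
Proof.
have [el es ek ec] := tensor_presentation
  (pullback_presentation (@prX R X) (cst_presentation (k := C) cZ))
  (cst_presentation (k := C) epigraph_closed).
split=> // p c; rewrite ek /=; split=> [[z1|z2] [Zp tp]|H].
- by have /eqP := z1 Zp; rewrite oner_eq0.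
- exact: z2.
- have [Zp|nZp] := pselect (Z p.1); last by left=> /nZp.
  by right=> tp; exact: H.
Qed.

Definition stalk_eval (p : X * R) (u : stalk (Esheaf phi Z) p) : C :=
  spval (germ_val u) (BiForm (@Eform_linl _ _ phi Z p) (@Eform_linr _ _ phi Z p)).

Lemma EvalE (U : opens (X * R)%type) (s : sec (Esheaf phi Z) U) p : oset U p ->
  Eval s p = stalk_eval (germ p s).
Proof. by move=> Up; rewrite /stalk_eval germ_valE. Qed.

Lemma stalk_eval_Estalk p c : Esupp p -> stalk_eval (Estalk_fun p c) = c.
Proof.
move=> [Zp tp]; rewrite /stalk_eval tensor_stalk_funE /= /pure_ev /= /Eform_fun.
rewrite pullback_stalk_funE !cst_stalk_funE /cst_on.
by case: pselect => // ?; case: pselect => // ?; exact: mul1r.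
Qed.

Lemma stalk_eval_lin p : linear (fun u : stalk (Esheaf phi Z) p => stalk_eval u : C^o).
Proof. by move=> a u v; rewrite /stalk_eval germ_val_lin. Qed.

Lemma Esheaf_stalks : exists e : forall p, C^o -> stalk (Esheaf phi Z) p,
  stalk_presentation (fun p => [set c : C^o | Esupp p -> c = 0]) e /\
  forall p c, stalk_eval (e p c) = if pselect (Esupp p) then c else 0.
Proof.
have [e [Pe eE]] : exists e : forall p, C^o -> stalk (Esheaf phi Z) p,
    stalk_presentation (fun p => [set c : C^o | Esupp p -> c = 0]) e /\
    forall p c, Esupp p -> stalk_eval (e p c) = c.
  by exists Estalk_fun; split; [exact: Esheaf_presentation|exact: stalk_eval_Estalk].
exists e; split=> // p c; case: pselect => [/eE//|np].
have -> : e p c = 0 by apply/(sp_ker Pe).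
exact: (lin0 (@stalk_eval_lin p)).
Qed.

End EsheafPresentation.

(** * Presentation of F_sigma *)

Section RelPresentation.
Context {k : fieldType} {X : topologicalType}.
Variables (F : sheaf k X) (E : lmodType k) (N : X -> set E).
Variable rel : forall U : opens X, E -> set (sec F U).
Arguments rel : clear implicits.
Hypothesis rel_lin : forall U a v w s t, rel U v s -> rel U w t -> rel U (a *: v + w) (a *: s + t).
Hypothesis rel_rst : forall (U V : opens X) v s, oset V `<=` oset U -> rel U v s -> rel V v (rst V s).
Hypothesis rel_ex : forall x v, exists U s, oset U x /\ rel U v s.
Hypothesis rel_surj : forall (U : opens X) (s : sec F U) x, oset U x ->
  exists W v, [/\ oset W x, oset W `<=` oset U & rel W v (rst W s)].
Hypothesis rel_ker : forall (U : opens X) v (s : sec F U) x, oset U x -> rel U v s ->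
  germ x s = 0 <-> N x v.

Lemma rel_presented : sheaf_presented F N.
Proof.
have U0 (U : opens X) v (s : sec F U) : rel U v s -> rel U 0 0.
  by move=> r; have := rel_lin (-1) r r; rewrite !scaleN1r !addNr.
(* The difference of two sections related to v is related to 0, hence has germ 0: the germ depends
   on v alone. *)
have diff x v U V (s : sec F U) (t : sec F V) : oset U x -> oset V x -> rel U v s -> rel V v t -> germ x s = germ x t.
  move=> Ux Vx rs rt; have O1 := @opensIl _ U V; have O2 := @opensIr _ U V.
  have Ox : oset (opensI U V) x by split.
  have := rel_lin (-1) (rel_rst O1 rs) (rel_rst O2 rt); rewrite !scaleN1r addNr => r.
  have N0 : N x 0 by apply/(rel_ker Ox (U0 _ _ _ r)); exact: germ0.
  have := (rel_ker Ox r).2 N0; rewrite addrC germB !germ_rst// => /eqP.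
  by rewrite subr_eq0 => /eqP ->.
have H x v : exists a : stalk F x, exists U s, [/\ oset U x, rel U v s & a = germ x s].
  by have [U [s [Ux rs]]] := rel_ex x v; exists (germ x s), U, s.
pose e x v := sval (cid (H x v)).
have eE x v U (s : sec F U) : oset U x -> rel U v s -> germ x s = e x v.
  move=> Ux rs; have : exists V t, [/\ oset V x, rel V v t & e x v = germ x t].
    exact: (svalP (cid (H x v))).
  by move=> [V [t [Vx rt ->]]]; exact: diff Ux Vx rs rt.
exists e; split.
- move=> x a v w; have [U [s [Ux rs]]] := rel_ex x v; have [V [t [Vx rt]]] := rel_ex x w.
  have O1 := @opensIl _ U V; have O2 := @opensIr _ U V.
  have Ox : oset (opensI U V) x by split.
  rewrite -(eE _ _ _ _ Ox (rel_lin a (rel_rst O1 rs) (rel_rst O2 rt))).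
  by rewrite germ_lin !germ_rst// (eE _ _ _ _ Ux rs) (eE _ _ _ _ Vx rt).
- move=> x a; have [U [s [Ux ->]]] := germ_surj a.
  have [W [v [Wx WU r]]] := rel_surj s Ux.
  by exists v; rewrite -(eE _ _ _ _ Wx r) germ_rst.
- move=> x v; have [U [s [Ux rs]]] := rel_ex x v.
  by rewrite -(eE _ _ _ _ Ux rs); exact: rel_ker.
- move=> x v; have [U [s [Ux rs]]] := rel_ex x v; exists U, s; split=> // y Uy.
  exact: eE.
Qed.

End RelPresentation.

(** * Restriction of a sheaf to a closed cylinder *)

Section ToRestrict.
Context {R : realType} {X : topologicalType}.
Local Notation C := R[i].
Variables (F : sheaf C (X * R)%type) (Z : set X).
Hypothesis cZ : closed Z.
Let Z' : set (X * R) := Z `*` [set: R].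

Lemma cylinder_closed : closed Z'.
Proof.
rewrite /Z' (_ : _ `*` _ = fst @^-1` Z); last first.
  by apply/seteqP; split=> p /=; [move=> []|split].
by apply: preimage_closed => // p _; exact: cvg_fst.
Qed.

Lemma fval_cst_one (U : opens (X * R)%type) p : oset U p ->
  fval (cst_one Z' U : sec (csheaf C Z') U) p = cst_on Z' (1 : C) p.
Proof.
by move=> Up; rewrite /cst_one; case: pselect => [h|]; [exact: fcutE|case; exact: cylinder_closed].
Qed.

Lemma germ_cst_one (U V : opens (X * R)%type) p : oset U p -> oset V p ->
  germ p (cst_one Z' U : sec (csheaf C Z') U) = germ p (cst_one Z' V : sec (csheaf C Z') V).
Proof.
move=> Up Vp; have O1 := @opensIl _ U V; have O2 := @opensIr _ U V.
have Op : oset (opensI U V) p by split.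
rewrite -(germ_rst (cst_one Z' U : sec (csheaf C Z') U) O1 Op).
rewrite -(germ_rst (cst_one Z' V : sec (csheaf C Z') V) O2 Op); congr germ.
apply: fsec_eq => q Oq; have [Uq Vq] := Oq.
by rewrite !fval_rst// !fval_cst_one.
Qed.

Lemma fval_to_restrict (U : opens (X * R)%type) (s : sec F U) p : oset U p ->
  fval (to_restrict Z s) p = pure (germ p s) (germ p (cst_one Z' U : sec (csheaf C Z') U)).
Proof. exact: fcutE. Qed.

Lemma to_restrict_rst (U V : opens (X * R)%type) (s : sec F U) : oset V `<=` oset U ->
  to_restrict Z (rst V s) = rst V (to_restrict Z s).
Proof.
move=> VU; apply: fsec_eq => p Vp; rewrite fval_rst// !fval_to_restrict//; last exact: VU.
by rewrite germ_rst//; congr pure; apply: germ_cst_one => //; exact: VU.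
Qed.

Lemma to_restrict_lin (U : opens (X * R)%type) : linear (@to_restrict R X F Z U).
Proof.
move=> a s t; apply: fsec_eq => p Up.
rewrite [RHS](_ : _ = a *: fval (to_restrict Z s) p + fval (to_restrict Z t) p)//.
by rewrite !fval_to_restrict// germ_lin pure_linl.
Qed.

Lemma to_restrict_germ0 (U : opens (X * R)%type) (s : sec F U) p : oset U p -> Z p.1 ->
  germ p (to_restrict Z s) = 0 -> germ p s = 0.
Proof.
move=> Up Zp /(congr1 (@germ_val _ _ _ _ p)).
rewrite germ_valE// (lin0 (@germ_val_lin _ _ _ _ p)) fval_to_restrict// => /pure_eq0[//|].
move=> /(congr1 (@germ_val _ _ _ _ p)); rewrite germ_valE// (lin0 (@germ_val_lin _ _ _ _ p)).
rewrite fval_cst_one// /cst_on; case: pselect => [_ /eqP|]; last by case; split.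
by rewrite oner_eq0.
Qed.

(** Locally the second factor of a tensor is a scalar multiple of [cst_one], and the scalar is moved
    to the first factor. *)
Lemma to_restrict_surj (U : opens (X * R)%type) (u : sec (Defs.restrict F Z) U) p : oset U p ->
  exists W (s : sec F W), [/\ oset W p, oset W `<=` oset U & rst W u = to_restrict Z s].
Proof.
move=> Up; have [_ /(_ p Up)[A [g0 [AU Ap [g [gS g0g]] ug]]]] := spvalP u.
suff [W [s [Wp WA gs]]] : exists W (s : sec F W), [/\ oset W p, oset W `<=` oset A &
    forall q, oset W q -> g q = fval (to_restrict Z s) q].
  have WU := subset_trans WA AU.
  exists W, s; split=> //; apply: fsec_eq => q Wq; rewrite fval_rst// -gs//.
  by rewrite [LHS]ug ?g0g//; exact: WA.
elim: gS => {g0g ug} [|c _ v [s [t ->]] _ [W [s' [Wp WA vs']]]].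
  exists A, 0; split=> // q Aq.
  by rewrite fval_to_restrict// germ0 (lin0 (pure_linl _)).
have [_ /(_ p Ap)[B [b [BA Bp [d [_ bd]] tb]]]] := spvalP t.
pose O := opensI W B.
have OW : oset O `<=` oset W by move=> q [].
have OB : oset O `<=` oset B by move=> q [].
have OA := subset_trans OW WA.
exists O, (c *: (d *: rst O s) + rst O s'); split=> //.
move=> q Oq; have Wq := OW _ Oq; have Aq := WA _ Wq.
have gt : germ q t = d *: germ q (cst_one Z' O : sec (csheaf C Z') O).
  rewrite -(germ_rst t OA Oq) -(linZf _ _ (@germ_linear _ _ _ q O)); congr germ.
  apply: fsec_eq => y Oy; rewrite fval_rst//.
  rewrite [RHS](_ : _ = d *: fval (cst_one Z' O : sec (csheaf C Z') O) y)// fval_cst_one//.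
  rewrite [LHS]tb; last exact: OB.
  rewrite bd; last exact: OB.
  by rewrite /cst_on; case: pselect => ?; rewrite ?scaler0//; exact: (esym (mulr1 _)).
rewrite [LHS](_ : _ = c *: tens_germ s t q + v q)// vs'// !fval_to_restrict//.
rewrite /tens_germ gt germ_lin pure_linl !(linZf _ _ (@germ_linear _ _ _ q O)) !germ_rst//.
rewrite (linZf _ _ (pure_linr _)) (linZf _ _ (pure_linl _)); congr (_ + pure _ _).
exact: germ_cst_one.
Qed.

End ToRestrict.

(** * Sheaves glued from exponentials over four sectors *)

Section Glued.
Context {R : realType} {X : topologicalType}.
Local Notation C := R[i].
Local Notation XR := (X * R)%type.
Variables (S : 'Z_4 -> set X) (q : 'I_2 -> X -> R) (sigma : 'Z_4 -> 'M[C]_2).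
Variable F : sheaf C XR.
Variable alpha : forall j : 'Z_4, mor (Defs.restrict F (S j))
  (dsum (fun i : 'I_2 => Esheaf (fun z => - q i z) (S j))).
Hypothesis cS : forall j, closed (S j).
Hypothesis cq : forall i, continuous (q i).
Hypothesis alpha_iso : forall j, is_iso (alpha j).
Hypothesis alpha_sigma : forall (j : 'Z_4) (U : opens XR) (s : sec F U) (p : XR) (i : 'I_2),
  oset U p -> S j p.1 -> S (j + 1) p.1 -> 0 <= p.2 - q i p.1 ->
  Eval (alpha (j + 1) U (to_restrict (S (j + 1)) s) i) p =
  \sum_(l < 2) sigma j i l * Eval (alpha j U (to_restrict (S j) s) l) p.
Hypothesis sigma_tri : forall (j : 'Z_4) z i l, S j z -> S (j + 1) z ->
  q i z < q l z -> sigma j i l = 0.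
(* A sector containing z from which the others are reached by turning
   anticlockwise through sectors containing z. *)
Hypothesis S_start : forall z, exists j0, S j0 z /\ forall Q : 'Z_4 -> Prop, Q j0 ->
  (forall j, S j z -> S (j + 1) z -> Q j -> Q (j + 1)) -> forall j, S j z -> Q j.
Variable M : 'Z_4 -> 'M[C]_2.
Hypothesis M_unit : forall j, M j \in unitmx.
Hypothesis M_step : forall j, M (j + 1) = sigma j *m M j.

(** [M j] carries one fixed C^2 to the coordinates over sector j; [M_step] makes it compatible with
    the transitions, so that a vector v stands for a section near any point. *)
Definition frame_coord (j : 'Z_4) (i : 'I_2) (v : 'cV[C]_2) : C := (M j *m v) i 0.
Definition sector_supp j i : set XR := [set p | S j p.1 /\ 0 <= p.2 - q i p.1].

Let ev (U : opens XR) (s : sec F U) j i p : C := (Eval (alpha j U (to_restrict (S j) s) i) p).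

Let phic i : continuous (fun z => - q i z).
Proof. by move=> z; apply: continuousN; exact: cq. Qed.

Lemma ev_rst (U V : opens XR) (s : sec F U) j i p : oset V `<=` oset U -> oset V p ->
  ev (rst V s) j i p = ev s j i p.
Proof.
move=> VU Vp; rewrite /ev to_restrict_rst// mor_rst.
have -> : (rst V (alpha j U (to_restrict (S j) s)) :
    sec (dsum (fun i : 'I_2 => Esheaf (fun z => - q i z) (S j))) V) i =
    rst V (alpha j U (to_restrict (S j) s) i) by rewrite !(rstE VU).
by rewrite /Eval fval_rst.
Qed.

Lemma ev_lin (U : opens XR) a (s t : sec F U) j i p :
  ev (a *: s + t) j i p = a * ev s j i p + ev t j i p.
Proof. by rewrite /ev to_restrict_lin// mor_lin. Qed.

Lemma ev_near (U : opens XR) (s : sec F U) j i p : oset U p ->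
  exists W c, [/\ oset W p, oset W `<=` oset U &
    forall p', oset W p' -> ev s j i p' = if pselect (sector_supp j i p') then c else 0].
Proof.
move=> Up; have [e [Pe eE]] := Esheaf_stalks (@phic i) (@cS j).
have [W [c [Wp WU sW]]] := sp_near Pe (alpha j U (to_restrict (S j) s) i) Up.
exists W, c; split=> // p' Wp'.
by rewrite /ev EvalE; [rewrite sW// eE|exact: WU].
Qed.

Definition frame_rel (U : opens XR) (v : 'cV[C]_2) (s : sec F U) :=
  forall p, oset U p -> forall j i, sector_supp j i p -> ev s j i p = frame_coord j i v.

(** There are finitely many pairs (j, i). On its support each coordinate of [s] is locally constant;
    the supports are closed, so a pair absent at p stays absent nearby. *)
Lemma frame_rel_at (U : opens XR) (s : sec F U) v p : oset U p ->
  (forall j i, sector_supp j i p -> ev s j i p = frame_coord j i v) ->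
  exists W, [/\ oset W p, oset W `<=` oset U & frame_rel v (rst W s)].
Proof.
move=> Up H.
have : nbhs p [set p' | forall ji : 'Z_4 * 'I_2, oset U p' /\
    (sector_supp ji.1 ji.2 p' -> ev s ji.1 ji.2 p' = frame_coord ji.1 ji.2 v)].
  apply: (@filter_forall _ _ (fun (ji : 'Z_4 * 'I_2) p' => oset U p' /\
    (sector_supp ji.1 ji.2 p' -> ev s ji.1 ji.2 p' = frame_coord ji.1 ji.2 v)) (nbhs p)).
  move=> -[j i] /=; have [W [c [Wp WU sW]]] := ev_near s j i Up.
  have [sp|nsp] := pselect (sector_supp j i p).
    apply: filterS (open_nbhs_nbhs (conj (osetP W) Wp)) => p' Wp'; split; first exact: WU.
    rewrite sW//; case: pselect => // ? _.
    by rewrite -H// sW//; case: pselect.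
  have cs : closed (sector_supp j i).
    rewrite (_ : sector_supp j i = (S j `*` [set: R]) `&` [set p | 0 <= p.2 + - q i p.1]); last first.
      by apply/seteqP; split=> x /= [h1 h2]; [split|case: h1].
    by apply: closedI; [exact: cylinder_closed|exact: (@epigraph_closed _ _ (fun z => - q i z))].
  have : nbhs p (oset U `&` ~` sector_supp j i).
    by apply: open_nbhs_nbhs; split=> //; apply: openI; [exact: osetP|exact: closed_openC].
  by apply: filterS => p' [Up' np']; split.
move=> /nbhs_opens[W [Wp WH]]; exists W.
have WU : oset W `<=` oset U by move=> p' /WH/(_ (0, 0))[].
split=> // p' Wp' j i sp; rewrite ev_rst//.
by have [_] := WH _ Wp' (j, i); exact.
Qed.

(** The l-th coordinate is unknown where its summand is absent, that is for t < q l; as q i <= t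
    there, triangularity makes the entry (i, l) zero. *)
Lemma frame_chain (U : opens XR) (s : sec F U) v p j : oset U p -> S j p.1 -> S (j + 1) p.1 ->
  (forall i, sector_supp j i p -> ev s j i p = frame_coord j i v) ->
  forall i, sector_supp (j + 1) i p -> ev s (j + 1) i p = frame_coord (j + 1) i v.
Proof.
move=> Up Sj Sj1 H i [_ ti]; rewrite /ev alpha_sigma// /frame_coord M_step -mulmxA mxE.
apply: eq_bigr => l _; have [tl|tl] := leP 0 (p.2 - q l p.1).
  by congr (_ * _); apply: H.
by rewrite (sigma_tri Sj Sj1) ?mul0r//; move: ti tl; rewrite subr_ge0 subr_lt0; exact: le_lt_trans.
Qed.

Lemma frame_all (U : opens XR) (s : sec F U) v p j0 : oset U p ->
  (forall Q : 'Z_4 -> Prop, Q j0 ->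
    (forall j, S j p.1 -> S (j + 1) p.1 -> Q j -> Q (j + 1)) -> forall j, S j p.1 -> Q j) ->
  (forall i, sector_supp j0 i p -> ev s j0 i p = frame_coord j0 i v) ->
  forall j i, sector_supp j i p -> ev s j i p = frame_coord j i v.
Proof.
move=> Up chain H j i sp.
apply: (chain (fun j => forall i, sector_supp j i p -> ev s j i p = frame_coord j i v)) => //.
  by move=> j' Sj Sj1 Hj; exact: frame_chain.
exact: sp.1.
Qed.

Lemma frame_surj (p : XR) j (w : 'I_2 -> C) : S j p.1 ->
  exists U (s : sec F U), oset U p /\ forall i, sector_supp j i p -> ev s j i p = w i.
Proof.
move=> Sj; pose D := dsum (fun i : 'I_2 => Esheaf (fun z => - q i z) (S j)).
have H i : exists U (t : sec (Esheaf (fun z => - q i z) (S j)) U), oset U p /\ (sector_supp j i p -> Eval t p = w i).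
  have [e [Pe eE]] := Esheaf_stalks (@phic i) (@cS j).
  have [U [t [Up tE]]] := sp_loc Pe p (w i); exists U, t; split=> // sp.
  by rewrite EvalE// tE// eE; case: pselect.
have [U0 [t0 [U0p t0E]]] := H 0; have [U1 [t1 [U1p t1E]]] := H 1.
pose U := opensI U0 U1; have O0 := @opensIl _ U0 U1; have O1 := @opensIr _ U0 U1.
have Up : oset U p by split.
have [t tE] : exists t : sec D U, forall i, sector_supp j i p -> Eval (t i) p = w i.
  have T i : exists t : sec (Esheaf (fun z => - q i z) (S j)) U,
      sector_supp j i p -> Eval t p = w i.
    case: (unliftP 0 i) => [i'|] ->.
      rewrite (ord1 i') (_ : lift 0 0 = 1); last exact: val_inj.
      by exists (rst U t1) => /t1E <-; rewrite /Eval fval_rst.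
    by exists (rst U t0) => /t0E <-; rewrite /Eval fval_rst.
  by exists (fun i => sval (cid (T i))) => i; exact: (svalP (cid (T i))).
have [beta bE] := alpha_iso j.
have [W [s [Wp WU e]]] := to_restrict_surj (@cS j) (beta U t) Up.
exists W, s; split=> // i sp; rewrite /ev -e mor_rst.
have -> : (rst W (alpha j U (beta U t)) : sec D W) i = rst W (alpha j U (beta U t) i).
  by rewrite !(rstE WU).
by rewrite (bE U).2 /Eval fval_rst//; exact: tE.
Qed.

Lemma frame_ker (U : opens XR) (v : 'cV[C]_2) (s : sec F U) p : oset U p -> frame_rel v s ->
  germ p s = 0 <-> forall j i, sector_supp j i p -> frame_coord j i v = 0.
Proof.
move=> Up rs; split=> [s0 j i sp|H].
  have [W [Wp WU sW]] := germ0_rst Up s0.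
  rewrite -(rs p Up j i sp) -(ev_rst s j i WU Wp) sW.
  by have := ev_lin (-1) (0 : sec F W) 0 j i p; rewrite scaler0 addr0 mulN1r addNr.
have [j0 [Sj0 _]] := S_start p.1.
apply: (to_restrict_germ0 (@cS j0) Up Sj0).
have [beta bE] := alpha_iso j0; set u := to_restrict _ s.
have Hi i : exists W, [/\ oset W p, oset W `<=` oset U & rst W (alpha j0 U u i) = 0].
  apply: germ0_rst => //; have [e [Pe eE]] := Esheaf_stalks (@phic i) (@cS j0).
  have [c ec] := sp_surj Pe (germ p (alpha j0 U u i)); rewrite ec; apply/(sp_ker Pe) => sp.
  have := rs p Up j0 i sp; rewrite H// /ev EvalE// ec eE.
  by case: pselect.
have [W0 [W0p W0U e0]] := Hi 0; have [W1 [W1p W1U e1]] := Hi 1.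
pose W := opensI W0 W1; have O0 := @opensIl _ W0 W1; have O1 := @opensIr _ W0 W1.
have WU := subset_trans O0 W0U.
apply: (@rst0_germ _ _ _ p U W) => //.
rewrite -[u](bE U).1 -mor_rst (_ : rst W (alpha j0 U u) = 0) ?mor_0//.
apply: functional_extensionality_dep => i.
have -> : (rst W (alpha j0 U u) : sec (dsum (fun i : 'I_2 => Esheaf (fun z => - q i z) (S j0))) W) i =
    rst W (alpha j0 U u i) by rewrite !(rstE WU).
case: (unliftP 0 i) => [i'|] ->.
  rewrite (ord1 i') (_ : lift 0 0 = 1); last exact: val_inj.
  exact: (rst_eq0S O1 W1U e1).
exact: (rst_eq0S O0 W0U e0).
Qed.

Lemma glued_presented : sheaf_presented F (fun p => [set v : 'cV[C]_2 |
  forall j i, sector_supp j i p -> frame_coord j i v = 0]).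
Proof.
apply: (@rel_presented _ _ F _ _ frame_rel).
- move=> U a v w s t rs rt p Up j i sp; rewrite ev_lin (rs p Up j i sp) (rt p Up j i sp).
  by rewrite /frame_coord mulmxDr -scalemxAr !mxE.
- by move=> U V v s VU rs p Vp j i sp; rewrite ev_rst// (rs p (VU _ Vp) j i sp).
- move=> p v; have [j0 [Sj0 chain]] := S_start p.1.
  have [U [s [Up sE]]] := frame_surj (fun i => frame_coord j0 i v) Sj0.
  have [W [Wp WU r]] := frame_rel_at Up (frame_all Up chain sE).
  by exists W, (rst W s).
- move=> U s p Up; have [j0 [Sj0 chain]] := S_start p.1.
  pose w : 'cV[C]_2 := \col_i ev s j0 i p.
  have sE i : sector_supp j0 i p -> ev s j0 i p = frame_coord j0 i (invmx (M j0) *m w).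
    by rewrite /frame_coord mulmxA mulmxV// mul1mx mxE.
  have [W [Wp WU r]] := frame_rel_at Up (frame_all Up chain sE).
  by exists W, (invmx (M j0) *m w).
- by move=> U v s p; exact: frame_ker.
Qed.

End Glued.

(** * Rotated coordinates and quadratic exponents *)

Section RotatedCoordinates.
Context {R : realType}.
Local Notation C := R[i].
Implicit Types (th t : R) (z : Cline R).

Definition re z : R := complex.Re (z : C).
Definition im z : R := complex.Im (z : C).

(* z = e^(i th) (rx th z + i ry th z) *)
Definition rx th z := cos th * re z + sin th * im z.
Definition ry th z := cos th * im z - sin th * re z.

Lemma complex_ext (z w : C) : complex.Re z = complex.Re w -> complex.Im z = complex.Im w -> z = w.
Proof. by case: z w => a b [c d] /= -> ->. Qed.

Lemma re_rxy th z : re z = cos th * rx th z - sin th * ry th z.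
Proof.
rewrite /rx /ry; transitivity ((cos th ^+ 2 + sin th ^+ 2) * re z); last by ring.
by rewrite cos2Dsin2 mul1r.
Qed.
Lemma im_rxy th z : im z = sin th * rx th z + cos th * ry th z.
Proof.
rewrite /rx /ry; transitivity ((cos th ^+ 2 + sin th ^+ 2) * im z); last by ring.
by rewrite cos2Dsin2 mul1r.
Qed.

Lemma rxy_inj th z w : rx th z = rx th w -> ry th z = ry th w -> z = w.
Proof.
by move=> ex ey; apply: complex_ext; rewrite -/(re _) -/(im _) ?(re_rxy th) ?(im_rxy th);
  rewrite -/(re _) -/(im _) ?(re_rxy th w) ?(im_rxy th w) ex ey.
Qed.

Lemma rxy_has_arg th z t : has_arg (z : C) t -> exists2 r, 0 < r &
  rx th z = r * cos (t - th) /\ ry th z = r * sin (t - th).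
Proof.
move=> [r r0 zE]; exists r => //; rewrite /rx /ry /re /im zE /= cosB sinB.
by split; ring.
Qed.

Lemma has_arg_rxy th z t r : 0 < r ->
  rx th z = r * cos (t - th) -> ry th z = r * sin (t - th) -> has_arg (z : C) t.
Proof.
move=> r0 ex ey; exists r => //.
have h : cos t = cos th * cos (t - th) - sin th * sin (t - th).
  by rewrite -cosD addrC subrK.
have h' : sin t = sin th * cos (t - th) + cos th * sin (t - th).
  by rewrite -sinD addrC subrK.
apply: complex_ext; rewrite /= -/(re z) -/(im z).
  by rewrite (re_rxy th) ex ey h; ring.
by rewrite (im_rxy th) ex ey h'; ring.
Qed.

Lemma polar_quadrant (x y : R) : 0 <= x -> 0 <= y -> (x != 0) || (y != 0) ->
  exists r s, [/\ 0 < r, 0 <= s <= pi / 2, x = r * cos s & y = r * sin s].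
Proof.
move=> x0 y0 xy.
have s0 : 0 < x ^+ 2 + y ^+ 2.
  have x2 := sqr_ge0 x; have y2 := sqr_ge0 y.
  case/orP: xy => [xn|yn].
    have h : 0 < x ^+ 2 by rewrite exprn_even_gt0.
    lra.
  have h : 0 < y ^+ 2 by rewrite exprn_even_gt0.
  lra.
pose r := Num.sqrt (x ^+ 2 + y ^+ 2).
have r0 : 0 < r by rewrite sqrtr_gt0.
have r2 : r ^+ 2 = x ^+ 2 + y ^+ 2 by rewrite sqr_sqrtr// ltW.
have xr : x <= r.
  by rewrite -[X in X <= _]ger0_norm// -sqrtr_sqr ler_wsqrtr// lerDl sqr_ge0.
have u0 : 0 <= x / r by rewrite divr_ge0// ltW.
have u1 : x / r <= 1 by rewrite ler_pdivrMr// mul1r.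
have um : -1 <= x / r <= 1 by apply/andP; split=> //; lra.
exists r, (acos (x / r)); split=> //.
- rewrite acos_ge0//= leNgt; apply/negP => h.
  have : cos (acos (x / r)) < 0.
    have -> : acos (x / r) = (acos (x / r) - pi / 2) + pi / 2 by rewrite subrK.
    rewrite cosDpihalf oppr_lt0; apply: sin_gt0_pi.
    have := acos_lepi um; have := @pi_gt0 R; move: h; set a := acos _ => *.
    by apply/andP; split; lra.
  by rewrite acosK ?in_itv//= => ?; lra.
- by rewrite acosK ?in_itv//= mulrCA divff ?mulr1// gt_eqF.
- rewrite sin_acos// -[LHS](@ger0_norm _ y)// -sqrtr_sqr.
  have -> : y ^+ 2 = r ^+ 2 * (1 - (x / r) ^+ 2).
    by rewrite expr_div_n mulrBr mulr1 mulrCA divff ?mulr1 ?r2 ?gt_eqF//; ring.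
  by rewrite sqrtrM ?sqr_ge0// sqrtr_sqr ger0_norm// ltW.
Qed.

Lemma quadrant_sector th z :
  (z = 0 :> C \/ exists2 t, th <= t <= th + pi / 2 & has_arg (z : C) t) <->
  0 <= rx th z /\ 0 <= ry th z.
Proof.
have pi0 := @pi_gt0 R; split=> [[z0|[t /andP[t1 t2] /(rxy_has_arg th)[r r0 [-> ->]]]]|[hx hy]].
- by rewrite /rx /ry /re /im z0 /= !mulr0 addr0 subr0.
- split; apply: mulr_ge0; rewrite ?(ltW r0)//.
    by apply: cos_ge0_pihalf; apply/andP; split; lra.
  by apply: sin_ge0_pi; apply/andP; split; lra.
have [xy|/norP[]] := boolP ((rx th z != 0) || (ry th z != 0)); last first.
  rewrite !negbK => /eqP x0 /eqP y0; left.
  apply: (@rxy_inj th _ (0 : C)); rewrite ?x0 ?y0 /rx /ry /re /im /= ?mulr0 ?addr0 ?subr0//.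
have [r [s [r0 /andP[s1 s2] ex ey]]] := polar_quadrant hx hy xy.
right; exists (th + s); first by apply/andP; split; lra.
by apply: (has_arg_rxy (th := th) r0); rewrite addrAC subrr add0r.
Qed.

(** 0 is the class of 4 in Z/4, hence the fourth quadrant. *)
Definition quadrant (j : 'Z_4) (x y : R) : Prop :=
  match (j : nat) with
  | 0%N => 0 <= x /\ y <= 0 | 1%N => 0 <= x /\ 0 <= y
  | 2%N => x <= 0 /\ 0 <= y | _ => x <= 0 /\ y <= 0 end.

Lemma Z4_ind (Q : 'Z_4 -> Prop) : Q 0 -> Q 1 -> Q 2%:R -> Q 3%:R -> forall j, Q j.
Proof.
move=> Q0 Q1 Q2 Q3 [[|[|[|[|j]]]] jlt] //.
- by rewrite (_ : Ordinal jlt = 0)//; exact: val_inj.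
- by rewrite (_ : Ordinal jlt = 1)//; exact: val_inj.
- by rewrite (_ : Ordinal jlt = 2%:R)//; exact: val_inj.
- by rewrite (_ : Ordinal jlt = 3%:R)//; exact: val_inj.
Qed.

Lemma sectorE th (j : 'Z_4) z : sector th j z <-> quadrant j (rx th z) (ry th z).
Proof.
have rot (n : nat) (a : R) : a = (n%:R - 1) * (pi / 2) ->
    (z = 0 :> C \/ exists2 t, th + (n%:R - 1) * (pi / 2) <= t <= th + n%:R * (pi / 2) &
       has_arg (z : C) t) <-> 0 <= rx (th + a) z /\ 0 <= ry (th + a) z.
  move=> ->; rewrite -quadrant_sector.
  by have -> : th + (n%:R - 1) * (pi / 2) + pi / 2 = th + n%:R * (pi / 2) by ring.
elim/Z4_ind: j; rewrite /sector /quadrant /=.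
- rewrite (rot 0%N (- (pi / 2))); last by ring.
  rewrite /rx /ry cosBpihalf sinBpihalf.
  by split=> -[h1 h2]; split; lra.
- rewrite (rot 1%N 0); last by ring.
  by rewrite addr0.
- rewrite (rot 2%N (pi / 2)); last by ring.
  rewrite /rx /ry cosDpihalf sinDpihalf.
  by split=> -[h1 h2]; split; lra.
- rewrite (rot 3%N pi); last by field.
  rewrite /rx /ry cosDpi sinDpi.
  by split=> -[h1 h2]; split; lra.
Qed.

Lemma real_complex_gt0 (e : R) : 0 < e -> 0 < e%:C%C :> C.
Proof. by move=> e0; rewrite ltcE /= eqxx. Qed.

Lemma normc_ge_Im (z : C) : `|complex.Im z|%:C%C <= `|z|.
Proof.
rewrite normc_def lecE /= eqxx /= -sqrtr_sqr ler_sqrt; last first.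
  by rewrite addr_ge0// sqr_ge0.
by rewrite lerDr sqr_ge0.
Qed.

Lemma re_continuous : continuous re.
Proof.
move=> z A /nbhs_ballP[e /= e0 eA]; apply/nbhs_ballP.
exists e%:C%C; first exact: real_complex_gt0.
move=> w zw; apply: eA; rewrite /ball /= /ball_ /=.
have : `|complex.Re ((z : C) - w)|%:C%C < e%:C%C by apply: le_lt_trans (normc_ge_Re _) _; exact: zw.
rewrite ltcE /= eqxx /=; congr (`|_| < _).
by rewrite /re; case: (z) (w) => a b [c d].
Qed.

Lemma im_continuous : continuous im.
Proof.
move=> z A /nbhs_ballP[e /= e0 eA]; apply/nbhs_ballP.
exists e%:C%C; first exact: real_complex_gt0.
move=> w zw; apply: eA; rewrite /ball /= /ball_ /=.
have : `|complex.Im ((z : C) - w)|%:C%C < e%:C%C by apply: le_lt_trans (normc_ge_Im _) _; exact: zw.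
rewrite ltcE /= eqxx /=; congr (`|_| < _).
by rewrite /im; case: (z) (w) => a b [c d].
Qed.

Lemma pair_to_Cline_continuous :
  continuous (fun p : R * R => ((p.1 +i* p.2)%C : Cline R)).
Proof.
move=> [a b] A /nbhs_ballP[e /= e0 eA].
have [er er0 eE] : exists2 er : R, 0 < er & e = er%:C%C.
  case: e e0 {eA} => e1 e2; rewrite ltcE /= => /andP[/eqP -> e10].
  by exists e1.
have h : 0 < er / 2 by rewrite divr_gt0.
exists (ball a (er / 2), ball b (er / 2)); first by split; exact: nbhsx_ballx.
move=> [c d] [/= ac bd]; apply: eA; rewrite /ball /= /ball_ /=.
have -> : (a +i* b)%C - (c +i* d)%C = ((a - c) +i* (b - d))%C :> C by [].
apply: (@le_lt_trans _ _ (`|a - c| + `|b - d|)%:C%C).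
  rewrite normc_def lecE /= eqxx /= -[leRHS]ger0_norm ?addr_ge0// -[leRHS]sqrtr_sqr.
  rewrite ler_wsqrtr// [leRHS]sqrrD !real_normK ?num_real//.
  by rewrite lerD2r lerDl mulrn_wge0// mulr_ge0.
by rewrite [X in _ < X]eE ltcE /= eqxx /=; move: ac bd; rewrite /ball /= /ball_ /= => ? ?; lra.
Qed.

Lemma continuous_lincomb (T : topologicalType) (a b : R) (f g : T -> R) :
  continuous f -> continuous g -> continuous (fun u => a * f u + b * g u).
Proof.
move=> cf cg u; apply: cvgD; apply: cvgM; try exact: cvg_cst; [exact: cf|exact: cg].
Qed.

Lemma continuous_mul (T : topologicalType) (f g : T -> R) :
  continuous f -> continuous g -> continuous (fun u => f u * g u).
Proof. by move=> cf cg u; apply: cvgM; [exact: cf|exact: cg]. Qed.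

Lemma rx_continuous th : continuous (rx th).
Proof. by apply: continuous_lincomb; [exact: re_continuous|exact: im_continuous]. Qed.
Lemma ry_continuous th : continuous (ry th).
Proof.
rewrite (_ : ry th = fun z => cos th * im z + - sin th * re z); last first.
  by apply/funext => z; rewrite /ry mulNr.
by apply: continuous_lincomb; [exact: im_continuous|exact: re_continuous].
Qed.

Lemma sector_closed th j : closed (sector th j : set (Cline R)).
Proof.
have cge (f : Cline R -> R) : continuous f -> closed [set z | 0 <= f z].
  by move=> cf; apply: (@preimage_closed _ _ f [set r | 0 <= r]); [move=> z _; exact: cf|exact: closed_ge].
have cle (f : Cline R -> R) : continuous f -> closed [set z | f z <= 0].
  by move=> cf; apply: (@preimage_closed _ _ f [set r | r <= 0]); [move=> z _; exact: cf|exact: closed_le].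
have cx := @rx_continuous th; have cy := @ry_continuous th.
rewrite (_ : sector th j = [set z | quadrant j (rx th z) (ry th z)]); last first.
  by apply/seteqP; split=> z /sectorE.
elim/Z4_ind: j; rewrite /quadrant /=; apply: closedI; do ?[exact: cge|exact: cle].
Qed.

Lemma quadE (c : C) z : quad c z =
  (complex.Re c * (re z ^+ 2 - im z ^+ 2) - complex.Im c * (2 * re z * im z)) / 2.
Proof.
have h : c / 2 = ((complex.Re c / 2) +i* (complex.Im c / 2))%C.
  apply: (mulIf (x := 2)); first by rewrite pnatr_eq0.
  rewrite divfK ?pnatr_eq0// mulr_natr mulr2n; apply: complex_ext => /=; lra.
by rewrite /quad h /re /im; case: (z : C) => x y; rewrite expr2 /=; field.
Qed.

(* c e^(2 i th) = qA th c + i qB th c *)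
Definition qA th (c : C) := complex.Re c * (cos th ^+ 2 - sin th ^+ 2)
  - complex.Im c * (2 * cos th * sin th).
Definition qB th (c : C) := complex.Im c * (cos th ^+ 2 - sin th ^+ 2)
  + complex.Re c * (2 * cos th * sin th).

Lemma quad_rot th c z : quad c z =
  qA th c * (rx th z ^+ 2 - ry th z ^+ 2) / 2 - qB th c * (rx th z * ry th z).
Proof. by rewrite quadE (re_rxy th) (im_rxy th) /qA /qB; field. Qed.

Lemma quad_continuous c : continuous (quad c : Cline R -> R).
Proof.
have cr := re_continuous; have ci := im_continuous.
rewrite (_ : quad c = fun u : Cline R =>
    complex.Re c / 2 * (1 * (re u * re u) + - 1 * (im u * im u)) + - complex.Im c * (re u * im u)).
  do ?[apply: continuous_lincomb|apply: continuous_mul] => //.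
by apply/funext => u; rewrite quadE; field.
Qed.

End RotatedCoordinates.

(** * The four functionals of F_sigma *)

Section FsigmaPresentation.
Context {R : realType}.
Local Notation C := R[i].
Implicit Types (th t : R) (sigma : 'Z_4 -> 'M[C]_2).

Definition four_kernel (k : fieldType) (E : lmodType k) (CR CL DU DD : E -> k)
    (q0 q1 x y t : R) : set E := [set v |
  (q0 <= t -> (0 <= x -> CR v = 0) /\ (x <= 0 -> CL v = 0)) /\
  (q1 <= t -> (0 <= y -> DU v = 0) /\ (y <= 0 -> DD v = 0))].

(** Frames based at sector 1 and continued anticlockwise; the value at 0, the class of 4, ends the
    turn, and the step from 0 to 1 is the relation [sigma_prod]. *)
Definition frame sigma (j : 'Z_4) : 'M[C]_2 := match (j : nat) with
  | 0%N => sigma 3%:R *m sigma 2%:R *m sigma 1 | 1%N => 1%:M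
  | 2%N => sigma 1 | _ => sigma 2%:R *m sigma 1 end.

(** The functionals CR, CL, DU, DD: the first coordinate in sectors 1 and 2, the second in sectors 1
    and 3. *)
Definition cright (v : 'cV[C]_2) : C := v 0 0.
Definition cleft sigma (v : 'cV[C]_2) : C := (sigma 1 *m v) 0 0.
Definition dup (v : 'cV[C]_2) : C := v 1 0.
Definition ddown sigma (v : 'cV[C]_2) : C := (sigma 2%:R *m sigma 1 *m v) 1 0.

Lemma qA_numbering th (A : set C) (c : 'I_2 -> C) : numbering A th c ->
  A = [set c 0; c 1] /\ qA th (c 0) < qA th (c 1).
Proof.
move=> [-> H]; split=> //.
pose z : Cline R := (cos th +i* sin th)%C.
have zth : has_arg (z : C) th by exists 1; rewrite // !mul1r.
have ex : rx th z = 1 by rewrite /rx /re /im /= -!expr2 cos2Dsin2.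
have ey : ry th z = 0 by rewrite /ry /re /im /=; ring.
have := H _ zth; rewrite !(quad_rot th) ex ey => ?; lra.
Qed.

Lemma ord2_cases (i : 'I_2) : i = 0 \/ i = 1.
Proof.
by case: (unliftP 0 i) => [m|] ->; [right; rewrite (ord1 m); exact: val_inj|left].
Qed.

Lemma mulmx_ord2 (A : 'M[C]_2) (v : 'cV[C]_2) i :
  (A *m v) i 0 = A i 0 * v 0 0 + A i 1 * v 1 0.
Proof.
rewrite mxE (bigD1 (0 : 'I_2))//= (bigD1 (1 : 'I_2))//= big1 ?addr0// => i0.
by case/andP; have [->|->] := ord2_cases i0.
Qed.

Variable sigma : 'Z_4 -> 'M[C]_2.
Hypothesis sigma_odd : forall j : 'Z_4, odd j -> is_trig_mx (sigma j)^T.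
Hypothesis sigma_even : forall j : 'Z_4, ~~ odd j -> is_trig_mx (sigma j).
Hypothesis sigma_prod : sigma 4%:R *m sigma 3%:R *m sigma 2%:R *m sigma 1 = 1%:M.

Lemma sigma4 : sigma 4%:R = sigma 0.
Proof. by congr sigma; apply: val_inj. Qed.

Lemma sigma_upper (j : 'Z_4) : odd j -> sigma j 1 0 = 0.
Proof. by move=> /sigma_odd/is_trig_mxP/(_ 0 1 isT); rewrite mxE. Qed.
Lemma sigma_lower (j : 'Z_4) : ~~ odd j -> sigma j 0 1 = 0.
Proof. by move=> /sigma_even/is_trig_mxP/(_ 0 1 isT). Qed.

Lemma sigma_unit j : sigma j \in unitmx.
Proof.
have d1 : \det (sigma 0) * \det (sigma 3%:R) * \det (sigma 2%:R) * \det (sigma 1) = 1.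
  by rewrite -!det_mulmx -sigma4 sigma_prod det1.
rewrite unitmxE unitfE; apply/negP => /eqP dj; move: (oner_neq0 C); rewrite -d1.
elim/Z4_ind: j dj => ->; by rewrite ?(mul0r, mulr0) eqxx.
Qed.

Lemma det_ord2 (A : 'M[C]_2) : \det A = A 0 0 * A 1 1 - A 0 1 * A 1 0.
Proof.
rewrite (expand_det_row _ 0) (bigD1 (0 : 'I_2))//= (bigD1 (1 : 'I_2))//= big1; last first.
  by move=> i0; case/andP; have [->|->] := ord2_cases i0.
rewrite addr0 /cofactor !det_mx11 !mxE /= expr0 mul1r.
have -> : lift 0 (0 : 'I_1) = 1 :> 'I_2 by apply: val_inj.
have -> : lift 1 (0 : 'I_1) = 0 :> 'I_2 by apply: val_inj.
by rewrite /= expr1; ring.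
Qed.

Lemma sigma_diag j (i : 'I_2) : sigma j i i != 0.
Proof.
have := sigma_unit j; rewrite unitmxE unitfE det_ord2.
have -> : sigma j 0 1 * sigma j 1 0 = 0 :> C.
  by have [oj|oj] := boolP (odd j); rewrite ?(sigma_upper oj) ?(sigma_lower oj) ?mulr0 ?mul0r.
rewrite subr0 mulf_eq0 negb_or => /andP[h0 h1].
by have [->|->] := ord2_cases i.
Qed.

(** An upper triangular transition multiplies the second coordinate by a nonzero scalar, so its
    vanishing is one condition for both sectors; with [lower_coord] this reduces the eight sector
    coordinates to four functionals. *)
Lemma upper_coord (j : 'Z_4) (v : 'cV[C]_2) : odd j -> (sigma j *m v) 1 0 = 0 <-> v 1 0 = 0 :> C.
Proof.
move=> oj; rewrite mulmx_ord2 sigma_upper// mul0r add0r; split=> [/eqP|->]; last exact: mulr0.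
by rewrite mulf_eq0 (negbTE (sigma_diag _ _)) => /eqP.
Qed.
Lemma lower_coord (j : 'Z_4) (v : 'cV[C]_2) : ~~ odd j -> (sigma j *m v) 0 0 = 0 <-> v 0 0 = 0 :> C.
Proof.
move=> oj; rewrite mulmx_ord2 sigma_lower// mul0r addr0; split=> [/eqP|->]; last exact: mulr0.
by rewrite mulf_eq0 (negbTE (sigma_diag _ _)) => /eqP.
Qed.

Lemma frame_step j : frame sigma (j + 1) = sigma j *m frame sigma j.
Proof.
elim/Z4_ind: j; rewrite /frame /=.
- by rewrite -sigma4 !mulmxA sigma_prod.
- by rewrite mulmx1.
- by [].
- by rewrite !mulmxA.
Qed.

Lemma frame_unit j : frame sigma j \in unitmx.
Proof. by elim/Z4_ind: j; rewrite /frame /= ?unitmx1 ?unitmx_mul ?sigma_unit. Qed.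

Lemma frame_coord10 v : frame_coord (frame sigma) 1 0 v = cright v.
Proof. by rewrite /frame_coord /frame /= mul1mx. Qed.
Lemma frame_coord11 v : frame_coord (frame sigma) 1 1 v = dup v.
Proof. by rewrite /frame_coord /frame /= mul1mx. Qed.
Lemma frame_coord00 v : frame_coord (frame sigma) 0 0 v = 0 <-> cright v = 0.
Proof.
rewrite -frame_coord10 /frame_coord -[1]add0r frame_step -mulmxA.
by split=> /(@lower_coord 0); exact.
Qed.
Lemma frame_coord20 v : frame_coord (frame sigma) 2%:R 0 v = cleft sigma v.
Proof. by []. Qed.
Lemma frame_coord30 v : frame_coord (frame sigma) 3%:R 0 v = 0 <-> cleft sigma v = 0.
Proof.
rewrite -frame_coord20 /frame_coord (_ : 3%:R = 2%:R + 1 :> 'Z_4) ?frame_step -?mulmxA.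
  exact: lower_coord.
by apply: val_inj.
Qed.
Lemma frame_coord21 v : frame_coord (frame sigma) 2%:R 1 v = 0 <-> dup v = 0.
Proof. exact: upper_coord. Qed.
Lemma frame_coord31 v : frame_coord (frame sigma) 3%:R 1 v = ddown sigma v.
Proof. by []. Qed.
Lemma frame_coord01 v : frame_coord (frame sigma) 0 1 v = 0 <-> ddown sigma v = 0.
Proof.
rewrite -frame_coord31 /frame_coord (_ : 0 = 3%:R + 1 :> 'Z_4) ?frame_step -?mulmxA.
  exact: upper_coord.
by apply: val_inj.
Qed.

(** Off the axes there is one quadrant, on an axis two adjacent ones, and at the origin all four,
    reached from 0 through 1, 2, 3. *)
Lemma quadrant_start (x y : R) : exists j0, quadrant j0 x y /\ forall Q : 'Z_4 -> Prop, Q j0 ->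
  (forall j, quadrant j x y -> quadrant (j + 1) x y -> Q j -> Q (j + 1)) ->
  forall j, quadrant j x y -> Q j.
Proof.
have s0 : 0 + 1 = 1 :> 'Z_4 by apply: val_inj.
have s1 : 1 + 1 = 2%:R :> 'Z_4 by apply: val_inj.
have s2 : 2%:R + 1 = 3%:R :> 'Z_4 by apply: val_inj.
have s3 : 3%:R + 1 = 0 :> 'Z_4 by apply: val_inj.
have imp j0 : quadrant j0 x y -> (forall Q : 'Z_4 -> Prop, Q j0 ->
    (quadrant 0 x y -> quadrant 1 x y -> Q 0 -> Q 1) ->
    (quadrant 1 x y -> quadrant 2%:R x y -> Q 1 -> Q 2%:R) ->
    (quadrant 2%:R x y -> quadrant 3%:R x y -> Q 2%:R -> Q 3%:R) ->
    (quadrant 3%:R x y -> quadrant 0 x y -> Q 3%:R -> Q 0) ->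
    [/\ quadrant 0 x y -> Q 0, quadrant 1 x y -> Q 1, quadrant 2%:R x y -> Q 2%:R &
        quadrant 3%:R x y -> Q 3%:R]) -> exists j0, quadrant j0 x y /\ forall Q : 'Z_4 -> Prop, Q j0 ->
  (forall j, quadrant j x y -> quadrant (j + 1) x y -> Q j -> Q (j + 1)) ->
  forall j, quadrant j x y -> Q j.
  move=> q0 H; exists j0; split=> // Q Q0 st.
  have h0 := st 0; have h1 := st 1; have h2 := st 2%:R; have h3 := st 3%:R.
  rewrite s0 in h0; rewrite s1 in h1; rewrite s2 in h2; rewrite s3 in h3.
  have [r0 r1 r2 r3] := H Q Q0 h0 h1 h2 h3.
  by elim/Z4_ind.
have [x0|x0|x0] := ltgtP 0 x; have [y0|y0|y0] := ltgtP 0 y.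
- apply: (imp 1); clear s0 s1 s2 s3 imp; rewrite /quadrant /=; first by split; lra.
  by move=> Q Q0 t0 t1 t2 t3; split=> // -[? ?]; lra.
- apply: (imp 0); clear s0 s1 s2 s3 imp; rewrite /quadrant /=; first by split; lra.
  by move=> Q Q0 t0 t1 t2 t3; split=> // -[? ?]; lra.
- apply: (imp 0); clear s0 s1 s2 s3 imp; rewrite /quadrant /=; first by split; lra.
  move=> Q Q0 t0 t1 t2 t3; split=> // -[? ?]; try lra.
  by apply: t0 => //; split; lra.
- apply: (imp 2%:R); clear s0 s1 s2 s3 imp; rewrite /quadrant /=; first by split; lra.
  by move=> Q Q0 t0 t1 t2 t3; split=> // -[? ?]; lra.
- apply: (imp 3%:R); clear s0 s1 s2 s3 imp; rewrite /quadrant /=; first by split; lra.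
  by move=> Q Q0 t0 t1 t2 t3; split=> // -[? ?]; lra.
- apply: (imp 2%:R); clear s0 s1 s2 s3 imp; rewrite /quadrant /=; first by split; lra.
  move=> Q Q0 t0 t1 t2 t3; split=> // -[? ?]; try lra.
  by apply: t2 => //; split; lra.
- apply: (imp 1); clear s0 s1 s2 s3 imp; rewrite /quadrant /=; first by split; lra.
  move=> Q Q0 t0 t1 t2 t3; split=> // -[? ?]; try lra.
  by apply: t1 => //; split; lra.
- apply: (imp 3%:R); clear s0 s1 s2 s3 imp; rewrite /quadrant /=; first by split; lra.
  move=> Q Q0 t0 t1 t2 t3; split=> // -[? ?]; try lra.
  by apply: t3 => //; split; lra.
- apply: (imp 0); clear s0 s1 s2 s3 imp; rewrite /quadrant /=; first by split; lra.
  move=> Q Q0 t0 t1 t2 t3.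
  have Q1 : Q 1 by apply: t0 => //; split; lra.
  have Q2 : Q 2%:R by apply: t1 => //; split; lra.
  have Q3 : Q 3%:R by apply: t2 => //; split; lra.
  by split.
Qed.

Theorem Fsigma_presented (A : set C) th (F : sheaf C (Cline R * R)%type) :
  is_Fsigma A th sigma F -> exists c : 'I_2 -> C,
    [/\ A = [set c 0; c 1], qA th (c 0) < qA th (c 1) &
    sheaf_presented F (fun p : Cline R * R =>
      four_kernel cright (cleft sigma) dup (ddown sigma)
        (quad (c 0) p.1) (quad (c 1) p.1) (rx th p.1) (ry th p.1) p.2)].
Proof.
move=> [c [/qA_numbering[Ac qc] [alpha [aiso asig]]]]; exists c; split=> //.
have s_start (z : Cline R) : exists j0, sector th j0 z /\ forall Q : 'Z_4 -> Prop, Q j0 ->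
    (forall j, sector th j z -> sector th (j + 1) z -> Q j -> Q (j + 1)) ->
    forall j, sector th j z -> Q j.
  have [j0 [Sj0 H]] := quadrant_start (rx th z) (ry th z).
  exists j0; split; first exact/sectorE.
  move=> Q Q0 st j /sectorE; apply: H => // j' h1 h2; apply: st; exact/sectorE.
(* For odd j the two sectors meet on x = 0, where the second exponent is the smaller, for even j on
   y = 0, where the first is; [sigma j] is upper, respectively lower triangular, so the entry from
   the larger exponent to the smaller is 0 in each case. *)
have tri (j : 'Z_4) z i l : sector th j z -> sector th (j + 1) z ->
    quad (c i) z < quad (c l) z -> sigma j i l = 0.
  have qx : rx th z = 0 -> quad (c 1) z <= quad (c 0) z.
    move=> h; rewrite !(quad_rot th) h; have := sqr_ge0 (ry th z); move: (_ ^+ 2) => y2 ?.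
    suff : qA th (c 0) * y2 <= qA th (c 1) * y2 by lra.
    by apply: ler_wpM2r => //; exact: ltW.
  have qy : ry th z = 0 -> quad (c 0) z <= quad (c 1) z.
    move=> h; rewrite !(quad_rot th) h; have := sqr_ge0 (rx th z); move: (_ ^+ 2) => y2 ?.
    suff : qA th (c 0) * y2 <= qA th (c 1) * y2 by lra.
    by apply: ler_wpM2r => //; exact: ltW.
  have il (i' l' : 'I_2) : (i' = l') \/ (i' = 0 /\ l' = 1) \/ (i' = 1 /\ l' = 0).
    have [->|->] := ord2_cases i'; have [->|->] := ord2_cases l'; tauto.
  move=> /sectorE S1 /sectorE S2 lt.
  have [e|[[e0 e1]|[e0 e1]]] := il i l; first by rewrite e ltxx in lt.
    rewrite e0 e1 in lt *; have [oj|/sigma_lower//] := boolP (odd j).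
    have /qx : rx th z = 0; last by rewrite leNgt lt.
    move: oj S1 S2; elim/Z4_ind: (j) => //= _; rewrite /quadrant /= => -[? ?] [? ?]; lra.
  rewrite e0 e1 in lt *; have [/sigma_upper//|oj] := boolP (odd j).
  have /qy : ry th z = 0; last by rewrite leNgt lt.
  move: oj S1 S2; elim/Z4_ind: (j) => //= _; rewrite /quadrant /= => -[? ?] [? ?]; lra.
have := @glued_presented _ _ (sector th) (fun i => quad (c i)) sigma F alpha (@sector_closed _ th)
  (fun i => @quad_continuous _ (c i)) aiso asig tri s_start (frame sigma) frame_unit frame_step.
apply: sheaf_presented_ext => -[z t] v; rewrite /four_kernel /sector_supp /=.
have S0 := sectorE th 0 z; have S1 := sectorE th 1 z; have S2 := sectorE th 2%:R z.
have S3 := sectorE th 3%:R z; rewrite /quadrant /= in S0 S1 S2 S3.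
have f00 := frame_coord00 v; have f01 := frame_coord01 v; have f10 := frame_coord10 v.
have f11 := frame_coord11 v; have f20 := frame_coord20 v; have f21 := frame_coord21 v.
have f30 := frame_coord30 v; have f31 := frame_coord31 v.
have t0 i : 0 <= t - quad (c i) z <-> quad (c i) z <= t by rewrite subr_ge0.
have tot (a : R) : 0 <= a \/ a <= 0 by have [?|/ltW ?] := leP 0 a; [left|right].
split=> [H|[H0 H1] j i [Sj /t0 ti]].
  have G j i : quad (c i) z <= t -> sector th j z -> frame_coord (frame sigma) j i v = 0.
    by move=> h hj; apply: H; split=> //; exact/t0.
  split=> [/G G0|/G G1]; split=> h.
  - by have [hy|hy] := tot (ry th z); [rewrite -f10; apply/G0/S1|apply/f00/G0/S0].
  - by have [hy|hy] := tot (ry th z); [rewrite -f20; apply/G0/S2|apply/f30/G0/S3].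
  - by have [hx|hx] := tot (rx th z); [rewrite -f11; apply/G1/S1|apply/f21/G1/S2].
  - by have [hx|hx] := tot (rx th z); [apply/f01/G1/S0|rewrite -f31; apply/G1/S3].
have [ei|ei] := ord2_cases i; rewrite ei in ti *; last first.
  have [U D] := H1 ti; elim/Z4_ind: j Sj => [/S0[_ h]|/S1[_ h]|/S2[_ h]|/S3[_ h]].
  - exact/f01/D.
  - by rewrite f11; exact: U.
  - exact/f21/U.
  - by rewrite f31; exact: D.
have [U D] := H0 ti; elim/Z4_ind: j Sj => [/S0[h _]|/S1[h _]|/S2[h _]|/S3[h _]].
- exact/f00/U.
- by rewrite f10; exact: U.
- by rewrite f20; exact: D.
- exact/f30/D.
Qed.

End FsigmaPresentation.

(** * Kernels of four functionals along lines *)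

Section FibreFamilies.
Context {k : fieldType} {R : realType} {E : lmodType k}.

Definition line_family (N : R -> set E) (nu : R -> E) :=
  forall r, exists e v, 0 < e /\ forall r', `|r' - r| < e -> N r' (nu r' - v).

(** Locally [nu] is constant modulo kernels on which X vanishes; [interval_patch] makes X constant
    from a to b. *)
Lemma coord_const (N : R -> set E) (nu : R -> E) (X : E -> k^o) (a b : R) :
  linear X -> line_family N nu -> a <= b ->
  (forall r v, a <= r <= b -> N r v -> X v = 0) -> X (nu a) = X (nu b).
Proof.
move=> Xl fam ab H.
pose P c d := forall r r', a <= r <= b -> a <= r' <= b -> c <= r <= d -> c <= r' <= d ->
  X (nu r) = X (nu r').
suff : P a b by apply; rewrite ?lexx ?ab.
apply: (interval_patch ab).
- by move=> c d c' d' cc dd Pcd r r' ? ? ? ?; apply: Pcd => //; lra.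
- move=> c d c' d' cc cd dd P1 P2 r r' hr hr' h h'.
  have [r1|r1] := leP c' r; have [r2|r2] := leP c' r'.
  + by apply: P2; lra.
  + have [r3|r3] := leP r d; first by apply: P1; lra.
    by transitivity (X (nu c')); [apply: P2; lra|apply: P1; lra].
  + have [r3|r3] := leP r' d; first by apply: P1; lra.
    by transitivity (X (nu c')); [apply: P1; lra|apply: P2; lra].
  + by apply: P1; lra.
- move=> r hr; have [e [v [e0 He]]] := fam r.
  have h r' : a <= r' <= b -> `|r' - r| < e -> X (nu r') = X v.
    by move=> h1 h2; apply/eqP; rewrite -subr_eq0 -(linBf _ _ Xl) (H r')//; exact: He.
  exists (e / 2); first by rewrite divr_gt0.
  move=> r1 r2 h1 h2 h3 h4; rewrite !h// ltr_norml; apply/andP; split; lra.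
Qed.

Lemma coord_const2 (N : R -> set E) (nu : R -> E) (X : E -> k^o) (a b : R) :
  linear X -> line_family N nu ->
  (forall r v, Num.min a b <= r <= Num.max a b -> N r v -> X v = 0) -> X (nu a) = X (nu b).
Proof.
move=> Xl fam; have [ab|/ltW ab] := leP a b => H; last apply: esym;
  exact: (coord_const Xl fam).
Qed.

Definition dual_basis (X Y : E -> k^o) := [/\ linear X, linear Y,
  forall v, X v = 0 -> Y v = 0 -> v = 0 & forall a b, exists v, X v = a /\ Y v = b].

End FibreFamilies.

(** * Monotonicity and extrema of parabolas *)

Section Parabola.
Context {R : realType}.
Implicit Types A B u v : R.

Definition parab A B u := A * u ^+ 2 / 2 + B * u.

Lemma parab_diff A B u v : parab A B v - parab A B u =
  A * (v - u) ^+ 2 / 2 + (A * u + B) * (v - u).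
Proof. by rewrite /parab; field. Qed.

Lemma parab0 A B : parab A B 0 = 0.
Proof. by rewrite /parab; ring. Qed.

Lemma parab_right A B u v : 0 < A -> 0 <= A * u + B -> u <= v -> parab A B u <= parab A B v.
Proof.
move=> A0 d uv; rewrite -subr_ge0 parab_diff addr_ge0// ?divr_ge0// mulr_ge0 ?sqr_ge0 ?subr_ge0//.
exact: ltW.
Qed.

Lemma parab_left A B u v : 0 < A -> A * u + B <= 0 -> v <= u -> parab A B u <= parab A B v.
Proof.
move=> A0 d uv; rewrite -subr_ge0 parab_diff addr_ge0//.
  by rewrite divr_ge0// mulr_ge0 ?sqr_ge0// ltW.
by rewrite mulr_le0// subr_le0.
Qed.

Lemma parab_min A B u : 0 < A -> - B ^+ 2 / (2 * A) <= parab A B u.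
Proof.
move=> A0; have -> : - B ^+ 2 / (2 * A) = parab A B (- (B / A)).
  by rewrite /parab; field; rewrite gt_eqF.
have e : A * - (B / A) + B = 0 by field; rewrite gt_eqF.
have [h|/ltW h] := leP (- (B / A)) u; [apply: parab_right|apply: parab_left] => //; rewrite e//.
Qed.

Lemma parab_argmin A B : 0 < A -> parab A B (- (B / A)) = - B ^+ 2 / (2 * A).
Proof. by move=> A0; rewrite /parab; field; rewrite gt_eqF. Qed.

Lemma parab_between A B u v w c : 0 < A -> Num.min u v <= w <= Num.max u v ->
  parab A B u <= c -> parab A B v <= c -> parab A B w <= c.
Proof.
move=> A0 /andP[h1 h2] hu hv; have [d|d] := leP 0 (A * w + B).
  by apply: le_trans (parab_right A0 d h2) _; case: (leP u v).
by apply: le_trans (parab_left A0 (ltW d) h1) _; case: (leP u v).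
Qed.

End Parabola.

(** * Kernels for two quadratic exponents *)

Section Geometry.
Context {k : fieldType} {R : realType} {E : lmodType k}.
Variables (CR CL DU DD : E -> k^o).
Hypothesis RU : dual_basis CR DU.
Hypothesis LU : dual_basis CL DU.
Hypothesis RD : dual_basis CR DD.
Hypothesis LD : dual_basis CL DD.
Local Notation ker4 := (four_kernel (R := R) CR CL DU DD).

Let CR_lin : linear CR. Proof. by case: RU. Qed.
Let CL_lin : linear CL. Proof. by case: LU. Qed.
Let DU_lin : linear DU. Proof. by case: RU. Qed.
Let DD_lin : linear DD. Proof. by case: RD. Qed.

Lemma ker4_lin q0 q1 x y t a u v : ker4 q0 q1 x y t u -> ker4 q0 q1 x y t v ->
  ker4 q0 q1 x y t (a *: u + v).
Proof.
move=> [u0 u1] [v0 v1]; split=> h.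
  have [u0r u0l] := u0 h; have [v0r v0l] := v0 h.
  by split=> hx; rewrite ?CR_lin ?CL_lin ?u0r ?u0l ?v0r ?v0l// scaler0 addr0.
have [u1r u1l] := u1 h; have [v1r v1l] := v1 h.
by split=> hx; rewrite ?DU_lin ?DD_lin ?u1r ?u1l ?v1r ?v1l// scaler0 addr0.
Qed.

Lemma ker4_0 q0 q1 x y t : ker4 q0 q1 x y t 0.
Proof. by split=> _; split=> _; rewrite lin0. Qed.

Lemma ker4_eq0 q0 q1 (x y t : R) v : q0 <= t -> q1 <= t -> ker4 q0 q1 x y t v -> v = 0.
Proof.
move=> h0 h1 [/(_ h0)[cr cl] /(_ h1)[du dd]].
have [_ _ iRU _] := RU; have [_ _ iLU _] := LU; have [_ _ iRD _] := RD; have [_ _ iLD _] := LD.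
have [x0|/ltW x0] := leP 0 x; have [y0|/ltW y0] := leP 0 y.
- by apply: iRU; [exact: cr|exact: du].
- by apply: iRD; [exact: cr|exact: dd].
- by apply: iLU; [exact: cl|exact: du].
- by apply: iLD; [exact: cl|exact: dd].
Qed.

Lemma ker4_all q0 q1 (x y t : R) v : t < q0 -> t < q1 -> ker4 q0 q1 x y t v.
Proof. by move=> h0 h1; split; rewrite leNgt ?h0 ?h1. Qed.

(* Only the condition on C constrains u, and only the one on D constrains w. *)
Lemma ker4_split q0 q1 q0' q1' (x y x' y' t t' : R) v :
  (x != 0) || (t < q0) -> (y' != 0) || (t' < q1') -> t < q1 -> t' < q0' ->
  exists u w, [/\ v = u + w, ker4 q0 q1 x y t u & ker4 q0' q1' x' y' t' w].
Proof.
have [_ _ _ sRU] := RU; have [_ _ _ sLU] := LU; have [_ _ _ sRD] := RD; have [_ _ _ sLD] := LD.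
move=> hx hy t1 t0.
have [tq0|tq0] := ltP t q0.
  by exists v, 0; split; [rewrite addr0|exact: ker4_all|exact: ker4_0].
have [tq1|tq1] := ltP t' q1'.
  by exists 0, v; split; [rewrite add0r|exact: ker4_0|exact: ker4_all].
move: hx hy; rewrite !ltNge tq0 tq1 !orbF => x0 y0.
pose C := if 0 <= x then CR else CL; pose D := if 0 <= y' then DU else DD.
have [u [Cu Du]] : exists u, C u = 0 /\ D u = D v.
  by rewrite /C /D; case: (0 <= x); case: (0 <= y').
exists u, (v - u); split; first by rewrite addrC subrK.
  split=> h; last by move: h; rewrite leNgt t1.
  have xx : x <= 0 -> 0 <= x -> False by move=> h1 h2; move: x0; rewrite eq_le h1 h2.
  move: Cu; rewrite /C; have [h1|h1] := leP 0 x => e; split=> // h2.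
  by case: (xx h2 h1).
split=> h; first by move: h; rewrite leNgt t0.
have yy : y' <= 0 -> 0 <= y' -> False by move=> h1 h2; move: y0; rewrite eq_le h1 h2.
have Dl : linear D by rewrite /D; case: (0 <= y').
have : D (v - u) = 0 by rewrite (linBf _ _ Dl) Du subrr.
rewrite /D; have [h1|h1] := leP 0 y' => e; split=> // h2.
by case: (yy h2 h1).
Qed.

Variables (kap de1 de2 : R).
Hypothesis kap0 : 0 < kap.
Hypothesis kapde : kap < de1.
Let de0 : 0 < de1. Proof. exact: lt_trans kap0 kapde. Qed.

Definition qc (x y : R) := kap * (x ^+ 2 - y ^+ 2) / 2.
Definition qd (x y : R) := de1 * (x ^+ 2 - y ^+ 2) / 2 - de2 * (x * y).

(* With z = e^(i th0) (x + i y), e^(i th0) w = a + i b, c e^(2 i th0) = kap and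
   d e^(2 i th0) = de1 + i de2, one has Re (z w) = x a - y b; Mc and Md are the
   maxima over y of q + Re (z w), and hc and hd the minima of Mc and Md over x. *)
Definition Mc (a b x : R) := x * a + kap * x ^+ 2 / 2 + b ^+ 2 / (2 * kap).
Definition Md (a b x : R) := x * a + de1 * x ^+ 2 / 2 + (de2 * x + b) ^+ 2 / (2 * de1).

Definition hc (a b : R) := (b ^+ 2 - a ^+ 2) / (2 * kap).
Definition hd (a b : R) := (de1 * (b ^+ 2 - a ^+ 2) - 2 * de2 * (a * b)) / (2 * (de1 ^+ 2 + de2 ^+ 2)).

(** * The fibre in the direction y *)

Section LineY.
Variables (a b x t : R).
Let N y := ker4 (qc x y) (qd x y) x y (t - (x * a - y * b)).
Let Pc y := qc x y <= t - (x * a - y * b).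
Let Pd y := qd x y <= t - (x * a - y * b).

Lemma PcE y : Pc y = (x * a + kap * x ^+ 2 / 2 - t <= parab kap b y).
Proof. by rewrite /Pc /qc /parab; apply/idP/idP => ?; lra. Qed.
Lemma PdE y : Pd y = (x * a + de1 * x ^+ 2 / 2 - t <= parab de1 (de2 * x + b) y).
Proof. by rewrite /Pd /qd /parab; apply/idP/idP => ?; nra. Qed.

(** At y = 0 the exponents are kap x^2 / 2 and de1 x^2 / 2, and kap < de1: on the axis where DU
    gives way to DD, C is active whenever D is. *)
Lemma Pd0_Pc0 : Pd 0 -> Pc 0.
Proof.
rewrite PcE PdE !parab0 => h.
have : kap * x ^+ 2 <= de1 * x ^+ 2 by rewrite ler_wpM2r ?sqr_ge0// ltW.
lra.
Qed.

(** By [PcE] activity is a superlevel set of a convex parabola, so it lasts to infinity on at least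
    one side of any active point. *)
Lemma Pc_ray r : Pc r -> (forall r', r <= r' -> Pc r') \/ (forall r', r' <= r -> Pc r').
Proof.
rewrite PcE => h; have [d|/ltW d] := leP 0 (kap * r + b); [left|right] => r' rr'; rewrite PcE.
  by apply: le_trans h _; exact: parab_right.
by apply: le_trans h _; exact: parab_left.
Qed.
Lemma Pd_ray r : Pd r -> (forall r', r <= r' -> Pd r') \/ (forall r', r' <= r -> Pd r').
Proof.
rewrite PdE => h; have [d|/ltW d] := leP 0 (de1 * r + (de2 * x + b)); [left|right] => r' rr'; rewrite PdE.
  by apply: le_trans h _; exact: parab_right.
by apply: le_trans h _; exact: parab_left.
Qed.

Variable nu : R -> E.
Hypothesis fam : line_family N nu.
Hypothesis ninf : exists M, forall r, M < `|r| -> N r (nu r).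

Let coord_right (X : E -> k^o) r : linear X ->
  (forall r' v, r <= r' -> N r' v -> X v = 0) -> X (nu r) = 0.
Proof.
move=> Xl H; have [M HM] := ninf.
pose s := Num.max r (`|M| + 1).
have rs : r <= s by rewrite le_max lexx.
have Ms : `|M| + 1 <= s by rewrite le_max lexx orbT.
have -> : X (nu r) = X (nu s).
  by apply: (coord_const Xl fam rs) => r' v /andP[h _]; exact: H.
by apply: (H s) => //; apply: HM; have := ler_norm M; have := ler_norm s; lra.
Qed.
Let coord_left (X : E -> k^o) r : linear X ->
  (forall r' v, r' <= r -> N r' v -> X v = 0) -> X (nu r) = 0.
Proof.
move=> Xl H; have [M HM] := ninf.
pose s := Num.min r (- (`|M| + 1)).
have rs : s <= r by rewrite ge_min lexx.
have Ms : s <= - (`|M| + 1) by rewrite ge_min lexx orbT.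
have <- : X (nu s) = X (nu r).
  by apply: (coord_const Xl fam rs) => r' v /andP[_ h]; exact: H.
by apply: (H s) => //; apply: HM; have := ler_norm M; have := ler_norm (- s); rewrite normrN; lra.
Qed.

Let coord_C (X : E -> k^o) r : linear X -> (forall r' v, Pc r' -> N r' v -> X v = 0) ->
  Pc r -> X (nu r) = 0.
Proof.
move=> Xl H /Pc_ray[h|h].
  by apply: coord_right => // r' v /h; exact: H.
by apply: coord_left => // r' v /h; exact: H.
Qed.

Lemma line_y_family r : N r (nu r).
Proof.
split=> Pr.
  split=> hx; apply: coord_C => // r' v P' [/(_ P')[h1 h2] _]; [exact: h1|exact: h2].
(* An active ray of D may cross y = 0, where the functional changes. Then D, hence C, is active at
   0, and a full basis of the dual vanishes on [nu 0]. *)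
have nu0 : Pd 0 -> (forall r', 0 <= r' -> Pd r') \/ (forall r', r' <= 0 -> Pd r') -> nu 0 = 0.
  move=> Pd0 ray; have Pc0 := Pd0_Pc0 Pd0.
  have [cr cl] : (0 <= x -> CR (nu 0) = 0) /\ (x <= 0 -> CL (nu 0) = 0).
    split=> hx; apply: coord_C => // r' v P' [/(_ P')[h1 h2] _]; [exact: h1|exact: h2].
  have [_ _ iRU _] := RU; have [_ _ iLU _] := LU; have [_ _ iRD _] := RD; have [_ _ iLD _] := LD.
  case: ray => ray.
    have du : DU (nu 0) = 0.
      by apply: coord_right => // r' v r0 [_ /(_ (ray _ r0))[h _]]; exact: h.
    by have [hx|/ltW hx] := leP 0 x; [apply: iRU => //; exact: cr|apply: iLU => //; exact: cl].
  have dd : DD (nu 0) = 0.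
    by apply: coord_left => // r' v r0 [_ /(_ (ray _ r0))[_ h]]; exact: h.
  by have [hx|/ltW hx] := leP 0 x; [apply: iRD => //; exact: cr|apply: iLD => //; exact: cl].
split=> hr; have [ray|ray] := Pd_ray Pr.
- apply: coord_right => // r' v r0 [_ /(_ (ray _ r0))[h _]]; apply: h; exact: le_trans r0.
- have e0 : nu 0 = 0 by apply: nu0; [exact: ray|right=> r' h; apply: ray; lra].
  have <- : DU (nu 0) = DU (nu r).
    apply: (coord_const DU_lin fam hr) => r' v /andP[h1 h2] [_ /(_ (ray _ h2))[h _]]; exact: h.
  by rewrite e0 lin0.
- have e0 : nu 0 = 0 by apply: nu0; [exact: ray|left=> r' h; apply: ray; lra].
  have -> : DD (nu r) = DD (nu 0).
    apply: (coord_const DD_lin fam hr) => r' v /andP[h1 h2] [_ /(_ (ray _ h1))[_ h]]; exact: h.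
  by rewrite e0 lin0.
- apply: coord_left => // r' v r0 [_ /(_ (ray _ r0))[_ h]]; apply: h; exact: le_trans hr.
Qed.

End LineY.

(** An exponent is active on the whole fibre exactly when its maximum is at most t; otherwise it is
    inactive at the place of its maximum and puts no condition there. The exponent of C has its
    maximum at y = - b / kap, whose sign is that of - b: hence - b in place of y. *)
Lemma line_y_span a b x t v :
  ker4 (Mc a b x) (Md a b x) x (- b) t v <->
  lspan [set w | exists y, ker4 (qc x y) (qd x y) x y (t - (x * a - y * b)) w] v.
Proof.
have Pc_top y : Mc a b x <= t -> qc x y <= t - (x * a - y * b).
  move=> h; rewrite PcE; apply: le_trans (parab_min b y kap0); move: h; rewrite /Mc; lra.
have Pd_top y : Md a b x <= t -> qd x y <= t - (x * a - y * b).
  move=> h; rewrite PdE; apply: le_trans (parab_min (de2 * x + b) y de0); move: h; rewrite /Md; lra.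
have nPc : t < Mc a b x -> t - (x * a - - (b / kap) * b) < qc x (- (b / kap)).
  move=> h; rewrite ltNge PcE -ltNge parab_argmin//; move: h; rewrite /Mc; lra.
have nPd : t < Md a b x -> t - (x * a - - ((de2 * x + b) / de1) * b) < qd x (- ((de2 * x + b) / de1)).
  move=> h; rewrite ltNge PdE -ltNge parab_argmin//; move: h; rewrite /Md; lra.
split=> [[v0 v1]|].
  have one u w y : ker4 (qc x y) (qd x y) x y (t - (x * a - y * b)) u ->
      lspan [set w | exists y, ker4 (qc x y) (qd x y) x y (t - (x * a - y * b)) w] w ->
      lspan [set w | exists y, ker4 (qc x y) (qd x y) x y (t - (x * a - y * b)) w] (u + w).
    by move=> h hw; rewrite -[u]scale1r; apply: lspan_cons => //; exists y.
  have [tc|tc] := leP (Mc a b x) t; have [td|td] := leP (Md a b x) t.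
  - rewrite (@ker4_eq0 (Mc a b x) (Md a b x) x (- b) t v)//; exact: lspan0.
  - rewrite -[v]addr0; apply: (one _ _ (- ((de2 * x + b) / de1))); last exact: lspan0.
    by split=> h; [exact: v0|move: h; rewrite leNgt nPd].
  - rewrite -[v]addr0; apply: (one _ _ (- (b / kap))); last exact: lspan0.
    split=> h; first by move: h; rewrite leNgt nPc.
    have [du dd] := v1 td; rewrite oppr_ge0 oppr_le0.
    by split=> hb; [apply: du|apply: dd]; move: hb;
      rewrite ?pmulr_lle0 ?pmulr_lge0 ?invr_gt0// ?oppr_ge0 ?oppr_le0.
  (* Both maxima exceed t: v is split between the two places of maximum, with D inactive at the
     first and C at the second. For x = 0 or b = 0 the side condition follows from kap < de1, which
     makes the other exponent inactive as well. *)
  have := @ker4_split (qc x (- ((de2 * x + b) / de1))) (qd x (- ((de2 * x + b) / de1)))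
    (qc x (- (b / kap))) (qd x (- (b / kap))) x (- ((de2 * x + b) / de1)) x (- (b / kap))
    (t - (x * a - - ((de2 * x + b) / de1) * b)) (t - (x * a - - (b / kap) * b)) v.
  case.
  - have [x0|//] := eqVneq x 0; have := nPd td; set y := - ((de2 * x + b) / de1).
    move: y => y; rewrite /= x0 /qd /qc => h; have y2 := sqr_ge0 y.
    have : kap * y ^+ 2 <= de1 * y ^+ 2 by rewrite ler_wpM2r// ltW.
    by move: h; rewrite expr0n /=; lra.
  - have [b0|b0] := eqVneq b 0.
      rewrite b0 mul0r oppr0 eqxx /=; rewrite ltNge -/(qd _ _); apply/negP => h.
      have := @Pd0_Pc0 a b x t; rewrite b0 => /(_ h); rewrite leNgt.
      by have := nPc tc; rewrite b0 mul0r oppr0 => ->.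
    by rewrite oppr_eq0 mulf_neq0// invr_neq0// gt_eqF.
  - exact: nPd.
  - exact: nPc.
  - move=> u [w [-> hu hw]]; apply: (one _ _ _ hu); rewrite -[w]addr0.
    by apply: (one _ _ _ hw); exact: lspan0.
elim=> [|c s u [y Hy] _ IH]; first exact: ker4_0.
apply: ker4_lin IH; have [s0 s1] := Hy; split=> h.
  by apply: s0; exact: Pc_top.
(* D is active everywhere, so C is active at y = 0 and, by the slope of [parab] at 0, on the side of
   0 away from - b / kap. A vector of a fibre on that side is 0; on the other side y and - b have
   the same sign. *)
have [du dd] := s1 (Pd_top y h); have Pd0 := Pd_top 0 h; have Pc0 := Pd0_Pc0 Pd0.
rewrite oppr_ge0 oppr_le0; split=> hb.
  have [y0|/ltW y0] := leP 0 y; first exact: du.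
  rewrite (@ker4_eq0 _ _ x y _ s _ (Pd_top y h) Hy) ?lin0//.
  rewrite PcE; move: Pc0; rewrite PcE => /le_trans; apply; apply: parab_left => //.
  by rewrite mulr0 add0r.
have [y0|/ltW y0] := leP y 0; first exact: dd.
rewrite (@ker4_eq0 _ _ x y _ s _ (Pd_top y h) Hy) ?lin0//.
rewrite PcE; move: Pc0; rewrite PcE => /le_trans; apply; apply: parab_right => //.
by rewrite mulr0 add0r.
Qed.

(** * The fibre in the direction x *)

Section LineX.
Variables (a b t : R).
Let N x := ker4 (Mc a b x) (Md a b x) x (- b) t.
Let dd0 : 0 < de1 ^+ 2 + de2 ^+ 2.
Proof. by rewrite ltr_wpDr ?sqr_ge0// exprn_gt0. Qed.
Let A := (de1 ^+ 2 + de2 ^+ 2) / de1.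
Let B := a + de2 * b / de1.
Let A0 : 0 < A. Proof. by rewrite divr_gt0. Qed.

Lemma McE x : Mc a b x = parab kap a x + b ^+ 2 / (2 * kap).
Proof. by rewrite /Mc /parab; ring. Qed.
Lemma MdE x : Md a b x = parab A B x + b ^+ 2 / (2 * de1).
Proof. by rewrite /Md /parab /A /B; field; rewrite gt_eqF. Qed.

Lemma hc_min x : hc a b <= Mc a b x.
Proof. by rewrite McE; have := parab_min a x kap0; rewrite /hc; lra. Qed.
Lemma hc_argmin : hc a b = Mc a b (- (a / kap)).
Proof. by rewrite McE parab_argmin// /hc; ring. Qed.

Let hdE : hd a b = - B ^+ 2 / (2 * A) + b ^+ 2 / (2 * de1).
Proof. by rewrite /hd /A /B; field; rewrite !gt_eqF// mulr_gt0. Qed.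
Lemma hd_min x : hd a b <= Md a b x.
Proof. by rewrite MdE hdE; have := parab_min B x A0; lra. Qed.
Lemma hd_argmin : hd a b = Md a b (- (B / A)).
Proof. by rewrite MdE parab_argmin// hdE. Qed.

Let b_inv : b ^+ 2 / (2 * de1) <= b ^+ 2 / (2 * kap).
Proof.
rewrite ler_wpM2l ?sqr_ge0// lef_pV2 ?posrE ?mulr_gt0// ler_pM2l//; exact: ltW.
Qed.

(** Maxima over y put kap and de1 into denominators and so reverse the order of the exponents: on
    the axis x = 0, where CR gives way to CL, D is active whenever C is. *)
Let Md0 : Md a b 0 <= Mc a b 0.
Proof. by rewrite McE MdE !parab0; have := b_inv; lra. Qed.

(** A convex exponent is active somewhere exactly when its minimum is at most t, and that of Mc is
    at x = - a / kap, which has the sign of - a. If C is active on the other side of 0, it is active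
    at 0 by monotonicity, so D is too and v = 0. *)
Lemma line_x_ker v : ker4 (hc a b) (hd a b) (- a) (- b) t v <-> forall x, N x v.
Proof.
split=> [Nv x|H].
  have [v0 v1] := Nv; split=> h; last by apply: v1; exact: le_trans (hd_min x) h.
  have hct := le_trans (hc_min x) h; have [cr cl] := v0 hct.
  have main : Mc a b 0 <= t -> v = 0.
    move=> h0; apply: (ker4_eq0 hct _ Nv); apply: le_trans (hd_min 0) _; exact: le_trans Md0 h0.
  rewrite oppr_ge0 oppr_le0 in cr cl.
  split=> x0.
    have [a0|/ltW a0] := leP a 0; first exact: cr.
    rewrite main ?(lin0 CR_lin)//; apply: le_trans _ h; rewrite !McE lerD2r; apply: parab_right => //.
    by rewrite mulr0 add0r.
  have [a0|/ltW a0] := leP 0 a; first exact: cl.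
  rewrite main ?(lin0 CL_lin)//; apply: le_trans _ h; rewrite !McE lerD2r; apply: parab_left => //.
  by rewrite mulr0 add0r.
split=> h.
  have [/(_ _)[]] := H (- (a / kap)); first by rewrite -hc_argmin.
  move=> cr cl _; split=> ha; [apply: cr|apply: cl].
    by rewrite -mulNr mulr_ge0// invr_ge0 ltW.
  by rewrite -mulNr mulr_le0_ge0// invr_ge0 ltW.
by have [_ /(_ _)] := H (- (B / A)); apply; rewrite -hd_argmin.
Qed.

Variable nu : R -> E.
Hypothesis fam : line_family N nu.

Let Ic_between u v w : Num.min u v <= w <= Num.max u v ->
  Mc a b u <= t -> Mc a b v <= t -> Mc a b w <= t.
Proof.
move=> uvw; rewrite !McE -![_ + b ^+ 2 / _ <= _]lerBrDr => hu hv; exact: (parab_between kap0 uvw hu hv).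
Qed.
Let Id_between u v w : Num.min u v <= w <= Num.max u v ->
  Md a b u <= t -> Md a b v <= t -> Md a b w <= t.
Proof.
move=> uvw; rewrite !MdE -![_ + b ^+ 2 / _ <= _]lerBrDr => hu hv; exact: (parab_between A0 uvw hu hv).
Qed.

Let CR_const u v : 0 <= u -> 0 <= v -> Mc a b u <= t -> Mc a b v <= t -> CR (nu u) = CR (nu v).
Proof.
move=> u0 v0 hu hv; apply: (coord_const2 CR_lin fam) => r w uvw [/(_ (Ic_between uvw hu hv))[h _] _].
by apply: h; have /andP[] := uvw; rewrite ge_min => /orP[] h' _; exact: le_trans h'.
Qed.
Let CL_const u v : u <= 0 -> v <= 0 -> Mc a b u <= t -> Mc a b v <= t -> CL (nu u) = CL (nu v).
Proof.
move=> u0 v0 hu hv; apply: (coord_const2 CL_lin fam) => r w uvw [/(_ (Ic_between uvw hu hv))[_ h] _].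
by apply: h; have /andP[_] := uvw; rewrite le_max => /orP[] /le_trans; apply.
Qed.
Let DU_const u v : 0 <= - b -> Md a b u <= t -> Md a b v <= t -> DU (nu u) = DU (nu v).
Proof.
move=> b0 hu hv; apply: (coord_const2 DU_lin fam) => r w uvw [_ /(_ (Id_between uvw hu hv))[h _]].
exact: h.
Qed.
Let DD_const u v : - b <= 0 -> Md a b u <= t -> Md a b v <= t -> DD (nu u) = DD (nu v).
Proof.
move=> b0 hu hv; apply: (coord_const2 DD_lin fam) => r w uvw [_ /(_ (Id_between uvw hu hv))[_ h]].
exact: h.
Qed.

Let sub0 (X : E -> k^o) u v : linear X -> X u = X v -> X (u - v) = 0.
Proof. by move=> Xl e; rewrite (linBf _ _ Xl) e subrr. Qed.

(** Where an exponent is active, a functional that stays in force is constant along [nu]. The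
    constants for C and D are matched by one v: the value of [nu] at 0 or at a common active point
    if there is one, otherwise a vector with prescribed C and D, which a dual basis provides. *)
Lemma line_x_family : exists v, forall x, N x (nu x - v).
Proof.
have D_part u x : Md a b u <= t -> Md a b x <= t ->
    (0 <= - b -> DU (nu x - nu u) = 0) /\ (- b <= 0 -> DD (nu x - nu u) = 0).
  by move=> hu hx; split=> hb; apply: sub0 => //; [exact: DU_const|exact: DD_const].
have [c0|c0] := leP (Mc a b 0) t.
  exists (nu 0) => x; split=> hx; last by apply: D_part hx; exact: le_trans Md0 c0.
  by split=> x0; apply: sub0 => //; [exact: CR_const|exact: CL_const].
(* The interval {x | Mc a b x <= t} avoids 0, hence lies on one side of it. *)
have same u x : Mc a b u <= t -> Mc a b x <= t -> (0 < u /\ 0 < x) \/ (u < 0 /\ x < 0).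
  move=> hu hx; have nb : ~ (Num.min u x <= 0 <= Num.max u x).
    by move=> /Ic_between/(_ hu hx); rewrite leNgt c0.
  have [u0|u0|u0] := ltgtP 0 u; have [x0|x0|x0] := ltgtP 0 x; try by [left|right].
  - by case: nb; rewrite ge_min le_max (ltW u0) (ltW x0) orbT.
  - by case: nb; rewrite ge_min le_max -x0 lexx !orbT.
  - by case: nb; rewrite ge_min le_max (ltW u0) (ltW x0) orbT.
  - by case: nb; rewrite ge_min le_max -x0 lexx !orbT.
  - by case: nb; rewrite ge_min le_max -u0 lexx.
  - by case: nb; rewrite ge_min le_max -u0 lexx.
  - by case: nb; rewrite ge_min le_max -u0 lexx.
have C_part u x : Mc a b u <= t -> Mc a b x <= t ->
    (0 <= x -> CR (nu x - nu u) = 0) /\ (x <= 0 -> CL (nu x - nu u) = 0).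
  move=> hu hx; have [[u0 x0]|[u0 x0]] := same u x hu hx; split=> h.
  - by apply: sub0 => //; apply: CR_const => //; exact: ltW.
  - by move: h; rewrite leNgt x0.
  - by move: h; rewrite leNgt x0.
  - by apply: sub0 => //; apply: CL_const => //; exact: ltW.
have [[u [hcu hdu]]|dis] := pselect (exists u, Mc a b u <= t /\ Md a b u <= t).
  by exists (nu u) => x; split=> hx; [exact: C_part|exact: D_part].
have [[xc hxc]|nc] := pselect (exists x, Mc a b x <= t); last first.
  have [[xd hxd]|nd] := pselect (exists x, Md a b x <= t).
    by exists (nu xd) => x; split=> hx; [case: nc; exists x|exact: D_part].
  by exists 0 => x; split=> hx; [case: nc; exists x|case: nd; exists x].
have [[xd hxd]|nd] := pselect (exists x, Md a b x <= t); last first.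
  by exists (nu xc) => x; split=> hx; [exact: C_part|case: nd; exists x].
(* For b = 0 one has Mc <= Md, so [xd] would be a common active point; b <> 0 leaves only one of DU
   and DD in force. *)
have b0 : b != 0.
  apply/eqP => b0; case: dis; exists xd; split=> //; apply: le_trans _ hxd.
  rewrite /Mc /Md b0 expr0n /= mul0r addr0 addr0.
  have := sqr_ge0 (de2 * xd); have : kap * xd ^+ 2 <= de1 * xd ^+ 2.
    by rewrite ler_wpM2r ?sqr_ge0// ltW.
  move=> h1 h2; have : 0 <= (de2 * xd) ^+ 2 / (2 * de1) by rewrite divr_ge0// mulr_ge0// ltW.
  by move: h1; lra.
pose C := if 0 <= xc then CR else CL; pose D := if 0 <= - b then DU else DD.
have [_ _ _ sRU] := RU; have [_ _ _ sLU] := LU; have [_ _ _ sRD] := RD; have [_ _ _ sLD] := LD.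
have [v [Cv Dv]] : exists v, C v = C (nu xc) /\ D v = D (nu xd).
  by rewrite /C /D; case: (0 <= xc); case: (0 <= - b).
exists v => x; split=> hx.
  rewrite /C in Cv; have [[u0 x0]|[u0 x0]] := same xc x hxc hx; split=> h.
  - by apply: sub0 => //; move: Cv; rewrite (ltW u0) => ->; apply: CR_const => //; exact: ltW.
  - by move: h; rewrite leNgt x0.
  - by move: h; rewrite leNgt x0.
  - by apply: sub0 => //; move: Cv; rewrite leNgt u0 /= => ->; apply: CL_const => //; exact: ltW.
split=> hb; apply: sub0 => //; move: Dv; rewrite /D.
  by rewrite hb => ->; exact: DU_const.
have -> : (0 <= - b) = false.
  by apply/negP => hb'; case/eqP: b0; apply/eqP; rewrite -oppr_eq0 eq_le hb hb'.
by move=> ->; exact: DD_const.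
Qed.

End LineX.

Lemma line_x_proper (B T : R) : exists M, forall a b t x, `|a| <= B -> t <= T -> M < `|x| ->
  t < Mc a b x /\ t < Md a b x.
Proof.
(* From |x| > 1 and kap |x| / 2 > |B| + |T| one gets x a + kap x^2 / 2 >= |x| (kap |x| / 2 - |B|) >
   |T|; the remaining squares in Mc and Md are nonnegative, and de1 > kap. *)
exists (1 + 2 * (`|B| + `|T|) / kap) => a b t x aB tT Mx.
have B0 : B <= `|B| by exact: ler_norm.
have T0 : T <= `|T| by exact: ler_norm.
have nT : 0 <= `|T| by []. have nB : 0 <= `|B| by [].
have h0 : 0 <= 2 * (`|B| + `|T|) / kap by rewrite divr_ge0// ?mulr_ge0 ?addr_ge0// ltW.
have x1 : 1 < `|x| by lra.
have h1 : 2 * (`|B| + `|T|) < kap * `|x|.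
  have : 2 * (`|B| + `|T|) / kap < `|x| by lra.
  by rewrite ltr_pdivrMr// [X in _ < X]mulrC.
have xa : - (`|x| * `|B|) <= x * a.
  have : `|x * a| <= `|x| * `|B| by rewrite normrM ler_wpM2l//; lra.
  by rewrite ler_norml => /andP[].
have h2 : `|T| < x * a + kap * x ^+ 2 / 2.
  have -> : x ^+ 2 = `|x| ^+ 2 by rewrite real_normK ?num_real.
  have : `|x| * (2 * (`|B| + `|T|)) < `|x| * (kap * `|x|) by rewrite ltr_pM2l//; lra.
  have : 1 * `|T| <= `|x| * `|T| by rewrite ler_wpM2r// ltW.
  by rewrite expr2; lra.
have h3 : kap * x ^+ 2 <= de1 * x ^+ 2 by rewrite ler_wpM2r ?sqr_ge0// ltW.
have h4 : 0 <= b ^+ 2 / (2 * kap) by rewrite divr_ge0 ?sqr_ge0// mulr_ge0// ltW.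
have h5 : 0 <= (de2 * x + b) ^+ 2 / (2 * de1) by rewrite divr_ge0 ?sqr_ge0// mulr_ge0// ltW.
by split; rewrite /Mc /Md; lra.
Qed.

(** * The fibre of the convolution *)

Section HalfLine.
Variables (q0 q1 x y t a : R).
Let N r : set E := [set v | a <= r -> ker4 q0 q1 x y (t - r) v].

Lemma half_line_ker v : ker4 q0 q1 x y (t - a) v <-> forall r, N r v.
Proof.
split=> [[v0 v1] r ar|H]; last exact: H.
by split=> h; [apply: v0|apply: v1]; lra.
Qed.

(** The kernel grows with r, as t - r decreases: a functional in force at r is in force from a to r,
    so [nu r] can be compared with [nu a]. *)
Lemma half_line_family nu : line_family N nu -> exists v, forall r, N r (nu r - v).
Proof.
move=> fam; exists (nu a) => r ar.
have sub0 (X : E -> k^o) : linear X -> (forall r' v, r' <= r -> a <= r' ->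
    ker4 q0 q1 x y (t - r') v -> X v = 0) -> X (nu r - nu a) = 0.
  move=> Xl H; rewrite (linBf _ _ Xl); apply/eqP; rewrite subr_eq0; apply/eqP; apply: esym.
  apply: (coord_const Xl fam ar) => r' v /andP[h1 h2] /(_ h1); exact: H.
split=> h; split=> hx; apply: sub0 => // r' v rr _ [v0 v1].
- have /v0[h1 _] : q0 <= t - r' by lra.
  exact: h1.
- have /v0[_ h1] : q0 <= t - r' by lra.
  exact: h1.
- have /v1[h1 _] : q1 <= t - r' by lra.
  exact: h1.
- have /v1[_ h1] : q1 <= t - r' by lra.
  exact: h1.
Qed.

End HalfLine.

End Geometry.

(** * Composition of proper direct images *)

Section Regular.

Lemma product_regular (X Y : topologicalType) : regular_space X -> regular_space Y ->
  regular_space (X * Y)%type.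
Proof.
move=> rX rY [x y] A [[B C] /= [Bx Cy] BCA].
have [B' B'x B'B] := rX x B Bx; have [C' C'y C'C] := rY y C Cy.
exists (B' `*` C'); first by exists (B', C').
move=> [u v] cl; apply: BCA; split=> /=; [apply: B'B|apply: C'C] => D Dn.
  have nD : nbhs (u, v) (D `*` setT) by exists (D, setT) => //; split=> //; exact: filterT.
  by have [[a b] [[/= ? ?] [/= ? ?]]] := cl _ nD; exists a.
have nD : nbhs (u, v) (setT `*` D) by exists (setT, D) => //; split=> //; exact: filterT.
by have [[a b] [[/= ? ?] [/= ? ?]]] := cl _ nD; exists b.
Qed.

Lemma regular_opens (Y : topologicalType) : regular_space Y ->
  forall (V : opens Y) y, oset V y ->
  exists V' : opens Y, oset V' y /\ closure (oset V') `<=` oset V.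
Proof.
move=> rY V y Vy.
have [B By BV] := rY y (oset V) (open_nbhs_nbhs (conj (osetP V) Vy)).
have [W [Wy WB]] := nbhs_opens By; exists W; split=> //.
by apply: subset_trans BV; exact: closureS.
Qed.

Lemma real_regular (R : realType) : regular_space R.
Proof. exact: uniform_regular. Qed.
Lemma Cline_regular (R : realType) : regular_space (Cline R).
Proof. exact: (@uniform_regular R[i]^o). Qed.

End Regular.

Section QuasiIsoOfBijections.
Context {k : fieldType} {X : topologicalType}.

Lemma bijective_quasi_iso (K L : @cpx k X) (u : cmor K L) :
  (forall n (U : opens X), exists v, cancel (u n U) v /\ cancel v (u n U)) -> quasi_iso u.
Proof.
move=> bij n x.
have inj m (U : opens X) (s : sec (ob K m) U) : u m U s = 0 -> s = 0.
  have [v [uv _]] := bij m U; move=> us; rewrite -[s]uv us -[RHS]uv; congr v.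
  by rewrite mor_0.
split=> [a da [b ab]|b db].
  have [U [s [Ux aE]]] := germ_surj a; have [V [t [Vx bE]]] := germ_surj b.
  have [v [_ vu]] := bij n V; exists (germ x (v t)).
  move: ab; rewrite aE bE !stalk_mapE// => e.
  have O1 := @opensIl _ U V; have O2 := @opensIr _ U V.
  have Ox : oset (opensI U V) x by split.
  apply/eqP; rewrite -subr_eq0; apply/eqP.
  rewrite -(germ_rst s O1 Ox) -(germ_rst (dif K n V (v t)) O2 Ox) -germB.
  have : germ x (u _ _ (rst (opensI U V) s - rst (opensI U V) (dif K n V (v t)))) = 0.
    by rewrite morB germB !mor_rst !germ_rst// cfun_dif vu e subrr.
  move=> /(germ0_rst Ox)[W [Wx WO]]; rewrite -mor_rst => /inj.
  exact: rst0_germ.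
have [U [t [Ux bE]]] := germ_surj b; have [v [_ vu]] := bij (n + 1) U.
exists (germ x (v t)), 0; rewrite stalk_mapE// stalk_mapE//; split; last first.
  by rewrite vu (lin0 (@stalk_map_linear _ _ _ _ (dif L n) x)) addr0.
move: db; rewrite bE stalk_mapE// => /(germ0_rst Ux)[W [Wx WU e]].
apply: (rst0_germ Wx WU); apply: inj.
by rewrite mor_rst cfun_dif vu e.
Qed.

Lemma presented_shift1 (K : @cpx k X) i (E : lmodType k) (N : X -> set E) :
  presented K (i + 1) N -> presented (shift1 K) i N.
Proof.
move=> [rep P]; exists rep.
have dE n (U : opens X) (s : sec (ob K (n + 1)) U) : dif (shift1 K) n U s = - dif K (n + 1) U s by [].
have dN n (U : opens X) (s : sec (ob K n) U) : dif K n U (- s) = - dif K n U s by exact: mor_N.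
split.
- move=> j ji U s x Ux; rewrite dE => /eqP; rewrite oppr_eq0 => /eqP ds.
  have [|W [b [Wx WU e]]] := pr_exact P (j := j + 1) _ Ux ds; first by rewrite (inj_eq (addIr _)).
  by exists W, (- b); split=> //; rewrite dE dN opprK.
- exact: (pr_res P).
- exact: (pr_loc P).
- by move=> U v s rs; rewrite dE (pr_closed P rs) oppr0.
- exact: (pr_lin P).
- exact: (pr_ex P).
- move=> U s x Ux; rewrite dE => /eqP; rewrite oppr_eq0 => /eqP ds; exact: (pr_surj P Ux ds).
- move=> U v s x Ux rs; rewrite (pr_ker P Ux rs).
  by split=> -[W [b [Wx WU e]]]; exists W, (- b); split=> //; rewrite ?dE dN ?opprK.
- by move=> U v s b rs; rewrite dE -dN; exact: (pr_d P).
Qed.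

End QuasiIsoOfBijections.

(** * Composition of two projections along lines *)

Section ShriekComposition.
Context {k : fieldType} {R : realType} {X Y Z : topologicalType}.
Variables (f : continuousType X Y) (h1 : X -> R) (io1 : Y -> R -> X).
Variables (g : continuousType Y Z) (h2 : Y -> R) (io2 : Z -> R -> Y).
Variable q : continuousType X Z.
Hypothesis ch1 : chart f h1 io1.
Hypothesis ch2 : chart g h2 io2.
Hypothesis qE : forall x, q x = g (f x).

Lemma pre_comp (V : opens Z) : oset (opens_pre q V) = oset (opens_pre f (opens_pre g V)).
Proof. by apply/seteqP; split=> x; rewrite /= /preimage /= qE. Qed.

Section OneSheaf.
Variable F : sheaf k X.

(** The image of the support is closed over W by properness, so a point of W outside it has a
    neighbourhood over which the section is 0. *)
Lemma supp_shriek (W : opens Y) (u : sec (shriek f F) W) :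
  supp u = f @` supp (spval u).
Proof.
have [cl _] := spvalP u; have cl1 : closure (f @` supp (spval u)) `&` oset W `<=` f @` supp (spval u).
  by have := cl setT (@closedT _); rewrite setIT.
apply/seteqP; split=> [y [Wy nz]|y [x [Wx nz] <-]].
  apply: contrapT => ny; apply: nz.
  have Oo : open (oset W `&` ~` closure (f @` supp (spval u))).
    by apply: openI; [exact: osetP|exact: closed_openC (@closed_closure _ _)].
  have Oy : (oset W `&` ~` closure (f @` supp (spval u))) y.
    by split=> // cy; apply: ny; exact: cl1.
  have OW : oset (Opens Oo) `<=` oset W by move=> z [].
  apply: (rst0_germ (W := Opens Oo)) => //; apply: spval_inj; rewrite shriek_rst//.
  apply: sec_germ_eq => x Ox; have [Wx nx] := Ox; rewrite germ0 germ_rst//; last exact: pre_sub OW.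
  apply: contrapT => nz; apply: nx; apply: subset_closure; exists x => //; split.
have Wfx : oset W (f x) := Wx.
split=> // /(germ0_rst Wfx)[O [Ox OW]] /(congr1 (fun s => spval s)).
rewrite shriek_rst// => e; apply: nz.
by apply: (rst0_germ _ _ e) => //; exact: pre_sub OW.
Qed.

Lemma shriek_comp_proper (V : opens Z) (u : sec (shriek g (shriek f F)) V) :
  proper_supp (f := q) (V := V) (rst (opens_pre q V) (spval (spval u))).
Proof.
set s := spval (spval u); set A := supp s.
have sE : supp (rst (opens_pre q V) s) = A.
  have sub : oset (opens_pre q V) `<=` oset (opens_pre f (opens_pre g V)) by rewrite pre_comp.
  by rewrite (rstE sub) supp_res; apply/seteqP; split=> x; [case|move=> sx; split=> //; rewrite pre_comp; case: sx].
rewrite /proper_supp /= sE; have [pf kf] := spvalP (spval u); have [pg kg] := spvalP u.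
rewrite supp_shriek -/s -/A in pg kg; rewrite -/s -/A in pf kf.
split=> [B cB y [cy Vy]|y Vy].
  have [|x [[p Ap px] cx] xy] := pg (closure (f @` (A `&` B))) (@closed_closure _ _) y.
  - split=> //; apply: closureS cy => _ [p [Ap Bp] <-].
    exists (f p); last by rewrite qE.
    by split; [exists p|apply: subset_closure; exists p].
  - have Vx : oset (opens_pre g V) x by rewrite /= /preimage /= xy.
    have [p' [Ap' Bp'] p'x] := pf B cB x (conj cx Vx).
    by exists p'; rewrite // qE p'x.
have [D [cD AE]] := supp_closed s.
have [M2 b2] : exists M2, forall p, A p -> q p = y -> `|h2 (f p)| <= M2.
  have [V' [M [V'y _ H]]] := proper_over_bounded (ch_h ch2) (conj pg kg) Vy.
  by exists M => p Ap qp; apply: H; [rewrite -qE qp|exists p].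
(* Properness over Y bounds h1 near each point of the fibre of g; [interval_patch] makes the bound
   uniform for |h2| <= |M2|, which covers the support. *)
have [M1 b1] : exists M1, forall p, A p -> q p = y -> `|h1 p| <= M1.
  pose P c d := exists M, forall p, A p -> q p = y -> c <= h2 (f p) <= d -> `|h1 p| <= M.
  have : P (- `|M2|) `|M2|.
    apply: interval_patch.
    - by have := normr_ge0 M2; lra.
    - move=> c d c' d' cc dd [M H]; exists M => p Ap qp hp; apply: H => //; lra.
    - move=> c d c' d' cc cd dd [M H] [M' H']; exists (`|M| + `|M'|) => p Ap qp hp.
      have nM := ler_norm M; have nM' := ler_norm M'.
      have nM0 := normr_ge0 M; have nM0' := normr_ge0 M'.
      have [hd|hd] := leP (h2 (f p)) d.
        by have := H p Ap qp; rewrite hd andbT => /(_ _); have /andP[-> _] := hp => /(_ isT); lra.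
      have : `|h1 p| <= M' by apply: H' => //; lra.
      lra.
    - move=> r _; have Wr : oset (opens_pre g V) (io2 y r) by rewrite /= /preimage /= (ch_fio ch2).
      have [W [M [Wy _ H]]] := proper_over_bounded (ch_h ch1) (conj pf kf) Wr.
      have [V' [e [V'y e0 sub]]] := bx_nbhs ch2 Wy.
      exists (e / 2); first by rewrite divr_gt0.
      exists M => p Ap qp hp; apply: H => //; apply: sub; apply/bxE; split=> /=.
        by rewrite -qE qp.
      by apply/andP; split; lra.
  move=> [M H]; exists M => p Ap qp; apply: H => //.
  by rewrite -ler_norml; apply: le_trans (b2 p Ap qp) (ler_norm _).
(* [m] parametrizes the fibre of q by the plane; the support in this fibre is closed in the image of
   a rectangle. *)
pose m (r : R * R) := io1 (io2 y r.2) r.1.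
have cm : continuous m.
  apply: (@comp_cts _ _ _ (fun r : R * R => (io2 y r.2, r.1)) (fun p : Y * R => io1 p.1 p.2)).
    apply: pair_cts; last exact: fst_cts.
    apply: (@comp_cts _ _ _ (fun r : R * R => (y, r.2)) (fun p : Z * R => io2 p.1 p.2)).
      by apply: pair_cts; [move=> r; exact: cvg_cst|exact: snd_cts].
    exact: (ch_cio ch2).
  exact: (ch_cio ch1).
have -> : A `&` q @^-1` [set y] =
    (m @` ([set r | r \in `[- M1, M1]] `*` [set r | r \in `[- M2, M2]])) `&` D.
  apply/seteqP; split=> p.
    move=> [Ap /= qp]; split; last by move: Ap; rewrite /A AE => -[].
    exists (h1 p, h2 (f p)).
      by split; rewrite /= in_itv /= -ler_norml; [exact: b1|exact: b2].
    by rewrite /m /= -qp qE (ch_io ch2) (ch_io ch1).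
  move=> [[r _ <-] Dr]; have mr : q (m r) = y by rewrite qE /m (ch_fio ch1) (ch_fio ch2).
  by split=> //; rewrite /A AE; split=> //; rewrite -pre_comp /= /preimage /= mr.
apply: compact_closedI cD; apply: continuous_compact; first exact: continuous_subspaceT.
by apply: compact_setX; exact: segment_compact.
Qed.

Lemma shriek_comp_lift (V : opens Z) (t : sec (shriek q F) V) :
  exists u : sec (shriek g (shriek f F)) V,
    spval (spval u) = rst (opens_pre f (opens_pre g V)) (spval t).
Proof.
have pt : proper_over q V (supp (spval t)) := spvalP t.
have sub : oset (opens_pre f (opens_pre g V)) `<=` oset (opens_pre q V) by rewrite pre_comp.
have b2 : continuous (fun p => h2 (f p)).
  by apply: (comp_cts (f := f)); [exact: cts_fun|exact: ch_h ch2].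
have bs : bounded_supp h1 (rst (opens_pre f (opens_pre g V)) (spval t)).
  move=> y Vy; have [V' [M [V'y V'V H]]] := proper_over_bounded (ch_h ch1) pt Vy.
  exists (opens_pre g V'), M; split=> //; first by move=> z /V'V.
  move=> p V'p Mp; have Up : oset (opens_pre f (opens_pre g V)) p := V'V _ V'p.
  rewrite germ_rst//; apply: contrapT => nz; move: Mp; rewrite ltNge => /negP; apply.
  by apply: H; [rewrite qE|split=> //; exact: sub].
pose w := mk_shriek ch1 bs.
suff bw : bounded_supp h2 w by exists (mk_shriek ch2 bw).
move=> y Vy; have [V' [M [V'y V'V H]]] := proper_over_bounded b2 pt Vy.
exists V', M; split=> // x V'x Mx.
have Oo : open (g @^-1` oset V' `&` h2 @^-1` [set r | M < `|r|]).
  apply: openI; first exact: open_pre.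
  apply: open_comp; first by move=> z _; exact: (ch_h ch2).
  apply: (@open_comp _ _ (fun r : R => `|r|) [set r | M < r]); last exact: open_gt.
  by move=> z _; exact: norm_continuous.
have OV : oset (Opens Oo) `<=` oset (opens_pre g V) by move=> z [/V'V].
apply: (rst0_germ (W := Opens Oo)) => //; apply: spval_inj; rewrite shriek_rst//.
apply: sec_germ_eq => p Op; have [V'p /= Mp] := Op; rewrite germ0 germ_rst//; last first.
  by move=> z; exact: OV.
have Up : oset (opens_pre f (opens_pre g V)) p := V'V _ V'p.
rewrite germ_rst//; apply: contrapT => nz; move: Mp; rewrite ltNge => /negP; apply.
by apply: H; [rewrite qE|split=> //; exact: sub].
Qed.

Definition shriek_comp_fun (V : opens Z) (u : sec (shriek g (shriek f F)) V) :
  sec (shriek q F) V := @SubSp _ _ (shriek_sub q F V) _ (shriek_comp_proper u).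

Lemma shriek_comp_lin V : linear (@shriek_comp_fun V).
Proof. by move=> a s t; apply: spval_inj; exact: rst_lin. Qed.

Lemma shriek_comp_nat V W (h : oset W `<=` oset V) s :
  shriek_comp_fun (res h s) = res h (shriek_comp_fun s).
Proof.
apply: spval_inj => /=; rewrite -(rstE (pre_sub h)) -(rstE (pre_sub (pre_sub h))).
rewrite !rst_rst// ?pre_comp//; first exact: pre_sub (pre_sub h).
by rewrite -!pre_comp; exact: pre_sub.
Qed.

Definition shriek_comp_mor : mor (shriek g (shriek f F)) (shriek q F) :=
  Mor shriek_comp_lin shriek_comp_nat.

Lemma shriek_comp_bij V : exists v, cancel (shriek_comp_mor V) v /\ cancel v (shriek_comp_mor V).
Proof.
have [v vE] := choice (@shriek_comp_lift V); exists v; split=> u; last first.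
  by apply: spval_inj; rewrite /= vE rst_rst ?pre_comp// rst_id.
by apply: spval_inj; apply: spval_inj; rewrite vE /= rst_rst ?pre_comp// rst_id.
Qed.

End OneSheaf.

Lemma shriek_comp_dif (K : @cpx k X) n (V : opens Z)
    (s : sec (ob (shriek_cpx g (shriek_cpx f K)) n) V) :
  shriek_comp_mor (ob K (n + 1)) V (dif (shriek_cpx g (shriek_cpx f K)) n V s) =
  dif (shriek_cpx q K) n V (shriek_comp_mor (ob K n) V s).
Proof. by apply: spval_inj => /=; rewrite mor_rst. Qed.

(** The isomorphism of g_! f_! with q_! is one of complexes, degree by degree, so a derived direct
    image along q is computed on one resolution by two underived direct images. *)
Lemma presented_shriek_comp (K : @cpx k X) i (E : lmodType k) (N : Z -> set E) :
  presented (shriek_cpx g (shriek_cpx f K)) i N -> presented (shriek_cpx q K) i N.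
Proof.
apply: (presented_quasi_iso (f := @CMor _ _ (shriek_cpx g (shriek_cpx f K)) (shriek_cpx q K)
  (fun n => shriek_comp_mor (ob K n)) (@shriek_comp_dif K))).
by apply: bijective_quasi_iso => n U; exact: shriek_comp_bij.
Qed.

End ShriekComposition.

(** * The Fourier-Sato transform of F_sigma *)

Section DualBases.
Context {R : realType}.
Local Notation C := R[i].

Lemma matrix_dual_basis (M : 'M[C]_2) (X Y : 'cV[C]_2 -> C^o) (a b : C) :
  M \in unitmx -> a != 0 -> b != 0 -> linear X -> linear Y ->
  (forall v : 'cV_2, (M *m v) 0 0 = a * X v) -> (forall v : 'cV_2, (M *m v) 1 0 = b * Y v) ->
  dual_basis X Y.
Proof.
move=> Mu a0 b0 Xl Yl XE YE; split=> // [v Xv Yv|x y].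
  rewrite -[v](mulKmx Mu) (_ : M *m v = 0) ?mulmx0//; apply/matrixP => i j.
  by rewrite (ord1 j) [RHS]mxE; have [->|->] := ord2_cases i; rewrite ?XE ?YE ?Xv ?Yv mulr0.
pose w : 'cV[C]_2 := \col_i (if i == 0 then a * x else b * y).
exists (invmx M *m w); split; [apply: (mulfI a0)|apply: (mulfI b0)].
  by rewrite -XE mulKVmx// mxE.
by rewrite -YE mulKVmx// mxE.
Qed.

Lemma mulmx_coord_linear (M : 'M[C]_2) i : linear (fun v : 'cV[C]_2 => (M *m v) i 0 : C^o).
Proof. by move=> a u v; rewrite mulmxDr -scalemxAr !mxE. Qed.

Variable sigma : 'Z_4 -> 'M[C]_2.
Hypothesis sigma_odd : forall j : 'Z_4, odd j -> is_trig_mx (sigma j)^T.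
Hypothesis sigma_even : forall j : 'Z_4, ~~ odd j -> is_trig_mx (sigma j).
Hypothesis sigma_prod : sigma 4%:R *m sigma 3%:R *m sigma 2%:R *m sigma 1 = 1%:M.

Let cright_lin : linear (@cright R : _ -> C^o). Proof. by move=> a u v; rewrite /cright !mxE. Qed.
Let dup_lin : linear (@dup R : _ -> C^o). Proof. by move=> a u v; rewrite /dup !mxE. Qed.
Let cleft_lin : linear (cleft sigma : _ -> C^o). Proof. exact: mulmx_coord_linear. Qed.
Let ddown_lin : linear (ddown sigma : _ -> C^o). Proof. exact: mulmx_coord_linear. Qed.
Let funit j : frame sigma j \in unitmx := frame_unit sigma_prod j.
Let sd j i : sigma j i i != 0 := sigma_diag sigma_odd sigma_even sigma_prod j i.

Lemma upper_row (j : 'Z_4) (v : 'cV[C]_2) : odd j -> (sigma j *m v) 1 0 = sigma j 1 1 * v 1 0.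
Proof. by move=> oj; rewrite mulmx_ord2 (sigma_upper sigma_odd)// mul0r add0r. Qed.
Lemma lower_row (j : 'Z_4) (v : 'cV[C]_2) : ~~ odd j -> (sigma j *m v) 0 0 = sigma j 0 0 * v 0 0.
Proof. by move=> oj; rewrite mulmx_ord2 (sigma_lower sigma_even)// mul0r addr0. Qed.

(** The rows of the frames at 1, 2, 3, 0 are, up to nonzero scalars, the pairs right-up, left-up,
    left-down, right-down, which are bases because the frames are invertible. *)
Lemma dual_right_up : dual_basis (@cright R : _ -> C^o) (@dup R : _ -> C^o).
Proof.
apply: (matrix_dual_basis (unitmx1 _ _) (oner_neq0 C) (oner_neq0 C)) => // v;
  by rewrite mul1mx mul1r.
Qed.
Lemma dual_left_up : dual_basis (cleft sigma : _ -> C^o) (@dup R : _ -> C^o).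
Proof.
apply: (matrix_dual_basis (funit 2%:R) (oner_neq0 C) (sd 1 1)) => // v.
  by rewrite mul1r.
exact: upper_row.
Qed.
Lemma dual_left_down : dual_basis (cleft sigma : _ -> C^o) (ddown sigma : _ -> C^o).
Proof.
apply: (matrix_dual_basis (funit 3%:R) (sd 2%:R 0) (oner_neq0 C)) => // v.
  by rewrite /frame /= -mulmxA lower_row.
by rewrite mul1r.
Qed.
Lemma dual_right_down : dual_basis (@cright R : _ -> C^o) (ddown sigma : _ -> C^o).
Proof.
have s0 : (sigma 0 0 0)^-1 != 0 by rewrite invr_neq0.
apply: (matrix_dual_basis (funit 0) s0 (sd 3%:R 1)) => // v.
  apply: (mulfI (sd 0 0)); rewrite mulrA divff// mul1r -lower_row// mulmxA.
  by rewrite /frame /= !mulmxA -sigma4 sigma_prod mul1mx.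
by rewrite /frame /= -!mulmxA upper_row// mulmxA.
Qed.

End DualBases.

(** * Coefficients of the exponents in rotated frames *)

Section RotatedCoefficients.
Context {R : realType}.
Local Notation C := R[i].
Implicit Types (th : R) (c d : C).

Lemma numbering_unique th (c d : C) (e : 'I_2 -> C) : [set c; d] = [set e 0; e 1] ->
  qA th c < qA th d -> qA th (e 0) < qA th (e 1) -> e 0 = c /\ e 1 = d.
Proof.
move=> E cd ee.
have : [set c; d] (e 0) by rewrite E; left.
have : [set c; d] (e 1) by rewrite E; right.
move=> [] e1 [] e0 //; move: ee; rewrite e0 e1.
- by rewrite ltxx.
- by rewrite ltNge (ltW cd).
- by rewrite ltxx.
Qed.

Lemma mulc_re (u v : C) : complex.Re (u * v) = complex.Re u * complex.Re v - complex.Im u * complex.Im v.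
Proof. by case: u v => a b [a' b']. Qed.
Lemma mulc_im (u v : C) : complex.Im (u * v) = complex.Re u * complex.Im v + complex.Im u * complex.Re v.
Proof. by case: u v => a b [a' b']. Qed.

(* The product of c e^(2 i th) and - c^-1 e^(2 i (pi - th)) is -1. *)
Lemma qA_qB_inverse th c : c != 0 -> qA th c ^+ 2 + qB th c ^+ 2 != 0 ->
  qA (pi - th) (- c^-1) = - qA th c / (qA th c ^+ 2 + qB th c ^+ 2) /\
  qB (pi - th) (- c^-1) = qB th c / (qA th c ^+ 2 + qB th c ^+ 2).
Proof.
move=> c0; set A := qA th c; set B := qB th c; move=> n0.
set A' := qA (pi - th) (- c^-1); set B' := qB (pi - th) (- c^-1).
have cinv := mulfV c0; set d := c^-1 in cinv A' B' *.
have h1 : complex.Re c * complex.Re d - complex.Im c * complex.Im d = 1 by rewrite -mulc_re cinv.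
have h2 : complex.Re c * complex.Im d + complex.Im c * complex.Re d = 0 by rewrite -mulc_im cinv.
have ReN (u : C) : complex.Re (- u) = - complex.Re u by case: u.
have ImN (u : C) : complex.Im (- u) = - complex.Im u by case: u.
have cs := cos2Dsin2 th.
have cs2 : (cos th ^+ 2 + sin th ^+ 2) ^+ 2 = 1 by rewrite cs expr1n.
have cp : cos (pi - th) = - cos th by rewrite cosB cospi sinpi mulN1r mul0r addr0.
have sp : sin (pi - th) = sin th by rewrite sinB cospi sinpi mul0r mulN1r sub0r opprK.
have e1 : A' * A - B' * B = -1.
  rewrite /A' /A /B' /B /qA /qB cp sp ReN ImN.
  transitivity (- ((cos th ^+ 2 + sin th ^+ 2) ^+ 2 *
    (complex.Re c * complex.Re d - complex.Im c * complex.Im d))); first by ring.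
  by rewrite cs2 h1 mulr1.
have e2 : A' * B + B' * A = 0.
  rewrite /A' /A /B' /B /qA /qB cp sp ReN ImN.
  transitivity (- ((cos th ^+ 2 + sin th ^+ 2) ^+ 2 *
    (complex.Re c * complex.Im d + complex.Im c * complex.Re d))); first by ring.
  by rewrite h2 mulr0 oppr0.
split; apply: (mulIf n0); rewrite divfK//.
  transitivity (A * (A' * A - B' * B) + B * (A' * B + B' * A)); first by ring.
  by rewrite e1 e2 mulr0 addr0 mulrN1.
transitivity (A * (A' * B + B' * A) - B * (A' * A - B' * B)); first by ring.
by rewrite e1 e2 mulr0 sub0r mulrN1 opprK.
Qed.

(** The directions pi - th and - th differ by a half turn, whence the signs of - a and - b in the
    kernels. *)
Lemma rx_hat th (w : Cline R) : rx (pi - th) w = - rx (- th) w.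
Proof.
rewrite /rx cosB sinB cospi sinpi cosN sinN; ring.
Qed.
Lemma ry_hat th (w : Cline R) : ry (pi - th) w = - ry (- th) w.
Proof. by rewrite /ry cosB sinB cospi sinpi cosN sinN; ring. Qed.

Lemma re_mul_rxy th (z w : Cline R) : complex.Re ((z : C) * (w : C)) =
  rx th z * rx (- th) w - ry th z * ry (- th) w.
Proof.
rewrite mulc_re -/(re z) -/(re w) -/(im z) -/(im w) (re_rxy th z) (im_rxy th z).
rewrite (re_rxy (- th) w) (im_rxy (- th) w) cosN sinN.
transitivity ((cos th ^+ 2 + sin th ^+ 2) * (rx th z * rx (- th) w - ry th z * ry (- th) w)).
  by ring.
by rewrite cos2Dsin2 mul1r.
Qed.

(* e^(i th) (x + i y) *)
Definition rot th (x y : R) : Cline R :=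
  ((cos th * x - sin th * y) +i* (sin th * x + cos th * y))%C.

Lemma rx_rot th x y : rx th (rot th x y) = x.
Proof.
rewrite /rx /rot /re /im /=; transitivity ((cos th ^+ 2 + sin th ^+ 2) * x); first by ring.
by rewrite cos2Dsin2 mul1r.
Qed.
Lemma ry_rot th x y : ry th (rot th x y) = y.
Proof.
rewrite /ry /rot /re /im /=; transitivity ((cos th ^+ 2 + sin th ^+ 2) * y); first by ring.
by rewrite cos2Dsin2 mul1r.
Qed.

End RotatedCoefficients.

(** If t1 is large and positive, t - t1 is below both exponents; if t1 is large and negative, it is
    outside the half line - f <= t1. The constant 2 absorbs the unit neighbourhoods. *)
Lemma far_half_line (R : realType) (f0 a0 b0 t0 f a b t t1 : R) : `|f - f0| < 1 ->
  `|a - a0| < 1 -> `|b - b0| < 1 -> `|t - t0| < 1 ->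
  `|f0| + `|t0| + `|a0| + `|b0| + 2 < `|t1| -> - f <= t1 -> t - t1 < a /\ t - t1 < b.
Proof.
move=> /ltr_normlP[f1 f2] /ltr_normlP[a1 a2] /ltr_normlP[b1 b2] /ltr_normlP[d1 d2] ht ft.
have n1 := ler_norm f0; have n2 := ler_norm t0.
have n3 := ler_norm (- a0); have n4 := ler_norm (- b0); rewrite !normrN in n3 n4.
have m1 := normr_ge0 f0; have m2 := normr_ge0 t0; have m3 := normr_ge0 a0; have m4 := normr_ge0 b0.
have [h|h] := leP 0 t1; [rewrite (ger0_norm h) in ht|rewrite (ltr0_norm h) in ht]; split; lra.
Qed.

(** * Convolution with an exponential sheaf *)

Section Convolution.
Context {R : realType} {X : topologicalType}.
Local Notation C := R[i].
Hypothesis rX : regular_space X.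

Lemma continuous_near1 (T : topologicalType) (f : T -> R) (x : T) : continuous f ->
  nbhs x [set y | `|f y - f x| < 1].
Proof.
move=> cf; have h : nbhs x (f @^-1` ball (f x) 1) := cf x _ (nbhsx_ballx _ _ ltr01).
by apply: filterS h => y; rewrite /preimage /ball /= distrC.
Qed.

Lemma mu_chart : chart (@mu R X) (fun p => p.2.1) (fun y r => (y.1, (r, y.2 - r))).
Proof.
split.
- by move=> [x t] r; congr (_, _); exact: subrKC.
- by [].
- by move=> [x [t1 t2]]; congr (_, (_, _)); rewrite /= addrAC subrr add0r.
- exact: (comp_cts (@snd_cts X (R * R)%type) (@fst_cts R R)).
- have c1 : continuous (fun p : (X * R) * R => p.1.2).
    exact: (comp_cts (@fst_cts (X * R)%type R) (@snd_cts X R)).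
  have c2 : continuous (fun p : (X * R) * R => p.1.1).
    exact: (comp_cts (@fst_cts (X * R)%type R) (@fst_cts X R)).
  have c3 : continuous (fun p : (X * R) * R => p.2) by exact: snd_cts.
  apply: pair_cts => //; apply: pair_cts => // p.
  by apply: cvgB; [exact: c1|exact: c3].
Qed.

Lemma in_deg0_bounded (k : fieldType) (Y : topologicalType) (F : sheaf k Y) : bounded_below (in_deg0 F).
Proof.
exists 0 => n n0 U /=; rewrite (_ : (n == 0) = false); last by apply/negbTE; rewrite lt_eqF.
move=> s; apply: fsec_eq => x Ux.
have [_ /(_ x Ux)[W [b [_ Wx [a [_ sa]] sb]]]] := spvalP s.
rewrite [LHS]sb// sa// /cst_on; case: pselect => //.
Qed.

Lemma shriek_bounded_below (k : fieldType) (Y Z : topologicalType) (f : continuousType Y Z)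
  (K : @cpx k Y) : bounded_below K -> bounded_below (shriek_cpx f K).
Proof. by move=> [N H]; exists N => n nN U s; apply: spval_inj; exact: H. Qed.

Variables (phi q0 q1 x y : X -> R).
Hypothesis cphi : continuous phi.
Hypothesis cq0 : continuous q0.
Hypothesis cq1 : continuous q1.
Variables (E : lmodType C) (CR CL DU DD : E -> C^o).
Hypothesis RU : dual_basis CR DU.
Hypothesis LU : dual_basis CL DU.
Hypothesis RD : dual_basis CR DD.
Variable G : sheaf C (X * R)%type.
Hypothesis PG : sheaf_presented G (fun p : X * R =>
  four_kernel CR CL DU DD (q0 p.1) (q1 p.1) (x p.1) (y p.1) p.2).

Lemma convolution_bounded : bounded_below (convolution (Esheaf phi setT) G).
Proof.
have [_ [_ [b _]]] := injective_resolutionP (in_deg0_bounded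
  (tensor (pullback (@Defs.q1 R X) (Esheaf phi setT)) (pullback (@Defs.q2 R X) G))).
exact: shriek_bounded_below b.
Qed.

(** Along t1 the exponential sheaf leaves the half line t1 >= - phi, on which the kernels grow, so
    the one at the end point decides: the convolution replaces t by t + phi. *)
Lemma convolution_presented : presented (convolution (Esheaf phi setT) G) (Negz 1)
  (fun p : X * R => four_kernel CR CL DU DD (q0 p.1) (q1 p.1) (x p.1) (y p.1) (p.2 + phi p.1)).
Proof.
have bT := in_deg0_bounded (tensor (pullback (@Defs.q1 R X) (Esheaf phi setT)) (pullback (@Defs.q2 R X) G)).
have [u [qu [_ fl]]] := injective_resolutionP bT.
have [a Pa] : sheaf_presented (pullback (@Defs.q1 R X) (Esheaf phi setT))
    (fun p => [set c : C^o | Esupp phi setT (p.1, p.2.1) -> c = 0]).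
  exact: (pullback_presented (@Defs.q1 R X) (ex_intro _ _ (Esheaf_presentation cphi (@closedT _)))).
have [b Pb] := pullback_presented (@Defs.q2 R X) PG.
have PT := stalk_presentation_in_deg0 (ex_intro _ _ (tensor_presentation Pa Pb)).
have PI := presented_quasi_iso qu PT.
have rXR : regular_space (X * R)%type by apply: product_regular => //; exact: real_regular.
have NE p v : ((Esupp phi setT (p.1, p.2.1) -> 1 = 0 :> C^o) \/
    four_kernel CR CL DU DD (q0 p.1) (q1 p.1) (x p.1) (y p.1) p.2.2 v) <->
    (- phi p.1 <= p.2.1 -> four_kernel CR CL DU DD (q0 p.1) (q1 p.1) (x p.1) (y p.1) p.2.2 v).
  have sE : Esupp phi setT (p.1, p.2.1) <-> - phi p.1 <= p.2.1.
    by split=> [[_ /= h]|h]; [|split=> //=]; lra.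
  split=> [[h /sE/h/eqP|h _]|h]; [by rewrite oner_eq0|exact: h|].
  by have [h1|h1] := leP (- phi p.1) p.2.1; [right; exact: h|left=> /sE; rewrite leNgt h1].
have fibE (z : X) (t r : R) v : ((Esupp phi setT (z, r) -> 1 = 0 :> C^o) \/
    four_kernel CR CL DU DD (q0 z) (q1 z) (x z) (y z) (t - r) v) <->
    (- phi z <= r -> four_kernel CR CL DU DD (q0 z) (q1 z) (x z) (y z) (t - r) v).
  exact: (NE (z, (r, t - r))).
apply: (presented_push_interval mu_chart (regular_opens rXR) _ _ _ _ PI).
- by move=> n; apply: flabby_soft; exact: fl.
- move=> [z t].
  pose A := [set p : X * R | [/\ `|phi p.1 - phi z| < 1, `|q0 p.1 - q0 z| < 1,
    `|q1 p.1 - q1 z| < 1 & `|p.2 - t| < 1]].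
  have cf (g : X -> R) : continuous g -> nbhs (z, t) [set p : X * R | `|g p.1 - g z| < 1].
    move=> cg; apply: (@continuous_near1 _ (fun p : X * R => g p.1)).
    exact: (comp_cts (@fst_cts X R) cg).
  have nA : nbhs (z, t) A.
    have FF : Filter (nbhs (z, t)) := @nbhs_filter (X * R)%type (z, t).
    have ct := @continuous_near1 _ (fun p : X * R => p.2) (z, t) (@snd_cts X R).
    apply: filterS (filterI (filterI (cf _ cphi) (cf _ cq0)) (filterI (cf _ cq1) ct)) => p [[? ?] [? ?]].
    by split.
  have [V [Vy VA]] := nbhs_opens nA.
  exists V, (`|phi z| + `|t| + `|q0 z| + `|q1 z| + 2); split=> // -[x0 [t1 t2]] /= Vp Mp v.
  apply/(NE (x0, (t1, t2))) => /= h1.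
  have [a1 b1 c1 d1] := VA _ Vp.
  have [l0 l1] := far_half_line a1 b1 c1 d1 Mp h1.
  have t2E : t1 + t2 - t1 = t2 by rewrite addrC addKr.
  by apply: (@ker4_all _ _ _ (CR : E -> C^o)); rewrite -t2E.
- move=> [z t] nu fam.
  have [|v Hv] := half_line_family RU LU RD (q0 := q0 z) (q1 := q1 z) (x := x z) (y := y z)
      (t := t) (a := - phi z) (nu := nu).
    by move=> r; have [e [v [e0 H]]] := fam r; exists e, v; split=> // r' /H /fibE.
  by exists v => r; apply/fibE; exact: Hv.
- move=> [z t] v; have -> : (z, t).2 + phi (z, t).1 = t - - phi z by rewrite opprK.
  rewrite (half_line_ker CR CL DU DD); split=> H r; first exact/fibE/H.
  exact: ((fibE z t r v).1 (H r)).
Qed.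

End Convolution.

(** * Integration over the plane of z *)

Section Projection.
Context {R : realType}.
Local Notation C := R[i].
Variable th : R.

(* The fibre C_z of qtilde is integrated first along y, then along x, where
   z = e^(i th) (x + i y). *)
Definition forget_y_fun (p : (Cline R * Cline R) * R) : R * (Cline R * R) :=
  (rx th p.1.1, (p.1.2, p.2)).

Lemma forget_y_cts : continuous forget_y_fun.
Proof.
have c1 : continuous (fun p : (Cline R * Cline R) * R => p.1.1).
  exact: (comp_cts (@fst_cts _ R) (@fst_cts (Cline R) (Cline R))).
have c2 : continuous (fun p : (Cline R * Cline R) * R => p.1.2).
  exact: (comp_cts (@fst_cts _ R) (@snd_cts (Cline R) (Cline R))).
apply: pair_cts; first exact: (comp_cts c1 (@rx_continuous R th)).
by apply: pair_cts => //; exact: snd_cts.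
Qed.
Definition forget_y := mkcontinuous forget_y_cts.
Definition forget_x : continuousType (R * (Cline R * R))%type (Cline R * R)%type :=
  mkcontinuous (@snd_cts R (Cline R * R)%type).

Lemma forget_y_chart : chart forget_y (fun p => ry th p.1.1)
  (fun u r => ((rot th u.1 r, u.2.1), u.2.2)).
Proof.
split.
- by move=> [x [w t]] r; congr (_, _); exact: rx_rot.
- by move=> u r; exact: ry_rot.
- move=> [[z w] t]; congr (_, _, _); apply: (@rxy_inj _ th); [exact: rx_rot|exact: ry_rot].
- have c1 : continuous (fun p : (Cline R * Cline R) * R => p.1.1).
    exact: (comp_cts (@fst_cts _ R) (@fst_cts (Cline R) (Cline R))).
  exact: (comp_cts c1 (@ry_continuous R th)).
- have c1 : continuous (fun p : (R * (Cline R * R)) * R => p.1).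
    exact: fst_cts.
  have cx : continuous (fun p : (R * (Cline R * R)) * R => p.1.1) by exact: (comp_cts c1 (@fst_cts _ _)).
  have cr : continuous (fun p : (R * (Cline R * R)) * R => p.2) by exact: snd_cts.
  have cwt : continuous (fun p : (R * (Cline R * R)) * R => p.1.2) by exact: (comp_cts c1 (@snd_cts _ _)).
  apply: pair_cts; last exact: (comp_cts cwt (@snd_cts _ _)).
  apply: pair_cts; last exact: (comp_cts cwt (@fst_cts _ _)).
  apply: (comp_cts (f := fun p : (R * (Cline R * R)) * R => (cos th * p.1.1 - sin th * p.2, sin th * p.1.1 + cos th * p.2))
    (g := fun p : R * R => (p.1 +i* p.2)%C : Cline R)); last exact: pair_to_Cline_continuous.
  apply: pair_cts; last exact: continuous_lincomb.
  have := continuous_lincomb (a := cos th) (b := - sin th) cx cr.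
  by under eq_fun do rewrite mulNr.
Qed.

Lemma forget_x_chart : chart forget_x fst (fun u r => (r, u)).
Proof.
split=> //.
- by case.
- exact: fst_cts.
- by apply: pair_cts; [exact: snd_cts|exact: fst_cts].
Qed.

Variables (E : lmodType C) (CR CL DU DD : E -> C^o).
Hypothesis RU : dual_basis CR DU.
Hypothesis LU : dual_basis CL DU.
Hypothesis RD : dual_basis CR DD.
Hypothesis LD : dual_basis CL DD.
Variables c d : C.
Hypothesis c_pos : 0 < qA th c.
Hypothesis c_real : qB th c = 0.
Hypothesis cd : qA th c < qA th d.
Variable F : sheaf C (Cline R * R)%type.
Hypothesis PF : sheaf_presented F (fun p : Cline R * R =>
  four_kernel CR CL DU DD (quad c p.1) (quad d p.1) (rx th p.1) (ry th p.1) p.2).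

Let a (w : Cline R) := rx (- th) w.
Let b (w : Cline R) := ry (- th) w.

(** The push along y raises the degree by 1, to [Negz 1 + 1], and [shift1] brings it back. The
    resolution J is pushed along y without further resolution, and [shriek_soft] prepares the push
    along x. *)
Lemma fourier_sato_presented : presented (fourier_sato F) (Negz 1) (fun p : Cline R * R =>
  four_kernel CR CL DU DD (hc (qA th c) (a p.1) (b p.1)) (hd (qA th d) (qB th d) (a p.1) (b p.1))
    (- a p.1) (- b p.1) p.2).
Proof.
pose phi (x : Cline R * Cline R) := - complex.Re ((x.1 : C) * (x.2 : C)).
have PG := pullback_presented (@ptilde R) PF.
have r2 : regular_space (Cline R * Cline R)%type.
  by apply: product_regular; exact: Cline_regular.
have r3 : regular_space (Cline R * R)%type.
  by apply: product_regular; [exact: Cline_regular|exact: real_regular].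
have r4 : regular_space (R * (Cline R * R))%type by apply: product_regular => //; exact: real_regular.
have cphi : continuous phi.
  have cr : continuous (fun x : Cline R * Cline R => re x.1) by exact: (comp_cts (@fst_cts _ _) (@re_continuous R)).
  have ci : continuous (fun x : Cline R * Cline R => im x.1) by exact: (comp_cts (@fst_cts _ _) (@im_continuous R)).
  have cr' : continuous (fun x : Cline R * Cline R => re x.2) by exact: (comp_cts (@snd_cts _ _) (@re_continuous R)).
  have ci' : continuous (fun x : Cline R * Cline R => im x.2) by exact: (comp_cts (@snd_cts _ _) (@im_continuous R)).
  rewrite (_ : phi = fun x : Cline R * Cline R => -1 * (re x.1 * re x.2) + 1 * (im x.1 * im x.2)).
    by apply: continuous_lincomb; exact: continuous_mul.
  by apply/funext => x; rewrite /phi mulc_re /re /im; ring.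
have cqz e : continuous (fun x : Cline R * Cline R => quad e x.1).
  exact: (comp_cts (@fst_cts (Cline R) (Cline R)) (@quad_continuous R e)).
have PK := convolution_presented r2 cphi (cqz c) (cqz d) RU LU RD
  (x := fun x => rx th x.1) (y := fun x => ry th x.1) PG.
have bK : bounded_below (convolution (Esheaf phi setT) (pullback (@ptilde R) F)).
  exact: convolution_bounded.
have [u [qu [_ fl]]] := injective_resolutionP bK.
have {qu u} := presented_quasi_iso qu PK.
set J := injective_resolution _ => PJ.
(* [c_real] removes the mixed term x y from the exponent of c, which leaves [qc]. *)
have fib x w t r v : four_kernel CR CL DU DD (quad c (rot th x r)) (quad d (rot th x r))
      (rx th (rot th x r)) (ry th (rot th x r)) (t + phi (rot th x r, w)) v <->
    four_kernel CR CL DU DD (qc (qA th c) x r) (qd (qA th d) (qB th d) x r) x r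
      (t - (x * a w - r * b w)) v.
  by rewrite !(quad_rot th) rx_rot ry_rot c_real mul0r subr0 /phi (re_mul_rxy th) rx_rot ry_rot.
have P1 : presented (shriek_cpx forget_y J) (Negz 1 + 1) (fun u : R * (Cline R * R) =>
    four_kernel CR CL DU DD (Mc (qA th c) (a u.2.1) (b u.2.1) u.1)
      (Md (qA th d) (qB th d) (a u.2.1) (b u.2.1) u.1) u.1 (- b u.2.1) u.2.2).
  apply: (presented_push_line forget_y_chart (regular_opens r4) _ _ _ PJ).
  - by move=> n; apply: flabby_soft; exact: fl.
  - move=> [x [w t]] nu fam [M HM] r.
    apply/(fib x w t r); apply: (line_y_family RU LU RD LD c_pos cd).
      by move=> s; have [e [v [e0 H]]] := fam s; exists e, v; split=> // s' /H /fib.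
    by exists M => s /HM /fib.
  - move=> [x [w t]] v; rewrite (line_y_span RU LU RD LD (qB th d) c_pos cd) /=.
    suff -> : [set v | exists r, four_kernel CR CL DU DD (qc (qA th c) x r)
      (qd (qA th d) (qB th d) x r) x r (t - (x * a w - r * b w)) v] =
      [set v | exists r, four_kernel CR CL DU DD (quad c (rot th x r)) (quad d (rot th x r))
      (rx th (rot th x r)) (ry th (rot th x r)) (t + phi (rot th x r, w)) v] by [].
    by apply/seteqP; split=> v' [r /fib H]; exists r.
apply: presented_shift1; apply: (presented_shriek_comp forget_y_chart forget_x_chart) => //.
apply: (presented_push_interval forget_x_chart (regular_opens r3) _ _ _ _ P1).
- by move=> n; apply: (shriek_soft forget_y_chart); exact: fl.
- move=> [w t]; have [M HM] := line_x_proper (qB th d) c_pos cd (`|a w| + 1) (t + 1).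
  have FF : Filter (nbhs (w, t)) := @nbhs_filter (Cline R * R)%type (w, t).
  have ca : nbhs (w, t) [set p : Cline R * R | `|a p.1 - a w| < 1].
    apply: (@continuous_near1 _ _ (fun p : Cline R * R => a p.1)).
    exact: (comp_cts (@fst_cts _ _) (@rx_continuous R (- th))).
  have ct := @continuous_near1 R _ (fun p : Cline R * R => p.2) (w, t) (@snd_cts _ R).
  have [V [Vy VA]] := nbhs_opens (filterI ca ct).
  exists V, M; split=> // -[x [w' t']] /= /VA[/= h1 h2] Mx v.
  have [||l0 l1] := HM (a w') (b w') t' x _ _ Mx; last exact: (@ker4_all _ _ _ (CR : E -> C^o)).
    rewrite -[a w'](subrK (a w)); apply: le_trans (ler_normD _ _) _; rewrite addrC lerD2l; exact: ltW.
  by move: h2 => /ltr_normlP[? ?]; lra.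
- by move=> [w t] nu fam; exact: (@line_x_family _ _ _ _ _ _ _ RU LU RD LD _ _ (qB th d) c_pos cd (a w) (b w) t nu fam).
- by move=> [w t] v; exact: (line_x_ker RU LU RD LD (qB th d) c_pos cd).
Qed.

End Projection.

(** For the angle - theta / 2 the factor e^(2 i th) is e^(- i theta). *)
Lemma qA_half (R : realType) (theta : R) (c : R[i]) :
  qA (- (theta / 2)) c = complex.Re c * cos theta + complex.Im c * sin theta /\
  qB (- (theta / 2)) c = complex.Im c * cos theta - complex.Re c * sin theta.
Proof.
have e : theta = - (- (theta / 2) + - (theta / 2)) by field.
have hc : cos theta = cos (- (theta / 2)) ^+ 2 - sin (- (theta / 2)) ^+ 2.
  by rewrite [in LHS]e cosN cosD !expr2.
have hs : sin theta = - (2 * cos (- (theta / 2)) * sin (- (theta / 2))).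
  by rewrite [in LHS]e sinN sinD; ring.
by rewrite /qA /qB hc hs; split; ring.
Qed.

Theorem theorem11p2 (R : realType) (c1 c2 d1 d2 theta : R)
    (sigma : 'Z_4 -> 'M[R[i]]_2)
    (F Fhat : sheaf R[i] (Cline R * R)%type) :
  let c := (c1 +i* c2)%C in
  let d := (d1 +i* d2)%C in
  let theta0 := - (theta / 2) in
  0 < c1 -> 0 <= c2 -> c1 < d1 -> c2 / c1 <= d2 / d1 ->
  0 <= theta < pi / 2 -> has_arg c theta ->
  (forall j : 'Z_4, odd j -> is_trig_mx (sigma j)^T) ->
  (forall j : 'Z_4, ~~ odd j -> is_trig_mx (sigma j)) ->
  sigma 4%:R *m sigma 3%:R *m sigma 2%:R *m sigma 1%:R = 1%:M ->
  is_Fsigma [set c; d] theta0 sigma F ->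
  is_Fsigma [set - c^-1; - d^-1] (pi - theta0) sigma Fhat ->
  derived_iso (fourier_sato F) (in_deg0 Fhat).
Proof.
move=> c d theta0 c1_gt0 c2_ge0 cd1 slope /andP[th0 th1] argc odd_tri even_tri prod PF PFh.
have th_in : - (pi / 2) < theta < pi / 2 by apply/andP; split=> //; have := @pi_gt0 R; lra.
have cos0 : 0 < cos theta by apply: cos_gt0_pihalf.
have sin0 : 0 <= sin theta by apply: sin_ge0_pi; apply/andP; split=> //; have := @pi_gt0 R; lra.
have [qAc qBc] := qA_half theta c; have [qAd _] := qA_half theta d.
have d1_gt0 : 0 < d1 := lt_trans c1_gt0 cd1.
(* The condition on the slopes is used in this form: with c1 < d1 it gives Re (c e^(- i theta)) < Re
   (d e^(- i theta)), since cos theta > 0 and sin theta >= 0. *)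
have cd2 : c2 <= d2.
  have : c2 / c1 * c1 <= d2 / d1 * d1.
    apply: le_trans (_ : c2 / c1 * d1 <= _); last by rewrite ler_wpM2r// ltW.
    by apply: ler_wpM2l; [rewrite divr_ge0// ltW|exact: ltW].
  by rewrite !divfK// gt_eqF.
have c0 : c != 0.
  by apply/eqP => /(congr1 (@complex.Re R)) /= e; move: c1_gt0; rewrite e ltxx.
have d0 : d != 0.
  by apply/eqP => /(congr1 (@complex.Re R)) /= e; move: d1_gt0; rewrite e ltxx.
have qA_pos : 0 < qA theta0 c.
  by rewrite qAc /= ltr_pwDl ?mulr_gt0 ?mulr_ge0.
have qB0 : qB theta0 c = 0.
  by rewrite qBc; have [r _ ->] := argc => /=; ring.
have qAcd : qA theta0 c < qA theta0 d.
  rewrite qAc qAd /=; apply: ltr_leD; first by rewrite ltr_pM2r.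
  by rewrite ler_wpM2r.
have [e [eC eq Pe]] := Fsigma_presented odd_tri even_tri prod PF.
have [e0 e1] := numbering_unique eC qAcd eq; rewrite e0 e1 in Pe.
have RU := @dual_right_up R; have LU := dual_left_up odd_tri even_tri prod.
have RD := dual_right_down odd_tri even_tri prod; have LD := dual_left_down odd_tri even_tri prod.
have PL := fourier_sato_presented RU LU RD LD qA_pos qB0 qAcd Pe.
apply: (presented_derived_iso PL).
have [eh [ehC ehq Peh]] := Fsigma_presented odd_tri even_tri prod PFh.
have nc : 0 < qA theta0 c ^+ 2 + qB theta0 c ^+ 2 by rewrite qB0 expr0n addr0 exprn_gt0.
have qAd_pos := lt_trans qA_pos qAcd.
have nd : 0 < qA theta0 d ^+ 2 + qB theta0 d ^+ 2 by rewrite ltr_pwDl ?sqr_ge0// exprn_gt0.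
have [hAc hBc] := qA_qB_inverse c0 (lt0r_neq0 nc).
have [hAd hBd] := qA_qB_inverse d0 (lt0r_neq0 nd).
(* With d e^(2 i theta0) = A + i B this amounts to |c| A < A^2 + B^2. So - 1/c comes first in the
   numbering of the transformed set, as c does in that of the original one. *)
have hq : qA (pi - theta0) (- c^-1) < qA (pi - theta0) (- d^-1).
  rewrite hAc hAd qB0 expr0n addr0 !mulNr ltrN2 ltr_pdivrMr// mulrAC ltr_pdivlMr ?exprn_gt0//.
  have h1 : qA theta0 c * (qA theta0 c * qA theta0 d) < qA theta0 c * (qA theta0 d * qA theta0 d).
    by rewrite !ltr_pM2l ?ltr_pM2r.
  have h2 : 0 <= qA theta0 c * qB theta0 d ^+ 2 by rewrite mulr_ge0 ?sqr_ge0// ltW.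
  by rewrite !expr2 in h2 *; lra.
have [eh0 eh1] := numbering_unique ehC hq ehq; rewrite eh0 eh1 in Peh.
apply: sheaf_presented_ext Peh => -[w t] v /=; rewrite !(quad_rot (pi - theta0)) rx_hat ry_hat.
rewrite hAc hBc hAd hBd qB0 /hc /hd.
set a := rx _ w; set b := ry _ w.
have -> : - qA theta0 c / (qA theta0 c ^+ 2 + 0 ^+ 2) * ((- a) ^+ 2 - (- b) ^+ 2) / 2 -
    0 / (qA theta0 c ^+ 2 + 0 ^+ 2) * (- a * - b) = (b ^+ 2 - a ^+ 2) / (2 * qA theta0 c).
  by field; rewrite gt_eqF.
have -> : - qA theta0 d / (qA theta0 d ^+ 2 + qB theta0 d ^+ 2) * ((- a) ^+ 2 - (- b) ^+ 2) / 2 -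
    qB theta0 d / (qA theta0 d ^+ 2 + qB theta0 d ^+ 2) * (- a * - b) =
    (qA theta0 d * (b ^+ 2 - a ^+ 2) - 2 * qB theta0 d * (a * b)) /
    (2 * (qA theta0 d ^+ 2 + qB theta0 d ^+ 2)).
  by field; rewrite gt_eqF.
by [].
Qed.
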